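(* Let $m\ge 3$ and let $\Omega\subset\mathbb{S}^m$ be a simply connected open set which admits a geodesic isometric embedding $\mathbb{S}^2_+\hookrightarrow\Omega$. Then the two-hull $\Omega^{(2)}$ of $\Omega$ is isometric to $\mathbb{S}^m$.
   Context: $\mathbb{M}^m[\kappa]$ denotes the complete simply connected $m$-dimensional Riemannian manifold of constant sectional curvature $\kappa$; $\mathbb{S}^m=\mathbb{M}^m[1]$ is the unit $m$-sphere, and $\mathbb{S}^2_+$ is the closed hemisphere of the unit 2-sphere. ''Geodesic'' for an immersion or embedding means totally geodesic. A Riemannian manifold (possibly not complete) of constant curvature $\kappa$ is called $\kappa$-flat. Immersions are not assumed to be injective; an open isometric immersion is a local isometry between manifolds of the same dimension. A $\kappa$-flat manifold $\Phi$ is called two-convex if the following holds: given a tetrahedron (nondegenerate solid geodesic 3-simplex) $\Delta$ in $\mathbb{M}^3[\kappa]$ and a subset $\Lambda\subset\Delta$ formed by 3 out of the 4 faces of $\Delta$, any immersion $f\colon\Lambda\to\Phi$ which is isometric and geodesic on each face of $\Lambda$ can be extended to an isometric geodesic immersion $F\colon\Delta\to\Phi$. Let $\Omega$ be a simply connected $m$-dimensional $\kappa$-flat manifold. A simply connected $\kappa$-flat two-convex manifold $\Phi$ is called the two-hull of $\Omega$, written $\Phi=\Omega^{(2)}$, if there is an open isometric immersion $\phi\colon\Omega\to\Phi$ such that for any open isometric immersion $\psi\colon\Omega\to\Psi$ into a simply connected $\kappa$-flat two-convex manifold $\Psi$ there is an isometric immersion $\theta_\psi\colon\Phi\to\Psi$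 with $\psi=\theta_\psi\circ\phi$. The two-hull of a simply connected $\kappa$-flat manifold exists and is unique up to isometry. Here the two-hull is taken with $\kappa=1$. *)

(* Defs.v *)
From HB Require Import structures.
From mathcomp Require Import all_boot all_order all_algebra.
From mathcomp Require Import all_classical all_reals all_analysis.

Set Implicit Arguments.
Unset Strict Implicit.
Unset Printing Implicit Defensive.

Import Order.TTheory GRing.Theory Num.Theory.
Import numFieldNormedType.Exports.

Local Open Scope classical_set_scope.
Local Open Scope ring_scope.

Definition dot (R : realType) (n : nat) (x y : 'rV[R]_n) : R :=
  \sum_(i < n) x 0 i * y 0 i.

Definition gdot (R : realType) (m : nat) (g : 'M[R]_m) (u v : 'rV[R]_m) : R :=
  \sum_(i < m) \sum_(j < m) g i j * u 0 i * v 0 j.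

(* Meant for open [U]: continuity of all iterated directional derivatives of
   order at most k is then equivalent to being C^k. *)
Fixpoint Ck (R : realType) (V W : normedModType R) (k : nat)
    (U : set V) (f : V -> W) : Prop :=
  (forall x, U x -> {for x, continuous f}) /\
  if k is k'.+1 then
    (forall x v, U x -> derivable f x v) /\ (forall v, Ck k' U ('D_v f))
  else True.

Definition smooth (R : realType) (V W : normedModType R)
  (U : set V) (f : V -> W) : Prop := forall k, Ck k U f.

Definition simply_connected (R : realType) (T : topologicalType) : Prop :=
  [/\ exists x : T, True,
      forall x y : T, exists c : R -> T,
        [/\ {within `[0, 1], continuous c}, c 0 = x & c 1 = y]
    & forall c : R -> T, {within `[0, 1], continuous c} -> c 0 = c 1 ->
        exists H : R * R -> T,
          [/\ {within `[0, 1] `*` `[0, 1], continuous H},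
              forall t, t \in `[0, 1] -> H (0, t) = c t,
              forall t, t \in `[0, 1] -> H (1, t) = c 0
            & forall s, s \in `[0, 1] -> H (s, 0) = c 0 /\ H (s, 1) = c 0] ].

(* The data of a Riemannian manifold of dimension m given by an atlas; the
   axioms are in [riemannian].  [cdom i] is the domain of the chart [chart i],
   and [metric i y] is the Gram matrix of the coordinate fields at the point
   with coordinates [y].  Values of [chart i] outside [cdom i], and of
   [metric i] outside [chart i @` cdom i], are irrelevant. *)
Record atlas_space (R : realType) (m : nat) := AtlasSpace {
  mspace :> topologicalType;
  cindex : Type;
  cdom : cindex -> set mspace;
  chart : cindex -> mspace -> 'rV[R]_m;
  metric : cindex -> 'rV[R]_m -> 'M[R]_m }.

Definition cimage (R : realType) (m : nat) (M : atlas_space R m)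
  (i : cindex M) : set 'rV[R]_m := chart i @` cdom i.

(* [h] composed with the inverse of the chart [i] (0 off the chart image) *)
Definition read (R : realType) (m n : nat) (M : atlas_space R m)
    (i : cindex M) (h : M -> 'rV[R]_n) (y : 'rV[R]_m) : 'rV[R]_n :=
  xget 0 [set h x | x in cdom i `&` [set x | chart i x = y]].

(* Not assumed injective.  When m = n this is an open isometric immersion. *)
Definition isometric_immersion (R : realType) (m n : nat)
    (M : atlas_space R m) (N : atlas_space R n) (f : M -> N) : Prop :=
  continuous f /\
  forall (i : cindex M) (j : cindex N),
    let U := chart i @` (cdom i `&` f @^-1` cdom j) in
    let F := read i (chart j \o f) in
    smooth U F /\
    forall y u v, U y ->
      gdot (metric j (F y)) ('D_u F y) ('D_v F y) = gdot (metric i y) u v.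

Definition isometric (R : realType) (m : nat) (M N : atlas_space R m) : Prop :=
  exists (f : M -> N) (g : N -> M),
    [/\ isometric_immersion f, isometric_immersion g, cancel f g & cancel g f].

(* The last clause says that the transition maps are smooth and respect the
   metric. *)
Definition riemannian (R : realType) (m : nat) (M : atlas_space R m) : Prop :=
  [/\ hausdorff_space M /\ @second_countable M,
      forall x : M, exists i, cdom i x,
      forall i : cindex M,
        [/\ open (cdom i),
            forall x, cdom i x -> {for x, continuous (chart i)},
            {in cdom i &, injective (chart i)}
          & forall A, open A -> A `<=` cdom i -> open (chart i @` A)],
      forall i : cindex M,
        [/\ smooth (cimage i) (metric i),
            forall y, cimage i y -> (metric i y)^T = metric i y
          & forall y u, cimage i y -> u != 0 -> 0 < gdot (metric i y) u u]
    & isometric_immersion (@id M) ].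

Definition pd (R : realType) (m : nat) (i : 'I_m) (f : 'rV[R]_m -> R) :
  'rV[R]_m -> R := 'D_(delta_mx 0 i) f.

Definition christoffel (R : realType) (m : nat) (g : 'rV[R]_m -> 'M[R]_m)
    (k i j : 'I_m) (y : 'rV[R]_m) : R :=
  2^-1 * \sum_(l < m) invmx (g y) k l *
    (pd i (fun z => g z j l) y + pd j (fun z => g z i l) y
     - pd l (fun z => g z i j) y).

(* R(d_i, d_j) d_k = \sum_l (riemann g l k i j) d_l, with the convention
   R(X, Y) = [nabla_X, nabla_Y] - nabla_[X, Y] *)
Definition riemann (R : realType) (m : nat) (g : 'rV[R]_m -> 'M[R]_m)
    (l k i j : 'I_m) (y : 'rV[R]_m) : R :=
  pd i (christoffel g l j k) y - pd j (christoffel g l i k) y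
  + \sum_(p < m) (christoffel g l i p y * christoffel g p j k y
                  - christoffel g l j p y * christoffel g p i k y).

Definition sectional (R : realType) (m : nat) (g : 'rV[R]_m -> 'M[R]_m)
    (y u v : 'rV[R]_m) : R :=
  let Ruvv := \row_(l < m) \sum_(i < m) \sum_(j < m) \sum_(k < m)
                 riemann g l k i j y * u 0 i * v 0 j * v 0 k in
  gdot (g y) Ruvv u
  / (gdot (g y) u u * gdot (g y) v v - gdot (g y) u v ^+ 2).

Definition kflat (R : realType) (m : nat) (kappa : R) (M : atlas_space R m) :
    Prop :=
  riemannian M /\
  forall (i : cindex M) y u v, cimage i y -> row_free (col_mx u v) ->
    sectional (metric i) y u v = kappa.

Definition geodesic_at (R : realType) (m : nat) (M : atlas_space R m)
    (c : R -> M) (t : R) : Prop :=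
  {for t, continuous c} /\
  forall j : cindex M, cdom j (c t) ->
    let x := chart j \o c in
    [/\ \forall s \near t, derivable x s 1, derivable (derive1 x) t 1
      & forall k, derive1 (derive1 x) t 0 k
          + \sum_(p < m) \sum_(q < m) christoffel (metric j) k p q (x t)
              * derive1 x t 0 p * derive1 x t 0 q = 0].

(* [S] is a subset of the unit sphere of R^n contained in the great subsphere
   cut out by the row space of [V], and is the closure of its interior there
   (in the uses below: a geodesic simplex or a closed hemisphere).  Only the
   values of [f] on [S] matter.  Smoothness on [S] means, as usual, having
   local smooth extensions; since [S] is the closure of its interior, the
   derivatives of the extension [F] along vectors tangent to the great
   subsphere do not depend on [F].  The last clause says that [f] maps unit
   speed great circle arcs in [S] to geodesics. *)
Definition geodesic_isometric_on (R : realType) (k n m : nat)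
    (V : 'M[R]_(k, n)) (S : set 'rV[R]_n) (M : atlas_space R m)
    (f : 'rV[R]_n -> M) : Prop :=
  (forall p (j : cindex M), S p -> cdom j (f p) ->
     exists (U : set 'rV[R]_n) (F : 'rV[R]_n -> 'rV[R]_m),
       [/\ open U, U p, smooth U F,
           forall q, S q -> U q -> cdom j (f q) /\ F q = chart j (f q)
         & forall q u v, S q -> U q ->
             (u <= V)%MS -> dot u q = 0 -> (v <= V)%MS -> dot v q = 0 ->
             gdot (metric j (F q)) ('D_u F q) ('D_v F q) = dot u v]) /\
  (forall p a t, dot p p = 1 -> dot a a = 1 -> dot p a = 0 ->
     (\forall s \near t, S (cos s *: p + sin s *: a)) ->
     geodesic_at (fun s => f (cos s *: p + sin s *: a)) t).

(* geodesic simplex of the unit sphere with vertices the rows of [V] *)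
Definition spherical_simplex (R : realType) (k n : nat) (V : 'M[R]_(k, n)) :
    set 'rV[R]_n :=
  [set x | dot x x = 1 /\
           exists2 c : 'rV[R]_k, (forall i, 0 <= c 0 i) & x = c *m V].

(* Two-convexity of 1-flat manifolds: the tetrahedron lies in the unit sphere
   of R^4, its vertices are the rows of [V], the face opposite to the i-th
   vertex is spanned by the rows of [row' i V], and Lambda is the union of the
   faces other than the [i0]-th. *)
Definition two_convex (R : realType) (m : nat) (M : atlas_space R m) : Prop :=
  forall (V : 'M[R]_4) (i0 : 'I_4) (f : 'rV[R]_4 -> M),
    (forall i, dot (row i V) (row i V) = 1) -> V \in unitmx ->
    (forall i, i != i0 ->
       geodesic_isometric_on (row' i V) (spherical_simplex (row' i V)) f) ->
    exists F : 'rV[R]_4 -> M,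
      geodesic_isometric_on V (spherical_simplex V) F /\
      forall i, i != i0 ->
        forall x, spherical_simplex (row' i V) x -> F x = f x.

Definition is_two_hull (R : realType) (m : nat) (Omega Phi : atlas_space R m) :
    Prop :=
  [/\ simply_connected R Phi, kflat 1 Phi, two_convex Phi
    & exists2 phi : Omega -> Phi, isometric_immersion phi
      & forall (Psi : atlas_space R m) (psi : Omega -> Psi),
          simply_connected R Psi -> kflat 1 Psi -> two_convex Psi ->
          isometric_immersion psi ->
          exists2 theta : Phi -> Psi,
            isometric_immersion theta & psi = theta \o phi ].

Definition unit_sphere (R : realType) (m : nat) : set 'rV[R]_(1 + m) :=
  [set x | dot x x = 1].

(* inverse of the stereographic projection from the pole (s, 0, ..., 0), where
   s = (-1) ^+ b *)
Definition stereo_inv (R : realType) (m : nat) (b : bool) (y : 'rV[R]_m) :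
    'rV[R]_(1 + m) :=
  row_mx ((-1) ^+ b * (dot y y - 1) / (dot y y + 1))%:M
         ((2 / (dot y y + 1)) *: y).

(* Charts: the stereographic projections from two opposite poles.  Metric:
   induced by the Euclidean inner product. *)
Definition sphere (R : realType) (m : nat) : atlas_space R m :=
  {| mspace := set_type (@unit_sphere R m);
     cindex := bool;
     cdom := fun b =>
       [set x : set_type (@unit_sphere R m) | \val x 0 0 != (-1) ^+ b];
     chart := fun b (x : set_type (@unit_sphere R m)) =>
       (1 - (-1) ^+ b * \val x 0 0)^-1 *: rsubmx (\val x);
     metric := fun b y => \matrix_(i < m, j < m)
       dot ('D_(delta_mx 0 i) (@stereo_inv R m b) y)
           ('D_(delta_mx 0 j) (@stereo_inv R m b) y) |}.

(* the subset [O], meant to be open, with the charts and metric of [M] *)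
Definition submanifold (R : realType) (m : nat) (M : atlas_space R m)
    (O : set M) : atlas_space R m :=
  {| mspace := set_type O;
     cindex := cindex M;
     cdom := fun i => set_val @^-1` cdom i;
     chart := fun i => chart i \o set_val;
     metric := @metric R m M |}.

Definition hemisphere (R : realType) : set 'rV[R]_3 :=
  [set x | dot x x = 1 /\ 0 <= x 0 ord_max].

(* The closed hemisphere is compact, so an injective continuous map from it to
   a Hausdorff space is a topological embedding. *)
Definition geodesic_embedding_of_hemisphere (R : realType) (m : nat)
    (M : atlas_space R m) (e : 'rV[R]_3 -> M) : Prop :=
  geodesic_isometric_on (1%:M : 'M[R]_3) (@hemisphere R) e /\
  forall x y, hemisphere x -> hemisphere y -> e x = e y -> x = y.

(* Main.v *)
Require Import Defs.
From HB Require Import structures.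
From mathcomp Require Import all_boot all_order all_algebra.
From mathcomp Require Import all_classical all_reals all_analysis.
From mathcomp Require Import ring lra.

Set Implicit Arguments.
Unset Strict Implicit.
Unset Printing Implicit Defensive.

Import Order.TTheory GRing.Theory Num.Theory.
Import numFieldNormedType.Exports.

Local Open Scope classical_set_scope.
Local Open Scope ring_scope.


(** The sphere itself is a two-hull of Omega, and two two-hulls are isometric.

    Spherical maps.  Everything rests on one description of manifolds of
    constant curvature 1: around each point there is a map [s] to the unit
    sphere of R^(1+m) that pulls the Euclidean inner product back to the metric
    ([spherical_at]).  In a chart with metric g such a map phi is the same as a
    solution X = (phi, d_1 phi, ..., d_m phi) of the linear system given by the
    Gauss formula; the system is integrable exactly when g has curvature 1
    ([curvature_matrix], [flat_of_curv_const]), and integrable linear systems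
    have local solutions ([flat_solution]).  Two spherical maps at a point
    differ by an orthogonal matrix ([spherical_at_unique]).  Hence local
    isometries are the maps through which spherical maps pull back to spherical
    maps ([local_isometry_at]), and they satisfy unique continuation
    ([path_rigidity]).  Through a spherical map, unit speed geodesics become
    great circles; so a geodesic isometric map of a piece of sphere becomes
    additive on cones ([cone_additive]).  All later geometry is linear algebra
    in R^(1+m).

    The universal property.  Let psi be an isometric immersion of Omega into a
    two-convex manifold Psi of curvature 1.  Fix v in Omega and continue psi
    along the rays b |-> normalization of x + b v, that is, along the great
    circle arcs joining x to v: [dom] is the largest open set that is
    star-shaped about v and carries a local isometry [dev] with the given germ
    at v.  A point x different from - v belongs to it as soon as [dev] has
    limits along the ray of x ([extension], [ray_lemma]).  Two-convexity
    supplies the limits in tetrahedra with vertex v whose three faces at v lie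
    in [dom] ([tetra]).  Let v be the pole of the given hemisphere H.  By
    rigidity psi itself gives the limits on H.  For a unit w orthogonal to the
    3-space of H, flat tetrahedra with vertex v whose base triangle lies
    slightly beyond the boundary of H sweep out the whole open half of the
    3-sphere on the side of w ([hemisphere_pos]); applied to all w this gives
    everything but - v ([hemisphere_dom]).  The same argument based at a point w
    orthogonal to H covers - v, the two continuations agree where both are
    defined, and psi extends to the sphere ([sphere_extension]).

    The sphere qualifies.  It has curvature 1 because the inverse stereographic
    projections are spherical maps.  It is two-convex because a map that is
    geodesic and isometric on three faces of a tetrahedron is the restriction of
    one linear isometry ([two_convex_sphere]).  It is simply connected because a
    loop is homotopic to a spherical polygon, which misses a point
    ([sphere_null_homotopic]).

    Uniqueness.  For a two-hull Phi the universal properties give isometric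
    immersions Phi -> S and S -> Phi over Omega; both composites are the
    identity by rigidity ([two_hull_isometric]). *)

(** * Maps of class C^k *)

Section CkBasics.
Variables (R : realType) (V : normedModType R).
Implicit Types (U : set V) (k : nat).

Lemma open_near U x (P : V -> Prop) :
  open U -> U x -> (forall y, U y -> P y) -> \forall y \near x, P y.
Proof. by move=> oU Ux UP; apply: filterS (open_nbhs_nbhs (conj oU Ux)). Qed.

Lemma continuous_for_ext (W : topologicalType) U (f g : V -> W) x :
  open U -> U x -> (forall y, U y -> f y = g y) ->
  {for x, continuous f} -> {for x, continuous g}.
Proof.
move=> oU Ux fg; rewrite /prop_for /continuous_at -(fg _ Ux).
move=> cf; apply: cvg_trans cf; apply: near_eq_cvg.
exact: open_near Ux fg.
Qed.

Lemma Ck_ext (W : normedModType R) k U (f g : V -> W) :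
  open U -> (forall x, U x -> f x = g x) -> Ck k U f -> Ck k U g.
Proof.
move=> oU; elim: k f g => [|k IH] f g fg [cf Hf].
  by split=> // x Ux; apply: (continuous_for_ext oU Ux fg (cf x Ux)).
case: Hf => df Hf; split; first by move=> x Ux; apply: (continuous_for_ext oU Ux fg (cf x Ux)).
split=> [x v Ux|v].
  by apply: near_eq_derivable (df x v Ux); exact: open_near Ux fg.
apply: IH (Hf v) => x Ux; apply: near_eq_derive; exact: open_near Ux fg.
Qed.

Lemma Ck_sub (W : normedModType R) k U U' (f : V -> W) :
  U' `<=` U -> Ck k U f -> Ck k U' f.
Proof.
move=> sU; elim: k f => [|k IH] f [cf Hf]; split=> //; first by move=> x /sU/cf.
  by move=> x /sU/cf.
case: Hf => df Hf; split=> [x v /sU Ux|v]; [exact: df|exact/IH/Hf].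
Qed.

(** The derivatives in [Ck] are those of the ambient map, so it suffices to be
    of class C^k on pieces, open or not, that cover [U]. *)
Lemma Ck_near (W : normedModType R) k U (f : V -> W) :
  (forall x, U x -> exists2 N, N x & Ck k N f) -> Ck k U f.
Proof.
elim: k f => [|k IH] f H; split=> //.
- by move=> x /H[N Nx [cf _]]; exact: cf.
- by move=> x /H[N Nx [cf _]]; exact: cf.
split=> [x v /H[N Nx [_ [df _]]]|v]; first exact: df.
by apply: IH => x /H[N Nx [_ [_ Hf]]]; exists N => //; exact: Hf.
Qed.

Lemma Ck_local (W : normedModType R) k U (f : V -> W) :
  (forall x, U x -> exists N g, [/\ open N, N x, Ck k N g &
     forall y, N y -> g y = f y]) -> Ck k U f.
Proof.
move=> H; apply: Ck_near => x /H[N [g [oN Nx Cg gf]]].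
by exists N => //; exact: Ck_ext Cg.
Qed.

Lemma CkW (W : normedModType R) k U (f : V -> W) : Ck k.+1 U f -> Ck k U f.
Proof.
elim: k f => [|k IH] f; first by case.
by case=> cf [df Hf]; split=> //; split=> // v; exact: IH.
Qed.

Lemma Ck_continuous (W : normedModType R) k U (f : V -> W) x :
  Ck k U f -> U x -> {for x, continuous f}.
Proof. by case: k => [|k] [cf _]; exact: cf. Qed.

Lemma CkD (W : normedModType R) k U (f : V -> W) v :
  Ck k.+1 U f -> Ck k U ('D_v f).
Proof. by case=> _ [_ H]; exact: H. Qed.

Lemma Ck_derivable (W : normedModType R) k U (f : V -> W) x v :
  Ck k.+1 U f -> U x -> derivable f x v.
Proof. by case=> _ [H _] Ux; exact: H. Qed.

Lemma smooth_ext (W : normedModType R) U (f g : V -> W) :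
  open U -> (forall x, U x -> f x = g x) -> smooth U f -> smooth U g.
Proof. by move=> oU fg sf k; apply: Ck_ext (sf k). Qed.

Lemma smooth_sub (W : normedModType R) U U' (f : V -> W) :
  U' `<=` U -> smooth U f -> smooth U' f.
Proof. by move=> s sf k; apply: Ck_sub (sf k). Qed.

Lemma smooth_continuous (W : normedModType R) U (f : V -> W) x :
  smooth U f -> U x -> {for x, continuous f}.
Proof. by move=> sf; apply: Ck_continuous (sf 0%N). Qed.

Lemma smoothD (W : normedModType R) U (f : V -> W) v :
  smooth U f -> smooth U ('D_v f).
Proof. by move=> sf k; apply: CkD (sf _). Qed.

Lemma smooth_derivable (W : normedModType R) U (f : V -> W) x v :
  smooth U f -> U x -> derivable f x v.
Proof. by move=> sf; apply: Ck_derivable (sf 1%N). Qed.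

Lemma smooth_local (W : normedModType R) U (f : V -> W) :
  (forall x, U x -> exists N g, [/\ open N, N x, smooth N g &
     forall y, N y -> g y = f y]) -> smooth U f.
Proof.
move=> H k; apply: Ck_local => x /H[N [g [oN Nx Cg gf]]].
by exists N, g; split.
Qed.

Lemma Ck_cst (W : normedModType R) k U (c : W) : Ck k U (cst c : V -> W).
Proof.
elim: k c => [|k IH] c; split=> //; try by move=> x _; exact: cst_continuous.
split=> [x v _|v]; first exact: derivable_cst.
by rewrite (_ : 'D_v _ = cst 0) ?funeqE => [|x]; [exact: IH|rewrite derive_cst].
Qed.

Lemma Ck_add (W : normedModType R) k U (f g : V -> W) : open U ->
  Ck k U f -> Ck k U g -> Ck k U (fun x => f x + g x).
Proof.
move=> oU; elim: k f g => [|k IH] f g [cf Hf] [cg Hg]; split=> //.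
- by move=> x Ux; apply: cvgD; [exact: cf|exact: cg].
- by move=> x Ux; apply: cvgD; [exact: cf|exact: cg].
case: Hf Hg => df Hf [dg Hg]; split=> [x v Ux|v].
  by apply: derivableD; [exact: df|exact: dg].
apply: Ck_ext (IH _ _ (Hf v) (Hg v)) => // x Ux.
by rewrite -deriveD //; [exact: df|exact: dg].
Qed.

Lemma Ck_scale (W : normedModType R) k U (c : R) (f : V -> W) : open U ->
  Ck k U f -> Ck k U (fun x => c *: f x).
Proof.
move=> oU; elim: k f => [|k IH] f [cf Hf]; split=> //.
- by move=> x Ux; apply: cvgZr; exact: cf.
- by move=> x Ux; apply: cvgZr; exact: cf.
case: Hf => df Hf; split=> [x v Ux|v]; first exact/derivableZ/df.
apply: Ck_ext (IH _ (Hf v)) => // x Ux.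
by rewrite -deriveZ //; exact: df.
Qed.

Lemma Ck_opp (W : normedModType R) k U (f : V -> W) : open U ->
  Ck k U f -> Ck k U (fun x => - f x).
Proof.
move=> oU /(Ck_scale (-1) oU); apply: Ck_ext => // x _; exact: scaleN1r.
Qed.

Lemma Ck_sub_fun (W : normedModType R) k U (f g : V -> W) : open U ->
  Ck k U f -> Ck k U g -> Ck k U (fun x => f x - g x).
Proof. by move=> oU cf cg; apply: Ck_add => //; exact: Ck_opp. Qed.

Lemma Ck_sum (W : normedModType R) k U (I : Type) (r : seq I) (P : pred I)
  (F : I -> V -> W) : open U ->
  (forall i, Ck k U (F i)) -> Ck k U (fun x => \sum_(i <- r | P i) F i x).
Proof.
move=> oU CF; elim: r => [|i r IH].
  by apply: Ck_ext (Ck_cst k U (0 : W)) => // x _; rewrite big_nil.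
case Pi: (P i).
  apply: Ck_ext (Ck_add oU (CF i) IH) => // x _; by rewrite big_cons Pi.
by apply: Ck_ext IH => // x _; rewrite big_cons Pi.
Qed.

Lemma Ck_mul k U (f g : V -> R) : open U ->
  Ck k U f -> Ck k U g -> Ck k U (fun x => f x * g x).
Proof.
move=> oU; elim: k f g => [|k IH] f g Cf Cg; split=> //.
- by move=> x Ux; apply: cvgM; [exact: Ck_continuous Cf Ux|exact: Ck_continuous Cg Ux].
- by move=> x Ux; apply: cvgM; [exact: Ck_continuous Cf Ux|exact: Ck_continuous Cg Ux].
have [_ [df Hf]] := Cf; have [_ [dg Hg]] := Cg.
split=> [x v Ux|v].
  by apply: derivableM; [exact: df|exact: dg].
have C1 := IH _ _ (CkW Cf) (Hg v); have C2 := IH _ _ (CkW Cg) (Hf v).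
apply: Ck_ext (Ck_add oU C1 C2) => // x Ux.
by rewrite (deriveM (df x v Ux) (dg x v Ux)).
Qed.

Lemma Ck_inv k U (f : V -> R) : open U -> (forall x, U x -> f x != 0) ->
  Ck k U f -> Ck k U (fun x => (f x)^-1).
Proof.
move=> oU nz; elim: k f nz => [|k IH] f nz Cf; split=> //.
- by move=> x Ux; apply: cvgV; [exact: nz|exact: Ck_continuous Cf Ux].
- by move=> x Ux; apply: cvgV; [exact: nz|exact: Ck_continuous Cf Ux].
have [_ [df Hf]] := Cf.
split=> [x v Ux|v]; first by apply: derivableV; [exact: nz|exact: df].
have C1 := IH _ nz (CkW Cf); have C2 := Ck_mul oU (Ck_mul oU C1 C1) (Hf v).
apply: Ck_ext (Ck_opp oU C2) => // x Ux.
by rewrite (deriveV (nz x Ux) (df x v Ux)) -mulNr -invfM -expr2.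
Qed.

(** Reduces directional derivatives to derivatives of functions of one real
    variable. *)
Lemma is_derive_lineP (W : normedModType R) (f : V -> W) x v (t : R) d :
  is_derive t 1 (fun s => f (x + s *: v)) d <-> is_derive (x + t *: v) v f d.
Proof.
have E : (fun h : R => h^-1 *: (((fun s => f (x + s *: v)) \o shift t) (h *: (1 : R))
     - (fun s => f (x + s *: v)) t))
  = (fun h => h^-1 *: ((f \o shift (x + t *: v)) (h *: v) - f (x + t *: v))).
  apply/funext => h /=; congr (_ *: (f _ - _)).
  by rewrite [_%:A]mulr1 scalerDl addrCA.
have Ed : derivable (fun s : R => f (x + s *: v)) t 1 = derivable f (x + t *: v) v.
  by rewrite /derivable E.
have ED : 'D_1 (fun s : R => f (x + s *: v)) t = 'D_v f (x + t *: v).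
  by rewrite /derive E.
by split=> -[]; rewrite ?Ed ?ED => d1 d2; split; rewrite ?Ed ?ED.
Qed.

Lemma is_derive_line (W : normedModType R) (f : V -> W) x v (t : R) :
  derivable f (x + t *: v) v ->
  is_derive t 1 (fun s => f (x + s *: v)) ('D_v f (x + t *: v)).
Proof. by move=> df; apply/is_derive_lineP/derivableP. Qed.

Lemma is_derive_comp1_line (g F : R -> R) (d e : R) t :
  is_derive (F t) 1 g d -> is_derive t 1 F e ->
  is_derive t 1 (fun h => g (F h)) (d * e).
Proof.
move=> [dS DS] [dF DF]; split.
  apply: (@diff_derivable _ _ _ (g \o F)).
  by apply: differentiable_comp; exact/derivable1_diffP.
have := @derive1_comp R F g t dF dS.
by rewrite ![derive1 _ _]derive1E DS DF => ->.
Qed.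

Lemma is_derive_comp1 (g : R -> R) (d : R) (f : V -> R) x v :
  is_derive (f x) 1 g d -> derivable f x v ->
  is_derive x v (fun y => g (f y)) (d * 'D_v f x).
Proof.
move=> dg /derivableP df.
have x0 : x = x + 0 *: v by rewrite scale0r addr0.
rewrite {1}x0; apply/is_derive_lineP.
apply: (@is_derive_comp1_line g (fun s => f (x + s *: v))); first by rewrite -x0.
by apply/is_derive_lineP; rewrite -x0.
Qed.

Lemma is_derive_sqrt_comp (f : V -> R) x v : 0 < f x -> derivable f x v ->
  is_derive x v (fun y => Num.sqrt (f y)) ((2 * Num.sqrt (f x))^-1 * 'D_v f x).
Proof.
by move=> f0 df; exact: (is_derive_comp1 (is_derive1_sqrt f0) df).
Qed.

Lemma Ck_sqrt k U (f : V -> R) : open U -> (forall x, U x -> 0 < f x) ->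
  Ck k U f -> Ck k U (fun x => Num.sqrt (f x)).
Proof.
move=> oU nz; elim: k f nz => [|k IH] f nz Cf; split=> //.
- move=> x Ux; apply: (@continuous_comp _ _ _ f Num.sqrt); last exact: sqrt_continuous.
  exact: Ck_continuous Cf Ux.
- move=> x Ux; apply: (@continuous_comp _ _ _ f Num.sqrt); last exact: sqrt_continuous.
  exact: Ck_continuous Cf Ux.
have [_ [df Hf]] := Cf.
split=> [x v Ux|v].
  by have [] := is_derive_sqrt_comp (nz x Ux) (df x v Ux).
have C1 : Ck k U (fun x => (2 * Num.sqrt (f x))^-1).
  apply: Ck_inv => //; first by move=> x /nz fx; rewrite mulf_neq0 // ?sqrtr_eq0 -?ltNge // pnatr_eq0.
  by have /(Ck_scale 2 oU) := IH _ nz (CkW Cf).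
apply: Ck_ext (Ck_mul oU C1 (Hf v)) => // x Ux.
by have [_ ->] := is_derive_sqrt_comp (nz x Ux) (df x v Ux).
Qed.

End CkBasics.

(** * Matrix-valued maps and strict differentiability *)

Section CkMatrix.
Variables (R : realType) (V : normedModType R).

Lemma ler_coord (m n : nat) (M : 'M[R]_(m, n)) i j : `|M i j| <= `|M|.
Proof.
rewrite [leRHS]/Num.Def.normr/= mx_normrE.
exact: (le_bigmax _ (fun ij : 'I_m * 'I_n => `|M ij.1 ij.2|) (i, j)).
Qed.

Lemma mx_norm_le (m n : nat) (M : 'M[R]_(m, n)) (c : R) : 0 <= c ->
  (forall i j, `|M i j| <= c) -> `|M| <= c.
Proof.
move=> c0 H; rewrite [leLHS]/Num.Def.normr/= mx_normrE.
by apply: bigmax_le => // -[i j] _; exact: H.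
Qed.

Lemma mx_norm_lt (m n : nat) (M : 'M[R]_(m, n)) (c : R) : 0 < c ->
  (forall i j, `|M i j| < c) -> `|M| < c.
Proof.
move=> c0 H; rewrite [ltLHS]/Num.Def.normr/= mx_normrE.
by apply: bigmax_lt => // -[i j] _; exact: H.
Qed.

Lemma continuous_mxP (T : topologicalType) (m n : nat) (M : T -> 'M[R]_(m, n)) x :
  {for x, continuous M} <-> forall i j, {for x, continuous (fun y => M y i j)}.
Proof.
split=> [cM i j|cM].
  by apply: (@continuous_comp _ _ _ M (fun N : 'M[R]_(m, n) => N i j)); [exact: cM|exact: coord_continuous].
apply/cvgrPdist_lt => e e0; near=> y.
apply: mx_norm_lt => // i j; rewrite !mxE.
suff /(_ i)/(_ j) : forall i j, `|M x i j - M y i j| < e by [].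
near: y; apply: filter_forall => {}i; apply: filter_forall => {}j.
exact: ((cvgrPdist_lt _ _).1 (cM i j)).
Unshelve. all: by end_near. Qed.

Lemma Ck_mxP k (U : set V) (m n : nat) (M : V -> 'M[R]_(m, n)) : open U ->
  Ck k U M <-> forall i j, Ck k U (fun x => M x i j).
Proof.
move=> oU; elim: k M => [|k IH] M.
  split=> [[cM _] i j|H]; split=> // x Ux; first exact: (continuous_mxP M x).1 (cM x Ux) i j.
  by apply/continuous_mxP => i j; have [cM _] := H i j; exact: cM.
split=> [[cM [dM HM]] i j|H].
  split; first by move=> x Ux; exact: (continuous_mxP M x).1 (cM x Ux) i j.
  split=> [x v Ux|v]; first exact: (derivable_mxP M x v).1 (dM x v Ux) i j.
  apply: Ck_ext ((IH _).1 (HM v) i j) => // x Ux.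
  by rewrite (derive_mx (dM x v Ux)) mxE.
have dM x v : U x -> derivable M x v.
  by move=> Ux; apply/derivable_mxP => i j; exact: Ck_derivable (H i j) Ux.
split; first by move=> x Ux; apply/continuous_mxP => i j; exact: Ck_continuous (H i j) Ux.
split=> [x v Ux|v]; first exact: dM.
apply/IH => i j; apply: Ck_ext (CkD v (H i j)) => // x Ux.
by rewrite (derive_mx (dM x v Ux)) mxE.
Qed.

Lemma smooth_mxP (U : set V) (m n : nat) (M : V -> 'M[R]_(m, n)) : open U ->
  smooth U M <-> forall i j, smooth U (fun x => M x i j).
Proof.
move=> oU; split=> [sM i j k|sM k]; first exact: (Ck_mxP k M oU).1 (sM k) i j.
by apply/(Ck_mxP k M oU) => i j; exact: sM.
Qed.

Lemma derive_coord (m n : nat) (M : V -> 'M[R]_(m, n)) x v i j :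
  derivable M x v -> ('D_v M x) i j = 'D_v (fun y => M y i j) x.
Proof. by move=> dM; rewrite derive_mx // mxE. Qed.

Lemma Ck_mulmx k (U : set V) (m n p : nat) (M : V -> 'M[R]_(m, n)) (N : V -> 'M[R]_(n, p)) :
  open U -> Ck k U M -> Ck k U N -> Ck k U (fun x => M x *m N x).
Proof.
move=> oU /(Ck_mxP _ _ oU) CM /(Ck_mxP _ _ oU) CN; apply/(Ck_mxP _ _ oU) => i j.
apply: (@Ck_ext _ _ _ _ _ (fun x => \sum_l M x i l * N x l j)) => //.
  by move=> x _; rewrite mxE.
by apply: Ck_sum => // l; apply: Ck_mul.
Qed.

Lemma is_derive_mulmx (m n p : nat) (M : V -> 'M[R]_(m, n)) (N : V -> 'M[R]_(n, p)) x v dM dN :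
  is_derive x v M dM -> is_derive x v N dN ->
  is_derive x v (fun x => M x *m N x) (dM *m N x + M x *m dN).
Proof.
move=> [M1 M2] [N1 N2].
have H i j : is_derive x v (fun x => (M x *m N x) i j)
   ((dM *m N x + M x *m dN) i j).
  have E : (fun x => (M x *m N x) i j) = (fun x => (\sum_l (fun x => M x i l * N x l j)) x).
    by apply/funext => y; rewrite mxE fct_sumE.
  rewrite E !mxE -big_split /=.
  have K l : is_derive x v (fun x => M x i l * N x l j) (dM i l * N x l j + M x i l * dN l j).
    rewrite -M2 -N2 !derive_coord // addrC [X in _ + X]mulrC.
    by apply: is_deriveM; apply/derivableP; exact: (derivable_mxP _ _ _).1.
  rewrite (_ : (fun x0 => _) = \sum_l (fun x => M x i l * N x l j)); last by [].
  exact: is_derive_sum.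
split.
  by apply/derivable_mxP => i j; have [] := H i j.
rewrite derive_mx; last by apply/derivable_mxP => i j; have [] := H i j.
by apply/matrixP => i j; rewrite mxE; have [_ ->] := H i j.
Qed.

Lemma is_derive_mx (m n : nat) (M : V -> 'M[R]_(m, n)) x v (dM : 'M[R]_(m, n)) :
  (forall i j, is_derive x v (fun y => M y i j) (dM i j)) -> is_derive x v M dM.
Proof.
move=> H; have dm : derivable M x v by apply/derivable_mxP => i j; have [] := H i j.
split=> //; apply/matrixP => i j; rewrite derive_coord //.
by have [] := H i j.
Qed.

Lemma is_derive_coord (m n : nat) (M : V -> 'M[R]_(m, n)) x v (dM : 'M[R]_(m, n)) i j :
  is_derive x v M dM -> is_derive x v (fun y => M y i j) (dM i j).
Proof.
move=> [d1 d2]; split; first exact: (derivable_mxP _ _ _).1.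
by rewrite -derive_coord // d2.
Qed.

Lemma Ck_det k (U : set V) n (M : V -> 'M[R]_n) : open U -> Ck k U M ->
  Ck k U (fun x => \det (M x)).
Proof.
move=> oU /(Ck_mxP _ _ oU) CM.
have Cprod (s : 'I_n -> 'I_n) (r : seq 'I_n) : Ck k U (fun x => \prod_(i <- r) M x i (s i)).
  elim: r => [|i r IH].
    by apply: Ck_ext (Ck_cst k U (1 : R)) => // x _; rewrite big_nil.
  by apply: Ck_ext (Ck_mul oU (CM i (s i)) IH) => // x _; rewrite big_cons.
by apply: Ck_sum => // s; apply: Ck_mul => //; exact: Ck_cst.
Qed.

Lemma Ck_invmx k (U : set V) n (M : V -> 'M[R]_n) : open U -> Ck k U M ->
  (forall x, U x -> M x \in unitmx) -> Ck k U (fun x => invmx (M x)).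
Proof.
move=> oU CM uM.
have E x : U x -> (\det (M x))^-1 *: \adj (M x) = invmx (M x).
  by move=> Ux; rewrite /invmx uM.
apply: Ck_ext E _ => //; apply/(Ck_mxP _ _ oU) => i j.
apply: (@Ck_ext _ _ _ _ _ (fun x => (\det (M x))^-1 * cofactor (M x) j i)) => //.
  by move=> x _; rewrite !mxE.
apply: Ck_mul => //.
  apply: Ck_inv => //; last exact: Ck_det.
  by move=> x /uM; rewrite unitmxE unitfE.
apply: Ck_mul => //; first exact: Ck_cst.
apply: Ck_det => //; apply/(Ck_mxP _ _ oU) => a b.
apply: Ck_ext ((Ck_mxP _ _ oU).1 CM (lift j a) (lift i b)) => // x _.
by rewrite !mxE.
Qed.

End CkMatrix.

Section Strict.
Variables (R : realType).

Lemma conv_norm_lt (t a b d : R) : 0 <= t -> t <= 1 -> `|a| < d -> `|b| < d ->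
  `|a + t * (b - a)| < d.
Proof.
move=> t0 t1 ha hb; set c := Num.max `|a| `|b|.
have cd : c < d by rewrite gt_max ha.
apply: le_lt_trans cd.
have ca : `|a| <= c by rewrite le_max lexx.
have cb : `|b| <= c by rewrite le_max lexx orbT.
have -> : a + t * (b - a) = (1 - t) * a + t * b by ring.
apply: le_trans (ler_normD _ _) _; rewrite !normrM (ger0_norm t0) ger0_norm ?subr_ge0 //.
have -> : c = (1 - t) * c + t * c by ring.
by apply: lerD; apply: ler_wpM2l; rewrite ?subr_ge0.
Qed.

Lemma MVT_dir (V : normedModType R) (f : V -> R) x v (s : R) :
  (forall t : R, 0 <= t <= 1 -> derivable f (x + (t * s) *: v) v) ->
  exists2 t : R, 0 <= t <= 1 & f (x + s *: v) - f x = s * 'D_v f (x + (t * s) *: v).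
Proof.
move=> H.
have dG (t : R) : 0 <= t <= 1 -> is_derive t 1 (fun t : R => f (x + (t * s) *: v)) ('D_v f (x + (t * s) *: v) * s).
  move=> /H ht; apply: (@is_derive_comp1_line _ (fun r => f (x + r *: v)) (fun t => t * s)).
    exact: is_derive_line.
  rewrite -[X in is_derive _ _ _ X](mulr1 s).
  have -> : (fun t0 => t0 * s) = s \*: (id : R -> R) by apply/funext => z /=; rewrite mulrC.
  exact: is_deriveZ.
have [||c] := @MVT_segment R (fun t => f (x + (t * s) *: v))
    (fun t => 'D_v f (x + (t * s) *: v) * s) 0 1 ler01.
- by move=> t; rewrite in_itv /= => /andP[/ltW t0 /ltW t1]; apply: dG; rewrite t0.
- apply: derivable_within_continuous => t; rewrite in_itv /= => t01.
  by have [] := dG t t01.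
rewrite in_itv /= => c01; rewrite mul1r mul0r scale0r addr0 subr0 mulr1 => ->.
by exists c => //; rewrite mulrC.
Qed.

Variable n : nat.
Local Notation e_ i := (delta_mx 0 i : 'rV[R]_n).

Let mix (x y : 'rV[R]_n) k := \row_(i < n) (if (i < k)%N then y 0 i else x 0 i).

Let mixS x y (k : 'I_n) : mix x y k.+1 = mix x y k + (y 0 k - x 0 k) *: e_ k.
Proof.
apply/rowP => i; rewrite !mxE eqxx /= ltnS leq_eqVlt.
have [->|ne] := eqVneq i k; first by rewrite eqxx ltnn mulr1 subrKC.
by rewrite (negbTE (_ : _ != _)) ?(inj_eq val_inj) // mulr0 addr0.
Qed.

Let mix_ball x0 d x y k (t : R) (i : 'I_n) : 0 <= t <= 1 ->
  `|x - x0| < d -> `|y - x0| < d ->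
  `|mix x y k + (t * (y 0 i - x 0 i)) *: (if (i == k :> nat) then e_ i else 0) - x0| < d.
Proof.
move=> /andP[t0 t1] hx hy.
have d0 : 0 < d by apply: le_lt_trans hx.
have cx j : `|x 0 j - x0 0 j| < d.
  by apply: le_lt_trans hx; have := ler_coord (x - x0) 0 j; rewrite !mxE.
have cy j : `|y 0 j - x0 0 j| < d.
  by apply: le_lt_trans hy; have := ler_coord (y - x0) 0 j; rewrite !mxE.
apply: mx_norm_lt => // i0 j; rewrite ord1 {i0} !mxE.
have [ik|_] := eqVneq; last first.
  by rewrite !mxE mulr0 addr0; case: ifP.
rewrite !mxE eqxx /=; have [->|_] := eqVneq j i; last first.
  by rewrite mulr0 addr0; case: ifP.
rewrite ik ltnn mulr1.
have -> : x 0 i + t * (y 0 i - x 0 i) - x0 0 i =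
  (x 0 i - x0 0 i) + t * ((y 0 i - x0 0 i) - (x 0 i - x0 0 i)) by ring.
exact: conv_norm_lt.
Qed.

(** Strict differentiability: x is moved to y one coordinate at a time, and the
    mean value theorem is applied to each of the [n] moves, all of which stay in
    a ball around [x0] where the partial derivatives are almost constant. *)
Lemma C1_strict (f : 'rV[R]_n -> R) (U : set 'rV[R]_n) x0 : open U -> U x0 ->
  Ck 1 U f -> forall e, 0 < e ->
  exists2 d, 0 < d & forall x y, `|x - x0| < d -> `|y - x0| < d ->
    `|f y - f x - \sum_i (y - x) 0 i * 'D_(e_ i) f x0| <= e * `|y - x|.
Proof.
move=> oU Ux0 Cf e e0.
have n0 : 0 < n.+1%:R :> R by rewrite ltr0n.
set e' := e / n.+1%:R; have e'0 : 0 < e' by rewrite divr_gt0.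
have : \forall z \near x0, U z /\ forall i, `|'D_(e_ i) f x0 - 'D_(e_ i) f z| < e'.
  near=> z; split; first by near: z; exact: open_nbhs_nbhs.
  near: z; apply: filter_forall => i.
  have /cvgrPdist_lt := Ck_continuous (CkD (e_ i) Cf) Ux0; exact.
move=> /nbhs_ballP[d /= d0 Hd]; exists d => // x y hx hy.
have Hb z : `|z - x0| < d -> U z /\ forall i, `|'D_(e_ i) f x0 - 'D_(e_ i) f z| < e'.
  by move=> hz; apply: Hd; rewrite -ball_normE /= distrC.
have E : f y - f x = \sum_(i < n) (f (mix x y i.+1) - f (mix x y i)).
  rewrite -(big_mkord xpredT (fun i => f (mix x y i.+1) - f (mix x y i))) telescope_sumr //.
  congr (f _ - f _); apply/rowP => i; rewrite mxE //=.
  by rewrite ltn_ord.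
rewrite E -sumrB; apply: le_trans (ler_norm_sum _ _ _) _.
apply: (@le_trans _ _ (\sum_(i < n) e' * `|y - x|)); last first.
  rewrite sumr_const card_ord -[leLHS]mulr_natr -mulrA mulrC -mulrA [X in _ <= X]mulrC.
  apply: ler_wpM2l => //; rewrite /e' mulrCA ler_piMr ?(ltW e0) //.
  by rewrite ler_pdivrMr // mul1r ler_nat.
apply: ler_sum => i _.
have seg t : 0 <= t <= 1 -> `|mix x y i + (t * (y 0 i - x 0 i)) *: e_ i - x0| < d.
  by move=> t01; have := mix_ball i i t01 hx hy; rewrite eqxx.
have [|t t01] := @MVT_dir _ f (mix x y i) (e_ i) (y 0 i - x 0 i).
  by move=> t /seg /Hb[Uz _]; exact: Ck_derivable Cf Uz.
rewrite mixS => ->; rewrite !mxE -mulrBr normrM mulrC.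
have [_ /(_ i)] := Hb _ (seg t t01); rewrite distrC => /ltW H.
apply: ler_pM => //.
by have := ler_coord (y - x) 0 i; rewrite !mxE.
Unshelve. all: by end_near. Qed.

End Strict.

(** * Chain rule and symmetry of second derivatives *)

Section Chain.
Variables (R : realType).

Lemma is_deriveP (V W : normedModType R) (f : V -> W) (a v : V) (d : W) :
  is_derive a v f d <->
  (h^-1 *: (f (h *: v + a) - f a) @[h --> (0 : R)^']) --> d.
Proof.
split=> [[df <-]|cd]; first exact: df.
split; first by apply/cvg_ex; exists d.
exact: cvg_lim.
Qed.

Lemma cvg_sum_fin (T I : Type) (F : set_system T) (FF : Filter F) (r : seq I)
    (f : I -> T -> R) (l : I -> R) :
  (forall i, f i x @[x --> F] --> l i) ->
  \sum_(i <- r) f i x @[x --> F] --> \sum_(i <- r) l i.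
Proof.
move=> H; elim: r => [|i r IH].
  by rewrite big_nil; under eq_fun do rewrite big_nil; exact: cvg_cst.
by rewrite big_cons; under eq_fun do rewrite big_cons; exact: cvgD.
Qed.

Variable n : nat.
Local Notation e_ i := (delta_mx 0 i : 'rV[R]_n).

(** Directional derivatives alone satisfy no chain rule; strict
    differentiability of the outer function is what makes it work. *)
Lemma is_derive_chain (V : normedModType R) (F : V -> 'rV[R]_n) (x v : V) w
    (g : 'rV[R]_n -> R) (U : set 'rV[R]_n) : open U -> U (F x) -> Ck 1 U g ->
  is_derive x v F w ->
  is_derive x v (g \o F) (\sum_i w 0 i * 'D_(e_ i) g (F x)).
Proof.
move=> oU UFx Cg dF.
have /is_deriveP cF := dF; apply/is_deriveP => /=.
pose q h := h^-1 *: (F (h *: v + x) - F x).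
have cq : (\sum_i q h 0 i * 'D_(e_ i) g (F x)) @[h --> (0 : R)^'] -->
    \sum_i w 0 i * 'D_(e_ i) g (F x).
  apply: cvg_sum_fin => i; apply: cvgMl; rewrite /q.
  by apply: (@cvg_comp _ _ _ _ (fun M : 'rV[R]_n => M 0 i) _ _ _ cF); exact: coord_continuous.
apply/cvgrPdist_le => e e0.
set e1 := e / 2; have e10 : 0 < e1 by rewrite divr_gt0.
set M := `|w| + 1; have M0 : 0 < M by rewrite ltr_wpDl.
have [d d0 Hd] := C1_strict oU UFx Cg (divr_gt0 e10 M0).
have cFx : (fun h => F (h *: v + x)) @ (0 : R)^' --> F x.
  have : (fun h : R => h *: q h + F x) @ (0 : R)^' --> 0 *: w + F x.
    apply: cvgD; last exact: cvg_cst.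
    by apply: cvgZ => //; apply: cvg_within_filter; exact: cvg_id.
  rewrite scale0r add0r; apply: cvg_trans; apply: near_eq_cvg.
  near=> h; have h0 : h != 0 by near: h; exact: nbhs_dnbhs_neq.
  by rewrite /q scalerA mulfV // scale1r subrK.
near=> h.
have h0 : h != 0 by near: h; exact: nbhs_dnbhs_neq.
have b1 : `|F (h *: v + x) - F x| < d.
  by rewrite distrC; near: h; exact: ((cvgrPdist_lt _ _).1 cFx).
have b0 : `|F x - F x| < d by rewrite subrr normr0.
have Hh := Hd _ _ b0 b1.
have qM : `|q h| <= M.
  have : `|w - q h| <= 1 by near: h; exact: ((cvgrPdist_le _ _).1 cF).
  move=> H; rewrite -[q h](subKr w) (le_trans (ler_normB _ _)) // /M lerD2l.
  exact: H.
have H1 : `|\sum_i w 0 i * 'D_(e_ i) g (F x) - \sum_i q h 0 i * 'D_(e_ i) g (F x)| <= e1.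
  by near: h; exact: ((cvgrPdist_le _ _).1 cq).
have H2 : `|\sum_i q h 0 i * 'D_(e_ i) g (F x) - h^-1 *: (g (F (h *: v + x)) - g (F x))| <= e1.
  rewrite distrC.
  have -> : \sum_i q h 0 i * 'D_(e_ i) g (F x) =
     h^-1 * \sum_i (F (h *: v + x) - F x) 0 i * 'D_(e_ i) g (F x).
    by rewrite mulr_sumr; apply: eq_bigr => i _; rewrite !mxE mulrA.
  rewrite /GRing.scale /= -mulrBr normrM normfV ler_pdivrMl ?normr_gt0 //.
  apply: le_trans Hh _.
  have -> : F (h *: v + x) - F x = h *: q h by rewrite /q scalerA mulfV // scale1r.
  rewrite normrZ mulrCA ler_wpM2l // -mulrA ler_piMr ?(ltW e10) //.
  by rewrite mulrC ler_pdivrMr // mul1r.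
rewrite (splitr e) -(subrKA (\sum_i q h 0 i * 'D_(e_ i) g (F x))).
by apply: le_trans (ler_normD _ _) _; apply: lerD.
Unshelve. all: by end_near. Qed.

Lemma Ck1_derive_sum (g : 'rV[R]_n -> R) (U : set 'rV[R]_n) x v : open U -> U x ->
  Ck 1 U g -> 'D_v g x = \sum_i v 0 i * 'D_(e_ i) g x.
Proof.
move=> oU Ux Cg.
have := @is_derive_chain _ id x v v g U oU Ux Cg (is_derive_id _ _).
by case.
Qed.

Lemma is_derive_chain_dir (V : normedModType R) (F : V -> 'rV[R]_n) (x v : V) w
    (g : 'rV[R]_n -> R) (U : set 'rV[R]_n) : open U -> U (F x) -> Ck 1 U g ->
  is_derive x v F w -> is_derive x v (g \o F) ('D_w g (F x)).
Proof.
move=> oU UFx Cg dF.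
by rewrite (Ck1_derive_sum w oU UFx Cg); exact: (is_derive_chain oU UFx Cg dF).
Qed.

Lemma is_derive_chain_mx (p q : nat) (V : normedModType R) (F : V -> 'rV[R]_n) (x v : V) w
    (g : 'rV[R]_n -> 'M[R]_(p, q)) (U : set 'rV[R]_n) : open U -> U (F x) -> Ck 1 U g ->
  is_derive x v F w -> is_derive x v (g \o F) ('D_w g (F x)).
Proof.
move=> oU UFx Cg dF; apply: is_derive_mx => i j.
have Cij := (Ck_mxP _ _ oU).1 Cg i j.
rewrite derive_coord; last exact: Ck_derivable Cg UFx.
exact: (is_derive_chain_dir oU UFx Cij dF).
Qed.

Lemma Ck1_derive_sum_mx (p q : nat) (g : 'rV[R]_n -> 'M[R]_(p, q)) (U : set 'rV[R]_n) x v :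
  open U -> U x -> Ck 1 U g -> 'D_v g x = \sum_i v 0 i *: 'D_(e_ i) g x.
Proof.
move=> oU Ux Cg; apply/matrixP => a b.
have dg w : derivable g x w := Ck_derivable Cg Ux.
rewrite derive_coord // (Ck1_derive_sum v oU Ux ((Ck_mxP _ _ oU).1 Cg a b)).
by rewrite summxE; apply: eq_bigr => i _; rewrite !mxE derive_coord.
Qed.

Lemma open_preim_for (T T' : topologicalType) (f : T -> T') (U : set T) (N : set T') :
  open U -> open N -> (forall x, U x -> {for x, continuous f}) ->
  open [set x | U x /\ N (f x)].
Proof.
move=> oU oN cf; rewrite openE => x [Ux Nx]; rewrite /interior.
near=> y; split; first by near: y; exact: open_nbhs_nbhs.
by near: y; apply: (cf x Ux); exact: open_nbhs_nbhs.
Unshelve. all: by end_near. Qed.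

Lemma Ck_comp_scalar k (V : normedModType R) (U : set V) (F : V -> 'rV[R]_n)
    (N : set 'rV[R]_n) (g : 'rV[R]_n -> R) : open U -> open N ->
  (forall x, U x -> N (F x)) -> Ck k U F -> Ck k N g -> Ck k U (g \o F).
Proof.
move=> oU oN UN; elim: k g => [|k IH] g CF Cg.
  split=> // x Ux; apply: continuous_comp; first exact: Ck_continuous CF Ux.
  exact: Ck_continuous Cg (UN _ Ux).
have C1g : Ck 1 N g by have [a [b c]] := Cg; split=> //; split=> // v; split=> // x Nx; exact: Ck_continuous (c v) Nx.
have dd x v : U x -> is_derive x v (g \o F) (\sum_i ('D_v F x) 0 i * 'D_(e_ i) g (F x)).
  move=> Ux; apply: (is_derive_chain oN (UN _ Ux) C1g).
  by apply/derivableP; exact: Ck_derivable CF Ux.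
split.
  move=> x Ux; apply: continuous_comp; first exact: Ck_continuous CF Ux.
  exact: Ck_continuous Cg (UN _ Ux).
split=> [x v Ux|v]; first by have [] := dd x v Ux.
apply: (@Ck_ext _ _ _ k U (fun x => \sum_i ('D_v F x) 0 i * ('D_(e_ i) g \o F) x)) => //.
  by move=> x Ux; have [_ ->] := dd x v Ux.
apply: Ck_sum => // i; apply: Ck_mul => //.
  exact: (Ck_mxP _ _ oU).1 (CkD v CF) 0 i.
apply: IH; [exact: CkW|exact: CkD].
Qed.

Lemma Ck_comp k (p q : nat) (V : normedModType R) (U : set V) (F : V -> 'rV[R]_n)
    (N : set 'rV[R]_n) (g : 'rV[R]_n -> 'M[R]_(p, q)) : open U -> open N ->
  (forall x, U x -> N (F x)) -> Ck k U F -> Ck k N g -> Ck k U (g \o F).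
Proof.
move=> oU oN UN CF Cg; apply/(Ck_mxP _ _ oU) => i j.
exact: (Ck_comp_scalar oU oN UN CF ((Ck_mxP _ _ oN).1 Cg i j)).
Qed.

Lemma smooth_comp (p q : nat) (V : normedModType R) (U : set V) (F : V -> 'rV[R]_n)
    (N : set 'rV[R]_n) (g : 'rV[R]_n -> 'M[R]_(p, q)) : open U -> open N ->
  (forall x, U x -> N (F x)) -> smooth U F -> smooth N g -> smooth U (g \o F).
Proof. by move=> oU oN UN sF sg k; exact: (Ck_comp oU oN). Qed.

End Chain.

Section Schwarz.
Variables (R : realType) (V : normedModType R).

Let schwarz_aux (f : V -> R) (U : set V) x u v : open U -> U x -> Ck 2 U f ->
  forall e, 0 < e -> exists2 d, 0 < d & forall h : R, 0 < h -> h < d ->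
   `|h^-1 * h^-1 * (f (x + h *: u + h *: v) - f (x + h *: u) - f (x + h *: v) + f x)
     - 'D_v ('D_u f) x| < e.
Proof.
move=> oU Ux Cf e e0.
have cont := Ck_continuous (CkD v (CkD u Cf)) Ux.
have : \forall z \near x, U z /\ `|'D_v ('D_u f) x - 'D_v ('D_u f) z| < e.
  near=> z; split; first by near: z; exact: open_nbhs_nbhs.
  by near: z; move/cvgrPdist_lt: cont; exact.
move=> /nbhs_ballP[d /= d0 Hd].
set M := `|u| + `|v| + 1.
have M0 : 0 < M by rewrite ltr_wpDl // addr_ge0.
exists (d / M); first by rewrite divr_gt0.
move=> h h0 hd.
have Hb (s t : R) : 0 <= s <= 1 -> 0 <= t <= 1 ->
    U (x + (s * h) *: u + (t * h) *: v) /\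
    `|'D_v ('D_u f) x - 'D_v ('D_u f) (x + (s * h) *: u + (t * h) *: v)| < e.
  move=> /andP[s0 s1] /andP[t0 t1]; apply: Hd; rewrite -ball_normE /=.
  rewrite opprD addrA opprD addrA subrr add0r -opprD normrN.
  apply: le_lt_trans (ler_normD _ _) _; rewrite !normrZ.
  rewrite (ger0_norm s0) (ger0_norm t0) (gtr0_norm h0).
  apply: (@le_lt_trans _ _ (h * `|u| + h * `|v|)).
    by apply: lerD; apply: ler_wpM2r => //; rewrite ler_piMl // ltW.
  rewrite -mulrDr; move: hd; rewrite ltr_pdivlMr //; apply: le_lt_trans.
  by rewrite ler_wpM2l ?(ltW h0) // /M lerDl.
have C1 : Ck 1 U f := CkW Cf.
have der_shift (z : V) : U z -> U (z + h *: v) ->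
    is_derive z u (fun z => f (z + h *: v) - f z) ('D_u f (z + h *: v) - 'D_u f z).
  move=> Uz Uzh; apply: is_deriveB; last by apply/derivableP; exact: (Ck_derivable C1).
  have d1 : derivable f (z + h *: v) u := Ck_derivable C1 Uzh.
  have /derivableP/is_deriveP H := d1.
  by apply/is_deriveP; apply: cvg_trans H; apply: near_eq_cvg; near=> r; rewrite addrA.
have Uz (s : R) : 0 <= s <= 1 -> U (x + (s * h) *: u) /\ U (x + (s * h) *: u + h *: v).
  move=> s01; split.
    by have [] := Hb s 0 s01; rewrite ?lexx ?ler01 // mul0r scale0r addr0.
  by have [] := Hb s 1 s01; rewrite ?lexx ?ler01 // mul1r.
have [|s s01] := @MVT_dir _ _ (fun z => f (z + h *: v) - f z) x u h.
  by move=> s /Uz[U1 U2]; have [] := der_shift _ U1 U2.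
have [U1 U2] := Uz s s01.
have [_ ->] := der_shift _ U1 U2.
have [|t t01 ->] := @MVT_dir _ _ ('D_u f) (x + (s * h) *: u) v h.
  by move=> t t01; have [U3 _] := Hb s t s01 t01; exact: (Ck_derivable (CkD u Cf) U3).
move=> E.
have [_ H] := Hb s t s01 t01.
have -> : f (x + h *: u + h *: v) - f (x + h *: u) - f (x + h *: v) + f x =
  h * (h * 'D_v ('D_u f) (x + (s * h) *: u + (t * h) *: v)).
  by rewrite -E opprB addrA addrAC.
move: H; move: ('D_v ('D_u f) (x + (s * h) *: u + (t * h) *: v)) => z.
rewrite (distrC _ z).
suff -> : h^-1 * h^-1 * (h * (h * z)) = z by [].
by rewrite -mulrA (mulKf (lt0r_neq0 h0)) (mulKf (lt0r_neq0 h0)).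
Unshelve. all: by end_near. Qed.

(** Both mixed derivatives are the limit of the same symmetric second
    difference. *)
Lemma schwarz (f : V -> R) (U : set V) x u v : open U -> U x -> Ck 2 U f ->
  'D_v ('D_u f) x = 'D_u ('D_v f) x.
Proof.
move=> oU Ux Cf; apply/eqP; rewrite -subr_eq0 -normr_eq0; apply/negPn/negP => ne.
set c := `|_| in ne.
have c0 : 0 < c by rewrite lt_neqAle eq_sym ne normr_ge0.
have e0 : 0 < c / 2 by rewrite divr_gt0.
have [d1 d10 H1] := schwarz_aux u v oU Ux Cf e0.
have [d2 d20 H2] := schwarz_aux v u oU Ux Cf e0.
set h := Num.min d1 d2 / 2.
have hm : 0 < Num.min d1 d2 by rewrite lt_min d10.
have h0 : 0 < h by rewrite divr_gt0.
have hm2 : h < Num.min d1 d2 by rewrite ltr_pdivrMr // ltr_pMr // ltr1n.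
move: hm2; rewrite lt_min => /andP[h1 h2].
have := H1 h h0 h1; have := H2 h h0 h2.
have -> : f (x + h *: v + h *: u) - f (x + h *: v) - f (x + h *: u) + f x =
  f (x + h *: u + h *: v) - f (x + h *: u) - f (x + h *: v) + f x.
  by rewrite (addrAC x) -!addrA (addrCA (- f _)).
set Q := _ * _ * _ => A B.
have : c < c / 2 + c / 2.
  rewrite {1}/c -(subrKA Q); apply: le_lt_trans (ler_normD _ _) _.
  by apply: ltrD; [rewrite distrC; exact: B|exact: A].
by rewrite -splitr ltxx.
Qed.

Lemma schwarz_mx (p q : nat) (M : V -> 'M[R]_(p, q)) (U : set V) x u v : open U -> U x ->
  Ck 2 U M -> 'D_v ('D_u M) x = 'D_u ('D_v M) x.
Proof.
move=> oU Ux CM; apply/matrixP => a b.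
have H u' v' : ('D_v' ('D_u' M) x) a b = 'D_v' ('D_u' (fun y => M y a b)) x.
  rewrite derive_coord; last exact: (Ck_derivable (CkD u' CM)) Ux.
  apply: near_eq_derive; apply: (open_near oU Ux) => z Uz.
  by rewrite derive_coord //; exact: (Ck_derivable (CkW CM)) Uz.
have E := schwarz u v oU Ux ((Ck_mxP 2 M oU).1 CM a b).
exact: etrans (H u v) (etrans E (esym (H v u))).
Qed.
End Schwarz.

Opaque derive.

(** * Primitives and the Gronwall inequality *)

Section ODE.
Variables (R : realType).

(** The retraction of the line onto [-a, a]; composed with it, a function that
    is only controlled on that interval becomes continuous everywhere. *)
Definition clamp (a t : R) : R := (`|t + a| - `|t - a|) / 2.

Lemma clamp_id (a t : R) : `|t| <= a -> clamp a t = t.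
Proof.
rewrite ler_norml => /andP[t1 t2]; rewrite /clamp ger0_norm; last by lra.
by rewrite ler0_norm; [lra|lra].
Qed.

Lemma clamp_le (a t : R) : 0 <= a -> `|clamp a t| <= a.
Proof.
move=> a0; rewrite /clamp normrM [`|2^-1|]ger0_norm; last by lra.
have : `|(`|t + a| - `|t - a|)| <= `|(t + a) - (t - a)| by exact: ler_dist_dist.
have -> : t + a - (t - a) = 2 * a by ring.
rewrite [X in _ <= X]ger0_norm ?mulr_ge0 // => H.
by rewrite ler_pdivrMr // mulrC.
Qed.

Lemma clamp_continuous (a : R) : continuous (clamp a).
Proof.
move=> t; rewrite /clamp; apply: cvgMl; apply: cvgB; apply: cvg_norm.
  by apply: cvgD; [exact: cvg_id|exact: cvg_cst].
by apply: cvgB; [exact: cvg_id|exact: cvg_cst].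
Qed.

(** The fundamental theorem of calculus, on a fixed interval around 0 on which
    all later equations are solved. *)
Lemma primitive_ex (f : R -> R) : continuous f -> exists F : R -> R,
  [/\ continuous F, F 0 = 0 & forall t : R, `|t| < 2 -> is_derive t 1 F (f t)].
Proof.
move=> cf.
pose G x := \int[@lebesgue_measure R]_(t in [set` `[(-3 : R), x]]) (f t).
have dG (x : R) : `|x| < 3 -> is_derive x 1 G (f x).
  move=> x3; have [x1 x2] : -3 < x /\ x < 3 by move: x3; rewrite ltr_norml => /andP.
  have [||//||d1 d2] := @continuous_FTC1_closed R f (-3) x 3.
  - by [].
  - apply: continuous_compact_integrable; first exact: segment_compact.
    exact: continuous_subspaceT.
  - exact: cf.
  by split; [exact: d1|rewrite -derive1E; exact: d2].
have cG (x : R) : `|x| < 3 -> {for x, continuous G}.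
  move=> /dG[d _]; apply: differentiable_continuous; exact/derivable1_diffP.
exists (fun t => G (clamp 2 t) - G 0); split.
- move=> t; apply: cvgB; last exact: cvg_cst.
  apply: (@continuous_comp _ _ _ (clamp 2) G); first exact: clamp_continuous.
  by apply: cG; apply: le_lt_trans (clamp_le t _) _ => //; rewrite ltr_nat.
- by rewrite clamp_id ?subrr // normr0.
move=> t t2; have t3 : `|t| < 3 by apply: lt_trans t2 _; rewrite ltr_nat.
have H : is_derive t 1 (fun t => G t - G 0) (f t).
  by rewrite -[f t]subr0; apply: is_deriveB; exact: dG.
apply: near_eq_is_derive H; near=> s; rewrite clamp_id // ltW //.
near: s; apply: (@open_near _ _ [set s : R | `|s| < 2]) => //.
by apply: (@open_comp _ _ (fun s : R => `|s|) [set x | x < 2]) => [x _|]; [exact: norm_continuous|exact: open_lt].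
Unshelve. all: by end_near. Qed.

Lemma mx_norm_mul (m n p : nat) (A : 'M[R]_(m, n)) (B : 'M[R]_(n, p)) :
  `|A *m B| <= n%:R * `|A| * `|B|.
Proof.
apply: mx_norm_le => [|i j]; first by rewrite !mulr_ge0.
rewrite mxE; apply: le_trans (ler_norm_sum _ _ _) _.
apply: (@le_trans _ _ (\sum_(l < n) `|A| * `|B|)).
  by apply: ler_sum => l _; rewrite normrM; apply: ler_pM => //; exact: ler_coord.
by rewrite sumr_const card_ord -mulrA mulr_natl.
Qed.

Lemma mean_value_le (m n : nat) (Y Y' : R -> 'M[R]_(m, n)) (t C : R) :
  (forall s : R, 0 <= s <= 1 -> is_derive (s * t) 1 Y (Y' (s * t))) ->
  (forall s : R, 0 <= s <= 1 -> `|Y' (s * t)| <= C) ->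
  `|Y t - Y 0| <= C * `|t|.
Proof.
move=> dY bY.
have C0 : 0 <= C by apply: le_trans (bY 0 _); rewrite ?lexx ?ler01.
apply: mx_norm_le => [|i j]; first by rewrite mulr_ge0.
rewrite !mxE.
have E (s : R) : (0 : R) + s *: (1 : R) = s by rewrite add0r [LHS]mulr1.
have [|s s01] := @MVT_dir R R (fun s => Y s i j) 0 1 t.
  move=> s s01; have [d _] := is_derive_coord i j (dY s s01).
  by rewrite E.
rewrite !E => ->; rewrite normrM mulrC; apply: ler_pM => //.
have [_ ->] := is_derive_coord i j (dY s s01).
by apply: le_trans (bY s s01); exact: ler_coord.
Qed.

(** On [0, 1] the mean value bound reads sup |Y| <= (sup |Y|) / 4 + b, and the
    first term can be absorbed; no exponential is needed. *)
Lemma gronwall (m n : nat) (Y Y' : R -> 'M[R]_(m, n)) (b : R) :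
  (forall t : R, 0 <= t <= 1 -> is_derive t 1 Y (Y' t)) ->
  (forall t : R, 0 <= t <= 1 -> `|Y' t| <= 4^-1 * `|Y t| + b) ->
  Y 0 = 0 -> forall t : R, 0 <= t <= 1 -> `|Y t| <= 2 * b.
Proof.
move=> dY bY Y0.
have cY (t : R) : 0 <= t <= 1 -> {for t, continuous Y}.
  move=> t01; apply/continuous_mxP => i j.
  have [d _] := is_derive_coord i j (dY t t01).
  by apply: differentiable_continuous; exact/derivable1_diffP.
have cw : {within `[(0 : R), 1], continuous (fun t => `|Y t|)}.
  apply: continuous_in_subspaceT => t; rewrite inE /= in_itv /= => t01.
  by apply: (@continuous_comp _ _ _ Y (fun M => `|M|)); [exact: cY|exact: norm_continuous].
have [c c01 Hc] := EVT_max ler01 cw.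
move: c01; rewrite in_itv /= => c01.
have {}Hc (t : R) : 0 <= t <= 1 -> `|Y t| <= `|Y c| by move=> t01; apply: Hc; rewrite in_itv.
have c1 : `|c| <= 1 by have /andP[c0 c1] := c01; rewrite ger0_norm.
have b0 : 0 <= 4^-1 * `|Y c| + b by apply: le_trans (bY c c01).
have H : `|Y c - Y 0| <= (4^-1 * `|Y c| + b) * `|c|.
  have sc (s : R) : 0 <= s <= 1 -> 0 <= s * c <= 1.
    move=> /andP[s0 s1]; have /andP[c0' c1'] := c01.
    by rewrite mulr_ge0 //= mulr_ile1.
  apply: (@mean_value_le _ _ _ Y') => s /sc sc01; first exact: dY.
  by apply: le_trans (bY _ sc01) _; rewrite lerD2r ler_wpM2l ?invr_ge0 // Hc.
have H2 : `|Y c| <= 4^-1 * `|Y c| + b.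
  move: H; rewrite Y0 subr0 => /le_trans; apply.
  by rewrite ler_piMr.
move=> t /Hc Ht; apply: le_trans Ht _; have := normr_ge0 (Y c); move: H2.
by set y := `|Y c|; lra.
Qed.

(** Convergence of the Picard iterates, with the rate that later estimates use. *)
Lemma geometric_cauchy_ex (u : nat -> R) (C : R) :
  (forall n, `|u n.+1 - u n| <= C / 2 ^+ n) ->
  exists l, forall n, `|u n - l| <= 2 * C / 2 ^+ n.
Proof.
move=> H.
have p2 n : 0 < 2 ^+ n :> R by rewrite exprn_gt0.
have HC n : 2 * C / 2 ^+ n.+1 = C / 2 ^+ n.
  by rewrite exprS invfM mulrACA mulfV ?mul1r.
have mon (n k : nat) : u n - 2 * C / 2 ^+ n <= u (n + k)%N - 2 * C / 2 ^+ (n + k) /\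
    u (n + k)%N + 2 * C / 2 ^+ (n + k) <= u n + 2 * C / 2 ^+ n.
  elim: k => [|k [IH1 IH2]]; first by rewrite addn0 !lexx.
  rewrite addnS; have := H (n + k)%N; rewrite ler_norml HC => /andP[h1 h2].
  have E : 2 * C / 2 ^+ (n + k) = 2 * (C / 2 ^+ (n + k)) by rewrite mulrA.
  by move: IH1 IH2; rewrite E; split; lra.
have C0 : 0 <= C by have := H 0%N; rewrite expr0 divr1; apply: le_trans.
have a0 n : 0 <= 2 * C / 2 ^+ n by rewrite divr_ge0 ?mulr_ge0 // ltW.
pose S := [set u n - 2 * C / 2 ^+ n | n in [set: nat]].
have S0 : S !=set0 by exists (u 0%N - 2 * C / 2 ^+ 0); exists 0%N.
have ub n : ubound S (u n + 2 * C / 2 ^+ n).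
  move=> _ [k _ <-].
  have [h1 _] := mon k n; have [_ h2] := mon n k.
  rewrite addnC in h2; have := a0 (k + n)%N; lra.
have hs : has_sup S by split=> //; exists (u 0%N + 2 * C / 2 ^+ 0); exact: ub.
exists (sup S) => n.
have l1 : u n - 2 * C / 2 ^+ n <= sup S by apply: (ub_le_sup hs.2); exists n.
have l2 : sup S <= u n + 2 * C / 2 ^+ n by apply: ge_sup S0 (ub n).
rewrite ler_norml; apply/andP; split; lra.
Qed.
End ODE.

(** * Linear ordinary differential equations *)

Section LinearODE.
Variables (R : realType).

Lemma eq_continuous_for (T T' : topologicalType) (f g : T -> T') x :
  f =1 g -> {for x, continuous f} -> {for x, continuous g}.
Proof. by move=> /funext ->. Qed.

Lemma continuous_mulmx (T : topologicalType) (m n p : nat) (M : T -> 'M[R]_(m, n))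
    (N : T -> 'M[R]_(n, p)) x : {for x, continuous M} -> {for x, continuous N} ->
  {for x, continuous (fun y => M y *m N y)}.
Proof.
move=> cM cN; apply/continuous_mxP => i j.
apply: (@eq_continuous_for _ _ (fun y => \sum_l M y i l * N y l j)).
  by move=> y; rewrite mxE.
apply: cvg_sum_fin => l; apply: cvgM.
  exact: (continuous_mxP M x).1 cM _ _.
exact: (continuous_mxP N x).1 cN _ _.
Qed.

Lemma primitive_mx_ex (p q : nat) (f : R -> 'M[R]_(p, q)) : continuous f ->
  exists F : R -> 'M[R]_(p, q),
  [/\ continuous F, F 0 = 0 & forall t : R, `|t| < 2 -> is_derive t 1 F (f t)].
Proof.
move=> cf.
have /choice[F HF] : forall ij : 'I_p * 'I_q, exists F : R -> R,
   [/\ continuous F, F 0 = 0 & forall t : R, `|t| < 2 -> is_derive t 1 F (f t ij.1 ij.2)].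
  move=> ij; apply: (@primitive_ex R (fun t => f t ij.1 ij.2)) => t.
  exact: (continuous_mxP f t).1 (cf t) _ _.
exists (fun t => \matrix_(i, j) F (i, j) t); split.
- move=> t; apply/continuous_mxP => i j; have [c _ _] := HF (i, j).
  by apply: eq_continuous_for (c t) => s; rewrite mxE.
- by apply/matrixP => i j; rewrite !mxE; have [_ -> _] := HF (i, j).
move=> t t2; apply: is_derive_mx => i j.
under eq_fun do rewrite mxE.
by have [_ _ H] := HF (i, j); exact: H.
Qed.

Lemma half_pow_small (K e : R) : 0 < e -> exists n, K / 2 ^+ n <= e.
Proof.
move=> e0.
have [n Hn] : exists n : nat, K / e < n%:R.
  by exists (Num.trunc `|K / e|).+1; apply: le_lt_trans (ler_norm _) (truncnS_gt _).
exists n; rewrite ler_pdivrMr ?exprn_gt0 // mulrC -ler_pdivrMr //.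
apply: le_trans (ltW Hn) _.
by rewrite -natrX ler_nat ltnW // ltn_expl.
Qed.

Lemma half_pow_le0 (K x : R) : (forall n, x <= K / 2 ^+ n) -> x <= 0.
Proof.
move=> H; rewrite leNgt; apply/negP => x0.
have [n Hn] := half_pow_small K (divr_gt0 x0 (ltr0n R 2)).
have := le_trans (H n) Hn; rewrite ler_pdivlMr //; lra.
Qed.

(** Picard iteration.  The smallness assumption makes the integral operator a
    contraction with factor 1/4 on (-2, 2), so that one iteration scheme works
    on the whole interval; the limit is a solution on (-3/2, 3/2). *)
Lemma linear_ode (N q : nat) (B : R -> 'M[R]_N) (X0 : 'M[R]_(N, q)) :
  continuous B -> (forall t, N%:R * `|B t| <= 8^-1) ->
  exists2 X : R -> 'M[R]_(N, q), X 0 = X0 &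
    forall t : R, `|t| < 3 / 2 -> is_derive t 1 X (B t *m X t).
Proof.
move=> cB bB.
have bBM (t : R) (M : 'M[R]_(N, q)) : `|B t *m M| <= 8^-1 * `|M|.
  by apply: le_trans (mx_norm_mul _ _) _; rewrite ler_wpM2r.
have /choice[P HP] : forall Y : R -> 'M[R]_(N, q), exists Z : R -> 'M[R]_(N, q),
    continuous Y -> [/\ continuous Z, Z 0 = X0 &
      forall t : R, `|t| < 2 -> is_derive t 1 Z (B t *m Y t)].
  move=> Y; have [cY|] := pselect (continuous Y); last by exists Y.
  have [|F [cF F0 dF]] := @primitive_mx_ex N q (fun t => B t *m Y t).
    by move=> t; apply: continuous_mulmx; [exact: cB|exact: cY].
  exists (fun t => F t + X0) => _; split.
  - by move=> t; apply: cvgD; [exact: cF|exact: cvg_cst].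
  - by rewrite F0 add0r.
  move=> t t2; rewrite -[B t *m Y t]addr0.
  by apply: is_deriveD; exact: dF.
(* the Picard iterates *)
pose X n := iter n P (cst X0).
have cX n : continuous (X n).
  by elim: n => [|n IH]; [move=> t; exact: cvg_cst|have [] := HP _ IH].
have X0E n : X n 0 = X0 by case: n => [//|n]; have [] := HP _ (cX n).
have dX n (t : R) : `|t| < 2 -> is_derive t 1 (X n.+1) (B t *m X n t).
  by have [_ _] := HP _ (cX n); exact.
have scale_lt (s t : R) : 0 <= s <= 1 -> `|t| < 2 -> `|s * t| < 2.
  move=> /andP[s0 s1] t2; rewrite normrM (ger0_norm s0); apply: le_lt_trans t2.
  by rewrite ler_piMl.
set C0 := `|X0|.
have C00 : 0 <= C0 by exact: normr_ge0.
have step n (t : R) : `|t| < 2 -> `|X n.+1 t - X n t| <= C0 / 2 ^+ n.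
  elim: n t => [|n IH] t t2.
    rewrite expr0 divr1 {2}/X /= -[X0 in _ - cst X0 t](X0E 1%N).
    have H := @mean_value_le R _ _ (X 1%N) (fun s => B s *m X0) t (8^-1 * C0).
    apply: le_trans (H _ _) _.
    - by move=> s s01; exact: (dX 0%N _ (scale_lt _ _ s01 t2)).
    - by move=> s _; exact: bBM.
    have := normr_ge0 X0; rewrite -/C0; nra.
  have H := @mean_value_le R _ _ (fun s => X n.+2 s - X n.+1 s)
     (fun s => B s *m X n.+1 s - B s *m X n s) t (8^-1 * (C0 / 2 ^+ n)).
  rewrite !X0E subrr subr0 in H; apply: le_trans (H _ _) _.
  - by move=> s s01; apply: is_deriveB; apply: dX; exact: scale_lt.
  - move=> s s01; rewrite -mulmxBr; apply: le_trans (bBM _ _) _.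
    by rewrite ler_wpM2l ?invr_ge0 //; apply: IH; exact: scale_lt.
  rewrite exprS invfM.
  have : 0 <= C0 / 2 ^+ n by rewrite divr_ge0 // ?exprn_ge0.
  have -> : C0 * (2^-1 / 2 ^+ n) = 2^-1 * (C0 / 2 ^+ n) by rewrite mulrCA.
  set z := C0 / _ => z0; nra.
have /choice[L HL] : forall t : R, exists L : 'M[R]_(N, q),
    `|t| < 2 -> forall n, `|X n t - L| <= 2 * C0 / 2 ^+ n.
  move=> t; have [t2|] := boolP (`|t| < 2); last by exists 0.
  have /choice[l Hl] : forall ij : 'I_N * 'I_q, exists l, forall n,
       `|X n t ij.1 ij.2 - l| <= 2 * C0 / 2 ^+ n.
    move=> ij; apply: geometric_cauchy_ex => n; apply: le_trans (step n t t2).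
    by have := ler_coord (X n.+1 t - X n t) ij.1 ij.2; rewrite !mxE.
  exists (\matrix_(i, j) l (i, j)) => _ n.
  apply: mx_norm_le; first by rewrite divr_ge0 ?mulr_ge0 ?exprn_ge0.
  by move=> i j; rewrite !mxE; exact: (Hl (i, j) n).
have cL (t : R) : `|t| < 2 -> {for t, continuous L}.
  move=> t2; apply/cvgrPdist_le => e e0.
  have e3 : 0 < e / 3 by rewrite divr_gt0.
  have [n Hn] := half_pow_small (2 * C0) e3.
  near=> s.
  have s2 : `|s| < 2.
    near: s; apply: (@open_near _ _ [set s : R | `|s| < 2]) => //.
    by apply: (@open_comp _ _ (fun s : R => `|s|) [set x | x < 2]) => [x _|]; [exact: norm_continuous|exact: open_lt].
  have h1 := le_trans (HL t t2 n) Hn; have h2 := le_trans (HL s s2 n) Hn.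
  have h3 : `|X n t - X n s| <= e / 3 by near: s; exact: ((cvgrPdist_le _ _).1 (cX n t)).
  have -> : L t - L s = - (X n t - L t) + ((X n t - X n s) + (X n s - L s)).
    by rewrite subrKA opprB subrKA.
  apply: le_trans (ler_normD _ _) _; rewrite normrN.
  have := ler_normD (X n t - X n s) (X n s - L s); lra.
(* The limit is continuous on (-2, 2) only; it is replaced outside of
   [-3/2, 3/2] in order to apply P once more. *)
pose Lc t := L (clamp (3 / 2) t).
have c32 : 0 <= 3 / 2 :> R by rewrite divr_ge0.
have cl2 t : `|clamp (3 / 2 : R) t| < 2 by apply: le_lt_trans (clamp_le t c32) _; lra.
have cLc : continuous Lc.
  move=> t; apply: (@continuous_comp _ _ _ (clamp (3/2)) L); first exact: clamp_continuous.
  exact: cL.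
have [cY Y0 dY] := HP _ cLc.
exists (P Lc) => // t t32.
have t2 : `|t| < 2 by lra.
suff E : Lc t = P Lc t by rewrite -E; exact: dY.
rewrite /Lc clamp_id ?ltW //.
apply/eqP; rewrite -subr_eq0 -normr_le0; apply/(@half_pow_le0 (4 * C0)) => n.
have h1 := HL t t2 n.+1.
have H := @mean_value_le R _ _ (fun s => X n.+1 s - P Lc s)
     (fun s => B s *m X n s - B s *m Lc s) t (8^-1 * (2 * C0 / 2 ^+ n)).
rewrite X0E Y0 subrr subr0 in H.
have h2 : `|X n.+1 t - P Lc t| <= 8^-1 * (2 * C0 / 2 ^+ n) * `|t|; first apply: H.
- by move=> s s01; apply: is_deriveB; [apply: dX|apply: dY]; exact: scale_lt.
- move=> s s01; rewrite -mulmxBr; apply: le_trans (bBM _ _) _.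
  rewrite ler_wpM2l ?invr_ge0 // /Lc clamp_id; first by apply: HL; exact: scale_lt.
  move: s01 => /andP[s0 s1]; rewrite normrM (ger0_norm s0); apply: le_trans (ltW t32).
  by rewrite ler_piMl.
have -> : L t - P Lc t = - (X n.+1 t - L t) + (X n.+1 t - P Lc t).
  by rewrite opprB subrKA.
apply: le_trans (ler_normD _ _) _; rewrite normrN.
apply: le_trans (lerD h1 h2) _.
have z0 : 0 <= C0 / 2 ^+ n by rewrite divr_ge0 // ?exprn_ge0.
have e1 : 2 * C0 / 2 ^+ n.+1 = C0 / 2 ^+ n.
  by rewrite exprS invfM mulrACA mulfV ?mul1r.
have e2 : 4 * C0 / 2 ^+ n = 4 * (C0 / 2 ^+ n) by rewrite mulrA.
have e3 : 2 * C0 / 2 ^+ n = 2 * (C0 / 2 ^+ n) by rewrite mulrA.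
rewrite e1 e2 e3; move: z0; set z := C0 / _ => z0; nra.
Unshelve. all: by end_near. Qed.
End LinearODE.

(** * Second order estimates for linear systems *)

Section Flat.
Variables (R : realType) (m : nat).
Local Notation e_ i := (delta_mx 0 i : 'rV[R]_m).

(** A system of equations d_i X = A_i X says that the derivative of X along [v]
    is [Adir A v] X. *)
Definition Adir N (A : 'I_m -> 'rV[R]_m -> 'M[R]_N) (v y : 'rV[R]_m) : 'M[R]_N :=
  \sum_i v 0 i *: A i y.

Lemma AdirDZ N (A : 'I_m -> 'rV[R]_m -> 'M[R]_N) w v (h : R) y :
  Adir A (w + h *: v) y = Adir A w y + h *: Adir A v y.
Proof.
rewrite /Adir scaler_sumr -big_split /=; apply: eq_bigr => i _.
by rewrite !mxE scalerDl scalerA.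
Qed.

Lemma Ck_Adir N k U (A : 'I_m -> 'rV[R]_m -> 'M[R]_N) v : open U ->
  (forall i, Ck k U (A i)) -> Ck k U (Adir A v).
Proof. by move=> oU CA; apply: Ck_sum => // i; apply: Ck_scale. Qed.

Lemma Adir_bound N (A : 'I_m -> 'rV[R]_m -> 'M[R]_N) v y M :
  (forall i, `|A i y| <= M) -> `|Adir A v y| <= m%:R * M * `|v|.
Proof.
move=> H; apply: le_trans (ler_norm_sum _ _ _) _.
apply: (@le_trans _ _ (\sum_(i < m) M * `|v|)).
  apply: ler_sum => i _; rewrite normrZ mulrC.
  by apply: ler_pM => //; exact: ler_coord.
by rewrite sumr_const card_ord -mulrA mulr_natl.
Qed.

Definition cball (y0 : 'rV[R]_m) (r : R) := [set y : 'rV[R]_m | `|y - y0| <= r].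

Lemma cball_seg y0 r z v (s t : R) : cball y0 r z -> cball y0 r (z + t *: v) ->
  0 <= s <= 1 -> cball y0 r (z + (s * t) *: v).
Proof.
rewrite /cball /= => h1 h2 /andP[s0 s1].
have -> : z + (s * t) *: v - y0 = (1 - s) *: (z - y0) + s *: (z + t *: v - y0).
  apply/matrixP => i j; rewrite !mxE; ring.
apply: le_trans (ler_normD _ _) _; rewrite !normrZ (ger0_norm s0) ger0_norm ?subr_ge0 //.
have -> : r = (1 - s) * r + s * r by ring.
by apply: lerD; apply: ler_wpM2l; rewrite ?subr_ge0.
Qed.

Lemma open_cball U (y0 : 'rV[R]_m) : open U -> U y0 ->
  exists2 r : R, 0 < r & cball y0 r `<=` U.
Proof.
move=> oU Uy0; have /nbhs_ballP[r /= r0 H] : nbhs y0 U by exact: open_nbhs_nbhs.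
exists (r / 2); first by rewrite divr_gt0.
move=> y /= yr; apply: H; rewrite -ball_normE /= distrC.
by apply: le_lt_trans yr _; rewrite ltr_pdivrMr // ltr_pMr // ltr1n.
Qed.

Lemma open_oball (y0 : 'rV[R]_m) (r : R) : open [set y : 'rV[R]_m | `|y - y0| < r].
Proof.
have -> : [set y : 'rV[R]_m | `|y - y0| < r] = ball y0 r.
  by rewrite -ball_normE; apply/seteqP; split => y /=; rewrite distrC.
exact: ball_open.
Qed.

Lemma cball_compact (y0 : 'rV[R]_m) r : compact (cball y0 r).
Proof.
have cn : continuous (fun y : 'rV[R]_m => `|y - y0|).
  move=> y; apply: (@continuous_comp _ _ _ (fun y : 'rV[R]_m => y - y0) (fun y : 'rV[R]_m => `|y|)).
    by apply: (@continuousB R 'rV[R]_m 'rV[R]_m id (cst y0) y) => //; exact: cst_continuous.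
  exact: norm_continuous.
apply: bounded_closed_compact.
  exists (`|y0| + r); split; first exact: num_real.
  move=> M hM y /= yr; apply: le_trans (ltW hM).
  by rewrite -[y](subrK y0) addrC; apply: le_trans (ler_normD _ _) _; rewrite lerD2l.
have -> : cball y0 r = (fun y => `|y - y0|) @^-1` [set x | x <= r] by [].
apply: closed_comp; last exact: closed_le.
by move=> y _; exact: cn.
Qed.

Lemma cball_bounded (p q : nat) U y0 r (f : 'rV[R]_m -> 'M[R]_(p, q)) :
  open U -> cball y0 r `<=` U -> (forall y, U y -> {for y, continuous f}) ->
  exists2 M : R, 0 <= M & forall y, cball y0 r y -> `|f y| <= M.
Proof.
move=> oU KU cf; have [r0|r0] := leP 0 r; last first.
  by exists 0 => // y /= /(le_lt_trans) /(_ r0); rewrite normr_lt0.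
have cK : compact (cball y0 r) := @cball_compact y0 r.
have [||c cK' Hc] := @EVT_max_rV R m (fun y => `|f y|) (cball y0 r) _ cK.
- by exists y0; rewrite /cball /= subrr normr0.
- apply: continuous_in_subspaceT => y; rewrite inE => /KU Uy.
  by apply: (@continuous_comp _ _ _ f (fun M => `|M|)); [exact: cf|exact: norm_continuous].
by exists `|f c| => // y Ky; apply: Hc; rewrite inE.
Qed.

Lemma is_derive_scalel (V : normedModType R) (c : V) (t : R) :
  is_derive t 1 (fun t : R => t *: c) c.
Proof.
have := @is_derive_line R V V id 0 c t (@derivable_id _ _ _ _).
rewrite derive_id; congr (is_derive _ _ _ _).
by apply/funext => s; rewrite add0r.
Qed.

Lemma taylor2 (p q : nat) U y0 r (f : 'rV[R]_m -> 'M[R]_(p, q)) v :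
  open U -> cball y0 r `<=` U -> Ck 2 U f ->
  exists2 C : R, 0 <= C & forall z (s : R), cball y0 r z -> cball y0 r (z + s *: v) ->
    `|f (z + s *: v) - f z| <= C * `|s| /\
    `|f (z + s *: v) - f z - s *: 'D_v f z| <= C * `|s| * `|s|.
Proof.
move=> oU KU Cf.
have [C1 C10 H1] := cball_bounded oU KU (fun y => @Ck_continuous _ _ _ _ _ _ y (CkD v Cf)).
have [C2 C20 H2] := cball_bounded oU KU (fun y => @Ck_continuous _ _ _ _ _ _ y (CkD v (CkD v Cf))).
exists (C1 + C2); first exact: addr_ge0.
move=> z s Kz Ks.
have dl (g : 'rV[R]_m -> 'M[R]_(p, q)) (t : R) : Ck 1 U g -> 0 <= t <= 1 ->
    is_derive (t * s) 1 (fun t => g (z + t *: v)) ('D_v g (z + (t * s) *: v)).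
  move=> Cg t01; apply: is_derive_line; apply: (Ck_derivable Cg).
  exact/KU/cball_seg.
have key (g : 'rV[R]_m -> 'M[R]_(p, q)) C : Ck 1 U g -> (forall y, cball y0 r y -> `|'D_v g y| <= C) ->
    forall t : R, 0 <= t <= 1 -> `|g (z + (t * s) *: v) - g z| <= C * `|t * s|.
  move=> Cg Hg t t01.
  have H := @mean_value_le R _ _ (fun t => g (z + t *: v)) (fun t => 'D_v g (z + t *: v)) (t * s) C.
  rewrite scale0r addr0 in H.
  have tt (t' : R) : 0 <= t' <= 1 -> 0 <= t' * t <= 1.
    move=> /andP[a b]; move: t01 => /andP[c d].
    by rewrite mulr_ge0 //= mulr_ile1.
  apply: H => t' /tt t'01; rewrite mulrA; first exact: dl.
  by apply: Hg; apply: cball_seg.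
have one : 0 <= (1 : R) <= 1 by rewrite ler01 lexx.
split.
  have := key f C1 (CkW Cf) H1 1 one; rewrite mul1r => /le_trans; apply.
  by rewrite ler_wpM2r // lerDl.
have H := @mean_value_le R _ _ (fun t => f (z + t *: v) - t *: 'D_v f z)
  (fun t => 'D_v f (z + t *: v) - 'D_v f z) s (C2 * `|s|).
rewrite scale0r addr0 scale0r subr0 in H.
rewrite addrAC; apply: le_trans (H _ _) _.
- move=> t t01; apply: is_deriveB; first exact: dl (CkW Cf) t01.
  exact: is_derive_scalel.
- move=> t t01; apply: le_trans (key _ _ (CkD v Cf) H2 t t01) _.
  rewrite ler_wpM2l // normrM; case/andP: t01 => t0 t1.
  by rewrite (ger0_norm t0) ler_piMl.
by rewrite ler_wpM2r // ler_wpM2r // lerDr.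
Qed.

Lemma is_derive_quadratic (V W : normedModType R) (f : V -> W) y v L (K d : R) :
  0 < d -> (forall h : R, `|h| < d -> `|f (y + h *: v) - f y - h *: L| <= K * (`|h| * `|h|)) ->
  is_derive y v f L.
Proof.
move=> d0 H; apply/is_deriveP/cvgrPdist_le => e e0.
have K0 : 0 < `|K| + 1 by rewrite ltr_wpDl.
near=> h.
have h0 : h != 0 by near: h; exact: nbhs_dnbhs_neq.
have hd : `|h| < d by near: h; exact: dnbhs0_lt.
have he : `|h| < e / (`|K| + 1) by near: h; apply: dnbhs0_lt; rewrite divr_gt0.
have -> : L - h^-1 *: (f (h *: v + y) - f y) = h^-1 *: (h *: L - (f (h *: v + y) - f y)).
  by rewrite [RHS]scalerBr scalerA mulVf // scale1r.
rewrite normrZ normfV ler_pdivrMl ?normr_gt0 //.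
have := H h hd; rewrite [y + _]addrC distrC => /le_trans; apply.
rewrite mulrCA ler_wpM2l //.
move: he; rewrite ltr_pdivlMr // => /ltW; apply: le_trans.
by rewrite mulrC ler_wpM2l // ler_wpDr // ler_norm.
Unshelve. all: by end_near. Qed.

(** The error term of the variation of a solution along a ray, rearranged so
    that each summand is visibly of second order in [h]; the integrability
    condition cancels the first order terms. *)
Lemma flat_identity (N q : nat) (aw av aw' av' dvaw dwav : 'M[R]_N) (X X' : 'M[R]_(N, q)) (h t : R) :
  dvaw - dwav + aw *m av - av *m aw = 0 ->
  (aw' + h *: av') *m X' - aw *m X
     - (h *: (av *m X) + (h * t) *: (dwav *m X + av *m (aw *m X)))
  = (aw' + h *: av') *m (X' - X - (h * t) *: (av *m X))
    + ((aw' - aw - (h * t) *: dvaw) + h *: (av' - av) + (h * t) *: ((aw' - aw) *m av)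
       + (h * h * t) *: (av' *m av)) *m X.
Proof.
move=> H; have E : dvaw = dwav - aw *m av + av *m aw.
  have /eqP := H; rewrite subr_eq add0r => /eqP <-.
  by rewrite [RHS]addrC addrA (addrAC _ (aw *m av)) subrK addrK.
rewrite {}E {H}.
rewrite !(mulmxDl, mulmxBl, mulmxBr, mulmxDr, mulNmx, mulmxN, =^~scalemxAl, =^~scalemxAr, mulmxA).
set p1 := aw' *m X'; set p2 := av' *m X'; set p3 := aw *m X; set p4 := av *m X.
set p5 := dwav *m X; set p6 := av *m aw *m X; set p7 := aw' *m X; set p8 := av' *m X.
set p9 := aw' *m av *m X; set p10 := av' *m av *m X; set p11 := aw *m av *m X.
move: p1 p2 p3 p4 p5 p6 p7 p8 p9 p10 p11 => p1 p2 p3 p4 p5 p6 p7 p8 p9 p10 p11.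
by apply/matrixP => i j; rewrite !mxE; ring.
Qed.
End Flat.

(** * Integrable linear systems *)

Section FlatSolution.
Variables (R : realType) (m : nat).
Local Notation e_ i := (delta_mx 0 i : 'rV[R]_m).

Lemma gronwall1 (p q : nat) (Y Y' : R -> 'M[R]_(p, q)) (b : R) :
  (forall t : R, 0 <= t <= 1 -> is_derive t 1 Y (Y' t)) ->
  (forall t : R, 0 <= t <= 1 -> `|Y' t| <= 4^-1 * `|Y t| + b) ->
  Y 0 = 0 -> `|Y 1| <= 2 * b.
Proof. by move=> h1 h2 h3; apply: (gronwall h1 h2 h3); rewrite ler01 lexx. Qed.

Lemma is_derive_scalemx (V : normedModType R) (p q : nat) (a : V -> R) (M : V -> 'M[R]_(p, q))
    (x v : V) (da : R) (dM : 'M[R]_(p, q)) :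
  is_derive x v a da -> is_derive x v M dM ->
  is_derive x v (fun y => a y *: M y) (da *: M x + a x *: dM).
Proof.
move=> ha hM; apply: is_derive_mx => i j; rewrite !mxE.
rewrite (_ : (fun _ => _) = (a * (fun y => M y i j))); last first.
  by apply/funext => y; rewrite mxE.
have hij := is_derive_coord i j hM.
rewrite addrC [da * _]mulrC.
exact: is_deriveM.
Qed.

(** Gronwall along the segments that start at [y0]. *)
Lemma zero_local (p q : nat) (Z : 'rV[R]_m -> 'M[R]_(p, q)) Z' y0 (r C : R) :
  0 < r -> 0 <= C ->
  (forall y, `|y - y0| < r -> forall v, is_derive y v Z (Z' v y)) ->
  (forall y, `|y - y0| < r -> forall v, `|Z' v y| <= C * `|v| * `|Z y|) ->
  Z y0 = 0 ->
  exists2 d : R, 0 < d & forall y, `|y - y0| < d -> Z y = 0.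
Proof.
move=> r0 C0 dZ bZ Z0.
have c0 : 0 < (4 * (C + 1))^-1 by rewrite invr_gt0 mulr_gt0 // ltr_wpDl.
exists (Num.min r (4 * (C + 1))^-1); first by rewrite lt_min r0.
move=> y; rewrite lt_min => /andP[yr yc].
have inr (t : R) : 0 <= t <= 1 -> `|y0 + t *: (y - y0) - y0| < r.
  move=> /andP[t0 t1]; rewrite addrAC subrr add0r normrZ (ger0_norm t0).
  by apply: le_lt_trans yr; rewrite ler_piMl.
suff : `|Z (y0 + 1 *: (y - y0))| <= 2 * 0.
  by rewrite scale1r subrKC mulr0 normr_le0 => /eqP.
apply: (@gronwall1 _ _ (fun t => Z (y0 + t *: (y - y0))) (fun t => Z' (y - y0) (y0 + t *: (y - y0)))).
- by move=> t t01; apply/is_derive_lineP; apply: dZ; exact: inr.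
- move=> t t01; rewrite addr0; apply: le_trans (bZ _ (inr t t01) _) _.
  rewrite ler_wpM2r //; move/ltW: yc; rewrite -div1r ler_pdivlMr ?mulr_gt0 ?ltr_wpDl //.
  have := normr_ge0 (y - y0); set z := `|_|; nra.
by rewrite scale0r addr0.
Qed.

Variable N : nat.
Implicit Types A : 'I_m -> 'rV[R]_m -> 'M[R]_N.

Lemma Adir_unif_bound A U y0 r : open U -> cball y0 r `<=` U -> (forall i, Ck 0 U (A i)) ->
  exists2 M : R, 0 <= M & forall y, cball y0 r y -> forall v, `|Adir A v y| <= M * `|v|.
Proof.
move=> oU KU CA.
have /choice[M HM] : forall i, exists M : R, 0 <= M /\ forall y, cball y0 r y -> `|A i y| <= M.
  move=> i; have [M M0 H] := cball_bounded oU KU (fun y => @Ck_continuous _ _ _ _ _ _ y (CA i)).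
  by exists M.
exists (m%:R * \sum_i M i); first by rewrite mulr_ge0 // sumr_ge0 // => i _; have [] := HM i.
move=> y Ky v; apply: Adir_bound => i.
have [_ H] := HM i; apply: le_trans (H y Ky) _.
by rewrite (bigD1 i) //= lerDl sumr_ge0 // => j _; have [] := HM j.
Qed.

(** The compatibility conditions d_v (A_w X) = d_w (A_v X) of the system d_i X =
    A_i X, for all values of X. *)
Definition flat_on A U := forall y, U y -> forall v w,
  'D_v (Adir A w) y - 'D_w (Adir A v) y + Adir A w y *m Adir A v y
   - Adir A v y *m Adir A w y = 0.

(** The Frobenius theorem for linear systems.  The only possible solution is
    obtained by solving the equation along each ray t |-> y0 + t w.
    Integrability shows that its derivative in a transversal direction v solves
    the same equation along the ray as A_v X does; the difference is controlled
    by Gronwall, with an error quadratic in the increment. *)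
Lemma flat_solution (q : nat) A U y0 (X0 : 'M[R]_(N, q)) :
  open U -> U y0 -> (forall i, Ck 2 U (A i)) -> flat_on A U ->
  exists W X, [/\ open W, W y0, W `<=` U, X y0 = X0 &
    forall y, W y -> forall v, is_derive y v X (Adir A v y *m X y)].
Proof.
move=> oU Uy0 CA flatA.
have [rho rho0 KU] := open_cball oU Uy0.
have [M M0 HM] := Adir_unif_bound oU KU (fun i => CkW (CkW (CA i))).
have NM0 : 0 < 8 * (N%:R * M + 1) by rewrite mulr_gt0 // ltr_wpDl ?mulr_ge0.
(* On the ball of radius r the equations along all rays satisfy the
   smallness assumption of linear_ode. *)
set r := Num.min (rho / 2) (8 * (N%:R * M + 1))^-1.
have r0 : 0 < r by rewrite lt_min divr_gt0 //= invr_gt0.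
have small w y : `|w| < r -> cball y0 rho y -> N%:R * `|Adir A w y| <= 8^-1.
  rewrite lt_min => /andP[_ h2] Ky.
  apply: (@le_trans _ _ (N%:R * (M * `|w|))); first by rewrite ler_wpM2l // HM.
  move/ltW: h2; rewrite -div1r ler_pdivlMr //.
  have := normr_ge0 w; have : 0 <= N%:R * M by rewrite mulr_ge0.
  rewrite !mulrA; set z := `|w|; set a := N%:R * M; nra.
have inK w (t : R) : `|w| < r -> `|t| <= 3 / 2 -> cball y0 rho (y0 + t *: w).
  rewrite lt_min => /andP[h1 _] ht; rewrite /cball /= addrAC subrr add0r normrZ.
  have := normr_ge0 w; have := normr_ge0 t; move: h1 ht; set a := `|w|; set b := `|t| => *; nra.
have c32 : 0 <= 3 / 2 :> R by rewrite divr_ge0.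
have /choice[S HS] : forall w, exists X : R -> 'M[R]_(N, q), `|w| < r -> X 0 = X0 /\
    forall t : R, `|t| < 3 / 2 -> is_derive t 1 X (Adir A w (y0 + t *: w) *m X t).
  move=> w; have [wr|] := boolP (`|w| < r); last by exists (fun=> 0).
  have [||X XX0 dX] := @linear_ode R N q (fun t => Adir A w (y0 + clamp (3/2) t *: w)) X0.
  - move=> t; apply: (@continuous_comp _ _ _ (fun t => y0 + clamp (3/2) t *: w) (Adir A w)).
      apply: (@cvgD _ _ _ _ _ (cst y0) (fun t => clamp (3/2) t *: w)); first exact: cvg_cst.
      by apply: cvgZl; exact: clamp_continuous.
    apply: (Ck_continuous (Ck_Adir w oU CA)); apply/KU/inK => //; exact: clamp_le.
  - by move=> t; apply: small => //; apply: inK => //; exact: clamp_le.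
  exists X => _; split=> // t t32; have := dX t t32.
  by rewrite clamp_id // ltW.
have t32 (t : R) : 0 <= t <= 1 -> `|t| < 3 / 2.
  by move=> /andP[t0 t1]; rewrite ger0_norm //; lra.
have small4 w y (Z : 'M[R]_(N, q)) : `|w| < r -> cball y0 rho y -> `|Adir A w y *m Z| <= 8^-1 * `|Z|.
  by move=> wr Ky; apply: le_trans (mx_norm_mul _ _) _; rewrite ler_wpM2r // small.
have bS w : `|w| < r -> forall t : R, 0 <= t <= 1 -> `|S w t| <= 2 * `|X0|.
  move=> wr t t01; have [S0 dS] := HS w wr.
  have := @gronwall R _ _ (fun t => S w t - X0) (fun t => Adir A w (y0 + t *: w) *m S w t) (8^-1 * `|X0|).
  rewrite S0 subrr => /(_ _ _ erefl t t01) H.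
  rewrite -[S w t](subrK X0); apply: le_trans (ler_normD _ _) _.
  have := normr_ge0 X0; have : `|S w t - X0| <= 2 * (8^-1 * `|X0|); last by set z := `|X0|; lra.
  apply: H => s s01.
    by rewrite -[_ *m _]subr0; apply: is_deriveB; exact: dS (t32 _ s01).
  apply: le_trans (small4 _ _ _ wr (inK _ _ wr (ltW (t32 _ s01)))) _.
  have := ler_normD (S w s - X0) X0; rewrite subrK.
  have := normr_ge0 (S w s - X0); set a := `|_ - _|; set b := `|X0|; set c := `|S w s|; lra.
exists [set y | `|y - y0| < r], (fun y => S (y - y0) 1).
split.
- exact: open_oball.
- by rewrite /= subrr normr0.
- move=> y /= yr; apply: KU; have := inK _ 1 yr; rewrite scale1r subrKC; apply.
  by rewrite normr1; lra.
- have z0 : `|0 : 'rV[R]_m| < r by rewrite normr0.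
  rewrite subrr; have [S0 dS] := HS 0 z0.
  have := @mean_value_le R _ _ (S 0) (fun t => Adir A 0 (y0 + t *: 0) *m S 0 t) 1 0.
  rewrite S0 mul0r normr_le0 subr_eq0 => H; apply/eqP; apply: H => s s01.
    by apply: dS; rewrite mulr1; exact: t32.
  rewrite (_ : Adir A 0 _ = 0) ?mul0mx ?normr0 //.
  by rewrite /Adir big1 // => i _; rewrite mxE scale0r.
move=> y /= yr v; set w := y - y0.
have [C C0 HC] := taylor2 v oU KU (Ck_Adir w oU CA).
have [C' C'0 HC'] := taylor2 v oU KU (Ck_Adir v oU CA).
set Mv := M * `|v|.
have Mv0 : 0 <= Mv by rewrite mulr_ge0.
set K := N%:R * (C + C' + N%:R * C * Mv + N%:R * Mv * Mv) * (2 * `|X0|).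
set d := (r - `|w|) / (`|v| + 1).
have v10 : 0 < `|v| + 1 by rewrite ltr_wpDl.
have d0 : 0 < d by rewrite divr_gt0 // subr_gt0.
apply: (@is_derive_quadratic _ _ _ _ _ _ _ (2 * K) d) => // h hd.
have whr : `|w + h *: v| < r.
  apply: le_lt_trans (ler_normD _ _) _; rewrite normrZ.
  move: hd; rewrite ltr_pdivlMr // => hd.
  have := normr_ge0 h; have := normr_ge0 v; move: hd; set a := `|h|; set b := `|v|; set c := `|w|; nra.
have -> : y + h *: v - y0 = w + h *: v by rewrite addrAC.
have [S0 dS] := HS w yr; have [T0 dT] := HS _ whr.
(* the difference of two neighbouring rays, minus the expected first order
   term *)
pose Dt := fun t => S (w + h *: v) t - S w t - (h * t) *: (Adir A v (y0 + t *: w) *m S w t).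
pose Dt' := fun t => Adir A (w + h *: v) (y0 + t *: (w + h *: v)) *m S (w + h *: v) t
   - Adir A w (y0 + t *: w) *m S w t
   - (h *: (Adir A v (y0 + t *: w) *m S w t)
      + (h * t) *: ('D_w (Adir A v) (y0 + t *: w) *m S w t
           + Adir A v (y0 + t *: w) *m (Adir A w (y0 + t *: w) *m S w t))).
have zw : y0 + w = y by rewrite /w subrKC.
suff : `|Dt 1| <= 2 * (K * (`|h| * `|h|)) by rewrite /Dt scale1r mulr1 zw mulrA.
apply: (@gronwall1 _ _ Dt Dt'); last by rewrite /Dt S0 T0 subrr mulr0 scale0r subrr.
- move=> t t01; have tt := t32 t t01.
  rewrite /Dt' -/(Dt); apply: is_deriveB.
    by apply: is_deriveB; [exact: dT|exact: dS].
  have d1 : is_derive t 1 (fun t => Adir A v (y0 + t *: w) *m S w t)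
     ('D_w (Adir A v) (y0 + t *: w) *m S w t + Adir A v (y0 + t *: w) *m (Adir A w (y0 + t *: w) *m S w t)).
    apply: is_derive_mulmx; last exact: dS.
    apply: is_derive_line; apply: (Ck_derivable (Ck_Adir v oU CA)); apply/KU/inK => //; exact: ltW.
  have dh : is_derive t 1 (fun t : R => h * t) h.
    have := is_derive_scalel h t; congr (is_derive _ _ _ _).
    by apply/funext => s; rewrite /GRing.scale /= mulrC.
  exact: is_derive_scalemx dh d1.
move=> t t01; have tt := ltW (t32 t t01).
set z := y0 + t *: w; have Kz : cball y0 rho z by exact: inK.
have zE : y0 + t *: (w + h *: v) = z + (h * t) *: v.
  by rewrite scalerDr addrA scalerA mulrC.
have Kz' : cball y0 rho (z + (h * t) *: v) by rewrite -zE; exact: inK.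
rewrite /Dt' zE AdirDZ.
have /flat_identity -> := flatA z (KU _ Kz) v w.
apply: le_trans (ler_normD _ _) _; apply: lerD.
  rewrite -AdirDZ; apply: le_trans (small4 _ _ _ whr Kz') _.
  by rewrite ler_wpM2r //; lra.
apply: le_trans (mx_norm_mul _ _) _.
rewrite /K -[X in _ <= X]mulrA [2 * _ * _]mulrC [X in _ <= X]mulrA.
apply: ler_pM; rewrite ?mulr_ge0 //; last exact: bS.
rewrite -[X in _ <= X]mulrA; apply: ler_wpM2l => //.
have [h1 h2] := HC z (h * t) Kz Kz'; have [h1' _] := HC' z (h * t) Kz Kz'.
have bz := HM z Kz v; have bz' := HM _ Kz' v.
have ht : `|h * t| <= `|h|.
  by rewrite normrM ler_piMr //; case/andP: t01 => ta tb; rewrite ger0_norm.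
have h0 := normr_ge0 h; have ht0 := normr_ge0 (h * t).
apply: le_trans (ler_normD _ _) _.
rewrite [X in _ <= X]mulrDl; apply: lerD.
  apply: le_trans (ler_normD _ _) _; rewrite [X in _ <= X]mulrDl; apply: lerD.
    apply: le_trans (ler_normD _ _) _; rewrite [X in _ <= X]mulrDl; apply: lerD.
      apply: le_trans h2 _; rewrite -mulrA ler_wpM2l //; exact: ler_pM.
    rewrite normrZ mulrCA ler_wpM2l //; apply: le_trans h1' _; by rewrite ler_wpM2l.
  rewrite normrZ.
  apply: (@le_trans _ _ (`|h| * (N%:R * (C * `|h|) * Mv))); last first.
    by rewrite le_eqVlt; apply/orP; left; apply/eqP; ring.
  apply: ler_pM => //; apply: le_trans (mx_norm_mul _ _) _.
  apply: ler_pM; rewrite ?mulr_ge0 // ler_wpM2l //; apply: le_trans h1 _; by rewrite ler_wpM2l.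
rewrite normrZ -mulrA normrM.
apply: (@le_trans _ _ (`|h| * `|h| * (N%:R * Mv * Mv))); last by rewrite le_eqVlt; apply/orP; left; apply/eqP; ring.
apply: ler_pM; rewrite ?mulr_ge0 //; first by rewrite ler_wpM2l.
apply: le_trans (mx_norm_mul _ _) _.
by apply: ler_pM; rewrite ?mulr_ge0 // ler_wpM2l.
Qed.

(** A solution has a derivative that is a product of [A] and itself, so it gains
    one degree of differentiability at a time; continuity has to be proved
    first, since directional derivatives do not give it. *)
Lemma linear_system_smooth (q : nat) A U (X : 'rV[R]_m -> 'M[R]_(N, q)) :
  open U -> (forall i, smooth U (A i)) ->
  (forall y, U y -> forall v, is_derive y v X (Adir A v y *m X y)) -> smooth U X.
Proof.
move=> oU sA dX.
have cX y : U y -> {for y, continuous X}.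
  move=> Uy; have [rho rho0 KU] := open_cball oU Uy.
  have [M M0 HM] := Adir_unif_bound oU KU (fun i => sA i 0%N).
  have NM0 : 0 < 4 * (N%:R * M + 1) by rewrite mulr_gt0 // ltr_wpDl ?mulr_ge0.
  apply/(@cvgrPdist_le _ _ _ (nbhs y)) => e e0.
  have XX0 : 0 < 2 * (N%:R * M * `|X y|) + 1 by rewrite ltr_wpDl ?mulr_ge0.
  near=> z; rewrite distrC.
  have zr : `|z - y| < rho by rewrite distrC; near: z; apply/nbhs_ballP; exists rho => //= z; rewrite -ball_normE.
  have z4 : `|z - y| < (4 * (N%:R * M + 1))^-1.
    rewrite distrC; near: z; apply/nbhs_ballP; exists (4 * (N%:R * M + 1))^-1 => /=; first by rewrite invr_gt0.
    by move=> z; rewrite -ball_normE.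
  have ze : `|z - y| < e / (2 * (N%:R * M * `|X y|) + 1).
    rewrite distrC; near: z; apply/nbhs_ballP; exists (e / (2 * (N%:R * M * `|X y|) + 1)) => /=; first by rewrite divr_gt0.
    by move=> z; rewrite -ball_normE.
  have inK (t : R) : 0 <= t <= 1 -> cball y rho (y + t *: (z - y)).
    move=> /andP[t0 t1]; rewrite /cball /= addrAC subrr add0r normrZ (ger0_norm t0).
    by apply: le_trans (ltW zr); rewrite ler_piMl.
  have H : `|X (y + 1 *: (z - y)) - X y| <= 2 * (N%:R * (M * `|z - y|) * `|X y|); last first.
    rewrite scale1r subrKC in H; apply: le_trans H _.
    move: ze; rewrite ltr_pdivlMr // => /ltW; apply: le_trans.
    have := normr_ge0 (z - y); set a := `|_ - _|; set b := `|X y|.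
    have b0 : 0 <= b by exact: normr_ge0.
    have : 0 <= N%:R * M * b by rewrite !mulr_ge0.
    have -> : 2 * (N%:R * (M * a) * b) = 2 * (N%:R * M * b * a) by ring.
    nra.
  apply: (@gronwall1 _ _ (fun t => X (y + t *: (z - y)) - X y)
     (fun t => Adir A (z - y) (y + t *: (z - y)) *m X (y + t *: (z - y)))); last by rewrite scale0r addr0 subrr.
  - move=> t t01; rewrite -[X in is_derive _ _ _ X]subr0; apply: is_deriveB; last exact: is_derive_cst.
    apply/is_derive_lineP; apply: dX; exact/KU/inK.
  - move=> t t01; have Kt := inK t t01; apply: le_trans (mx_norm_mul _ _) _.
    have h1 := HM _ Kt (z - y).
    apply: (@le_trans _ _ (N%:R * (M * `|z - y|) * (`|X (y + t *: (z - y)) - X y| + `|X y|))).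
      apply: ler_pM; rewrite ?mulr_ge0 //; first by rewrite ler_wpM2l.
      by have := ler_normD (X (y + t *: (z - y)) - X y) (X y); rewrite subrK.
    rewrite mulrDr lerD2r ler_wpM2r //.
    move/ltW: z4; rewrite -div1r ler_pdivlMr //.
    have := normr_ge0 (z - y); set a := `|_ - _|.
    have : 0 <= N%:R * M by rewrite mulr_ge0.
    rewrite mulrA; set b := N%:R * M; nra.
elim=> [|k IH]; first by split.
split; first exact: cX.
split=> [y v Uy|v]; first by have [] := dX y Uy v.
apply: (@Ck_ext _ _ _ _ _ (fun y => Adir A v y *m X y)) => //.
  by move=> y Uy; have [_ ->] := dX y Uy v.
by apply: Ck_mulmx => //; apply: Ck_Adir => // i; exact: sA.
Unshelve. all: by end_near. Qed.
End FlatSolution.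

(** * Gauss formula in a chart *)

Section Dot.
Variable R : realType.

Lemma dotE n (x y : 'rV[R]_n) : dot x y = (x *m y^T) 0 0.
Proof. by rewrite mxE; apply: eq_bigr => i _; rewrite mxE. Qed.

Lemma dotC n (x y : 'rV[R]_n) : dot x y = dot y x.
Proof. by apply: eq_bigr => i _; rewrite mulrC. Qed.

Lemma dotDl n (x y z : 'rV[R]_n) : dot (x + y) z = dot x z + dot y z.
Proof. by rewrite !dotE mulmxDl mxE. Qed.

Lemma dotZl n (a : R) (x z : 'rV[R]_n) : dot (a *: x) z = a * dot x z.
Proof. by rewrite !dotE -scalemxAl mxE. Qed.

Lemma dotDr n (x y z : 'rV[R]_n) : dot z (x + y) = dot z x + dot z y.
Proof. by rewrite dotC dotDl !(dotC z). Qed.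

Lemma dotZr n (a : R) (x z : 'rV[R]_n) : dot z (a *: x) = a * dot z x.
Proof. by rewrite dotC dotZl dotC. Qed.

Lemma dotNl n (x z : 'rV[R]_n) : dot (- x) z = - dot x z.
Proof. by rewrite -scaleN1r dotZl mulN1r. Qed.

Lemma dotNr n (x z : 'rV[R]_n) : dot z (- x) = - dot z x.
Proof. by rewrite dotC dotNl dotC. Qed.

Lemma dotBl n (x y z : 'rV[R]_n) : dot (x - y) z = dot x z - dot y z.
Proof. by rewrite dotDl dotNl. Qed.

Lemma dotBr n (x y z : 'rV[R]_n) : dot z (x - y) = dot z x - dot z y.
Proof. by rewrite dotDr dotNr. Qed.

Lemma dot0l n (z : 'rV[R]_n) : dot 0 z = 0.
Proof. by rewrite dotE mul0mx mxE. Qed.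

Lemma dot_ge0 n (x : 'rV[R]_n) : 0 <= dot x x.
Proof. by apply: sumr_ge0 => i _; rewrite -expr2 sqr_ge0. Qed.

Lemma dot_eq0 n (x : 'rV[R]_n) : (dot x x == 0) = (x == 0).
Proof.
apply/eqP/eqP => [|->]; last exact: dot0l.
move/psumr_eq0P => H; apply/rowP => i; rewrite mxE.
apply/eqP; rewrite -sqrf_eq0 expr2; apply/eqP; apply: H => // j _.
by rewrite -expr2 sqr_ge0.
Qed.

Lemma dot_gt0 n (x : 'rV[R]_n) : (0 < dot x x) = (x != 0).
Proof. by rewrite lt_neqAle dot_ge0 andbT eq_sym dot_eq0. Qed.

Lemma dot_delta n (x : 'rV[R]_n) i : dot x (delta_mx 0 i) = x 0 i.
Proof.
rewrite /dot (bigD1 i) //= mxE !eqxx mulr1 big1 ?addr0 // => j ji.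
by rewrite mxE (negbTE ji) andbF mulr0.
Qed.

Lemma dot_mulmx n p (x : 'rV[R]_n) (y : 'rV[R]_p) (M : 'M[R]_(n, p)) :
  dot (x *m M) y = dot x (y *m M^T).
Proof. by rewrite !dotE trmx_mul trmxK mulmxA. Qed.

Lemma dot_orth n p (x y : 'rV[R]_n) (M : 'M[R]_(n, p)) : M *m M^T = 1%:M ->
  dot (x *m M) (y *m M) = dot x y.
Proof. by move=> H; rewrite dot_mulmx -mulmxA H mulmx1. Qed.

Lemma dot_sub_sqr n (x y : 'rV[R]_n) : dot (x - y) (x - y) = dot x x - 2 * dot x y + dot y y.
Proof. by rewrite !(dotBl, dotBr) (dotC y x); ring. Qed.

Lemma gdotE m (g : 'M[R]_m) u v : gdot g u v = (u *m g *m v^T) 0 0.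
Proof.
rewrite mxE /gdot exchange_big /=; apply: eq_bigr => j _; rewrite !mxE mulr_suml.
by apply: eq_bigr => i _; rewrite [g i j * _]mulrC.
Qed.

Lemma gdot_delta m (g : 'M[R]_m) i j : gdot g (delta_mx 0 i) (delta_mx 0 j) = g i j.
Proof. by rewrite gdotE -rowE trmx_delta -colE !mxE. Qed.

Lemma gdot_dot m (g : 'M[R]_m) u v : gdot g u v = dot (u *m g) v.
Proof. by rewrite gdotE dotE. Qed.

Lemma gdot_inj m (g h : 'M[R]_m) : (forall u v, gdot g u v = gdot h u v) -> g = h.
Proof. by move=> H; apply/matrixP => i j; rewrite -!gdot_delta H. Qed.

(** A positive definite matrix has trivial kernel. *)
Lemma posdef_unit m (g : 'M[R]_m) : (forall u, u != 0 -> 0 < gdot g u u) -> g \in unitmx.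
Proof.
move=> H; rewrite -row_free_unit -kermx_eq0; apply/eqP/row_matrixP => i.
rewrite row0; apply/eqP/negPn/negP => /H.
rewrite gdotE -row_mul mulmx_ker row0 mul0mx mxE ltxx //.
Qed.

Lemma unitmx_mul_eq0 m n (A : 'M[R]_(n, m)) (B : 'M[R]_m) :
  B \in unitmx -> A *m B = 0 -> A = 0.
Proof. by move=> uB AB; rewrite -[A](mulmxK uB) AB mul0mx. Qed.

Lemma is_derive_dot (V : normedModType R) n (f h : V -> 'rV[R]_n) x v df dh :
  is_derive x v f df -> is_derive x v h dh ->
  is_derive x v (fun y => dot (f y) (h y)) (dot df (h x) + dot (f x) dh).
Proof.
move=> hf hh; rewrite !dotE.
have ht : is_derive x v (fun y => (h y)^T) dh^T.
  apply: is_derive_mx => i j; rewrite mxE.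
  by have := is_derive_coord j i hh; congr (is_derive _ _ _ _); apply/funext => y; rewrite mxE.
have := is_derive_coord 0 0 (is_derive_mulmx hf ht); rewrite mxE.
by congr (is_derive _ _ _ _); apply/funext => y; rewrite dotE.
Qed.

Lemma Ck_dot (V : normedModType R) n k (U : set V) (f h : V -> 'rV[R]_n) : open U ->
  Ck k U f -> Ck k U h -> Ck k U (fun y => dot (f y) (h y)).
Proof.
move=> oU /(Ck_mxP _ _ oU) cf /(Ck_mxP _ _ oU) ch.
by apply: Ck_sum => // i; apply: Ck_mul.
Qed.
End Dot.

Section ChartMetric.
Variables (R : realType) (m : nat) (g : 'rV[R]_m -> 'M[R]_m) (U : set 'rV[R]_m).
Hypotheses (oU : open U) (sg : smooth U g)
  (symg : forall y, U y -> (g y)^T = g y) (ug : forall y, U y -> g y \in unitmx).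
Local Notation e_ i := (delta_mx 0 i : 'rV[R]_m).
Local Notation Gam := (christoffel g).

Let symE y i j : U y -> g y i j = g y j i.
Proof. by move=> /symg {1}<-; rewrite mxE. Qed.

Lemma smooth_metric_coord i j : smooth U (fun y => g y i j).
Proof. exact: (smooth_mxP _ oU).1 sg i j. Qed.

Lemma pd_metric_sym y i j l : U y -> pd l (fun z => g z i j) y = pd l (fun z => g z j i) y.
Proof.
move=> Uy; apply: near_eq_derive; apply: (open_near oU Uy) => z Uz; exact: symE.
Qed.

Lemma christoffel_sym k i j y : U y -> Gam k i j y = Gam k j i y.
Proof.
move=> Uy; rewrite /christoffel; congr (_ * _); apply: eq_bigr => l _.
by rewrite (pd_metric_sym i j l Uy) [pd i _ y + _]addrC.
Qed.

Lemma christoffel_low l i j y : U y -> \sum_k g y l k * Gam k i j y =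
  2^-1 * (pd i (fun z => g z j l) y + pd j (fun z => g z i l) y - pd l (fun z => g z i j) y).
Proof.
move=> Uy; rewrite /christoffel.
under eq_bigr => k _ do rewrite mulrCA mulr_sumr.
rewrite -mulr_sumr; congr (_ * _); rewrite exchange_big /=.
set T := fun l => pd i (fun z => g z j l) y + pd j (fun z => g z i l) y - pd l (fun z => g z i j) y.
rewrite -[RHS]/(T l).
rewrite (eq_bigr (fun p => (g y *m invmx (g y)) l p * T p)); last first.
  by move=> p _; rewrite mxE mulr_suml; apply: eq_bigr => k _; rewrite mulrA.
rewrite mulmxV ?ug // (bigD1 l) //= mxE eqxx mul1r big1 ?addr0 // => p pl.
by rewrite mxE eq_sym (negbTE pl) mul0r.
Qed.

Lemma metric_compat i j k y : U y -> pd i (fun z => g z j k) y =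
  \sum_p g y k p * Gam p i j y + \sum_p g y j p * Gam p i k y.
Proof.
move=> Uy; rewrite !christoffel_low // (pd_metric_sym k j i Uy).
by field.
Qed.

Lemma christoffel_smooth k i j : smooth U (Gam k i j).
Proof.
move=> n; rewrite /christoffel; apply: Ck_mul => //; first exact: Ck_cst.
apply: Ck_sum => // l; apply: Ck_mul => //.
  by apply: (Ck_mxP _ _ oU).1; apply: Ck_invmx => //; exact: sg.
apply: Ck_sub_fun => //; last by apply: CkD; apply: smooth_metric_coord.
by apply: Ck_add => //; apply: CkD; apply: smooth_metric_coord.
Qed.

(** The matrix of the Gauss formula d_i d_j phi = Gamma_ij^k d_k phi - g_ij phi
    together with the tautology d_i phi = d_i phi, acting on the column of
    blocks phi, d_1 phi, ..., d_m phi. *)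
Definition sysmx (i : 'I_m) (y : 'rV[R]_m) : 'M[R]_(1 + m) :=
  block_mx 0 (e_ i) (\col_j - g y i j) (\matrix_(j, k) Gam k i j y).

Lemma smooth_sysmx i : smooth U (sysmx i).
Proof.
move=> n; apply/(Ck_mxP _ _ oU) => a b; rewrite /sysmx.
case: (split_ordP a) => a' ->; case: (split_ordP b) => b' ->.
- by apply: Ck_ext (Ck_cst n U (0 : R)) => // y _; rewrite block_mxEul mxE.
- by apply: Ck_ext (Ck_cst n U (e_ i a' b')) => // y _; rewrite block_mxEur.
- apply: (@Ck_ext _ _ _ _ _ (fun y => - g y i a')) => //.
    by move=> y _; rewrite block_mxEdl mxE.
  by apply: Ck_opp => //; exact: smooth_metric_coord.
apply: (@Ck_ext _ _ _ _ _ (Gam b' i a')) => //.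
  by move=> y _; rewrite block_mxEdr mxE.
exact: christoffel_smooth.
Qed.

(** The curvature tensor of the unit sphere, R(X, Y) Z = g(Y, Z) X - g(X, Z) Y,
    in coordinates. *)
Definition curv_const y := forall l k i j, riemann g l k i j y =
  g y j k * (l == i)%:R - g y i k * (l == j)%:R.

Lemma derive_sysmx i j y : U y -> 'D_(e_ i) (sysmx j) y =
  block_mx 0 0 (\col_k - pd i (fun z => g z j k) y) (\matrix_(k, l) pd i (Gam l j k) y).
Proof.
move=> Uy; apply/matrixP => a b.
rewrite derive_coord; last exact: smooth_derivable (smooth_sysmx j) Uy.
case: (split_ordP a) => a' ->; case: (split_ordP b) => b' ->.
- rewrite block_mxEul mxE.
  by under eq_fun do rewrite block_mxEul mxE; exact: derive_cst.
- rewrite block_mxEur mxE.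
  by under eq_fun do rewrite block_mxEur; exact: derive_cst.
- rewrite block_mxEdl mxE.
  under eq_fun do rewrite block_mxEdl mxE.
  by rewrite deriveN //; exact: smooth_derivable (smooth_metric_coord j a') Uy.
rewrite block_mxEdr mxE.
by under eq_fun do rewrite block_mxEdr mxE.
Qed.

(** The first row and column vanish because Gamma is symmetric and compatible
    with g; in the remaining block the products of the column - g with the rows
    e_i and e_j produce exactly the curvature of the sphere. *)
Lemma curvature_matrix i j y : U y ->
  'D_(e_ i) (sysmx j) y - 'D_(e_ j) (sysmx i) y
    + sysmx j y *m sysmx i y - sysmx i y *m sysmx j y =
  block_mx 0 0 0 (\matrix_(k, l) (riemann g l k i j y -
     (g y j k * (l == i)%:R - g y i k * (l == j)%:R))).
Proof.
move=> Uy; move: (derive_sysmx i j Uy) (derive_sysmx j i Uy).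
generalize ('D_(e_ i) (sysmx j) y) ('D_(e_ j) (sysmx i) y) => d1 d2 -> ->.
rewrite /sysmx !mulmx_block.
rewrite !(opp_block_mx, add_block_mx) !(mul0mx, mulmx0, oppr0, add0r, addr0).
have eM p (M : 'M[R]_(m, p)) k : e_ k *m M = row k M by rewrite -rowE.
congr block_mx.
- apply/matrixP => a b; rewrite !eM !mxE symE // subrr //.
- apply/matrixP => a b; rewrite !eM !mxE christoffel_sym // subrr //.
- apply/matrixP => k b; rewrite !mxE (metric_compat i j k Uy) (metric_compat j i k Uy).
  have E a c : \sum_j0 (\matrix_(j1, k0) Gam k0 a j1 y) k j0 * (\col_j1 - g y c j1) j0 b =
     - \sum_p g y c p * Gam p a k y.
    by rewrite -sumrN; apply: eq_bigr => p _; rewrite !mxE mulrN mulrC.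
  rewrite !E.
  have -> : \sum_p g y k p * Gam p j i y = \sum_p g y k p * Gam p i j y.
    by apply: eq_bigr => p _; rewrite christoffel_sym.
  by ring.
apply/matrixP => k l; rewrite !mxE /riemann.
have E1 a c : \sum_j0 (\col_j1 - g y a j1) k j0 * (e_ c : 'rV_m) j0 l = - (g y a k * (l == c)%:R).
  by rewrite big_ord1 !mxE eqxx mulNr.
have E2 a c : \sum_j0 (\matrix_(j1, k0) Gam k0 a j1 y) k j0 * (\matrix_(j1, k0) Gam k0 c j1 y) j0 l =
   \sum_p Gam l c p y * Gam p a k y.
  by apply: eq_bigr => p _; rewrite !mxE mulrC.
rewrite !E1 !E2 sumrB.
move: (\sum_p _ * _) (\sum_p _ * _) (pd i _ y) (pd j _ y) (_ * _) (_ * _) => a1 a2 a3 a4 a5 a6.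
ring.
Qed.

Lemma flat_of_curv_const : (forall y, U y -> curv_const y) -> flat_on sysmx U.
Proof.
move=> H y Uy v w.
have d1 a b : 'D_a (Adir sysmx b) y = \sum_i \sum_j (a 0 i * b 0 j) *: 'D_(e_ i) (sysmx j) y.
  have CA := Ck_Adir b oU (fun i => smooth_sysmx i 1%N).
  rewrite (Ck1_derive_sum_mx a oU Uy CA); apply: eq_bigr => i _.
  have ds k : derivable (sysmx k) y (e_ i) by exact: smooth_derivable (smooth_sysmx k) Uy.
  rewrite (_ : Adir sysmx b = \sum_j (b 0 j \*: sysmx j)); last first.
    by apply/funext => z; rewrite /Adir fct_sumE.
  rewrite derive_sum; last by move=> j; exact: derivableZ.
  by rewrite scaler_sumr; apply: eq_bigr => j _; rewrite deriveZ // scalerA.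
have d2 a b : Adir sysmx a y *m Adir sysmx b y = \sum_i \sum_j (a 0 i * b 0 j) *: (sysmx i y *m sysmx j y).
  rewrite /Adir mulmx_suml; apply: eq_bigr => i _; rewrite mulmx_sumr.
  by apply: eq_bigr => j _; rewrite -scalemxAl -scalemxAr scalerA.
rewrite !d1 !d2 [\sum_i \sum_j (w 0 i * v 0 j) *: 'D__ _ _]exchange_big /=.
rewrite [\sum_i \sum_j (w 0 i * v 0 j) *: _]exchange_big /=.
rewrite -sumrB -big_split /= -sumrB; apply: big1 => i _.
rewrite -sumrB -big_split /= -sumrB; apply: big1 => j _.
rewrite [w 0 j * _]mulrC -scalerBr -scalerDr -scalerBr curvature_matrix //.
rewrite (_ : \matrix_(_, _) _ = 0) ?block_mx0 ?scaler0 //.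
by apply/matrixP => k l; rewrite !mxE H // subrr.
Qed.

(** The position vector and the coordinate vector fields of [phi]. *)
Definition frame (phi : 'rV[R]_m -> 'rV[R]_(1 + m)) (y : 'rV[R]_m) : 'M[R]_(1 + m) :=
  col_mx (phi y) (\matrix_j 'D_(e_ j) phi y).

(** [phi] is a local isometry from the metric [g] on [W] to the unit sphere. *)
Definition spherical_on (phi : 'rV[R]_m -> 'rV[R]_(1 + m)) (W : set 'rV[R]_m) :=
  [/\ smooth W phi, forall y, W y -> dot (phi y) (phi y) = 1 &
   forall y, W y -> forall u v, dot ('D_u phi y) ('D_v phi y) = gdot (g y) u v].

Variable phi : 'rV[R]_m -> 'rV[R]_(1 + m).
Hypothesis sph : spherical_on phi U.

Let sphi : smooth U phi. Proof. by case: sph. Qed.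
Let dphi v y : U y -> is_derive y v phi ('D_v phi y).
Proof. by move=> Uy; apply/derivableP; exact: smooth_derivable sphi Uy. Qed.
Let ddphi u v y : U y -> is_derive y v ('D_u phi) ('D_v ('D_u phi) y).
Proof. by move=> Uy; apply/derivableP; exact: smooth_derivable (smoothD u sphi) Uy. Qed.

(** Differentiate |phi|^2 = 1. *)
Lemma spherical_tangent v y : U y -> dot ('D_v phi y) (phi y) = 0.
Proof.
move=> Uy; have [_ s1 _] := sph.
have [_ h1] := is_derive_dot (dphi v Uy) (dphi v Uy).
have h2 : 'D_v (fun y => dot (phi y) (phi y)) y = 0.
  rewrite -(derive_cst (1 : R) y v); apply: near_eq_derive.
  by apply: (open_near oU Uy) => z Uz; exact: s1.
move: h1; rewrite h2 [dot (phi y) _]dotC; lra.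
Qed.

Let schwarz_phi u v y : U y -> 'D_v ('D_u phi) y = 'D_u ('D_v phi) y.
Proof. by move=> Uy; exact: schwarz_mx oU Uy (sphi 2%N). Qed.

Let c3 i j l y := dot ('D_(e_ i) ('D_(e_ j) phi) y) ('D_(e_ l) phi y).

Let pd_c3 i j l y : U y -> pd i (fun z => g z j l) y = c3 i j l y + c3 i l j y.
Proof.
move=> Uy; have [_ _ s2] := sph.
have [_ h1] := is_derive_dot (ddphi (e_ j) (e_ i) Uy) (ddphi (e_ l) (e_ i) Uy).
transitivity ('D_(e_ i) (fun z => dot ('D_(e_ j) phi z) ('D_(e_ l) phi z)) y).
  apply: near_eq_derive; apply: (open_near oU Uy) => z Uz.
  by rewrite s2 // gdot_delta.
by rewrite h1 /c3; congr (_ + _); exact: dotC.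
Qed.

(** The frame is orthogonal to the sphere in the first row and has Gram matrix
    [g] in the others; in particular it is invertible. *)
Lemma frame_mul_tr y : U y -> frame phi y *m (frame phi y)^T = block_mx 1 0 0 (g y).
Proof.
move=> Uy; have [_ s1 s2] := sph.
rewrite /frame tr_col_mx mul_col_row; congr block_mx.
- by apply/matrixP => a b; rewrite !ord1 -dotE s1 // mxE.
- apply/matrixP => a b; rewrite !ord1 [RHS]mxE.
  have := spherical_tangent (e_ b) Uy; rewrite dotC => H.
  rewrite -[RHS]H dotE !mxE; apply: eq_bigr => k _; by rewrite !mxE.
- apply/matrixP => a b; rewrite !ord1 [RHS]mxE.
  rewrite -[RHS](spherical_tangent (e_ a) Uy) dotE !mxE; apply: eq_bigr => k _; by rewrite !mxE.
apply/matrixP => a b; rewrite -(gdot_delta (g y)) -s2 // dotE !mxE.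
by apply: eq_bigr => k _; rewrite !mxE.
Qed.

Lemma frame_unit y : U y -> frame phi y \in unitmx.
Proof.
move=> Uy; suff : (frame phi y *m (frame phi y)^T) \in unitmx.
  by rewrite unitmx_mul => /andP[].
rewrite frame_mul_tr // unitmxE det_lblock det1 mul1r -unitmxE; exact: ug.
Qed.

Lemma smooth_frame : smooth U (frame phi).
Proof.
move=> n; apply/(Ck_mxP _ _ oU) => a b; rewrite /frame.
case: (split_ordP a) => a' ->.
  apply: (@Ck_ext _ _ _ _ _ (fun y => phi y 0 b)) => //.
    by move=> y _; rewrite col_mxEu ord1.
  exact: (smooth_mxP _ oU).1 sphi 0 b n.
apply: (@Ck_ext _ _ _ _ _ (fun y => 'D_(e_ a') phi y 0 b)) => //.
  by move=> y _; rewrite col_mxEd !mxE.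
exact: (smooth_mxP _ oU).1 (smoothD (e_ a') sphi) 0 b n.
Qed.

Lemma derive_frame i y : U y -> 'D_(e_ i) (frame phi) y =
   col_mx ('D_(e_ i) phi y) (\matrix_j 'D_(e_ i) ('D_(e_ j) phi) y).
Proof.
move=> Uy; apply/matrixP => a b.
rewrite derive_coord; last exact: smooth_derivable smooth_frame Uy.
case: (split_ordP a) => a' ->.
  rewrite col_mxEu; under eq_fun do rewrite col_mxEu.
  by rewrite -derive_coord //; have [] := dphi (e_ i) Uy.
rewrite col_mxEd mxE; under eq_fun do rewrite col_mxEd mxE.
by rewrite -derive_coord //; have [] := ddphi (e_ a') (e_ i) Uy.
Qed.

(** Since the frame is invertible, second derivatives of [phi] are determined by
    their inner products with it: those with phi come from [spherical_tangent],
    those with d_l phi from the Koszul formula. *)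
Lemma gauss_formula v y : U y -> is_derive y v (frame phi) (Adir sysmx v y *m frame phi y).
Proof.
move=> Uy.
split; first exact: smooth_derivable smooth_frame Uy.
rewrite (Ck1_derive_sum_mx v oU Uy (smooth_frame 1%N)) /Adir mulmx_suml.
apply: eq_bigr => i _; rewrite -scalemxAl; congr (_ *: _).
have uT : (frame phi y)^T \in unitmx by rewrite unitmx_tr frame_unit.
apply: (can_inj (mulmxK uT)); rewrite -mulmxA frame_mul_tr //.
have [_ s1 s2] := sph.
rewrite derive_frame // /frame tr_col_mx mul_col_row /sysmx mulmx_block.
rewrite !mul0mx !mulmx0 !mulmx1 !add0r !addr0; congr block_mx.
- by apply/matrixP => a b; rewrite !ord1 -dotE spherical_tangent // mxE.
- apply/matrixP => a b; rewrite ord1 -rowE !mxE -(gdot_delta (g y)) -s2 // dotE !mxE.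
  by apply: eq_bigr => k _; rewrite !mxE.
- apply/matrixP => a b; rewrite ord1 [RHS]mxE.
  have [_ h1] := is_derive_dot (ddphi (e_ a) (e_ i) Uy) (dphi (e_ i) Uy).
  have : 'D_(e_ i) (fun y => dot ('D_(e_ a) phi y) (phi y)) y = 0.
    rewrite -(derive_cst (0 : R) y (e_ i)); apply: near_eq_derive.
    by apply: (open_near oU Uy) => z Uz; exact: spherical_tangent.
  rewrite h1 s2 // gdot_delta symE // => /eqP; rewrite addr_eq0 => /eqP <-.
  by rewrite dotE !mxE; apply: eq_bigr => k _; rewrite !mxE.
apply/matrixP => a b.
have -> : (\matrix_j 'D_(e_ i) ('D_(e_ j) phi) y *m (\matrix_j 'D_(e_ j) phi y)^T) a b = c3 i a b y.
  by rewrite /c3 dotE !mxE; apply: eq_bigr => k _; rewrite !mxE.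
rewrite !mxE.
have -> : \sum_j (\matrix_(j0, k) Gam k i j0 y) a j * g y j b = \sum_k g y b k * Gam k i a y.
  by apply: eq_bigr => k _; rewrite mxE mulrC symE.
rewrite christoffel_low // !pd_c3 //.
have sc p q r : c3 p q r y = c3 q p r y := congr1 (fun w => dot w ('D_(e_ r) phi y)) (schwarz_phi _ _ Uy).
rewrite (sc a i b) (sc b i a) (sc b a i).
move: (c3 i a b y) (c3 i b a y) (c3 a b i y) => a1 a2 a3.
by field.
Qed.

(** The frame solves the linear system, so the integrability matrix kills it; as
    the frame is invertible, that matrix vanishes. *)
Lemma spherical_curv_const y : U y -> curv_const y.
Proof.
move=> Uy l k i j.
have dX p v z : U z -> is_derive z v (fun z => sysmx p z *m frame phi z)
   ('D_v (sysmx p) z *m frame phi z + sysmx p z *m (Adir sysmx v z *m frame phi z)).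
  move=> Uz; apply: is_derive_mulmx; last exact: gauss_formula.
  by apply/derivableP; exact: smooth_derivable (smooth_sysmx p) Uz.
have AdE q z : Adir sysmx (e_ q) z = sysmx q z.
  rewrite /Adir (bigD1 q) //= mxE !eqxx scale1r big1 ?addr0 // => p pi.
  by rewrite mxE (negbTE pi) andbF scale0r.
have DDX p v : 'D_v ('D_(e_ p) (frame phi)) y =
   'D_v (sysmx p) y *m frame phi y + sysmx p y *m (Adir sysmx v y *m frame phi y).
  have [_ <-] := dX p v y Uy; apply: near_eq_derive.
  by apply: (open_near oU Uy) => z Uz; have [_ ->] := gauss_formula (e_ p) Uz; rewrite AdE.
have sX : 'D_(e_ i) ('D_(e_ j) (frame phi)) y = 'D_(e_ j) ('D_(e_ i) (frame phi)) y.
  exact: schwarz_mx oU Uy (smooth_frame 2%N).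
have : ('D_(e_ i) (sysmx j) y - 'D_(e_ j) (sysmx i) y
    + sysmx j y *m sysmx i y - sysmx i y *m sysmx j y) *m frame phi y = 0.
  have := etrans (esym (DDX j (e_ i))) (etrans sX (DDX i (e_ j))).
  rewrite (AdE i) (AdE j).
  generalize ('D_(e_ i) (sysmx j) y) ('D_(e_ j) (sysmx i) y) (sysmx j y) (sysmx i y) (frame phi y).
  move=> d1 d2 s1 s2 F E.
  rewrite !(mulmxBl, mulmxDl) -!mulmxA (addrAC (d1 *m F)) E.
  by rewrite [d2 *m F + _]addrC addrK subrr.
move/(unitmx_mul_eq0 (frame_unit Uy)) => F0.
have := etrans (esym (curvature_matrix i j Uy)) F0.
move/(congr1 (fun M : 'M[R]_(1 + m) => M (rshift 1 k) (rshift 1 l))).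
by rewrite block_mxEdr !mxE => /eqP; rewrite subr_eq0 => /eqP.
Qed.
End ChartMetric.

Opaque christoffel.

(** * Sectional curvature 1 *)

Section Polarization.
Variables (R : realType) (m : nat).
Local Notation e_ i := (delta_mx 0 i : 'rV[R]_m).
Implicit Types (t : 'I_m -> 'I_m -> 'I_m -> 'I_m -> R) (a b c d : 'rV[R]_m).

(** The quadrilinear form of the array [t], with the arguments in the order in
    which sectional curvatures pair them. *)
Let T4 t a b c d := \sum_l a 0 l * (\sum_i c 0 i * (\sum_j d 0 j * (\sum_k b 0 k * t l k i j))).

Let sum_delta p (F : 'I_m -> R) : \sum_l (e_ p) 0 l * F l = F p.
Proof.
rewrite (bigD1 p) //= mxE !eqxx mul1r big1 ?addr0 // => l lp.
by rewrite mxE (negbTE lp) andbF mul0r.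
Qed.

Let sum_add a b (F : 'I_m -> R) : \sum_l (a + b) 0 l * F l = \sum_l a 0 l * F l + \sum_l b 0 l * F l.
Proof. by rewrite -big_split /=; apply: eq_bigr => l _; rewrite mxE mulrDl. Qed.

Let sum_addF a (F G : 'I_m -> R) : \sum_l a 0 l * (F l + G l) = \sum_l a 0 l * F l + \sum_l a 0 l * G l.
Proof. by rewrite -big_split /=; apply: eq_bigr => l _; rewrite mulrDr. Qed.

Let T4D1 t a a' b c d : T4 t (a + a') b c d = T4 t a b c d + T4 t a' b c d.
Proof. exact: sum_add. Qed.

Let T4D3 t a b c c' d : T4 t a b (c + c') d = T4 t a b c d + T4 t a b c' d.
Proof. by rewrite /T4; under eq_bigr => l _ do rewrite sum_add; exact: sum_addF. Qed.

Let T4D4 t a b c d d' : T4 t a b c (d + d') = T4 t a b c d + T4 t a b c d'.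
Proof.
rewrite /T4; under eq_bigr => l _ do
  (under eq_bigr => i _ do rewrite sum_add; rewrite sum_addF).
exact: sum_addF.
Qed.

Let T4D2 t a b b' c d : T4 t a (b + b') c d = T4 t a b c d + T4 t a b' c d.
Proof.
rewrite /T4; under eq_bigr => l _ do
  (under eq_bigr => i _ do (under eq_bigr => j _ do rewrite sum_add; rewrite sum_addF); rewrite sum_addF).
exact: sum_addF.
Qed.

Let T4e t p q r s : T4 t (e_ p) (e_ q) (e_ r) (e_ s) = t p q r s.
Proof. by rewrite /T4 !sum_delta. Qed.

(** Sectional curvatures determine the curvature tensor: polarizing the
    vanishing form in u and in v makes t skew in two more positions, and the
    Bianchi identity then forces it to vanish. *)
Lemma polarization t :
  (forall l k i j, t l k i j = - t l k j i) -> (forall l k i j, t l k i j = - t k l i j) ->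
  (forall l k i j, t l k i j + t l i j k + t l j k i = 0) ->
  (forall u v : 'rV[R]_m, \sum_l u 0 l * (\sum_i u 0 i * (\sum_j v 0 j * (\sum_k v 0 k * t l k i j))) = 0) ->
  forall l k i j, t l k i j = 0.
Proof.
move=> a34 a12 bi q.
have Q u v : T4 t u v u v = 0 by exact: q.
have q2 u w v : T4 t u v w v + T4 t w v u v = 0.
  by have := Q (u + w) v; rewrite !(T4D1, T4D3) !Q addr0 add0r addrC.
have q3 u w v z : T4 t u v w z + T4 t u z w v + (T4 t w v u z + T4 t w z u v) = 0.
  have := q2 u w (v + z); rewrite !(T4D2, T4D4) => H; rewrite -[RHS]H.
  have := q2 u w v; have := q2 u w z; lra.
have p (a b c d : 'I_m) : t a b c d = t c d a b.
  have := bi a b c d; have := bi b c d a; have := bi c d a b; have := bi d a b c.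
  have := (a34 a b c d, a34 a c d b, a34 a d b c, a34 b c d a, a34 b d a c, a34 b a c d,
    a34 c d a b, a34 c a b d, a34 c b d a, (a34 d a b c, a34 d b c a, a34 d c a b)).
  move=> [[[[[[[[[h1 h2] h3] h4] h5] h6] h7] h8] h9] [[h10 h11] h12]].
  have := (a12 a b c d, a12 a c d b, a12 a d b c, a12 b c d a, a12 b d a c, a12 b a c d,
    a12 c d a b, a12 c a b d, a12 c b d a, (a12 d a b c, a12 d b c a, a12 d c a b)).
  move=> [[[[[[[[[g1 g2] g3] g4] g5] g6] g7] g8] g9] [[g10 g11] g12]].
  have := (a12 a b d c, a12 a c b d, a12 a d c b, a12 b c a d, a12 b d c a, a12 b a d c).
  move=> [[[[[k1 k2] k3] k4] k5] k6]; lra.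
have s (l k i j : 'I_m) : t l k i j = - t l j i k.
  have := q3 (e_ l) (e_ i) (e_ k) (e_ j); rewrite !T4e (p i k l j) (p i j l k); lra.
move=> l k i j; have := bi l k i j; have := s l i j k; have := s l j k i; have := a34 l k i j.
have := a34 l i k j; have := a34 l i j k; have := a34 l k j i; have := s l k j i; have := a34 l j k i; lra.
Qed.
End Polarization.

Section CurvConst.
Variables (R : realType) (m : nat) (g : 'rV[R]_m -> 'M[R]_m) (U : set 'rV[R]_m).
Hypotheses (oU : open U) (sg : smooth U g)
  (symg : forall y, U y -> (g y)^T = g y)
  (posg : forall y u, U y -> u != 0 -> 0 < gdot (g y) u u).
Local Notation e_ i := (delta_mx 0 i : 'rV[R]_m).
Local Notation Gam := (christoffel g).
Let ug y (Uy : U y) : g y \in unitmx := posdef_unit (fun u => posg Uy).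

Lemma is_derive_tr (V : normedModType R) p q (f : V -> 'M[R]_(p, q)) x v (df : 'M[R]_(p, q)) :
  is_derive x v f df -> is_derive x v (fun y => (f y)^T) df^T.
Proof.
move=> hf; apply: is_derive_mx => i j; rewrite mxE.
by have := is_derive_coord j i hf; congr (is_derive _ _ _ _); apply/funext => y; rewrite mxE.
Qed.

Definition gam (i : 'I_m) (y : 'rV[R]_m) : 'M[R]_m := \matrix_(k, l) Gam l i k y.

Let smooth_gam i : smooth U (gam i).
Proof.
move=> n; apply/(Ck_mxP _ _ oU) => k l.
apply: Ck_ext (christoffel_smooth oU sg ug l i k n) => // y _; by rewrite mxE.
Qed.

Lemma metric_compat_mx i y : U y -> is_derive y (e_ i) g (gam i y *m g y + g y *m (gam i y)^T).
Proof.
move=> Uy; apply: is_derive_mx => a b.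
have -> : (gam i y *m g y + g y *m (gam i y)^T) a b = pd i (fun z => g z a b) y.
  rewrite (metric_compat oU symg ug) // !mxE; congr (_ + _).
    apply: eq_bigr => p _; rewrite !mxE mulrC; congr (_ * _).
    by rewrite -[in LHS](symg Uy) mxE.
  by apply: eq_bigr => p _; rewrite !mxE.
by apply/derivableP; exact: smooth_derivable (smooth_metric_coord oU sg a b) Uy.
Qed.

Let gam_derive i j y : U y -> is_derive y (e_ i) (gam j) ('D_(e_ i) (gam j) y).
Proof. by move=> Uy; apply/derivableP; exact: smooth_derivable (smooth_gam j) Uy. Qed.

Let curvmx i j y := 'D_(e_ i) (gam j) y - 'D_(e_ j) (gam i) y + gam j y *m gam i y - gam i y *m gam j y.

Let curvmxE i j k l y : U y -> curvmx i j y k l = riemann g l k i j y.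
Proof.
move=> Uy; have E a c : ('D_(e_ a) (gam c) y) k l = pd a (Gam l c k) y.
  have [d _] := gam_derive a c Uy; apply: etrans (derive_coord k l d) _.
  have -> : (fun z => gam c z k l) = Gam l c k by apply/funext => z; rewrite mxE.
  by [].
rewrite /curvmx /riemann sumrB addrA.
have M a c : (gam a y *m gam c y) k l = \sum_(p < m) Gam l c p y * Gam p a k y.
  by rewrite mxE; apply: eq_bigr => p _; rewrite !mxE mulrC.
rewrite -(M j i) -(M i j) -(E i j) -(E j i).
move: ('D_(e_ i) (gam j) y) ('D_(e_ j) (gam i) y) (gam j y *m gam i y) (gam i y *m gam j y).
by move=> m1 m2 m3 m4; rewrite !mxE.
Qed.

(** The curvature is skew with respect to the metric: differentiate g twice,
    using compatibility with the connection, and use the symmetry of second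
    derivatives. *)
Let curvmx_antisym i j y : U y -> curvmx i j y *m g y = - (curvmx i j y *m g y)^T.
Proof.
move=> Uy.
have D2 a b : is_derive y (e_ a) ('D_(e_ b) g)
   (('D_(e_ a) (gam b) y *m g y + gam b y *m (gam a y *m g y + g y *m (gam a y)^T)) +
    ((gam a y *m g y + g y *m (gam a y)^T) *m (gam b y)^T + g y *m ('D_(e_ a) (gam b) y)^T)).
  apply: (@near_eq_is_derive _ _ _ (fun y => gam b y *m g y + g y *m (gam b y)^T)).
    by apply: (open_near oU Uy) => z Uz; have [_ ->] := metric_compat_mx b Uz.
  apply: is_deriveD.
    by apply: is_derive_mulmx; [exact: gam_derive|exact: metric_compat_mx].
  by apply: is_derive_mulmx; [exact: metric_compat_mx|apply: is_derive_tr; exact: gam_derive].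
have := schwarz_mx (e_ j) (e_ i) oU Uy (sg 2%N).
have [_ E1] := D2 i j; have [_ E2] := D2 j i => E3.
have := etrans (esym E1) (etrans E3 E2).
rewrite /curvmx.
move: ('D_(e_ i) (gam j) y) ('D_(e_ j) (gam i) y) (gam i y) (gam j y) (g y) (symg Uy).
move=> dij dji gi gj G sG.
have trB (A B : 'M[R]_m) : (A - B)^T = A^T - B^T by rewrite linearB.
have trD (A B : 'M[R]_m) : (A + B)^T = A^T + B^T by rewrite linearD.
rewrite !(trmx_mul, trB, trD, mulmxBl, mulmxDl, mulmxDr, sG).
rewrite !mulmxA.
set q1 := dij *m G; set q2 := gj *m gi *m G; set q3 := gj *m G *m gi^T; set q4 := gi *m G *m gj^T.
set q5 := G *m gi^T *m gj^T; set q6 := G *m dij^T; set q7 := dji *m G; set q8 := gi *m gj *m G.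
set q9 := G *m gj^T *m gi^T; set q10 := G *m dji^T.
move: q1 q2 q3 q4 q5 q6 q7 q8 q9 q10 => q1 q2 q3 q4 q5 q6 q7 q8 q9 q10 E.
apply/matrixP => a b; move/matrixP: E => /(_ a b); rewrite !mxE; lra.
Qed.

Let riemann_low l k i j y := (curvmx i j y *m g y) k l.

(** The vector R(u, v) v whose inner product with u is the numerator of the
    sectional curvature. *)
Definition ruvv (rho : 'I_m -> 'I_m -> 'I_m -> 'I_m -> R) (u v : 'rV[R]_m) : 'rV[R]_m :=
  \row_(l < m) \sum_(i < m) \sum_(j < m) \sum_(k < m) rho l k i j * u 0 i * v 0 j * v 0 k.

Let rho0 y l k i j := g y j k * (l == i)%:R - g y i k * (l == j)%:R.

Let gdot_sum3 y (u v : 'rV[R]_m) : \sum_j \sum_k g y j k * u 0 j * v 0 k = gdot (g y) u v.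
Proof. by []. Qed.

Lemma ruvv_const y (u v : 'rV[R]_m) : ruvv (rho0 y) u v = gdot (g y) v v *: u - gdot (g y) u v *: v.
Proof.
apply/rowP => l; rewrite !mxE /rho0.
transitivity (\sum_i \sum_j \sum_k (((l == i)%:R * u 0 i) * (g y j k * v 0 j * v 0 k) -
   ((l == j)%:R * v 0 j) * (g y i k * u 0 i * v 0 k))).
  by do 3! (apply: eq_bigr => ? _); ring.
have dl (F : 'I_m -> R) : \sum_i (l == i)%:R * F i = F l.
  rewrite (bigD1 l) //= eqxx mul1r big1 ?addr0 // => p pl.
  by rewrite eq_sym (negbTE pl) mul0r.
rewrite (eq_bigr (fun i => (l == i)%:R * u 0 i * gdot (g y) v v -
   v 0 l * \sum_k g y i k * u 0 i * v 0 k)); last first.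
  move=> i _; rewrite -[gdot _ v v]gdot_sum3.
  have -> : v 0 l * \sum_k g y i k * u 0 i * v 0 k =
     \sum_j (l == j)%:R * (v 0 j * \sum_k g y i k * u 0 i * v 0 k).
    by rewrite (dl (fun j => v 0 j * \sum_k g y i k * u 0 i * v 0 k)).
  rewrite mulr_sumr -sumrB.
  apply: eq_bigr => j _; rewrite sumrB; congr (_ - _); first by rewrite mulr_sumr.
  by rewrite -mulr_sumr mulrA.
rewrite sumrB -mulr_sumr gdot_sum3 [gdot _ u v * _]mulrC; congr (_ - _).
under eq_bigr => i _ do rewrite -mulrA.
by rewrite (dl (fun i => u 0 i * gdot (g y) v v)) mulrC.
Qed.

Lemma sectional_of_curv_const y u v : U y -> curv_const g y -> row_free (col_mx u v) ->
  sectional g y u v = 1.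
Proof.
move=> Uy cc uv; rewrite /sectional.
have -> : (\row_(l < m) \sum_(i < m) \sum_(j < m) \sum_(k < m)
                 riemann g l k i j y * u 0 i * v 0 j * v 0 k) = ruvv (rho0 y) u v.
  by apply/rowP => l; rewrite !mxE; do 3! (apply: eq_bigr => ? _); rewrite cc.
rewrite ruvv_const.
have gsym a b : gdot (g y) a b = gdot (g y) b a.
  by rewrite !gdot_dot dot_mulmx symg // dotC.
have -> : gdot (g y) (gdot (g y) v v *: u - gdot (g y) u v *: v) u =
   gdot (g y) u u * gdot (g y) v v - gdot (g y) u v ^+ 2.
  by rewrite gdot_dot mulmxBl dotBl -!scalemxAl !dotZl -!gdot_dot (gsym v u); ring.
rewrite divff //; apply/eqP => H.
have v0 : v != 0.
  apply: contraTneq uv => ->; rewrite /row_free.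
  rewrite neq_ltn; apply/orP; left; rewrite -addsmxE addsmx0.
  exact: (rank_leq_row u).
have := posg Uy (u := gdot (g y) v v *: u - gdot (g y) u v *: v).
have gv := posg Uy v0.
have -> : gdot (g y) (gdot (g y) v v *: u - gdot (g y) u v *: v)
     (gdot (g y) v v *: u - gdot (g y) u v *: v) =
   gdot (g y) v v * (gdot (g y) u u * gdot (g y) v v - gdot (g y) u v ^+ 2).
  rewrite gdot_dot mulmxBl !(dotBl, dotBr) -!scalemxAl !(dotZl, dotZr) -!gdot_dot (gsym v u); ring.
rewrite H mulr0 ltxx => K; have /eqP : gdot (g y) v v *: u - gdot (g y) u v *: v == 0.
  by apply/negPn/negP => /K.
move=> E; move/row_freeP: uv => [B].
move/(congr1 (mulmx (row_mx (gdot (g y) v v)%:M (- gdot (g y) u v)%:M : 'rV[R]_(1 + 1)))).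
rewrite mulmxA mul_row_col !mul_scalar_mx scaleNr E mul0mx mulmx1.
move/(congr1 (fun M : 'rV[R]_(1 + 1) => M 0 (lshift 1 0))); rewrite row_mxEl !mxE eqxx mulr1n.
by move=> E2; move: gv; rewrite -E2 ltxx.
Qed.

(** The difference between the curvature tensor and the one of the sphere is an
    algebraic curvature tensor whose sectional curvatures vanish. *)
Lemma curv_const_of_sectional y : U y ->
  (forall u v, row_free (col_mx u v) -> sectional g y u v = 1) -> curv_const g y.
Proof.
move=> Uy sec.
pose rho l k i j := riemann g l k i j y - rho0 y l k i j.
pose t l k i j := \sum_p rho p k i j * g y p l.
have low l k i j : t l k i j = riemann_low l k i j y - (g y j k * g y i l - g y i k * g y j l).
  rewrite /t /riemann_low mxE /rho /rho0.
  under eq_bigr => p _ do rewrite mulrBl; rewrite sumrB; congr (_ - _).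
    by apply: eq_bigr => p _; rewrite curvmxE.
  under eq_bigr => p _ do rewrite mulrBl; rewrite sumrB.
  have dl a (F : 'I_m -> R) : \sum_p (p == a)%:R * F p = F a.
    rewrite (bigD1 a) //= eqxx mul1r big1 ?addr0 // => p pl.
    by rewrite (negbTE pl) mul0r.
  congr (_ - _).
    by under eq_bigr => p _ do rewrite -mulrA; rewrite -mulr_sumr dl.
  by under eq_bigr => p _ do rewrite -mulrA; rewrite -mulr_sumr dl.
have gS a b : g y a b = g y b a by rewrite -{1}(symg Uy) mxE.
have rho_anti l k i j : rho l k i j = - rho l k j i.
  have : riemann g l k i j y = - riemann g l k j i y.
    rewrite /riemann !sumrB; move: (pd i _ y) (pd j _ y) (\sum_p _) (\sum_p _) => r1 r2 r3 r4.
    by ring.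
  by rewrite /rho /rho0 => ->; ring.
have t0 : forall l k i j, t l k i j = 0.
  apply: polarization.
  - by move=> l k i j; rewrite /t -sumrN; apply: eq_bigr => p _; rewrite rho_anti mulNr.
  - move=> l k i j; rewrite !low /riemann_low; have := curvmx_antisym i j Uy.
    move: (curvmx i j y *m g y) => P /matrixP/(_ k l); rewrite !mxE => ->.
    by ring.
  - move=> l k i j; rewrite /t -!big_split /= big1 // => p _.
    rewrite -!mulrDl (_ : _ + _ = 0) ?mul0r // /rho /rho0.
    have H : riemann g p k i j y + riemann g p i j k y + riemann g p j k i y = 0.
      have cs a b c : pd a (Gam p b c) y = pd a (Gam p c b) y.
        apply: near_eq_derive; apply: (open_near oU Uy) => z Uz; exact: christoffel_sym oU symg _ _ _ _ Uz.
      have cs' q b c : Gam q b c y = Gam q c b y by exact: christoffel_sym oU symg _ _ _ _ Uy.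
      pose S a b c := \sum_p0 Gam p a p0 y * Gam p0 b c y.
      have E a b c : S a b c = S a c b.
        by apply: eq_bigr => q _; rewrite (cs' q b c).
      have RE a b c : riemann g p c a b y =
          pd a (Gam p b c) y - pd b (Gam p a c) y + (S a b c - S b a c).
        by rewrite /riemann sumrB.
      clearbody S; rewrite (RE i j k) (RE j k i) (RE k i j) (cs i k j) (cs j k i) (cs k j i).
      rewrite (E i k j) (E j k i) (E k j i).
      generalize (pd i (Gam p j k) y) (pd j (Gam p i k) y) (pd k (Gam p i j) y) (S i j k) (S j i k) (S k i j).
      by move=> s1 s2 s3 s4 s5 s6; ring.
    move: H; rewrite (gS i k) (gS j k) (gS j i).
    move: (riemann g p k i j y) (riemann g p i j k y) (riemann g p j k i y) => r1 r2 r3 H.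
    by rewrite -[RHS]H; ring.
  move=> u v.
  have E : \sum_l u 0 l * (\sum_i u 0 i * (\sum_j v 0 j * (\sum_k v 0 k * t l k i j))) =
     gdot (g y) (ruvv rho u v) u.
    rewrite gdot_dot dotC /dot; apply: eq_bigr => l _; congr (_ * _).
    rewrite mxE /ruvv.
    transitivity (\sum_i \sum_j \sum_k \sum_p rho p k i j * u 0 i * v 0 j * v 0 k * g y p l).
      apply: eq_bigr => i _; rewrite mulr_sumr; apply: eq_bigr => j _.
      rewrite !mulr_sumr; apply: eq_bigr => k _; rewrite !mulr_sumr; apply: eq_bigr => p _.
      by ring.
    under [RHS]eq_bigr => p _ do rewrite mxE mulr_suml.
    rewrite [RHS]exchange_big /=; apply: eq_bigr => i _.
    under [RHS]eq_bigr => p _ do rewrite mulr_suml.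
    rewrite [RHS]exchange_big /=; apply: eq_bigr => j _.
    under [RHS]eq_bigr => p _ do rewrite mulr_suml.
    by rewrite [RHS]exchange_big.
  have lin : ruvv rho u v = ruvv (fun l k i j => riemann g l k i j y) u v - ruvv (rho0 y) u v.
    apply/rowP => l; rewrite !mxE -sumrB; apply: eq_bigr => i _.
    rewrite -sumrB; apply: eq_bigr => j _; rewrite -sumrB; apply: eq_bigr => k _.
    by rewrite /rho; ring.
  rewrite E.
  have [uv|nuv] := boolP (row_free (col_mx u v)).
    rewrite lin gdot_dot mulmxBl dotBl -!gdot_dot ruvv_const.
    have := sec u v uv; rewrite /sectional -/(ruvv (fun l k i j => riemann g l k i j y) u v).
    set n1 := gdot _ _ u; set d1 := (X in n1 / X) => H.
    have gsym a b : gdot (g y) a b = gdot (g y) b a.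
      by rewrite !gdot_dot dot_mulmx symg // dotC.
    have d10 : d1 != 0.
      by apply: contra_eq_neq H => ->; rewrite invr0 mulr0 eq_sym oner_eq0.
    have -> : n1 = d1 by rewrite -[n1](mulfVK d10) H mul1r.
    rewrite /d1 [gdot _ (_ - _) _]gdot_dot mulmxBl dotBl -!scalemxAl !dotZl -!gdot_dot (gsym v u); ring.
  suff -> : ruvv rho u v = 0 by rewrite gdotE !mul0mx mxE.
  have [v0|v0] := eqVneq v 0.
    apply/rowP => l; rewrite !mxE; apply: big1 => i _; apply: big1 => j _; apply: big1 => k _.
    by rewrite v0 !mxE mulr0.
  have [c uc] : exists c, u = c *: v.
    apply: contrapT => nc; move/negP: nuv; apply.
    rewrite -kermx_eq0; apply/eqP/row_matrixP => r; rewrite row0.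
    have := congr1 (row r) (mulmx_ker (col_mx u v)); rewrite row_mul row0.
    set w := row r _; rewrite -[w]hsubmxK mul_row_col.
    rewrite [lsubmx w]mx11_scalar [rsubmx w]mx11_scalar !mul_scalar_mx.
    set a := lsubmx w 0 0; set b := rsubmx w 0 0 => ab.
    have a0 : a = 0.
      apply/eqP/negPn/negP => a0; apply: nc; exists (- b / a).
      move/eqP: ab; rewrite addr_eq0 => /eqP ab.
      by rewrite mulrC -scalerA scaleNr -ab scalerA mulVf // scale1r.
    move: ab; rewrite a0 scale0r add0r => /eqP; rewrite scaler_eq0 (negbTE v0) orbF => /eqP ->.
    by rewrite !raddf0 row_mx0.
  apply/rowP => l; rewrite !mxE uc.
  set S := \sum_i _; suff : S = - S by lra.
  rewrite /S [in RHS]exchange_big /= -sumrN; apply: eq_bigr => i _; rewrite -sumrN; apply: eq_bigr => j _.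
  rewrite -sumrN; apply: eq_bigr => k _; rewrite !mxE (rho_anti l k j i); ring.
have rho_mx i j : (\matrix_(k, p) rho p k i j) *m g y = 0.
  apply/matrixP => k l; rewrite !mxE -[RHS](t0 l k i j); apply: eq_bigr => p _; by rewrite mxE.
move=> l k i j; have := unitmx_mul_eq0 (ug Uy) (rho_mx i j).
by move/matrixP/(_ k l); rewrite !mxE => /eqP; rewrite subr_eq0 => /eqP.
Qed.
End CurvConst.

(** * Existence and uniqueness of spherical maps *)

Section SphericalCharts.
Variable (R : realType).

(** Used to start the linear system with a frame that has the prescribed Gram
    matrix at one point. *)
Lemma cholesky n (G : 'M[R]_n) : G^T = G -> (forall u, u != 0 -> 0 < gdot G u u) ->
  exists L : 'M[R]_n, L *m L^T = G.
Proof.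
elim: n G => [|n IH] G sG pG; first by exists 0; apply/matrixP => -[].
rewrite -[n.+1]/(1 + n)%N in G sG pG *.
set a := G 0 0; set b := ursubmx G; set C := drsubmx G.
have GE : G = block_mx a%:M b b^T C.
  rewrite -[LHS]submxK; congr block_mx.
    by rewrite [ulsubmx G]mx11_scalar /a !mxE; congr (_ %:M); congr (G _ _); apply: val_inj.
  by rewrite /b trmx_ursub sG.
have a0 : 0 < a.
  have := pG (delta_mx 0 0); rewrite gdot_delta; apply.
  by apply/eqP => /matrixP/(_ 0 0)/eqP; rewrite !mxE !eqxx oner_eq0.
have sC : C^T = C by rewrite /C trmx_drsub sG.
(* the Schur complement of the first entry *)
pose S := C - a^-1 *: (b^T *m b).
have [||L HL] := IH S.
- by rewrite /S linearB /= linearZ /= trmx_mul trmxK sC.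
- move=> u u0; have := pG (row_mx (- a^-1 *: (b *m u^T)^T) u).
  have -> : gdot G (row_mx (- a^-1 *: (b *m u^T)^T) u) (row_mx (- a^-1 *: (b *m u^T)^T) u) = gdot S u u.
    rewrite gdotE GE tr_row_mx mul_row_block mul_row_col.
    rewrite trmx_mul trmxK mul_mx_scalar scalerA mulrN mulfV ?gt_eqF // scaleN1r.
    rewrite addNr mul0mx add0r gdotE /S mulmxBr -scalemxAr mulmxA -scalemxAl scaleNr.
    by rewrite addrC.
  apply; apply: contra_neq u0 => /eqP; rewrite -[0]row_mx0 => /eqP /eq_row_mx[_ ->] //.
exists (block_mx (Num.sqrt a)%:M 0 ((Num.sqrt a)^-1 *: b^T) L).
have sa : Num.sqrt a * Num.sqrt a = a by rewrite -expr2 sqr_sqrtr // ltW.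
have sa0 : Num.sqrt a != 0 by rewrite gt_eqF // sqrtr_gt0.
rewrite GE tr_block_mx mulmx_block trmx0 tr_scalar_mx !mul0mx !mulmx0 !addr0.
congr block_mx.
- by rewrite -scalar_mxM sa.
- by rewrite mul_scalar_mx linearZ /= trmxK scalerA mulfV // scale1r.
- by rewrite mul_mx_scalar scalerA mulfV // scale1r.
rewrite HL /S -scalemxAl linearZ /= trmxK -scalemxAr scalerA -invfM sa.
by rewrite addrC subrK.
Qed.

Variable (m : nat) (g : 'rV[R]_m -> 'M[R]_m) (U : set 'rV[R]_m).
Hypotheses (oU : open U) (sg : smooth U g)
  (symg : forall y, U y -> (g y)^T = g y)
  (posg : forall y u, U y -> u != 0 -> 0 < gdot (g y) u u).
Local Notation e_ i := (delta_mx 0 i : 'rV[R]_m).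
Let ug y (Uy : U y) : g y \in unitmx := posdef_unit (fun u => posg Uy).
Let Gm y : 'M[R]_(1 + m) := block_mx 1 0 0 (g y).

Let smooth_sys i k : Ck k U (sysmx g i). Proof. exact: smooth_sysmx oU sg ug i k. Qed.

(** The Gram matrix diag(1, g) that a frame should have satisfies the
    differential equation that X X^T satisfies for a solution X. *)
Lemma metric_compat_sys v y : U y ->
  is_derive y v Gm (Adir (sysmx g) v y *m Gm y + Gm y *m (Adir (sysmx g) v y)^T).
Proof.
move=> Uy.
have CG : Ck 1 U Gm.
  apply/(Ck_mxP _ _ oU) => a b; rewrite /Gm.
  case: (split_ordP a) => a' ->; case: (split_ordP b) => b' ->.
  - by apply: Ck_ext (Ck_cst 1 U ((1 : 'M[R]_1) a' b')) => // z _; rewrite block_mxEul.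
  - by apply: Ck_ext (Ck_cst 1 U (0 : R)) => // z _; rewrite block_mxEur mxE.
  - by apply: Ck_ext (Ck_cst 1 U (0 : R)) => // z _; rewrite block_mxEdl mxE.
  apply: Ck_ext (smooth_metric_coord oU sg a' b' 1%N) => // z _; by rewrite block_mxEdr.
have De i : 'D_(e_ i) Gm y = sysmx g i y *m Gm y + Gm y *m (sysmx g i y)^T.
  have -> : 'D_(e_ i) Gm y = block_mx 0 0 0 ('D_(e_ i) g y).
    apply/matrixP => a b.
    have dG : derivable Gm y (e_ i) := Ck_derivable CG Uy.
    apply: etrans (derive_coord a b dG) _.
    case: (split_ordP a) => a' ->; case: (split_ordP b) => b' ->.
    - rewrite block_mxEul mxE (_ : (fun z => Gm z _ _) = cst ((1 : 'M[R]_1) a' b')) ?derive_cst //.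
      by apply/funext => z; rewrite /Gm block_mxEul.
    - rewrite block_mxEur mxE (_ : (fun z => Gm z _ _) = cst 0) ?derive_cst //.
      by apply/funext => z; rewrite /Gm block_mxEur mxE.
    - rewrite block_mxEdl mxE (_ : (fun z => Gm z _ _) = cst 0) ?derive_cst //.
      by apply/funext => z; rewrite /Gm block_mxEdl mxE.
    rewrite block_mxEdr (_ : (fun z => Gm z _ _) = (fun z => g z a' b')); last first.
      by apply/funext => z; rewrite /Gm block_mxEdr.
    apply: esym; apply: derive_coord; exact: smooth_derivable sg Uy.
  have [_ ->] := metric_compat_mx oU sg symg posg i Uy.
  rewrite /sysmx /Gm tr_block_mx !mulmx_block add_block_mx.
  rewrite !(mul0mx, mulmx0, trmx0, add0r, addr0, mulmx1, mul1mx).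
  have gi : (\col_j - g y i j) = - (e_ i *m g y)^T.
    by rewrite -rowE; apply/matrixP => a b; rewrite !mxE.
  congr block_mx.
  - by rewrite gi linearN /= trmxK addrN.
  - by rewrite gi trmx_mul symg // addNr.
split; first exact: (Ck_derivable CG Uy).
rewrite (Ck1_derive_sum_mx v oU Uy CG) /Adir mulmx_suml.
have -> : (\sum_i v 0 i *: sysmx g i y)^T = \sum_i v 0 i *: (sysmx g i y)^T.
  by rewrite raddf_sum; apply: eq_bigr => i _; apply/matrixP => a b; rewrite !mxE.
rewrite mulmx_sumr -big_split /=; apply: eq_bigr => i _.
by rewrite De scalerDr -scalemxAl -scalemxAr.
Qed.

(** Solve the Gauss system with an initial frame of Gram matrix diag(1, g).
    Then X X^T and diag(1, g) solve the same linear equation with the same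
    initial value, hence agree; so the first row of X is a map to the sphere,
    and the equation for it says that the other rows are its derivatives. *)
Lemma spherical_exists y0 : U y0 -> (forall y, U y -> curv_const g y) ->
  exists W phi, [/\ open W, W y0, W `<=` U & spherical_on g phi W].
Proof.
move=> Uy0 cc.
have [L HL] := cholesky (symg Uy0) (fun u => posg Uy0).
pose X0 : 'M[R]_(1 + m) := block_mx 1 0 0 L.
have flat := flat_of_curv_const oU sg symg ug cc.
have [W [X [oW Wy0 WU Xy0 dX]]] := flat_solution X0 oU Uy0 (fun i => smooth_sys i 2%N) flat.
have sX : smooth W X.
  apply: linear_system_smooth dX => // i k; apply: Ck_sub WU _; exact: smooth_sys.
have [r r0 KW] := open_cball oW Wy0.
have [M M0 HM] := Adir_unif_bound oU (subset_trans KW WU) (fun i => smooth_sys i 0%N).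
(* Z measures the failure of X to be a frame with Gram matrix diag(1, g). *)
pose Z y := X y *m (X y)^T - Gm y.
pose A v y := Adir (sysmx g) v y.
have ballK y : `|y - y0| < r -> cball y0 r y by move=> /ltW.
have [||||d d0 Zd] := @zero_local R m _ _ Z (fun v y => A v y *m Z y + Z y *m (A v y)^T) y0 r
   ((1 + m)%:R * M + (1 + m)%:R * M) r0.
- by rewrite addr_ge0 // mulr_ge0.
- move=> y /ballK/KW Wy v.
  have -> : A v y *m Z y + Z y *m (A v y)^T =
    (A v y *m X y *m (X y)^T + X y *m (A v y *m X y)^T) - (A v y *m Gm y + Gm y *m (A v y)^T).
    rewrite /Z mulmxBr mulmxBl trmx_mul !mulmxA.
    by rewrite addrACA opprD.
  apply: is_deriveB; last exact: metric_compat_sys (WU _ Wy).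
  by apply: is_derive_mulmx; [exact: dX|apply: is_derive_tr; exact: dX].
- move=> y /ballK Ky v; have bA := HM y Ky v.
  have trn (p q : nat) (B : 'M[R]_(p, q)) : `|B^T| <= `|B|.
    by apply: mx_norm_le => // i j; rewrite mxE ler_coord.
  apply: le_trans (ler_normD _ _) _; rewrite !mulrDl; apply: lerD.
    apply: le_trans (mx_norm_mul _ _) _; rewrite ler_wpM2r // -mulrA ler_wpM2l //.
  apply: le_trans (mx_norm_mul _ _) _; rewrite mulrAC ler_wpM2r // -[X in _ <= X]mulrA ler_wpM2l //.
  exact: le_trans (trn _ _ _) bA.
- rewrite /Z Xy0 /X0 /Gm tr_block_mx mulmx_block !trmx0 !mul0mx !mulmx0 !addr0 !add0r HL.
  by rewrite trmx1 mulmx1 subrr.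
set dr := Num.min d r.
have dr0 : 0 < dr by rewrite lt_min d0.
exists [set y | `|y - y0| < dr], (fun y => usubmx (X y)).
have WW y : `|y - y0| < dr -> W y /\ X y *m (X y)^T = Gm y.
  rewrite lt_min => /andP[yd yr]; split; first exact/KW/ballK.
  by have := Zd y yd; rewrite /Z => /eqP; rewrite subr_eq0 => /eqP.
have blk y : `|y - y0| < dr -> usubmx (X y) *m (usubmx (X y))^T = 1 /\ dsubmx (X y) *m (dsubmx (X y))^T = g y.
  move=> /WW[_]; rewrite -{1 2}[X y]vsubmxK tr_col_mx mul_col_row /Gm => /eq_block_mx[-> _ _ ->] //.
split.
- exact: open_oball.
- by rewrite /= subrr normr0.
- by move=> y /= /WW[/WU].
have dphi y v : `|y - y0| < dr -> is_derive y v (fun y => usubmx (X y)) (v *m dsubmx (X y)).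
  move=> /WW[Wy _].
  have -> : v *m dsubmx (X y) = usubmx (A v y *m X y).
    rewrite -{2}[X y]vsubmxK /A.
    have -> : Adir (sysmx g) v y = block_mx 0 v (dlsubmx (Adir (sysmx g) v y)) (drsubmx (Adir (sysmx g) v y)).
      rewrite -[LHS]submxK; congr block_mx.
        apply/matrixP => a b; rewrite !mxE /Adir summxE big1 // => i _.
        by rewrite mxE /sysmx block_mxEul mxE mulr0.
      apply/matrixP => a b; rewrite !mxE /Adir summxE (bigD1 b) //= big1 ?addr0.
        by rewrite mxE /sysmx block_mxEur !mxE ord1 !eqxx mulr1.
      by move=> i ib; rewrite mxE /sysmx block_mxEur mxE [b == i]eq_sym (negbTE ib) andbF mulr0.
    by rewrite mul_block_col col_mxKu mul0mx add0r.
  apply: is_derive_mx => i j; rewrite mxE.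
  have := is_derive_coord (lshift m i) j (dX y Wy v).
  by congr (is_derive _ _ _ _); apply/funext => z; rewrite mxE.
split.
- move=> k; have oB := @open_oball R m y0 dr; apply/(Ck_mxP k _ oB) => i j.
  apply: (@Ck_ext _ _ _ _ _ (fun y => X y (lshift m i) j)); [exact: open_oball|by move=> y _; rewrite mxE|].
  apply: (Ck_sub (U := W)); first by move=> y /= /WW[].
  exact: (Ck_mxP _ _ oW).1 (sX k) _ _.
- by move=> y /= /blk[H _]; rewrite dotE H mxE eqxx.
move=> y /= yd u v; have [_ Hu] := dphi y u yd; have [_ Hv] := dphi y v yd.
rewrite [in LHS]Hu [in LHS]Hv dotE gdotE trmx_mul mulmxA -[u *m dsubmx _ *m _]mulmxA.
by have [_ ->] := blk y yd.
Qed.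

(** The matrix taking one frame to the other at [y0] is orthogonal as both have
    the same Gram matrix; both sides of the claimed equation then solve the
    Gauss system with the same value at [y0]. *)
Lemma spherical_unique phi1 phi2 W y0 : open W -> W y0 -> W `<=` U ->
  spherical_on g phi1 W -> spherical_on g phi2 W ->
  exists C : 'M[R]_(1 + m), C *m C^T = 1%:M /\
    \forall y \near y0, phi2 y = phi1 y *m C.
Proof.
move=> oW Wy0 WU s1 s2.
have sgW : smooth W g := smooth_sub WU sg.
have symW y : W y -> (g y)^T = g y by move=> /WU/symg.
have ugW y : W y -> g y \in unitmx by move=> /WU/ug.
have u1 := frame_unit oW ugW s1.
have m1 := frame_mul_tr oW s1; have m2 := frame_mul_tr oW s2.
have [C XC] : exists C, frame phi1 y0 *m C = frame phi2 y0.
  by exists (invmx (frame phi1 y0) *m frame phi2 y0); rewrite mulmxA mulmxV ?mul1mx // u1.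
have [r r0 KW] := open_cball oW Wy0.
have [M M0 HM] := Adir_unif_bound oU (subset_trans KW WU) (fun i => smooth_sys i 0%N).
have [||||d d0 Zd] := @zero_local R m _ _ (fun y => frame phi2 y - frame phi1 y *m C)
    (fun v y => Adir (sysmx g) v y *m (frame phi2 y - frame phi1 y *m C)) y0 r ((1 + m)%:R * M) r0.
- by rewrite mulr_ge0.
- move=> y /ltW/KW Wy v; rewrite mulmxBr mulmxA.
  have d2 := gauss_formula oW symW ugW s2 v Wy.
  have d1 : is_derive y v (fun y => frame phi1 y *m C) (Adir (sysmx g) v y *m frame phi1 y *m C + frame phi1 y *m 0).
    exact: is_derive_mulmx (gauss_formula oW symW ugW s1 v Wy) (is_derive_cst C y v).
  have E : Adir (sysmx g) v y *m frame phi1 y *m C + frame phi1 y *m 0 = Adir (sysmx g) v y *m frame phi1 y *m C.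
    exact: etrans (congr1 _ (mulmx0 _ _)) (addr0 _).
  have := is_deriveB d2 d1; by rewrite E.
- move=> y /ltW Ky v; apply: le_trans (mx_norm_mul _ _) _.
  by rewrite ler_wpM2r // -mulrA ler_wpM2l // HM.
- by rewrite XC subrr.
exists C; split.
  have uX := u1 _ Wy0; have uXt : (frame phi1 y0)^T \in unitmx by rewrite unitmx_tr.
  apply: (can_inj (mulmxK uXt)); apply: (can_inj (mulKmx uX)).
  rewrite mul1mx m1 // -(m2 y0) // -XC trmx_mul.
  by rewrite !mulmxA.
apply/nbhs_ballP; exists d => // y; rewrite -ball_normE /= distrC => /Zd /eqP.
rewrite subr_eq0 => /eqP H.
have := congr1 usubmx H; rewrite /frame mul_col_mx !col_mxKu //.
Qed.
End SphericalCharts.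

(** * Spherical maps as immersions *)

Section Immersion.
Variable (R : realType).

Lemma smooth_coord n (i : 'I_n) (U : set 'rV[R]_n) : open U -> smooth U (fun x => x 0 i).
Proof.
move=> oU k; apply: (Ck_mxP k (U := U) id oU).1.
have c (x : 'rV[R]_n) : U x -> {for x, continuous (@id 'rV[R]_n)} by move=> _; exact: cvg_id.
case: k => [|k]; first by split.
split; first exact: c.
split=> [x v _|v]; first exact: derivable_id.
apply: (@Ck_ext _ _ _ k U (cst v)) (Ck_cst k U v) => // x _.
by rewrite derive_id.
Qed.

Lemma smooth_id n (U : set 'rV[R]_n) : open U -> smooth U id.
Proof. by move=> oU; apply/(smooth_mxP _ oU) => i j; rewrite ord1; exact: smooth_coord. Qed.

Lemma smooth_mulmxr n p (M : 'M[R]_(n, p)) (V : normedModType R) (U : set V) (f : V -> 'rV[R]_n) :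
  open U -> smooth U f -> smooth U (fun x => f x *m M).
Proof. by move=> oU sf k; apply: Ck_mulmx => //; exact: Ck_cst. Qed.

(** Row vectors are acted upon from the right, so row [j] is the derivative
    along the j-th basis vector. *)
Definition jacob n p (f : 'rV[R]_n -> 'rV[R]_p) (x : 'rV[R]_n) : 'M[R]_(n, p) :=
  \matrix_j 'D_(delta_mx 0 j) f x.

Lemma jacobE n p (f : 'rV[R]_n -> 'rV[R]_p) (U : set 'rV[R]_n) x v : open U -> U x -> Ck 1 U f ->
  'D_v f x = v *m jacob f x.
Proof.
move=> oU Ux Cf; rewrite (Ck1_derive_sum_mx v oU Ux Cf) mulmx_sum_row.
by apply: eq_bigr => i _; rewrite rowK.
Qed.

Lemma Ck_jacob n p k (f : 'rV[R]_n -> 'rV[R]_p) (U : set 'rV[R]_n) : open U ->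
  Ck k.+1 U f -> Ck k U (jacob f).
Proof.
move=> oU Cf; apply/(Ck_mxP _ _ oU) => i j.
apply: Ck_ext ((Ck_mxP _ _ oU).1 (CkD (delta_mx 0 i) Cf) 0 j) => // x _; by rewrite mxE.
Qed.

Lemma finite_min_pos (I : finType) (d : I -> R) : (forall j, 0 < d j) ->
  exists2 r : R, 0 < r & forall j, r <= d j.
Proof.
move=> d0; have s0 : 0 <= \sum_j (d j)^-1 by apply: sumr_ge0 => j _; rewrite invr_ge0 ltW.
exists (1 + \sum_j (d j)^-1)^-1; first by rewrite invr_gt0 ltr_wpDr.
move=> j; rewrite invf_ple ?posrE ?ltr_wpDr //.
rewrite (bigD1 j) //= addrCA lerDl addr_ge0 // sumr_ge0 // => i _; by rewrite invr_ge0 ltW.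
Qed.

Lemma C1_strict_mx n p (f : 'rV[R]_n -> 'rV[R]_p) (U : set 'rV[R]_n) x0 : open U -> U x0 ->
  Ck 1 U f -> forall e : R, 0 < e ->
  exists2 d : R, 0 < d & forall x y, `|x - x0| < d -> `|y - x0| < d ->
    `|f y - f x - (y - x) *m jacob f x0| <= e * `|y - x|.
Proof.
move=> oU Ux0 Cf e e0.
have /choice[d Hd] : forall j : 'I_p, exists d : R, 0 < d /\ forall x y, `|x - x0| < d -> `|y - x0| < d ->
    `|f y 0 j - f x 0 j - \sum_i (y - x) 0 i * 'D_(delta_mx 0 i) (fun z => f z 0 j) x0| <= e * `|y - x|.
  move=> j; have [d d0 H] := C1_strict oU Ux0 ((Ck_mxP _ _ oU).1 Cf 0 j) e0.
  by exists d.
have [r r0 Hr] : exists2 r : R, 0 < r & forall j, r <= d j.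
  by apply: finite_min_pos => j; have [] := Hd j.
exists r => // x y hx hy; apply: mx_norm_le => [|i j]; first by rewrite mulr_ge0 // ltW.
rewrite ord1 !mxE; have [d0 H] := Hd j.
have := H x y (lt_le_trans hx (Hr j)) (lt_le_trans hy (Hr j)).
congr (`|_ - _| <= _); apply: eq_bigr => k _; rewrite !mxE; congr (_ * _).
by apply: esym; apply: derive_coord; exact: (Ck_derivable Cf).
Qed.

(** A minimum of |G z - x| over a small closed ball is a zero, since a Newton
    step from a minimum would halve the distance. *)
Lemma local_surjection n (G : 'rV[R]_n -> 'rV[R]_n) (U : set 'rV[R]_n) z0 : open U -> U z0 ->
  Ck 1 U G -> jacob G z0 \in unitmx -> forall d : R, 0 < d ->
  exists2 r : R, 0 < r & forall x, `|x - G z0| < r -> exists z, [/\ U z, `|z - z0| < d & G z = x].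
Proof.
move=> oU Uz0 CG uJ d d0.
set J := jacob G z0; set c := n%:R * `|invmx J| + 1.
have c0 : 0 < c by rewrite ltr_wpDl ?mulr_ge0.
have bJ (w : 'rV[R]_n) : `|w *m invmx J| <= c * `|w|.
  apply: le_trans (mx_norm_mul _ _) _; rewrite mulrAC ler_wpM2r // /c lerDl //.
have e0 : 0 < (2 * c)^-1 by rewrite invr_gt0 mulr_gt0.
have [d1 d10 H1] := C1_strict_mx oU Uz0 CG e0.
have [d2 d20 H2] := open_cball oU Uz0.
have [d3 d30 [h1 h2 h3]] : exists2 d3 : R, 0 < d3 & [/\ d3 < d, d3 < d1 & d3 <= d2].
  exists (Num.min d (Num.min d1 d2) / 2); first by rewrite divr_gt0 // !lt_min d0 d10.
  set r := Num.min _ _; have r0 : 0 < r by rewrite !lt_min d0 d10.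
  have : r <= d /\ r <= d1 /\ r <= d2 by rewrite /r !ge_min !lexx /= !orbT.
  by move=> [? [? ?]]; split; lra.
set r := d3 / (8 * c).
have r0 : 0 < r by rewrite divr_gt0 // mulr_gt0.
exists r => // x xr.
have K (z z' : 'rV[R]_n) : cball z0 d3 z -> cball z0 d3 z' -> `|z - z'| <= 2 * c * `|G z - G z'|.
  move=> /le_lt_trans/(_ h2) hz /le_lt_trans/(_ h2) hz'.
  have := H1 _ _ hz' hz; rewrite -/J => H.
  have : `|(z - z')| <= c * (`|G z - G z'| + (2 * c)^-1 * `|z - z'|).
    rewrite -{1}[z - z'](mulmxK uJ); apply: le_trans (bJ _) _; rewrite ler_wpM2l ?(ltW c0) //.
    rewrite -[(z - z') *m J](subKr (G z - G z')); apply: le_trans (ler_normB _ _) _.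
    by rewrite lerD2l.
  rewrite mulrDr mulrA invfM mulrCA mulfV ?gt_eqF // mulr1.
  set a := `|z - z'|; set b := `|G z - G z'|; lra.
have cK : compact (cball z0 d3).
  by apply: (@cball_compact R n).
have [||z Kz Hz] := @EVT_min_rV R n (fun z => `|G z - x|) (cball z0 d3) _ cK.
- by exists z0; rewrite /cball /= subrr normr0 ltW.
- apply: continuous_in_subspaceT => z; rewrite inE => Kz.
  apply: (@continuous_comp _ _ _ (fun z => G z - x) (fun w => `|w|)); last exact: norm_continuous.
  apply: (@continuousB R 'rV[R]_n 'rV[R]_n G (cst x) z); last exact: cst_continuous.
  by apply: (Ck_continuous CG); apply: H2; exact: le_trans Kz h3.
rewrite inE in Kz.
have Kz0 : cball z0 d3 z0 by rewrite /cball /= subrr normr0 ltW.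
have m1 : `|G z - x| < r by apply: le_lt_trans (Hz z0 _) _; rewrite ?inE // distrC.
have m0 : `|x - G z0| < r by [].
have cr : c * r = d3 / 8 by rewrite /r; field; rewrite gt_eqF.
have zz : `|z - z0| <= d3 / 2.
  apply: le_trans (K _ _ Kz Kz0) _.
  have : `|G z - G z0| <= r + r.
    by rewrite -(subrKA x) (le_trans (ler_normD _ _)) // lerD // ltW.
  move/(ler_wpM2l (ltW c0)); rewrite mulrDr cr -mulrA; lra.
(* a Newton step from the minimum z *)
set T := z - (G z - x) *m invmx J.
have Tz : `|T - z| <= c * `|G z - x| by rewrite /T addrAC subrr add0r normrN.
have KT : cball z0 d3 T.
  rewrite /cball /= -(subrKA z) (le_trans (ler_normD _ _)) //.
  have := ler_wpM2l (ltW c0) (ltW m1); rewrite cr; lra.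
have GT : `|G T - x| <= 2^-1 * `|G z - x|.
  have := H1 z T (le_lt_trans Kz h2) (le_lt_trans KT h2); rewrite -/J.
  have -> : (T - z) *m J = - (G z - x) by rewrite /T addrAC subrr add0r mulNmx mulmxKV.
  rewrite opprK addrA subrK => /le_trans; apply.
  apply: le_trans (ler_wpM2l (ltW e0) Tz) _.
  by rewrite mulrA invfM mulfVK ?gt_eqF.
have := Hz T; rewrite inE => /(_ KT) /le_trans/(_ GT) H.
have E : G z - x = 0.
  apply/eqP; rewrite -normr_le0; move: H; set a := `|_|; lra.
exists z; split.
- by apply: H2; exact: le_trans Kz h3.
- by apply: le_lt_trans zz _; lra.
by apply/eqP; rewrite -subr_eq0 E.
Qed.

Section Spherical.
Variables (m : nat) (g : 'rV[R]_m -> 'M[R]_m) (U : set 'rV[R]_m) (phi : 'rV[R]_m -> 'rV[R]_(1 + m)).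
Hypotheses (oU : open U) (sg : smooth U g) (ug : forall y, U y -> g y \in unitmx)
  (sph : spherical_on g phi U).

Let sphi : smooth U phi. Proof. by case: sph. Qed.

Lemma jacob_mul_tr y : U y -> jacob phi y *m (jacob phi y)^T = g y.
Proof.
move=> Uy; have [_ _ s2] := sph; apply: gdot_inj => u v; rewrite -s2 //.
rewrite !(jacobE _ oU Uy (sphi 1%N)) gdotE dotE trmx_mul.
by rewrite !mulmxA.
Qed.

(** A left inverse of the differential of [phi], depending smoothly on the
    point. *)
Definition pseudo y : 'M[R]_(1 + m, m) := (jacob phi y)^T *m invmx (g y).

Lemma jacob_pseudo y : U y -> jacob phi y *m pseudo y = 1%:M.
Proof. by move=> Uy; rewrite /pseudo mulmxA jacob_mul_tr // mulmxV // ug. Qed.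

Lemma Ck_pseudo k : Ck k U pseudo.
Proof.
apply: Ck_mulmx => //; last by apply: Ck_invmx => //; exact: sg.
apply/(Ck_mxP _ _ oU) => i j.
by apply: Ck_ext ((Ck_mxP _ _ oU).1 (Ck_jacob oU (sphi k.+1)) j i) => // x _; rewrite [RHS]mxE.
Qed.

(** Strict differentiability and the left inverse of the differential. *)
Lemma locally_injective y0 : U y0 -> exists d K : R, [/\ 0 < d, 0 <= K,
  forall y, `|y - y0| < d -> U y & forall y y', `|y - y0| < d -> `|y' - y0| < d ->
    `|y - y'| <= K * `|phi y - phi y'| ].
Proof.
move=> Uy0; set P := pseudo y0.
set c := (1 + m)%:R * `|P| + 1.
have c0 : 0 < c by rewrite ltr_wpDl ?mulr_ge0.
have bP (w : 'rV[R]_(1 + m)) : `|w *m P| <= c * `|w|.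
  apply: le_trans (mx_norm_mul _ _) _; rewrite mulrAC ler_wpM2r // /c lerDl //.
have e0 : 0 < (2 * c)^-1 by rewrite invr_gt0 mulr_gt0.
have [d1 d10 H1] := C1_strict_mx oU Uy0 (sphi 1%N) e0.
have [d2 d20 H2] := open_cball oU Uy0.
exists (Num.min d1 d2), (2 * c); split.
- by rewrite lt_min d10.
- by rewrite mulr_ge0 // ltW.
- by move=> y; rewrite lt_min => /andP[_ /ltW]; exact: H2.
move=> z z'; rewrite !lt_min => /andP[hz _] /andP[hz' _].
have H := H1 _ _ hz' hz.
have : `|(z - z')| <= c * (`|phi z - phi z'| + (2 * c)^-1 * `|z - z'|).
  rewrite -{1}[z - z']mulmx1 -(jacob_pseudo Uy0) mulmxA; apply: le_trans (bP _) _; rewrite ler_wpM2l ?(ltW c0) //.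
  rewrite -[(z - z') *m _](subKr (phi z - phi z')); apply: le_trans (ler_normB _ _) _.
  by rewrite lerD2l.
rewrite mulrDr mulrA invfM mulrCA mulfV ?gt_eqF // mulr1.
set a := `|z - z'|; set b := `|phi z - phi z'|; lra.
Qed.

(** A continuous map is smooth if its composite with an immersion is: its
    difference quotients are obtained from those of [K] through the left inverse
    of the differential, and the resulting formula for the derivative can be
    differentiated again. *)
Lemma lift_smooth (V : normedModType R) (N : set V) (F : V -> 'rV[R]_m) (K : V -> 'rV[R]_(1 + m)) :
  open N -> (forall z, N z -> {for z, continuous F}) -> (forall z, N z -> U (F z)) ->
  (forall z, N z -> phi (F z) = K z) -> smooth N K ->
  smooth N F /\ forall z v, N z -> 'D_v K z = 'D_('D_v F z) phi (F z).
Proof.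
move=> oN cF UF FK sK.
have dF z v : N z -> is_derive z v F ('D_v K z *m pseudo (F z)).
  move=> Nz; set P := pseudo (F z); set J := jacob phi (F z).
  have JP : J *m P = 1%:M := jacob_pseudo (UF z Nz).
  set c := (1 + m)%:R * `|P| + 1.
  have c0 : 0 < c by rewrite ltr_wpDl ?mulr_ge0.
  have bP (w : 'rV[R]_(1 + m)) : `|w *m P| <= c * `|w|.
    apply: le_trans (mx_norm_mul _ _) _; rewrite mulrAC ler_wpM2r // /c lerDl //.
  have dK : is_derive z v K ('D_v K z) by apply/derivableP; exact: smooth_derivable sK Nz.
  have /is_deriveP cK := dK; apply/is_deriveP/cvgrPdist_le => e e0.
  set B := c * (`|'D_v K z| + 1).
  have B0 : 0 < B by rewrite mulr_gt0 // ltr_wpDl.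
  set e1 := Num.min (2 * c)^-1 (e / 2 / (c * (2 * B))).
  have cB : 0 < c * (2 * B) by rewrite !mulr_gt0.
  have e10 : 0 < e1 by rewrite /e1 lt_min invr_gt0 (mulr_gt0 _ c0) // divr_gt0 // divr_gt0.
  have [d d0 Hd] := C1_strict_mx oU (UF z Nz) (sphi 1%N) e10.
  have cline : (fun h : R => F (h *: v + z)) @ (0 : R)^' --> F z.
    have cl : {for (0 : R), continuous (fun h : R => F (h *: v + z))}.
      apply: (@continuous_comp _ _ _ (fun h : R => h *: v + z) F).
        by apply: cvgD; [apply: cvgZl; exact: cvg_id|exact: cvg_cst].
      by rewrite /= scale0r add0r; exact: cF.
    have := cl; rewrite /prop_for /continuous_at scale0r add0r => H.
    by apply: cvg_trans H; apply: cvg_app; exact: cvg_within.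
  have nN : \forall h \near (0 : R)^', N (h *: v + z).
    apply: cvg_within.
    have cl : {for (0 : R), continuous (fun h : R => h *: v + z)}.
      by apply: cvgD; [apply: cvgZl; exact: cvg_id|exact: cvg_cst].
    have := cl; rewrite /prop_for /continuous_at scale0r add0r; apply.
    exact: open_nbhs_nbhs.
  have e20 : 0 < Num.min 1 (e / 2 / c) by rewrite lt_min ltr01 !divr_gt0.
  have /cvgrPdist_le/(_ _ e20) cK1 := cK.
  near=> h.
  have h0 : h != 0 by near: h; exact: nbhs_dnbhs_neq.
  have hN : N (h *: v + z) by near: h; exact: nN.
  have b1 : `|F (h *: v + z) - F z| < d.
    by rewrite distrC; near: h; exact: ((cvgrPdist_lt _ _).1 cline).
  have b0 : `|F z - F z| < d by rewrite subrr normr0.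
  set q := h^-1 *: (F (h *: v + z) - F z).
  set k := h^-1 *: (K (h *: v + z) - K z).
  have Hk1 : `|'D_v K z - h^-1 *: (K (h *: v + z) - K z)| <= Num.min 1 (e / 2 / c).
    near: h; exact: cK1.
  have := Hk1; rewrite le_min => /andP[Hk2 Hk3].
  have kB : `|k *m P| <= B.
    apply: le_trans (bP _) _; rewrite /B ler_wpM2l ?(ltW c0) //.
    rewrite -[k](subKr ('D_v K z)); apply: le_trans (ler_normB _ _) _; by rewrite lerD2l.
  have H := Hd _ _ b0 b1.
  have Hq : `|k - q *m J| <= e1 * `|q|.
    have -> : k - q *m J = h^-1 *: (phi (F (h *: v + z)) - phi (F z) - (F (h *: v + z) - F z) *m J).
      by rewrite !FK // scalerBr -scalemxAl.
    rewrite /q !normrZ mulrCA ler_wpM2l //.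
  have Hqk : `|k *m P - q| <= c * (e1 * `|q|).
    have -> : k *m P - q = (k - q *m J) *m P by rewrite mulmxBl -mulmxA JP mulmx1.
    by apply: le_trans (bP _) _; rewrite ler_wpM2l ?(ltW c0).
  have e1c : e1 <= (2 * c)^-1 by rewrite /e1 ge_min lexx.
  have e1e : e1 <= e / 2 / (c * (2 * B)) by rewrite /e1 ge_min lexx orbT.
  have qB : `|q| <= 2 * B.
    have h1 : c * (e1 * `|q|) <= 2^-1 * `|q|.
      rewrite mulrA ler_wpM2r //; apply: le_trans (ler_wpM2l (ltW c0) e1c) _.
      by rewrite invfM mulrCA mulfV ?gt_eqF // mulr1.
    have : `|q| <= `|k *m P| + `|k *m P - q|.
      by rewrite -{1}[q](subKr (k *m P)); exact: ler_normB.
    move: Hqk h1 kB; set a := `|q|; set b := `|k *m P - q|; set b' := `|k *m P|; clear; lra.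
  rewrite -(subrKA (k *m P)) (splitr e); apply: le_trans (ler_normD _ _) _; apply: lerD.
    rewrite -mulmxBl; apply: le_trans (bP _) _; apply: le_trans (ler_wpM2l (ltW c0) Hk3) _.
    by rewrite mulrCA mulfV ?gt_eqF // mulr1.
  apply: le_trans Hqk _; rewrite mulrCA.
  apply: (@le_trans _ _ (e1 * (c * (2 * B)))).
    by rewrite ler_wpM2l ?(ltW e10) // ler_wpM2l ?(ltW c0).
  by apply: le_trans (ler_wpM2r _ e1e) _; rewrite ?mulfVK ?gt_eqF ?mulr_gt0 // mulr_ge0 ?(ltW c0) // mulr_ge0 // ltW.
have sF : smooth N F.
  elim=> [|k IH]; first by split.
  split; first exact: cF.
  split=> [z v Nz|v]; first by have [] := dF z v Nz.
  apply: (@Ck_ext _ _ _ _ _ (fun z => 'D_v K z *m (pseudo \o F) z)) => //.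
    by move=> z Nz; have [_ ->] := dF z v Nz.
  apply: Ck_mulmx => //; first exact: smoothD sK k.
  exact: (Ck_comp oN oU UF IH (Ck_pseudo k)).
split=> // z v Nz.
have dFz : is_derive z v F ('D_v F z) by apply/derivableP; exact: smooth_derivable sF Nz.
have [_ <-] := is_derive_chain_mx oU (UF z Nz) (sphi 1%N) dFz.
apply: near_eq_derive; apply: (open_near oN Nz) => z' Nz'.
by rewrite /= FK.
Unshelve. all: by end_near. Qed.

(** The radial extension (t, y) |-> t phi(y) is a map between spaces of the same
    dimension with invertible differential at (1, y0), so it covers a
    neighbourhood of phi(y0); lengths show that points of the sphere come from t
    = 1. *)
Lemma spherical_surjective y0 : U y0 -> forall d : R, 0 < d ->
  exists2 r : R, 0 < r & forall x, dot x x = 1 -> `|x - phi y0| < r ->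
     exists y, [/\ U y, `|y - y0| < d & phi y = x].
Proof.
move=> Uy0 d d0; have [_ s1 s2] := sph.
pose V := [set z : 'rV[R]_(1 + m) | U (rsubmx z)].
pose G (z : 'rV[R]_(1 + m)) := z 0 0 *: phi (rsubmx z).
pose z0 : 'rV[R]_(1 + m) := row_mx 1 y0.
have srs (T : set 'rV[R]_(1 + m)) : open T -> smooth T (@rsubmx R 1 1 m).
  move=> oT; apply/(smooth_mxP _ oT) => i j k.
  by apply: Ck_ext (smooth_coord (rshift 1 j) oT k) => // x _; rewrite !mxE ord1.
have oV : open V.
  rewrite (_ : V = [set z | setT z /\ U (rsubmx z)]); last by apply/seteqP; split => // z [].
  apply: (open_preim_for openT oU) => z _; exact: smooth_continuous (srs _ openT) _.
have Vz0 : V z0 by rewrite /V /= /z0 row_mxKr.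
have Cr k : Ck k V (phi \o (@rsubmx R 1 1 m)).
  by apply: (Ck_comp oV oU _ (srs _ oV k) (sphi k)).
have CG : Ck 1 V G.
  apply/(Ck_mxP _ _ oV) => i j.
  apply: (@Ck_ext _ _ _ _ _ (fun z : 'rV[R]_(1 + m) => z 0 0 * (phi \o (@rsubmx R 1 1 m)) z i j)) => //.
    by move=> z _; rewrite /G mxE.
  apply: Ck_mul => //; first exact: smooth_coord.
  exact: (Ck_mxP _ _ oV).1 (Cr 1%N) i j.
have JG : jacob G z0 = frame phi y0.
  apply/row_matrixP => i; rewrite rowK.
  have := Ck1_derive_sum_mx (delta_mx 0 i) oV Vz0 CG; move=> _.
  have rs : is_derive z0 (delta_mx 0 i) (@rsubmx R 1 1 m) (rsubmx (delta_mx 0 i)).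
    have lin := @is_derive_mulmx R 'rV[R]_(1 + m) 1 (1 + m) m id (fun=> rsubmx 1%:M) z0 (delta_mx 0 i) _ _
       (is_derive_id _ _) (is_derive_cst _ _ _).
    rewrite mulmx0 addr0 in lin.
    have E (z : 'rV[R]_(1 + m)) : z *m rsubmx 1%:M = rsubmx z.
      by rewrite -[in RHS](mulmx1 z) -{2}[1%:M]hsubmxK mul_mx_row row_mxKr.
    rewrite E in lin; move: lin; congr (is_derive _ _ _ _); apply/funext => z; exact: E.
  have r0 : rsubmx z0 = y0 by rewrite /z0 row_mxKr.
  have dr : is_derive z0 (delta_mx 0 i) (phi \o (@rsubmx R 1 1 m)) ('D_(rsubmx (delta_mx 0 i)) phi y0).
    have Ur : U (rsubmx z0) by rewrite r0.
    by have := is_derive_chain_mx oU Ur (sphi 1%N) rs; rewrite r0.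
  have dc : is_derive z0 (delta_mx 0 i) (fun z : 'rV[R]_(1 + m) => z 0 0) ((delta_mx 0 i : 'rV[R]_(1 + m)) 0 0).
    exact: is_derive_coord 0 0 (is_derive_id _ _).
  have [_ ->] := is_derive_scalemx dc dr.
  have z00 : z0 0 0 = 1.
    have e0 : (0 : 'I_(1 + m)) = lshift m (0 : 'I_1) by apply: val_inj.
    by rewrite /z0 e0 row_mxEl mxE.
  rewrite z00 scale1r /= r0 /frame.
  case: (split_ordP i) => i' ->.
    rewrite rowKu ord1 row_id.
    have -> : rsubmx (delta_mx 0 (lshift m 0) : 'rV[R]_(1 + m)) = 0.
      by apply/rowP => k; rewrite !mxE eq_rlshift andbF.
    rewrite (jacobE _ oU Uy0 (sphi 1%N)) mul0mx addr0 mxE.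
    by rewrite (_ : 0 == _) ?scale1r.
  rewrite rowKd rowK.
  have -> : rsubmx (delta_mx 0 (rshift 1 i') : 'rV[R]_(1 + m)) = delta_mx 0 i'.
    by apply/rowP => k; rewrite !mxE eq_rshift.
  have e0 : ((0 : 'I_(1 + m)) == rshift 1 i') = false by apply/negbTE/negP => /eqP/(congr1 val).
  by rewrite mxE e0 andbF scale0r add0r.
have Gz0 : G z0 = phi y0.
  have e0 : (0 : 'I_(1 + m)) = lshift m (0 : 'I_1) by apply: val_inj.
  by rewrite /G /z0 row_mxKr e0 row_mxEl mxE scale1r.
have uJ : jacob G z0 \in unitmx by rewrite JG; have := frame_unit oU ug sph Uy0.
have d10 : 0 < Num.min d 1 by rewrite lt_min d0 ltr01.
have [r r0 Hr] := local_surjection oV Vz0 CG uJ d10.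
exists r => // x x1 xr; have [|z [Vz zd Gz]] := Hr x; first by rewrite Gz0.
move: zd; rewrite lt_min => /andP[zd z1].
have zz : z 0 0 = 1.
  have : z 0 0 * z 0 0 = 1 by rewrite -x1 -Gz /G dotZl dotZr s1 // mulr1.
  have := ler_coord (z - z0) 0 0; move/le_lt_trans => /(_ _ z1).
  have -> : (z - z0) 0 0 = z 0 0 - 1.
    rewrite !mxE; case: splitP => [j _|j /=]; first by rewrite ord1 mxE.
    by [].
  rewrite ltr_norml => /andP[a b]; set c := z 0 0 in a b *; nra.
exists (rsubmx z); split => //.
  apply: le_lt_trans zd; apply: mx_norm_le => // i j; rewrite ord1.
  have := ler_coord (z - z0) 0 (rshift 1 j); rewrite !mxE.
  case: splitP => [k /= E|k /= /eqP]; first by have := ltn_ord k; rewrite -E.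
  by rewrite eqSS => /eqP/val_inj ->.
by rewrite -Gz /G zz scale1r.
Qed.
End Spherical.
End Immersion.

(** * Geodesics and great circles *)

Section Geodesics.
Variable (R : realType).

(** The great circle through [P] with velocity [Q] when these are orthonormal. *)
Definition trig n (P Q : 'rV[R]_n) (s : R) : 'rV[R]_n := cos s *: P + sin s *: Q.

Lemma is_derive_trig n (P Q : 'rV[R]_n) s v : is_derive s v (trig P Q) (v *: trig Q (- P) s).
Proof.
have dc : is_derive s v (fun y : R => cos y) (- sin s * v).
  have := @is_derive_comp1 R R cos (- sin s) id s v (is_derive_cos _) (@derivable_id _ _ _ _).
  by rewrite derive_id.
have ds : is_derive s v (fun y : R => sin y) (cos s * v).
  have := @is_derive_comp1 R R sin (cos s) id s v (is_derive_sin _) (@derivable_id _ _ _ _).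
  by rewrite derive_id.
have d1 := is_derive_scalemx dc (is_derive_cst P s v).
have d2 := is_derive_scalemx ds (is_derive_cst Q s v).
have := is_deriveD d1 d2; rewrite !scaler0 !addr0.
by congr (is_derive _ _ _ _); rewrite /trig scalerDr !scalerA scalerN addrC [v * cos _]mulrC mulNr scaleNr -scalerN [v * _]mulrC scalerN.
Qed.

Lemma smooth_trig n (P Q : 'rV[R]_n) (U : set R) : open U -> smooth U (trig P Q).
Proof.
move=> oU k; elim: k P Q => [|k IH] P Q.
  split; last by [].
  move=> s _; apply: differentiable_continuous; apply/derivable1_diffP.
  by case: (is_derive_trig P Q s 1).
split=> [s _|].
  apply: differentiable_continuous; apply/derivable1_diffP.
  by case: (is_derive_trig P Q s 1).
split=> [s v _|v]; first by case: (is_derive_trig P Q s v).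
apply: (@Ck_ext _ _ _ k U (trig (v *: Q) (v *: - P))) (IH _ _) => // s _.
by case: (is_derive_trig P Q s v) => _ ->; rewrite /trig scalerDr !scalerA ![v * _]mulrC.
Qed.

Lemma zero_derive_cst n (f : R -> 'rV[R]_n) (t d : R) : 
  (forall s, `|s - t| < d -> is_derive s 1 f 0) -> forall s, `|s - t| < d -> f s = f t.
Proof.
move=> H s sd.
have := @mean_value_le R 1 n (fun u => f (u + t)) (fun=> 0) (s - t) 0.
rewrite add0r subrK mul0r => K.
apply/eqP; rewrite -subr_eq0 -normr_le0; apply: K => [u /andP[u0 u1]|u _]; last by rewrite normr0.
have h : `|u * (s - t) + t - t| < d.
  by rewrite addrK normrM; apply: le_lt_trans sd; rewrite ler_piMl // ger0_norm.
have := @is_derive_line R R 'rV[R]_n f t 1 (u * (s - t)).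
have hid : derivable f (t + u * (s - t) *: 1) 1 by rewrite [_ *: 1]mulr1 addrC; case: (H _ h).
move=> /(_ hid).
have -> : t + u * (s - t) *: 1 = u * (s - t) + t by rewrite [_ *: 1]mulr1 addrC.
case: (H _ h) => _ ->.
by congr (is_derive _ _ _ _); apply/funext => r; rewrite [_ *: 1]mulr1 addrC.
Qed.

(** Rotating (c, c') backwards by the angle s gives constants. *)
Lemma harmonic n (c c1 : R -> 'rV[R]_n) (t : R) :
  (\forall s \near t, is_derive (s : R) (1 : R) c (c1 s) /\ is_derive (s : R) (1 : R) c1 (- c s)) ->
  exists P Q, \forall s \near t, c s = trig P Q s /\ c1 s = trig Q (- P) s.
Proof.
move=> /nbhs_ballP[d /= d0 H].
pose P s := cos s *: c s - sin s *: c1 s; pose Q s := sin s *: c s + cos s *: c1 s.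
have Hd s : `|s - t| < d -> is_derive s 1 c (c1 s) /\ is_derive s 1 c1 (- c s).
  by move=> sd; apply: H; rewrite /ball /= distrC.
have dP s : `|s - t| < d -> is_derive s 1 P 0.
  move=> /Hd[h1 h2].
  have := is_deriveB (is_derive_scalemx (is_derive_cos s) h1) (is_derive_scalemx (is_derive_sin s) h2).
  congr (is_derive _ _ _ _); rewrite scalerN scaleNr; apply/rowP => i; rewrite !mxE; ring.
have dQ s : `|s - t| < d -> is_derive s 1 Q 0.
  move=> /Hd[h1 h2].
  have := is_deriveD (is_derive_scalemx (is_derive_sin s) h1) (is_derive_scalemx (is_derive_cos s) h2).
  congr (is_derive _ _ _ _); rewrite scalerN scaleNr; apply/rowP => i; rewrite !mxE; ring.
exists (P t), (Q t); apply/nbhs_ballP; exists d => //= s; rewrite /ball /= distrC => sd.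
rewrite -(zero_derive_cst dP sd) -(zero_derive_cst dQ sd) /P /Q /trig.
have cs := cos2sin2 s.
split; apply/rowP => i; rewrite !mxE; ring: cs.
Qed.

Lemma trig_orthonormal n (P Q : 'rV[R]_n) s : dot (trig P Q s) (trig P Q s) = 1 ->
  dot (trig Q (- P) s) (trig Q (- P) s) = 1 -> dot (trig P Q s) (trig Q (- P) s) = 0 ->
  [/\ dot P P = 1, dot Q Q = 1 & dot P Q = 0].
Proof.
move=> h1 h2 h3.
have cs := cos2sin2 s.
have EP : P = cos s *: trig P Q s - sin s *: trig Q (- P) s.
  apply/rowP => i; rewrite /trig !mxE; ring: cs.
have EQ : Q = sin s *: trig P Q s + cos s *: trig Q (- P) s.
  apply/rowP => i; rewrite /trig !mxE; ring: cs.
move: h1 h2 h3 EP EQ; move: (trig P Q s) (trig Q (- P) s) => c c1 h1 h2 h3 -> ->.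
rewrite !(dotDl, dotDr, dotNl, dotNr, dotZl, dotZr) (dotC c1 c) h1 h2 h3.
by split; ring: cs.
Qed.

Section Chart.
Variables (m : nat) (g : 'rV[R]_m -> 'M[R]_m) (U : set 'rV[R]_m) (phi : 'rV[R]_m -> 'rV[R]_(1 + m)).
Hypotheses (oU : open U) (sg : smooth U g) (symg : forall y, U y -> (g y)^T = g y)
  (ug : forall y, U y -> g y \in unitmx) (sph : spherical_on g phi U).

Let sphi : smooth U phi. Proof. by case: sph. Qed.

(** The covariant acceleration of the curve [x]. *)
Definition geodesic_lhs (x : R -> 'rV[R]_m) (t : R) : 'rV[R]_m :=
  derive1 (derive1 x) t + \row_k (\sum_(p < m) \sum_(q < m) christoffel g k p q (x t)
              * derive1 x t 0 p * derive1 x t 0 q).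

(** Acceleration in the ambient space splits into the covariant acceleration,
    tangent to the sphere, and the centripetal term. *)
Lemma accel (x : R -> 'rV[R]_m) (t : R) :
  (\forall s \near t, derivable x s 1) -> derivable (derive1 x) t 1 -> U (x t) ->
  (\forall s \near t, is_derive (s : R) (1 : R) (phi \o x) (derive1 x s *m jacob phi (x s))) /\
  is_derive t 1 (fun s => derive1 x s *m jacob phi (x s))
    (- gdot (g (x t)) (derive1 x t) (derive1 x t) *: phi (x t) + geodesic_lhs x t *m jacob phi (x t)).
Proof.
move=> dx dx1 Ut.
have cx : {for t, continuous x}.
  apply: differentiable_continuous; apply/derivable1_diffP; exact: nbhs_singleton dx.
have nU : \forall s \near t, U (x s) by apply: cx; exact: open_nbhs_nbhs.
have d1 s : derivable x s 1 -> is_derive s 1 x (derive1 x s).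
  by move=> h; rewrite derive1E; exact/derivableP.
split.
  near=> s.
  have Us : U (x s) by near: s.
  have dxs : derivable x s 1 by near: s.
  have := is_derive_chain_mx oU Us (sphi 1%N) (d1 _ dxs).
  by rewrite (jacobE _ oU Us (sphi 1%N)).
have dxt : is_derive t 1 x (derive1 x t) by apply: d1; exact: nbhs_singleton dx.
have df := is_derive_chain_mx oU Ut (smooth_frame oU sph 1%N) dxt.
have [_ Eg] := gauss_formula oU symg ug sph (derive1 x t) Ut.
rewrite Eg {Eg} in df.
set B : 'M[R]_(m, 1 + m) := row_mx 0 1%:M.
have EB (v : 'rV[R]_m) y : v *m jacob phi y = v *m B *m frame phi y.
  by rewrite /B mul_mx_row mulmx0 mulmx1 /frame mul_row_col mul0mx add0r.
have dxx : is_derive t 1 (derive1 x) (derive1 (derive1 x) t) by rewrite [X in is_derive _ _ _ X]derive1E; exact/derivableP.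
have := is_derive_mulmx (is_derive_mulmx dxx (is_derive_cst B t 1)) df.
rewrite mulmx0 addr0.
rewrite (_ : (fun s => derive1 x s *m jacob phi (x s)) = (fun s => derive1 x s *m B *m (frame phi \o x) s)); last first.
  by apply/funext => s; rewrite EB.
congr (is_derive _ _ _ _).
rewrite /geodesic_lhs mulmxDl addrCA EB; congr (_ + _).
set v := derive1 x t; set y := x t.
have -> : v *m B *m (Adir (sysmx g) v y *m frame phi y) =
  row_mx (- gdot (g y) v v)%:M (\row_k (\sum_(p < m) \sum_(q < m) christoffel g k p q y * v 0 p * v 0 q)) *m frame phi y.
  rewrite mulmxA; congr (_ *m _).
  rewrite /B mul_mx_row mulmx0 mulmx1 /Adir mulmx_sumr.
  under eq_bigr do rewrite -scalemxAr /sysmx mul_row_block !mul0mx !add0r scale_row_mx.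
  rewrite -[RHS]hsubmxK row_mxKl row_mxKr -[LHS]hsubmxK; congr (row_mx _ _).
    rewrite linear_sum /=; apply/rowP => i; rewrite ord1 !mxE summxE eqxx mulr1n /gdot -sumrN.
    apply: eq_bigr => p _; rewrite row_mxKl !mxE mulr_sumr -sumrN; apply: eq_bigr => q _.
    rewrite !mxE; ring.
  rewrite linear_sum /=; apply/rowP => i; rewrite !mxE summxE.
  apply: eq_bigr => p _; rewrite row_mxKr !mxE mulr_sumr; apply: eq_bigr => q _.
  rewrite !mxE; ring.
by rewrite /frame mul_row_col mul_scalar_mx.
Unshelve. all: by end_near. Qed.

(** For a unit speed geodesic the acceleration formula reads c'' = - c. *)
Lemma geodesic_trig (x : R -> 'rV[R]_m) (t : R) :
  (\forall s \near t, [/\ U (x s), derivable x s 1, derivable (derive1 x) s 1, geodesic_lhs x s = 0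
      & gdot (g (x s)) (derive1 x s) (derive1 x s) = 1]) ->
  exists P Q, [/\ dot P P = 1, dot Q Q = 1, dot P Q = 0 & \forall s \near t, phi (x s) = trig P Q s].
Proof.
move=> H.
have [P [Q HPQ]] : exists P Q, \forall s \near t, (phi \o x) s = trig P Q s /\
    derive1 x s *m jacob phi (x s) = trig Q (- P) s.
  apply: harmonic; near=> s.
  have Hs : \forall u \near s, [/\ U (x u), derivable x u 1, derivable (derive1 x) u 1, geodesic_lhs x u = 0
      & gdot (g (x u)) (derive1 x u) (derive1 x u) = 1] by near: s; exact: nbhs_interior H.
  have [Us d1 d2 gl sp] := nbhs_singleton Hs.
  have [A B] := @accel x s (filterS (fun u (h : [/\ _, _, _, _ & _]) => let: And5 _ a _ _ _ := h in a) Hs) d2 Us.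
  split; first exact: nbhs_singleton A.
  by move: B; rewrite gl mul0mx addr0 sp scaleN1r.
have [Ut d1 d2 gl sp] := nbhs_singleton H.
have [E1 E2] := nbhs_singleton HPQ.
have [_ s1 s2] := sph.
have [p1 p2 p3] : [/\ dot P P = 1, dot Q Q = 1 & dot P Q = 0].
  apply: (@trig_orthonormal _ _ _ t).
  - by rewrite -E1 /= s1.
  - by rewrite -E2 -(jacobE _ oU Ut (sphi 1%N)) s2.
  - rewrite -E1 -E2 -(jacobE _ oU Ut (sphi 1%N)) dotC; exact: (spherical_tangent oU sph).
by exists P, Q; split => //; apply: filterS HPQ => s [].
Unshelve. all: by end_near. Qed.

(** By [lift_smooth] the curve is as smooth as its image; comparing c'' = - c
    with the acceleration formula and projecting to the tangent space leaves the
    geodesic equation. *)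
Lemma trig_geodesic (x : R -> 'rV[R]_m) P Q (t : R) : dot P P = 1 -> dot Q Q = 1 -> dot P Q = 0 ->
  (\forall s \near t, [/\ U (x s), {for s, continuous x} & phi (x s) = trig P Q s]) ->
  [/\ \forall s \near t, derivable x s 1, derivable (derive1 x) t 1 & geodesic_lhs x t = 0].
Proof.
move=> hP hQ hPQ /nbhs_ballP[d /= d0 H].
set N := ball t d.
have oN : open N by exact: ball_open.
have Nt : N t by exact: ballxx.
have [sx Dx] := @lift_smooth R m g U phi oU sg ug sph R N x (trig P Q) oN
  (fun s Ns => let: And3 _ a _ := H s Ns in a) (fun s Ns => let: And3 a _ _ := H s Ns in a)
  (fun s Ns => let: And3 _ _ a := H s Ns in a) (smooth_trig P Q oN).
have D1 : derive1 x = 'D_1 x by apply/funext => s; rewrite derive1E.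
have dx : \forall s \near t, derivable x s 1.
  by apply: (open_near oN Nt) => s Ns; exact: smooth_derivable sx Ns.
have dx1 : derivable (derive1 x) t 1 by rewrite D1; exact: smooth_derivable (smoothD _ sx) Nt.
split => //.
have [Ut _ Et] := H _ Nt.
have [A B] := accel dx dx1 Ut.
have [_ s1 s2] := sph.
have dtr (p q : 'rV[R]_(1 + m)) (s : R) : is_derive s 1 (trig p q) (trig q (- p) s).
  by have := is_derive_trig p q s 1; rewrite scale1r.
have E1 : \forall s \near t, derive1 x s *m jacob phi (x s) = trig Q (- P) s.
  apply: (open_near oN Nt) => s Ns; have [Us _ _] := H _ Ns.
  rewrite -(jacobE _ oU Us (sphi 1%N)) D1 -Dx //.
  by have [_ ->] := dtr P Q s.
have sp : gdot (g (x t)) (derive1 x t) (derive1 x t) = 1.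
  rewrite -s2 // !(jacobE _ oU Ut (sphi 1%N)) (nbhs_singleton E1).
  rewrite /trig !(dotDl, dotDr, dotZl, dotZr, dotNl, dotNr) [dot Q P]dotC hP hQ hPQ.
  have cs := cos2sin2 t; ring: cs.
have := B; rewrite sp scaleN1r => -[_].
have [_ E2] := dtr Q (- P) t.
have -> : 'D_1 (fun s => derive1 x s *m jacob phi (x s)) t = 'D_1 (trig Q (- P)) t.
  exact: near_eq_derive.
rewrite E2 => E3.
have E4 : trig (- P) (- Q) t = - phi (x t) by rewrite Et /trig !scalerN opprD.
have : geodesic_lhs x t *m jacob phi (x t) = 0.
  by apply: (@addrI _ (- phi (x t))); rewrite -E3 E4 addr0.
move/(congr1 (fun M => M *m pseudo g phi (x t))).
by rewrite -mulmxA (jacob_pseudo oU ug sph) // mulmx1 mul0mx.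
Qed.
End Chart.
End Geodesics.

(** * Local isometries and rigidity *)

Section Atlas.
Variable (R : realType).

Lemma nearP (T : topologicalType) (x : T) (P : set T) :
  nbhs x P -> exists A : set T, [/\ open A, A x & forall y, A y -> P y].
Proof. by rewrite nbhsE => -[A [oA Ax] AP]; exists A. Qed.

Lemma near_comp (T T' : topologicalType) (f : T -> T') (x : T) (P : T' -> Prop) :
  {for x, continuous f} -> (\forall y \near f x, P y) -> \forall z \near x, P (f z).
Proof. by move=> cf H; exact: cf. Qed.

(** The conditions on a Riemannian manifold that concern single charts.  They
    pass to open submanifolds and suffice for all local arguments. *)
Definition charted m (M : atlas_space R m) : Prop :=
  [/\ forall x : M, exists i, cdom i x,
      forall i : cindex M,
        [/\ open (cdom i),
            forall x, cdom i x -> {for x, continuous (chart i)},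
            {in cdom i &, injective (chart i)}
          & forall A, open A -> A `<=` cdom i -> open (chart i @` A)]
    & forall i : cindex M,
        [/\ smooth (cimage i) (metric i),
            forall y, cimage i y -> (metric i y)^T = metric i y
          & forall y u, cimage i y -> u != 0 -> 0 < gdot (metric i y) u u]].

Lemma riemannian_charted m (M : atlas_space R m) : riemannian M -> charted M.
Proof. by case=> _ ? ? ? _. Qed.

(** In every chart around [p], [s] is given near [p] by a spherical map.  The
    germ formulation frees all later statements from domains. *)
Definition spherical_at m (M : atlas_space R m) (s : M -> 'rV[R]_(1 + m)) (p : M) : Prop :=
  forall j, cdom j p -> exists (U : set 'rV[R]_m) (phi : 'rV[R]_m -> 'rV[R]_(1 + m)),
    [/\ open U, U (chart j p), U `<=` cimage j, spherical_on (metric j) phi U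
      & \forall x \near p, s x = phi (chart j x)].

Section OneChart.
Variables (m : nat) (M : atlas_space R m).
Hypothesis cM : charted M.

Lemma near_cdom j (p : M) : cdom j p -> \forall x \near p, cdom j x.
Proof. by case: cM => _ /(_ j)[oc _ _ _] _ cp; exact: open_nbhs_nbhs. Qed.

Lemma chart_continuous j (p : M) : cdom j p -> {for p, continuous (chart j)}.
Proof. by case: cM => _ /(_ j)[_ cc _ _] _; exact: cc. Qed.

Lemma chart_inj j (x y : M) : cdom j x -> cdom j y -> chart j x = chart j y -> x = y.
Proof. by case: cM => _ /(_ j)[_ _ ci _] _ cx cy; apply: ci; rewrite inE. Qed.

Lemma open_cimage (j : cindex M) : open (cimage j).
Proof. by case: cM => _ /(_ j)[oc _ _ co] _; exact: co. Qed.

Lemma chart_nbhs j (p : M) (A : set M) : cdom j p -> nbhs p A ->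
  nbhs (chart j p) (chart j @` (A `&` cdom j)).
Proof.
move=> cp /nearP[B [oB Bp BA]]; case: cM => _ /(_ j)[oc _ _ co] _.
have : open (chart j @` (B `&` cdom j)) by apply: co; [exact: openI|move=> x []].
move=> o; have : nbhs (chart j p) (chart j @` (B `&` cdom j)).
  by apply: open_nbhs_nbhs; split => //; exists p.
by apply: filterS => y [x [/BA Ax cx] <-]; exists x.
Qed.

Lemma readE n j (h : M -> 'rV[R]_n) (x : M) : cdom j x -> read j h (chart j x) = h x.
Proof.
move=> cx; rewrite /read; case: xgetP => [y _ [z [cz /= /(chart_inj cz cx) ->]] //|].
by move=> /(_ (h x)); case; exists x.
Qed.

Lemma metric_unit j y : cimage j y -> @metric R m M j y \in unitmx.
Proof. by case: cM => _ _ /(_ j)[_ _ pos] cy; apply: posdef_unit => u; exact: pos. Qed.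

Lemma metric_smooth (j : cindex M) U : U `<=` cimage j -> smooth U (metric j).
Proof. by case: cM => _ _ /(_ j)[sm _ _] sU; exact: smooth_sub sU sm. Qed.

Lemma metric_facts (j : cindex M) : [/\ open (cimage j), smooth (cimage j) (metric j),
  forall y, cimage j y -> (metric j y)^T = metric j y &
  forall y u, cimage j y -> u != 0 -> 0 < gdot (metric j y) u u].
Proof. by have [_ _ /(_ j)[? ? ?]] := cM; split => //; exact: open_cimage. Qed.
End OneChart.

Lemma spherical_on_sub m (g : 'rV[R]_m -> 'M[R]_m) phi U U' :
  U' `<=` U -> spherical_on g phi U -> spherical_on g phi U'.
Proof.
by move=> sU [h1 h2 h3]; split=> [|y /sU|y /sU]; [exact: smooth_sub sU h1|exact: h2|exact: h3].
Qed.

(** The coordinate expression of an isometric immersion composed with a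
    spherical map is again spherical, by the chain rule. *)
Lemma spherical_at_pull m (M N : atlas_space R m) (f : M -> N) (p : M)
    (i : cindex N) W phi : charted M -> charted N -> isometric_immersion f -> cdom i (f p) ->
  open W -> W (chart i (f p)) -> spherical_on (metric i) phi W ->
  spherical_at (fun x => phi (chart i (f x))) p.
Proof.
move=> cM cN [cf If] ci oW Wp sph j cj.
have [] := If j i; set U0 := _ @` _; set T := read _ _ => sT mT.
have Te x : cdom j x -> T (chart j x) = chart i (f x) by move=> cx; rewrite /T readE.
have oc : open (cdom j `&` f @^-1` cdom i).
  case: cM => _ /(_ j)[oj _ _ _] _; case: cN => _ /(_ i)[oi _ _ _] _.
  by apply: openI => //; apply: open_comp => // x _; exact: cf.
have oU0 : open U0 by case: cM => _ /(_ j)[_ _ _ co] _; apply: co => // x [].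
have oU : open [set y | U0 y /\ W (T y)].
  by apply: (open_preim_for oU0 oW) => y Uy; exact: smooth_continuous sT Uy.
exists [set y | U0 y /\ W (T y)], (phi \o T); split => //.
- by split; [exists p|rewrite Te].
- by move=> y [[x [cx _] <-] _]; exists x.
- have [s0 s1 s2] := sph.
  have sT' : smooth [set y | U0 y /\ W (T y)] T by apply: smooth_sub sT => y [].
  split=> [|y [_ Wy]|y [Uy Wy] u v]; [|exact: s1|].
    by apply: (smooth_comp oU oW _ sT' s0) => y [].
  have dT w : is_derive y w T ('D_w T y) by apply/derivableP; exact: smooth_derivable sT Uy.
  have [_ ->] := is_derive_chain_mx oW Wy (s0 1%N) (dT u).
  have [_ ->] := is_derive_chain_mx oW Wy (s0 1%N) (dT v).
  by rewrite s2 // mT.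
by near=> x; rewrite /= Te //; near: x; exact: near_cdom.
Unshelve. all: by end_near. Qed.

Section Spherical.
Variables (m : nat) (M : atlas_space R m).
Hypothesis cM : charted M.

Lemma spherical_at_ext (s s' : M -> 'rV[R]_(1 + m)) p :
  (\forall x \near p, s x = s' x) -> spherical_at s p -> spherical_at s' p.
Proof.
move=> H Hs j /Hs[U [phi [oU Up Uc sph E]]]; exists U, phi; split => //.
by near=> x; rewrite -(near H x) // (near E x).
Unshelve. all: by end_near. Qed.

Lemma spherical_at_unique (s1 s2 : M -> 'rV[R]_(1 + m)) p : spherical_at s1 p -> spherical_at s2 p ->
  exists C, C *m C^T = 1%:M /\ \forall x \near p, s2 x = s1 x *m C.
Proof.
have [cov _ _] := cM; have [j cj] := cov p.
move=> /(_ j cj)[U1 [phi1 [oU1 U1p c1 sph1 E1]]] /(_ j cj)[U2 [phi2 [oU2 U2p c2 sph2 E2]]].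
have [oc sm sy po] := metric_facts cM j.
have [|||C [CC H]] := spherical_unique oc sm sy po (openI oU1 oU2) (conj U1p U2p) (phi1 := phi1) (phi2 := phi2).
- by move=> y [/c1].
- by apply: spherical_on_sub sph1 => y [].
- by apply: spherical_on_sub sph2 => y [].
exists C; split => //.
have H' := near_comp (chart_continuous cM cj) H.
by near=> x; rewrite (near E1 x) // (near E2 x) // (near H' x).
Unshelve. all: by end_near. Qed.

Lemma spherical_on_orth (g : 'rV[R]_m -> 'M[R]_m) phi U (C : 'M[R]_(1 + m)) : open U -> C *m C^T = 1%:M ->
  spherical_on g phi U -> spherical_on g (fun y => phi y *m C) U.
Proof.
move=> oU CC [s0 s1 s2]; split=> [|y Uy|y Uy u v]; first exact: smooth_mulmxr.
  by rewrite dot_orth // s1.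
have D w : 'D_w (fun y => phi y *m C) y = 'D_w phi y *m C.
  have dphi : is_derive y w phi ('D_w phi y) by apply/derivableP; exact: smooth_derivable s0 Uy.
  have [_ ->] := is_derive_mulmx dphi (is_derive_cst C y w).
  by rewrite mulmx0 addr0.
by rewrite !D dot_orth // s2.
Qed.

Lemma spherical_at_orth (s : M -> 'rV[R]_(1 + m)) p (C : 'M[R]_(1 + m)) : C *m C^T = 1%:M ->
  spherical_at s p -> spherical_at (fun x => s x *m C) p.
Proof.
move=> CC Hs j /Hs[U [phi [oU Up Uc sph E]]]; exists U, (fun y => phi y *m C); split => //.
  exact: spherical_on_orth.
by near=> x; rewrite (near E x).
Unshelve. all: by end_near. Qed.

Lemma spherical_at_unit (s : M -> 'rV[R]_(1 + m)) p : spherical_at s p -> 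
  \forall x \near p, dot (s x) (s x) = 1 /\ {for x, continuous s}.
Proof.
have [cov _ _] := cM; have [j cj] := cov p.
move=> /(_ j cj)[U [phi [oU Up c sph E]]]; have [s0 s1 _] := sph.
have nU : \forall x \near p, U (chart j x) by apply: (chart_continuous cM cj); exact: open_nbhs_nbhs.
have E' := nbhs_interior E; have nc := near_cdom cM cj.
near=> x.
have Ux : U (chart j x) by near: x.
split; first by rewrite (near E x) // s1.
have Ex : \forall y \near x, s y = phi (chart j y) by near: x.
have cx : {for x, continuous (phi \o chart j)}.
  apply: continuous_comp; last exact: smooth_continuous s0 Ux.
  by apply: (chart_continuous cM); near: x.
rewrite /prop_for /continuous_at (nbhs_singleton Ex).
apply: cvg_trans cx; apply: near_eq_cvg; apply: filterS Ex => y ->; by [].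
Unshelve. all: by end_near. Qed.

Lemma spherical_at_inj (s : M -> 'rV[R]_(1 + m)) p : spherical_at s p -> 
  exists A, nbhs p A /\ forall x y, A x -> A y -> s x = s y -> x = y.
Proof.
have [cov _ _] := cM; have [j cj] := cov p.
move=> /(_ j cj)[U [phi [oU Up c sph E]]].
have ug y (Uy : U y) := metric_unit cM (c y Uy).
have [d [K [d0 K0 dU H]]] := locally_injective oU ug sph Up.
have nd : \forall x \near p, `|chart j x - chart j p| < d.
  have /cvgrPdist_lt/(_ _ d0) := chart_continuous cM cj.
  by apply: filterS => x; rewrite distrC.
exists [set x | [/\ cdom j x, s x = phi (chart j x) & `|chart j x - chart j p| < d]]; split.
  have nc := near_cdom cM cj; near=> x; split; by near: x.
move=> x y [cx Ex dx] [cy Ey dy]; rewrite Ex Ey => e.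
apply: (chart_inj cM cx cy); have := H _ _ dx dy; rewrite e subrr normr0 mulr0 normr_le0 subr_eq0.
by move/eqP.
Unshelve. all: by end_near. Qed.

Lemma spherical_at_surj (s : M -> 'rV[R]_(1 + m)) p A : spherical_at s p -> nbhs p A ->
  exists2 r : R, 0 < r & forall y, dot y y = 1 -> `|y - s p| < r -> exists2 x, A x & s x = y.
Proof.
have [cov _ _] := cM; have [j cj] := cov p.
move=> /(_ j cj)[U [phi [oU Up c sph E]]] nA.
have ug y (Uy : U y) := metric_unit cM (c y Uy).
have EA : nbhs p ([set x | s x = phi (chart j x)] `&` A) by apply: filterI.
have /nearP[B [oB Bp HB]] := chart_nbhs cM cj EA.
have [d d0 Hd] := open_cball oB Bp.
have [r r0 H] := spherical_surjective oU ug sph Up d0.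
exists r => // y y1; rewrite (nbhs_singleton E) => yr; have [z [Uz zd <-]] := H y y1 yr.
have [x [[Ex Ax] cx] Ez] := HB z (Hd z (ltW zd)).
by exists x => //; rewrite Ex Ez.
Qed.
End Spherical.

(** A spherical map in one chart is spherical in all, as transition maps are
    isometric: this is [spherical_at_pull] for the identity. *)
Lemma spherical_at_chart m (M : atlas_space R m) i (p : M) W phi : riemannian M ->  cdom i p ->
  open W -> W (chart i p) -> spherical_on (metric i) phi W -> spherical_at (phi \o chart i) p.
Proof.
move=> rM; have cM := riemannian_charted rM; have [_ _ _ _ im] := rM.
by apply: (@spherical_at_pull m M M id).
Qed.

(** Curvature 1 makes the Gauss system integrable in a chart around [p]. *)
Lemma spherical_at_ex m (M : atlas_space R m) (p : M) : kflat 1 M -> exists s, spherical_at s p.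
Proof.
move=> [rM sec]; have cM := riemannian_charted rM; have [cov _ _] := cM; have [i ci] := cov p.
have cp : cimage i (chart i p) by exists p.
have [oc sm sy po] := metric_facts cM i.
have curv y : cimage i y -> curv_const (metric i) y.
  by move=> cy; apply: (curv_const_of_sectional oc sm sy po cy) => u v; exact: sec.
have [W [phi H]] := spherical_exists oc sm sy po cp curv.
exists (phi \o chart i); case: H => oW Wp _ sph; exact: spherical_at_chart rM ci oW Wp sph.
Qed.

Lemma spherical_at_near m (M : atlas_space R m) (s : M -> 'rV[R]_(1 + m)) p : riemannian M ->
  spherical_at s p -> \forall q \near p, spherical_at s q.
Proof.
move=> rM; have cM := riemannian_charted rM; have [cov _ _] := cM; have [j cj] := cov p.
move=> /(_ j cj)[U [phi [oU Up c sph E]]].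
have nU : \forall x \near p, U (chart j x) by apply: (chart_continuous cM cj); exact: open_nbhs_nbhs.
have E' := nbhs_interior E; have nc := near_cdom cM cj.
near=> x.
have Ex : \forall y \near x, s y = phi (chart j y) by near: x.
have : spherical_at (phi \o chart j) x.
  by apply: (spherical_at_chart rM _ oU _ sph); near: x.
by apply: spherical_at_ext; apply: filterS Ex => y ->.
Unshelve. all: by end_near. Qed.

(** The germ of an isometric immersion at [p], without reference to charts or
    derivatives; this is adequate when the target has spherical maps at all
    points. *)
Definition local_isometry_at m (M N : atlas_space R m) (f : M -> N) (p : M) : Prop :=
  (\forall x \near p, {for x, continuous f}) /\
  forall s, spherical_at s (f p) -> spherical_at (s \o f) p.

Lemma local_isometry_continuous m (M N : atlas_space R m) (f : M -> N) (p : M) :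
  local_isometry_at f p -> {for p, continuous f}.
Proof. by case=> /nbhs_singleton. Qed.

(** One spherical map at [f p] suffices, because the others differ from it by
    orthogonal matrices. *)
Lemma local_isometry_ex m (M N : atlas_space R m) (f : M -> N) (p : M) s : charted N ->
  (\forall x \near p, {for x, continuous f}) -> spherical_at s (f p) -> spherical_at (s \o f) p ->
  local_isometry_at f p.
Proof.
move=> cN cf s1 s2; split => // s' s1'.
have [C [CC E]] := spherical_at_unique cN s1 s1'.
have E' := near_comp (nbhs_singleton cf) E.
by apply: spherical_at_ext (spherical_at_orth CC s2); apply: filterS E' => x /= ->.
Qed.

Lemma local_isometry_ext m (M N : atlas_space R m) (f g : M -> N) (p : M) :
  (\forall x \near p, f x = g x) -> local_isometry_at f p -> local_isometry_at g p.
Proof.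
move=> E [cf sf]; split.
  have E' := nbhs_interior E; near=> x.
  have Ex : \forall y \near x, f y = g y by near: x.
  have cx : {for x, continuous f} by near: x.
  rewrite /prop_for /continuous_at -(nbhs_singleton Ex); apply: cvg_trans cx.
  exact: near_eq_cvg.
move=> s; rewrite -(nbhs_singleton E) => /sf; apply: spherical_at_ext.
by apply: filterS E => x /= ->.
Unshelve. all: by end_near. Qed.

Lemma local_isometry_comp m (M N K : atlas_space R m) (f : M -> N) (g : N -> K) (p : M) :
  local_isometry_at f p -> local_isometry_at g (f p) -> local_isometry_at (g \o f) p.
Proof.
move=> Lf [cg sg]; have [cf sf] := Lf; split; last by move=> s /sg/sf.
have cg' := near_comp (nbhs_singleton cf) cg.
by near=> x; apply: continuous_comp; near: x.
Unshelve. all: by end_near. Qed.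

Lemma isometric_immersion_local m (M N : atlas_space R m) (f : M -> N) (p : M) :
  charted M -> charted N -> isometric_immersion f -> local_isometry_at f p.
Proof.
move=> cM cN If; have [cf _] := If; split; first by apply: nearW => x; exact: cf.
move=> s; have [cov _ _] := cN; have [i ci] := cov (f p).
move=> /(_ i ci)[U [phi [oU Up c sph E]]].
have := spherical_at_pull cM cN If ci oU Up sph.
by apply: spherical_at_ext; have := near_comp (cf p) E; apply: filterS => x /= ->.
Qed.

(** Conversely such maps are smooth and isometric in charts: the chart
    expression F satisfies phi o F = phi' with spherical phi and phi', so that
    it is smooth by [lift_smooth], and derivatives have the right inner
    products. *)
Lemma local_isometry_immersion m (M N : atlas_space R m) (f : M -> N) :
  charted M -> charted N -> (forall q : N, exists s, spherical_at s q) ->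
  (forall p, local_isometry_at f p) -> isometric_immersion f.
Proof.
move=> cM cN ex Lf; have cf p := local_isometry_continuous (Lf p).
split=> // i j U F.
have Fe x : cdom i x -> F (chart i x) = chart j (f x) by move=> cx; rewrite /F readE.
have key y : U y -> exists (N0 : set 'rV[R]_m) , [/\ open N0, N0 y, smooth N0 F &
    forall z, N0 z -> forall u v, gdot (metric j (F z)) ('D_u F z) ('D_v F z) = gdot (metric i z) u v].
  move=> [x [cx cfx] <-] {y}.
  have [s Hs] := ex (f x); have [_ /(_ _ Hs) Hsf] := Lf x.
  have [V [phi [oV Vp Vc sph E]]] := Hs j cfx.
  have [V' [phi' [oV' Vp' Vc' sph' E']]] := Hsf i cx.
  have nf : \forall x' \near x, [/\ cdom j (f x'), V (chart j (f x')) & s (f x') = phi (chart j (f x'))].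
    apply: (near_comp (cf x) (P := fun q => [/\ cdom j q, V (chart j q) & s q = phi (chart j q)])); near=> q; split; near: q => //; first exact: (near_cdom cN).
    apply: (chart_continuous cN cfx); exact: open_nbhs_nbhs.
  have nV : \forall x' \near x, V' (chart i x') by apply: (chart_continuous cM cx); exact: open_nbhs_nbhs.
  have : nbhs x (([set x' | [/\ cdom j (f x'), V (chart j (f x')) & s (f x') = phi (chart j (f x'))]]
    `&` [set x' | V' (chart i x')]) `&` [set x' | (s \o f) x' = phi' (chart i x')]) by apply: filterI => //; apply: filterI.
  move=> /(chart_nbhs cM cx)/nearP[N0 [oN Nx HN]].
  exists N0.
  have ug y (Vy : V y) := metric_unit cN (Vc y Vy).
  have [||||sF DF] := @lift_smooth R m (metric j) V phi oV (metric_smooth cN Vc) ug sph _ N0 F phi' oN.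
  - move=> z Nz; have [x' [[[[h1 h2 h3] h4] h5] cx'] Ez] := HN z Nz.
    move=> A; rewrite -Ez /= Fe // => nA.
    have nA' : nbhs x' (fun x => A (chart j (f x))).
      have := @continuous_comp _ _ _ f (chart j) x' (cf x') (chart_continuous cN h1); exact.
    have := chart_nbhs cM cx' nA'; apply: filterS => w [x2 [Ax2 cx2] <-].
    by rewrite /= Fe.
  - by move=> z Nz; have [x' [[[[h1 h2 h3] h4] h5] cx'] <-] := HN z Nz; rewrite Fe.
  - move=> z Nz; have [x' [[[[h1 h2 h3] h4] h5] cx'] <-] := HN z Nz; rewrite Fe //.
    by rewrite -h3 -h5.
  - have [sp' _ _] := sph'; apply: smooth_sub sp'.
    by move=> z Nz; have [x' [[[[h1 h2 h3] h4] h5] cx'] <-] := HN z Nz.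
  split=> // z Nz u v.
  have [x' [[[[h1 h2 h3] h4] h5] cx'] Ez] := HN z Nz.
  have [_ _ s2] := sph; have [_ _ s2'] := sph'.
  rewrite -s2' -?Ez // Ez -s2; last by rewrite -Ez Fe.
  exact: (congr2 (@dot R _) (esym (DF z u Nz)) (esym (DF z v Nz))).
split; last by move=> y u v /key[N0 [_ Ny _ H]]; exact: H.
by apply: smooth_local => y /key[N0 [oN Ny sF _]]; exists N0, F.
Unshelve. all: by end_near. Qed.

(** The value and the derivatives of a spherical map at one point span the whole
    space, and [C] fixes them. *)
Lemma spherical_orth_id m (g : 'rV[R]_m -> 'M[R]_m) U phi y0 (C : 'M[R]_(1 + m)) : open U ->
  (forall y, U y -> g y \in unitmx) -> spherical_on g phi U -> U y0 ->
  (\forall y \near y0, phi y = phi y *m C) -> C = 1%:M.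
Proof.
move=> oU ug sph Uy E; have [s0 s1 s2] := sph.
have D w : 'D_w phi y0 = 'D_w phi y0 *m C.
  have dphi : is_derive y0 w phi ('D_w phi y0) by apply/derivableP; exact: smooth_derivable s0 Uy.
  have [_ E1] := is_derive_mulmx dphi (is_derive_cst C y0 w).
  rewrite mulmx0 addr0 in E1; rewrite -E1; exact: near_eq_derive.
have F : frame phi y0 = frame phi y0 *m C.
  rewrite /frame mul_col_mx -(nbhs_singleton E); congr (col_mx _ _).
  by apply/row_matrixP => i; rewrite row_mul rowK -D.
have uF := frame_unit oU ug sph Uy.
by move/(congr1 (mulmx (invmx (frame phi y0)))): F; rewrite mulmxA mulVmx // mul1mx => <-.
Qed.

Definition agree_near (T : topologicalType) (S : Type) (f g : T -> S) (x : T) : Prop := \forall y \near x, f y = g y.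

(** Local isometries that agree near points arbitrarily close to [p] agree near
    [p]: after composition with a spherical map they differ by an orthogonal
    matrix, which is the identity wherever the maps agree on an open set. *)
Lemma local_rigidity m (M N : atlas_space R m) (f g : M -> N) (p : M) :
  charted M -> charted N -> hausdorff_space N -> (forall q : N, exists s, spherical_at s q) ->
  local_isometry_at f p -> local_isometry_at g p ->
  closure (agree_near f g) p -> agree_near f g p.
Proof.
move=> cM cN hN ex Lf Lg clp.
have cf := local_isometry_continuous Lf; have cg := local_isometry_continuous Lg.
have fg : f p = g p.
  apply: hN => A B nA nB.
  have [x [/nbhs_singleton/= e [Ax Bx]]] := clp _ (filterI (near_comp cf nA) (near_comp cg nB)).
  by exists (f x); split => //; rewrite e.
have [s Hs] := ex (f p).
have [_ /(_ _ Hs) Hf] := Lf; have [_ sg] := Lg; rewrite -fg in sg; have Hg := sg _ Hs.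
have [C [CC E]] := spherical_at_unique cM Hf Hg.
have [cov _ _] := cM; have [j cj] := cov p.
have [U [phi [oU Up c sph E1]]] := Hf j cj.
have nU : \forall x \near p, U (chart j x) by apply: (chart_continuous cM cj); exact: open_nbhs_nbhs.
have C1 : C = 1%:M.
  have [x [ax [Ux [Ex [E1x cx]]]]] := clp _ (filterI nU (filterI (nbhs_interior E) (filterI (nbhs_interior E1) (near_cdom cM cj)))).
  apply: (spherical_orth_id oU (fun y Uy => metric_unit cM (c y Uy)) sph Ux).
  have : \forall y \near x, phi (chart j y) = phi (chart j y) *m C.
    have Ex' : \forall y \near x, (s \o g) y = (s \o f) y *m C := Ex.
    have E1x' : \forall y \near x, (s \o f) y = phi (chart j y) := E1x.
    near=> y; rewrite -(near E1x' y) // -(near Ex' y) //=.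
    by congr (s _); near: y.
  move=> /(chart_nbhs cM cx); apply: filterS => z [y [h _] <-]; exact: h.
have [A [nA iA]] := spherical_at_inj cN Hs.
have nf := near_comp cf nA; have nA' := nA; rewrite fg in nA'; have ng := near_comp cg nA'.
near=> x; apply: iA; [by near: x|by near: x|].
have -> : s (g x) = (s \o g) x by [].
by rewrite (near E x) // C1 mulmx1.
Unshelve. all: by end_near. Qed.

(** Induction over the interval [0, 1]: a property that holds at 0, propagates a
    little to the right, and passes to limits from the left holds throughout. *)
Lemma real_ind (P : R -> Prop) : P 0 ->
  (forall t, 0 <= t < 1 -> P t -> exists2 e : R, 0 < e & forall s, t < s < t + e -> s <= 1 -> P s) ->
  (forall t, 0 < t <= 1 -> (forall s, 0 <= s < t -> P s) -> P t) -> forall t, 0 <= t <= 1 -> P t.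
Proof.
move=> P0 Po Pc.
pose S := [set t : R | 0 <= t <= 1 /\ forall s, 0 <= s <= t -> P s].
have S0 : S 0 by split=> [|s]; rewrite ?lexx ?ler01 // => s0; have -> : s = 0 by apply/le_anti; rewrite andbC.
have bS : has_ubound S by exists 1 => t [/andP[]].
have sS : has_sup S by split; [exists 0|].
set b := sup S.
have b0 : 0 <= b by apply: ub_le_sup.
have b1 : b <= 1 by apply: ge_sup; [exists 0|move=> t [/andP[]]].
have lt_b s : 0 <= s < b -> P s.
  move=> /andP[s0 sb]; have [t [t01 Ht] st] := sup_gt (ex_intro _ 0 S0) sb.
  by apply: Ht; rewrite s0 ltW.
have Pb : P b.
  move: b0; rewrite le_eqVlt => /orP[/eqP <- //|b0]; by apply: Pc => //; rewrite b0.
have b_eq : b = 1.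
  apply/eqP; rewrite eq_le b1 /= leNgt; apply/negP => b1'.
  have [|e e0 He] := Po b _ Pb; first by rewrite b0.
  pose c := Num.min 1 (b + e / 2).
  have e2 : 0 < e / 2 by rewrite divr_gt0.
  have cb : b < c by rewrite /c lt_min b1' ltrDl.
  have : c <= b; last by rewrite leNgt cb.
  apply: ub_le_sup => //; split; first by rewrite (le_trans b0 (ltW cb)) /c ge_min lexx.
  move=> s /andP[s0 sc]; have [sb|bs] := ltP s b; first by apply: lt_b; rewrite s0.
  move: bs; rewrite le_eqVlt => /orP[/eqP <- //|bs].
  have [sc1 sc2] : s <= 1 /\ s <= b + e / 2 by move: sc; rewrite /c le_min => /andP.
  apply: He => //; rewrite bs /=; lra.
move=> t /andP[t0 t1]; have [tb|] := ltP t b; first by apply: lt_b; rewrite t0.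
by rewrite b_eq => h; have -> : t = b by apply/le_anti; rewrite b_eq t1 h.
Qed.

Lemma within_itv_near (T : topologicalType) (c : R -> T) t (A : set T) :
  {within `[0, 1], continuous c} -> 0 <= t <= 1 -> nbhs (c t) A ->
  exists2 e : R, 0 < e & forall s, 0 <= s <= 1 -> `|s - t| < e -> A (c s).
Proof.
move=> /subspace_continuousP H t01 nA.
have : within `[0, 1] (nbhs t) (fun s => A (c s)) by apply: H => //; rewrite /= in_itv.
rewrite /within /= => /nbhs_ballP[e /= e0 He]; exists e => // s s01 se.
by apply: He; rewrite /ball /= ?in_itv // distrC.
Qed.

(** Unique continuation.  The continuity of [c] is stated at the points of [0,
    1] only, as for the loops and paths in the definition of simple
    connectedness. *)
Lemma path_rigidity m (M N : atlas_space R m) (f g : M -> N) (c : R -> M) :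
  charted M -> charted N -> hausdorff_space N -> (forall q : N, exists s, spherical_at s q) ->
  (forall t (A : set M), 0 <= t <= 1 -> nbhs (c t) A -> exists2 e : R, 0 < e & forall s, 0 <= s <= 1 -> `|s - t| < e -> A (c s)) ->
  (forall t, 0 <= t <= 1 -> local_isometry_at f (c t) /\ local_isometry_at g (c t)) ->
  agree_near f g (c 0) -> agree_near f g (c 1).
Proof.
move=> cM cN hN ex cc L a0.
apply: (@real_ind (fun t => agree_near f g (c t))) => //; last by rewrite ler01 lexx.
  move=> t /andP[t0 t1] /nbhs_interior at0.
  have [|e e0 He] := cc t _ _ at0; first by rewrite t0 ltW.
  exists e => // s /andP[ts se] s1; apply: He; first by rewrite s1 andbT (le_trans t0) // ltW.
  rewrite ger0_norm ?subr_ge0 ?(ltW ts) //; lra.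
move=> t /andP[t0 t1] H; have t01 : 0 <= t <= 1 by rewrite (ltW t0).
have [Lf Lg] := L t t01.
apply: local_rigidity => // A nA; have [e e0 He] := cc t _ t01 nA.
pose s := Num.max 0 (t - e / 2).
have e2 : 0 < e / 2 by rewrite divr_gt0.
have st : s < t by rewrite /s gt_max t0 ltrBlDr ltrDl.
have s0 : 0 <= s by rewrite /s le_max lexx.
have se : t - e / 2 <= s by rewrite /s le_max lexx orbT.
exists (c s); split; first by apply: H; rewrite s0.
apply: He; first by rewrite s0 (le_trans (ltW st)).
rewrite distrC ger0_norm ?subr_ge0 ?(ltW st) //; lra.
Qed.
End Atlas.

(** * The round sphere and its open subsets *)

Section SubspaceTopology.
Variables (R : realType) (X : topologicalType) (A : set X).

Lemma set_val_continuous : continuous (@set_val X A).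
Proof. exact: initial_continuous. Qed.

Lemma continuous_set_type (T : topologicalType) (f : T -> A) t :
  {for t, continuous (set_val \o f)} -> {for t, continuous f}.
Proof.
move=> cf U [?/= [[W oW <-]]] /= Wsfz /filterS; apply; apply: cf.
exact: open_nbhs_nbhs.
Qed.

Lemma open_set_type (B : set A) : open B -> exists2 W, open W & B = set_val @^-1` W.
Proof. by case=> W oW <-; exists W. Qed.

Lemma hausdorff_set_type : hausdorff_space X -> hausdorff_space A.
Proof.
move=> hX p q cl; apply: val_inj; apply: hX => U V nU nV.
have [x [Ux Vx]] := cl _ _ (set_val_continuous nU) (set_val_continuous nV).
by exists (set_val x).
Qed.

Lemma nbhs_open_sub (p : A) (B : set A) : open A -> nbhs p B -> nbhs (set_val p) (set_val @` B).
Proof.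
move=> oA /nearP[V [oV Vp WB]]; have [W oW eV] := open_set_type oV.
rewrite eV in Vp WB; have {Vp} Wp : W (set_val p) := Vp.
have : nbhs (set_val p) (W `&` A).
  by apply: open_nbhs_nbhs; split; [exact: openI|split => //; exact/set_mem/valP].
apply: filterS => x [Wx Ax]; exists (exist _ x (mem_set Ax)) => //; exact: WB.
Qed.
End SubspaceTopology.

Lemma local_isometry_id (R : realType) m (M : atlas_space R m) (p : M) : local_isometry_at (@id M) p.
Proof. by split=> //; apply: nearW => x; exact: cvg_id. Qed.

Section Sphere.
Variables (R : realType) (m : nat).
Local Notation E := 'rV[R]_(1 + m).

(** The position vector of a point of the sphere. *)
Definition sv (x : sphere R m) : E := \val x.

Lemma sv_continuous : continuous sv. Proof. exact: set_val_continuous. Qed.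

Lemma sv_inj : injective sv. Proof. exact: val_inj. Qed.

Lemma sv1 x : dot (sv x) (sv x) = 1. Proof. exact: (set_mem (valP x)). Qed.

Lemma sv_neq0 x : sv x != 0. Proof. by rewrite -dot_gt0 sv1 ltr01. Qed.

Lemma continuous_sphere (T : topologicalType) (f : T -> sphere R m) t :
  {for t, continuous (sv \o f)} -> {for t, continuous f}.
Proof. exact: continuous_set_type. Qed.

Definition pole : E := delta_mx 0 0.

Lemma pole1 : dot pole pole = 1. Proof. by rewrite /pole dot_delta mxE !eqxx. Qed.

Definition mkS (y : E) : sphere R m :=
  match pselect (dot y y = 1) with
  | left H => exist _ y (mem_set (H : unit_sphere y))
  | right _ => exist _ pole (mem_set (pole1 : unit_sphere pole))
  end.

Lemma sv_mkS y : dot y y = 1 -> sv (mkS y) = y.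
Proof. by rewrite /mkS; case: pselect. Qed.

Definition nrE n (y : 'rV[R]_n) : 'rV[R]_n := (Num.sqrt (dot y y))^-1 *: y.

Lemma sqrt_dot_gt0 n (y : 'rV[R]_n) : y != 0 -> 0 < Num.sqrt (dot y y).
Proof. by move=> y0; rewrite sqrtr_gt0 dot_gt0. Qed.

Lemma nrE1 n (y : 'rV[R]_n) : y != 0 -> dot (nrE y) (nrE y) = 1.
Proof.
move=> y0; have s0 := sqrt_dot_gt0 y0; rewrite /nrE dotZl dotZr.
rewrite -[X in _ * (_ * X)]sqr_sqrtr ?dot_ge0 //; field; by rewrite gt_eqF.
Qed.

Lemma nrE_id n (y : 'rV[R]_n) : dot y y = 1 -> nrE y = y.
Proof. by move=> y1; rewrite /nrE y1 sqrtr1 invr1 scale1r. Qed.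

Lemma nrEZ n a (y : 'rV[R]_n) : 0 < a -> nrE (a *: y) = nrE y.
Proof.
move=> a0; rewrite /nrE dotZl dotZr mulrA -expr2 sqrtrM ?sqr_ge0 // sqrtr_sqr gtr0_norm //.
by rewrite invfM scalerA mulrAC mulVf ?gt_eqF // mul1r.
Qed.

(** Radial projection to the sphere.  Points of the sphere are handled through
    positive multiples of their position vectors, so that arcs and simplices
    become convex combinations. *)
Definition nr (y : E) : sphere R m := mkS (nrE y).

Lemma sv_nr y : y != 0 -> sv (nr y) = nrE y.
Proof. by move=> y0; rewrite sv_mkS // nrE1. Qed.

Lemma sv_nrP y : y != 0 -> exists2 a, 0 < a & sv (nr y) = a *: y.
Proof.
by move=> y0; exists (Num.sqrt (dot y y))^-1; [rewrite invr_gt0 sqrt_dot_gt0|rewrite sv_nr].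
Qed.

Lemma nr_sv x : nr (sv x) = x.
Proof. by apply: sv_inj; rewrite sv_nr ?sv_neq0 // nrE_id // sv1. Qed.

Lemma nrZ a y : 0 < a -> nr (a *: y) = nr y.
Proof. by move=> a0; rewrite /nr nrEZ. Qed.

Lemma nr_unit y : dot y y = 1 -> sv (nr y) = y.
Proof. by move=> y1; rewrite sv_nr ?nrE_id // -dot_gt0 y1. Qed.

Lemma dot_continuous (T : topologicalType) n (f g : T -> 'rV[R]_n) t :
  {for t, continuous f} -> {for t, continuous g} -> {for t, continuous (fun s => dot (f s) (g s))}.
Proof.
move=> cf cg; apply: cvg_sum_fin => i; apply: cvgM.
  exact: ((continuous_mxP f t).1 cf 0 i).
exact: ((continuous_mxP g t).1 cg 0 i).
Qed.

Lemma smooth_dot (V : normedModType R) n (U : set V) (f g : V -> 'rV[R]_n) : open U ->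
  smooth U f -> smooth U g -> smooth U (fun y => dot (f y) (g y)).
Proof. by move=> oU sf sg k; exact: Ck_dot. Qed.

Lemma smooth_nrE (V : normedModType R) n (U : set V) (f : V -> 'rV[R]_n) : open U ->
  smooth U f -> (forall y, U y -> f y != 0) -> smooth U (fun y => nrE (f y)).
Proof.
move=> oU sf f0; have sd := smooth_dot oU sf sf.
have sn : smooth U (fun y => (Num.sqrt (dot (f y) (f y)))^-1).
  move=> k; apply: Ck_inv => //; first by move=> y /f0 y0; rewrite gt_eqF // sqrt_dot_gt0.
  by apply: Ck_sqrt => // y /f0; rewrite dot_gt0.
move=> k; apply/(Ck_mxP _ _ oU) => i j.
apply: (@Ck_ext _ _ _ _ _ (fun y => (Num.sqrt (dot (f y) (f y)))^-1 * f y i j)) => //.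
  by move=> y _; rewrite /nrE /= mxE.
apply: Ck_mul => //; exact: (Ck_mxP _ _ oU).1 (sf k) i j.
Qed.

Lemma continuous_near_ext (T T' : topologicalType) (f g : T -> T') t :
  (\forall s \near t, f s = g s) -> {for t, continuous f} -> {for t, continuous g}.
Proof.
move=> e cf; rewrite /prop_for /continuous_at -(nbhs_singleton e).
by apply: cvg_trans cf; exact: near_eq_cvg.
Qed.

Lemma continuous_scale (T : topologicalType) n (a : T -> R) (f : T -> 'rV[R]_n) t :
  {for t, continuous a} -> {for t, continuous f} -> {for t, continuous (fun s => a s *: f s)}.
Proof. by move=> ca cf; exact: cvgZ. Qed.

Lemma continuous_inv_for (T : topologicalType) (a : T -> R) t : a t != 0 ->
  {for t, continuous a} -> {for t, continuous (fun s => (a s)^-1)}.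
Proof. by move=> a0 ca; exact: cvgV. Qed.

Lemma continuous_sub_for (T : topologicalType) (V : normedModType R) (a b : T -> V) t : 
  {for t, continuous a} -> {for t, continuous b} -> {for t, continuous (fun s => a s - b s)}.
Proof. by move=> ca cb; exact: cvgB. Qed.

Lemma continuous_add_for (T : topologicalType) (V : normedModType R) (a b : T -> V) t : 
  {for t, continuous a} -> {for t, continuous b} -> {for t, continuous (fun s => a s + b s)}.
Proof. by move=> ca cb; exact: cvgD. Qed.

Lemma continuous_mul_for (T : topologicalType) (a b : T -> R) t : 
  {for t, continuous a} -> {for t, continuous b} -> {for t, continuous (fun s => a s * b s)}.
Proof. by move=> ca cb; exact: cvgM. Qed.

Lemma nrE_continuous n (y : 'rV[R]_n) : y != 0 -> {for y, continuous (@nrE n)}.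
Proof.
move=> y0; apply: continuous_scale; last exact: cvg_id.
apply: (continuous_inv_for (a := fun z : 'rV[R]_n => Num.sqrt (dot z z))); first by rewrite gt_eqF // sqrt_dot_gt0.
apply: (@continuous_comp _ _ _ (fun z : 'rV[R]_n => dot z z) Num.sqrt); last exact: sqrt_continuous.
by apply: dot_continuous; exact: cvg_id.
Qed.

Lemma near_nonzero n (y : 'rV[R]_n) : y != 0 -> \forall z \near y, z != 0.
Proof.
move=> y0; have cD : {for y, continuous (fun z : 'rV[R]_n => dot z z)} by apply: dot_continuous; exact: cvg_id.
have : \forall z \near y, 0 < dot z z by apply: (cvgr_gt _ cD); rewrite dot_gt0.
by apply: filterS => z; rewrite dot_gt0.
Qed.

Lemma nr_continuous y : y != 0 -> {for y, continuous nr}.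
Proof.
move=> y0; apply: continuous_sphere.
apply: continuous_near_ext (nrE_continuous y0); apply: filterS (near_nonzero y0) => z z0 /=.
by rewrite sv_nr.
Qed.

Lemma hausdorff_sphere : hausdorff_space (sphere R m).
Proof. by apply: hausdorff_set_type; exact: norm_hausdorff. Qed.

Lemma compact_unit_sphere : compact (@unit_sphere R m).
Proof.
apply: (subclosed_compact _ (@cball_compact R _ 0 1)).
  rewrite (_ : @unit_sphere R m = (fun z : E => dot z z) @^-1` [set 1]) //.
  apply: closed_comp; last exact: closed_eq.
  by move=> y _; apply: dot_continuous; exact: cvg_id.
move=> y y1; rewrite /cball /= subr0; apply: mx_norm_le => // i j; rewrite ord1.
rewrite -(@ler_sqr _ _ 1) ?nnegrE // expr1n -y1 /dot (bigD1 j) //= -expr2 real_normK ?num_real //.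
by rewrite lerDl sumr_ge0 // => k _; rewrite -expr2 sqr_ge0.
Qed.

Lemma compact_sphere : compact [set: sphere R m].
Proof.
rewrite (_ : [set: _] = nr @` @unit_sphere R m); last first.
  by apply/seteqP; split=> // x _; exists (sv x); [exact: sv1|exact: nr_sv].
apply: continuous_compact compact_unit_sphere.
apply: continuous_in_subspaceT => y; rewrite inE => y1; apply: nr_continuous.
by rewrite -dot_gt0 y1.
Qed.

Local Notation eps b := ((-1) ^+ b : R).

Lemma eps_sqr (b : bool) : eps b * eps b = 1.
Proof. by case: b; rewrite ?expr1 ?expr0 ?mulrNN ?mulr1. Qed.

Lemma dot_row (a : R) (y : 'rV[R]_m) (a' : R) y' :
  dot (row_mx (a%:M : 'rV[R]_1) y) (row_mx (a'%:M : 'rV[R]_1) y') = a * a' + dot y y'.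
Proof.
rewrite /dot big_split_ord /= big_ord1; congr (_ + _).
  by rewrite !row_mxEl !mxE eqxx !mulr1n.
by apply: eq_bigr => i _; rewrite !row_mxEr.
Qed.

Lemma dotp1 (y : 'rV[R]_m) : 0 < dot y y + 1.
Proof. by rewrite ltr_wpDl ?dot_ge0. Qed.

Lemma stereo_inv1 b (y : 'rV[R]_m) : dot (stereo_inv b y) (stereo_inv b y) = 1.
Proof.
rewrite /stereo_inv dot_row dotZl dotZr; have p := dotp1 y.
transitivity ((eps b * eps b) * ((dot y y - 1) ^+ 2 / (dot y y + 1) ^+ 2) + 4 * dot y y / (dot y y + 1) ^+ 2).
  by field; rewrite gt_eqF.
by rewrite eps_sqr; field; rewrite gt_eqF.
Qed.

Lemma stereo_inv0 b (y : 'rV[R]_m) : stereo_inv b y 0 0 = eps b * (dot y y - 1) / (dot y y + 1).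
Proof.
have e0 : (0 : 'I_(1 + m)) = lshift m (0 : 'I_1) by apply: val_inj.
by rewrite /stereo_inv e0 row_mxEl mxE eqxx mulr1n.
Qed.

Lemma smooth_stereo_inv b (U : set 'rV[R]_m) : open U -> smooth U (@stereo_inv R m b).
Proof.
move=> oU; have sd := smooth_dot oU (smooth_id oU) (smooth_id oU).
have sp k : Ck k U (fun y : 'rV[R]_m => (dot y y + 1)^-1).
  apply: Ck_inv => //; first by move=> y _; rewrite gt_eqF // dotp1.
  by apply: Ck_add => //; exact: Ck_cst.
move=> k; apply/(Ck_mxP _ _ oU) => i j; rewrite ord1.
case: (split_ordP j) => j' ->.
  apply: (@Ck_ext _ _ _ _ _ (fun y : 'rV[R]_m => eps b * (dot y y - 1) * (dot y y + 1)^-1)) => //.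
    by move=> y _; rewrite /stereo_inv row_mxEl mxE ord1 eqxx mulr1n.
  apply: Ck_mul => //; apply: Ck_mul => //; first exact: Ck_cst.
  by apply: Ck_sub_fun => //; exact: Ck_cst.
apply: (@Ck_ext _ _ _ _ _ (fun y : 'rV[R]_m => 2 * (dot y y + 1)^-1 * y 0 j')) => //.
  by move=> y _; rewrite /stereo_inv row_mxEr !mxE.
apply: Ck_mul => //; last exact: smooth_coord.
by apply: Ck_mul => //; exact: Ck_cst.
Qed.

Lemma chart_stereo (b : bool) y : @cdom R m (sphere R m) b (mkS (stereo_inv b y)) /\
  @chart R m (sphere R m) b (mkS (stereo_inv b y)) = y.
Proof.
have p := dotp1 y.
rewrite /= -/(sv _) sv_mkS ?stereo_inv1 // stereo_inv0.
have D : 1 - eps b * (eps b * (dot y y - 1) / (dot y y + 1)) = 2 / (dot y y + 1).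
  rewrite !mulrA eps_sqr; field; by rewrite gt_eqF.
split.
  apply/negP => /eqP e; move: D; rewrite e eps_sqr subrr => /esym/eqP.
  by rewrite gt_eqF // divr_gt0.
rewrite D /stereo_inv row_mxKr scalerA mulVf ?scale1r //.
by rewrite gt_eqF // divr_gt0.
Qed.

Lemma stereo_chart (b : bool) (x : sphere R m) : @cdom R m (sphere R m) b x -> mkS (stereo_inv b (@chart R m (sphere R m) b x)) = x.
Proof.
move=> cx; apply: sv_inj; rewrite sv_mkS ?stereo_inv1 //.
have e2 := eps_sqr b.
have x1 := sv1 x; move: cx; rewrite /= -/(sv x) => cx.
rewrite -[sv x]hsubmxK; move: x1 cx; rewrite -{1 2 3}[sv x]hsubmxK.
set a := lsubmx (sv x) 0 0.
have -> : lsubmx (sv x) = a%:M by apply/rowP => i; rewrite ord1 [RHS]mxE eqxx mulr1n.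
set w := rsubmx (sv x).
have e0 : (0 : 'I_(1 + m)) = lshift m (0 : 'I_1) by apply: val_inj.
rewrite dot_row => x1; rewrite e0 row_mxEl mxE eqxx mulr1n => cx.
have d0 : 1 - eps b * a != 0.
  apply/negP => /eqP d; move/negP: cx; apply; apply/eqP.
  have e : eps b * a = 1 by apply/eqP; rewrite eq_sym -subr_eq0 d.
  by transitivity (eps b * eps b * a); [rewrite e2 mul1r|rewrite -mulrA e mulr1].
have q : dot w w = (1 - eps b * a) * (1 + eps b * a).
  rewrite -[LHS](addKr (a * a)) x1 mulrDr mulr1 mulrBl mul1r mulrACA e2; ring.
rewrite row_mxKr /stereo_inv dotZl dotZr q.
have -> : (1 - eps b * a)^-1 * ((1 - eps b * a)^-1 * ((1 - eps b * a) * (1 + eps b * a))) =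
   (1 + eps b * a) / (1 - eps b * a) by field.
have D1 : (1 + eps b * a) / (1 - eps b * a) + 1 = 2 / (1 - eps b * a) by field.
have D2 : (1 + eps b * a) / (1 - eps b * a) - 1 = 2 * (eps b * a) / (1 - eps b * a) by field.
rewrite D1 D2; congr (row_mx _%:M _).
  transitivity ((eps b * eps b) * a); first by field.
  by rewrite e2 mul1r.
by rewrite scalerA (_ : _ * _ = 1) ?scale1r //; field.
Qed.

Lemma cimage_sphere b : @cimage R m (sphere R m) b = setT.
Proof.
by apply/seteqP; split=> // y _; have [c e] := chart_stereo b y; exists (mkS (stereo_inv b y)).
Qed.

Lemma stereo_metric b y u v : gdot (@metric R m (sphere R m) b y) u v =
  dot ('D_u (@stereo_inv R m b) y) ('D_v (@stereo_inv R m b) y).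
Proof.
have C1 := @smooth_stereo_inv b setT openT 1%N.
rewrite !(jacobE _ openT I C1) gdotE dotE trmx_mul !mulmxA; congr ((_ *m _) 0 0).
rewrite -!mulmxA; congr (_ *m _); apply/matrixP => i j; rewrite [LHS]mxE dotE.
by rewrite !mxE; apply: eq_bigr => k _; rewrite !mxE.
Qed.

(** The chart metric of the sphere was defined as the pullback by this map. *)
Lemma stereo_spherical b : spherical_on (@metric R m (sphere R m) b) (@stereo_inv R m b) setT.
Proof.
split; first exact: smooth_stereo_inv openT.
  by move=> y _; exact: stereo_inv1.
by move=> y _ u v; rewrite stereo_metric.
Qed.

Lemma stereo_deriv_inj b y u : 'D_u (@stereo_inv R m b) y = 0 -> u = 0.
Proof.
move=> D0; have s := @smooth_stereo_inv b setT openT.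
have ds : is_derive y u (@stereo_inv R m b) 0.
  by rewrite -D0; apply/derivableP; exact: smooth_derivable s I.
have d0 := is_derive_coord 0 0 ds.
have dr : is_derive y u (fun z : 'rV[R]_m => rsubmx (stereo_inv b z)) (0 : 'rV[R]_m).
  apply: is_derive_mx => i j.
  have := is_derive_coord i (rshift 1 j) ds; rewrite !mxE.
  by congr (is_derive _ _ _ _); apply/funext => z; rewrite [RHS]mxE.
have dl : is_derive y u (fun z : 'rV[R]_m => (1 - eps b * stereo_inv b z 0 0) *: z) ((1 - eps b * stereo_inv b y 0 0) *: u).
  have h1 : is_derive y u (fun z : 'rV[R]_m => 1 - eps b * stereo_inv b z 0 0) 0.
    have := is_deriveB (is_derive_cst (1 : R) y u) (is_deriveZ (eps b) d0).
    by rewrite mxE scaler0 subr0.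
  by have := is_derive_scalemx h1 (is_derive_id y u); rewrite scale0r add0r.
have E : (fun z : 'rV[R]_m => (1 - eps b * stereo_inv b z 0 0) *: z) = (fun z : 'rV[R]_m => rsubmx (stereo_inv b z)).
  apply/funext => z; rewrite stereo_inv0 /stereo_inv row_mxKr !mulrA eps_sqr mul1r; congr (_ *: _).
  by field; rewrite gt_eqF // dotp1.
have [_ E1] := dl; have [_ E2] := dr; rewrite E E2 in E1.
move/esym/eqP: E1; rewrite scaler_eq0 => /orP[|/eqP //].
rewrite stereo_inv0 !mulrA eps_sqr mul1r.
have p := dotp1 y.
by rewrite (_ : 1 - _ = 2 / (dot y y + 1)) ?gt_eqF ?divr_gt0 //; field; rewrite gt_eqF.
Qed.

Lemma charted_sphere : charted (sphere R m).
Proof.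
have csv := sv_continuous.
have cs0 x : {for x, continuous (fun z => sv z 0 0)}.
  exact: ((continuous_mxP sv x).1 (csv x) 0 0).
split.
- move=> x; have [e|] := eqVneq (sv x 0 0) 1; last by exists false.
  by exists true; rewrite /= -/(sv x) e expr1 -subr_eq0 opprK.
- move=> b; split.
  + rewrite (_ : cdom b = [set x | setT x /\ (fun z : R => z != eps b) (sv x 0 0)]); last first.
      by apply/seteqP; split=> [x|x []].
    apply: (@open_preim_for _ _ (fun x => sv x 0 0) setT [set z | z != eps b]); [exact: openT| |by move=> x _; exact: cs0].
    have -> : [set z : R | z != eps b] = ~` [set z | z = eps b] by apply/seteqP; split=> z /= /eqP.
    exact/closed_openC/closed_eq.
  + move=> x cx; rewrite /= -/(sv _).
    apply: (continuous_scale (a := fun z => (1 - eps b * sv z 0 0)^-1) (f := fun z => rsubmx (sv z))).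
      apply: (continuous_inv_for (a := fun z => 1 - eps b * sv z 0 0)).
        apply/negP => /eqP d; move/negP: cx; apply; apply/eqP; rewrite -/(sv x).
        have e : eps b * sv x 0 0 = 1 by apply/eqP; rewrite eq_sym -subr_eq0 d.
        by transitivity (eps b * eps b * sv x 0 0); [rewrite eps_sqr mul1r|rewrite -mulrA e mulr1].
      apply: (continuous_sub_for (V := R) (a := fun=> 1) (b := fun z => eps b * sv z 0 0)); first exact: cst_continuous.
      apply: (continuous_mul_for (a := fun=> eps b) (b := fun z => sv z 0 0)); last exact: cs0.
      exact: cst_continuous.
    apply/continuous_mxP => i j.
    apply: (@eq_continuous_for _ _ (fun z => sv z i (rshift 1 j))); first by move=> z; rewrite mxE.
    exact: ((continuous_mxP sv x).1 (csv x) i (rshift 1 j)).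
  + move=> x y /set_mem cx /set_mem cy e; rewrite -(stereo_chart cx) -(stereo_chart cy).
    by congr (mkS (stereo_inv b _)).
  + move=> A oA Ac.
    rewrite (_ : _ @` _ = [set y : 'rV[R]_m | setT y /\ A (mkS (stereo_inv b y))]); last first.
      apply/seteqP; split=> [y [x Ax <-]|y [_ Ay]].
        by split => //; rewrite stereo_chart //; exact: Ac.
      by exists (mkS (stereo_inv b y)) => //; have [] := chart_stereo b y.
    apply: open_preim_for => //; first exact: openT.
    move=> y _; apply: continuous_sphere.
    apply: (@eq_continuous_for _ _ (@stereo_inv R m b)); last exact: smooth_continuous (@smooth_stereo_inv b setT openT) I.
    by move=> z; rewrite /= sv_mkS // stereo_inv1.
- move=> b; split.
  + rewrite cimage_sphere; apply/(smooth_mxP _ openT) => i j.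
    apply: (@smooth_ext _ _ _ _ (fun y => dot ('D_(delta_mx 0 i) (@stereo_inv R m b) y) ('D_(delta_mx 0 j) (@stereo_inv R m b) y))).
    - exact: openT.
    - by move=> y _; rewrite mxE.
    - by apply: (smooth_dot openT); apply: smoothD; exact: smooth_stereo_inv openT.
  + by move=> y _; apply/matrixP => i j; rewrite [LHS]mxE [LHS]mxE [RHS]mxE; exact: dotC.
  + move=> y u _ u0; rewrite stereo_metric dot_gt0; apply/negP => /eqP/stereo_deriv_inj e.
    by rewrite e eqxx in u0.
Qed.

(** In a stereographic chart the position vector is the inverse stereographic
    projection. *)
Lemma spherical_sv p : spherical_at sv p.
Proof.
move=> b cp; exists setT, (@stereo_inv R m b); split => //; first exact: openT.
- by rewrite cimage_sphere.
- exact: stereo_spherical.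
near=> x; rewrite -[in LHS](@stereo_chart b x) ?sv_mkS ?stereo_inv1 //.
by near: x; exact: (near_cdom charted_sphere).
Unshelve. all: by end_near. Qed.

(** An alias of the carrier that bears the pseudometric of the ambient space,
    through which compactness gives second countability. *)
Definition psphere := set_type (@unit_sphere R m).
HB.instance Definition _ := PseudoMetric.copy psphere (set_type (@unit_sphere R m)).
HB.instance Definition _ := isPointed.Build psphere (mkS 0).

Lemma second_countable_sphere : @second_countable (sphere R m).
Proof. exact: (@compact_second_countable R psphere compact_sphere). Qed.

Lemma riemannian_sphere : riemannian (sphere R m).
Proof.
have [h1 h2 h3] := charted_sphere.
split=> //; first by split; [exact: hausdorff_sphere|exact: second_countable_sphere].
apply: local_isometry_immersion => //; try exact: charted_sphere.
  by move=> q; exists sv; exact: spherical_sv.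
by move=> p; exact: local_isometry_id.
Qed.

(** Existence of spherical maps in the charts forces curvature 1. *)
Lemma kflat_sphere : kflat 1 (sphere R m).
Proof.
split; first exact: riemannian_sphere.
move=> b y u v cy fr; have [oc sm sy po] := metric_facts charted_sphere b.
apply: (sectional_of_curv_const sy po cy _ fr).
have sph : spherical_on (@metric R m (sphere R m) b) (@stereo_inv R m b) (cimage b).
  by rewrite cimage_sphere; exact: stereo_spherical.
exact: (spherical_curv_const oc sm sy (fun y cy => metric_unit charted_sphere cy) sph cy).
Qed.

End Sphere.

Section Submanifold.
Variables (R : realType) (m : nat) (M : atlas_space R m) (O : set M).
Hypotheses (cM : charted M) (oO : open O).
Local Notation S := (submanifold O).

Lemma cimage_sub (j : cindex S) : @cimage R m S j = @chart R m M j @` (@cdom R m M j `&` O).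
Proof.
apply/seteqP; split=> [_ [x cx <-]|_ [x [cx Ox] <-]].
  by exists (set_val x) => //; split => //; exact/set_mem/valP.
by exists (exist _ x (mem_set Ox)).
Qed.

Lemma open_cimage_sub (j : cindex S) : open (@cimage R m S j).
Proof.
rewrite cimage_sub; have [_ /(_ j)[oc _ _ co] _] := cM; apply: co; first exact: openI.
by move=> x [].
Qed.

Lemma charted_submanifold : charted S.
Proof.
have [cov ch me] := cM; split.
- by move=> x; have [i ci] := cov (set_val x); exists i.
- move=> i; have [oc cc ci co] := ch i; split.
  + exact: (open_comp (fun x _ => set_val_continuous (A := O) (x := x)) oc).
  + move=> x cx; apply: continuous_comp; [exact: set_val_continuous|exact: cc].
  + move=> x y /set_mem cx /set_mem cy e; apply: val_inj; apply: ci; rewrite ?inE //.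
  + move=> A oA Ac; have [W oW eA] := open_set_type oA.
    rewrite (_ : _ @` _ = @chart R m M i @` (W `&` O `&` @cdom R m M i)).
      by apply: co => [|x []//]; apply: openI => //; exact: openI.
    apply/seteqP; split=> [_ [x Ax <-]|_ [x [[Wx Ox] cx] <-]].
      exists (set_val x) => //; split; last exact: Ac.
      by split; [rewrite eA in Ax|exact/set_mem/valP].
    by exists (exist _ x (mem_set Ox)) => //; rewrite eA.
- move=> i; have [sm sy po] := me i.
  have sub : @cimage R m S i `<=` @cimage R m M i.
    by rewrite cimage_sub => _ [x [cx _] <-]; exists x.
  split; first exact: smooth_sub sub sm.
    by move=> y /sub; exact: sy.
  by move=> y u /sub; exact: po.
Qed.

Lemma spherical_at_sub (s : M -> 'rV[R]_(1 + m)) (p : S) :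
  spherical_at s (set_val p) <-> @spherical_at R m S (s \o set_val) p.
Proof.
split=> H j cj; have [U [phi [oU Up Uc sph Es]]] := H j cj.
  exists (U `&` @cimage R m S j), phi; split.
  - by apply: openI => //; exact: open_cimage_sub.
  - by split => //; exists p.
  - by move=> y [].
  - by apply: spherical_on_sub sph => y [].
  - exact: (set_val_continuous Es).
exists U, phi; split => //.
  by move=> y /Uc; rewrite cimage_sub => -[x [cx _] <-]; exists x.
by have := nbhs_open_sub oO Es; apply: filterS => _ [x e <-].
Qed.

Lemma local_isometry_sub (N : atlas_space R m) (f : M -> N) (p : S) : 
  @local_isometry_at R m S N (f \o set_val) p <-> local_isometry_at f (set_val p).
Proof.
split=> -[cf sf]; split.
- have := nbhs_open_sub oO cf; apply: filterS => _ [x cx <-] A nA.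
  have := nbhs_open_sub oO (cx A nA); apply: filterS => _ [y Ay <-]; exact: Ay.
- by move=> s h; exact: (spherical_at_sub (s \o f) p).2 (sf s h).
- have := near_comp (set_val_continuous (x := p)) cf; apply: filterS => x cx.
  by apply: continuous_comp => //; exact: set_val_continuous.
- by move=> s h; exact: (spherical_at_sub (s \o f) p).1 (sf s h).
Qed.
End Submanifold.

(** * Geodesic isometric maps are linear on cones *)

Section Arcs.
Variables (R : realType).

Lemma trig_continuous n (P Q : 'rV[R]_n) : continuous (trig P Q).
Proof. by move=> s; exact: smooth_continuous (smooth_trig P Q openT) I. Qed.

Lemma is_derive_trig1 n (p q : 'rV[R]_n) (s : R) : is_derive s 1 (trig p q) (trig q (- p) s).
Proof. by have := is_derive_trig p q s 1; rewrite scale1r. Qed.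

Lemma trig_mulmx n k (P Q : 'rV[R]_n) (M : 'M[R]_(n, k)) s : trig P Q s *m M = trig (P *m M) (Q *m M) s.
Proof. by rewrite /trig mulmxDl -!scalemxAl. Qed.

Lemma trigK n (P Q : 'rV[R]_n) s : P = cos s *: trig P Q s - sin s *: trig Q (- P) s /\
  Q = sin s *: trig P Q s + cos s *: trig Q (- P) s.
Proof.
have cs := cos2sin2 s.
by split; apply/rowP => i; rewrite /trig !mxE; ring: cs.
Qed.

Lemma trig_unit n (P Q : 'rV[R]_n) s : dot P P = 1 -> dot Q Q = 1 -> dot P Q = 0 ->
  dot (trig P Q s) (trig P Q s) = 1.
Proof.
move=> hP hQ hPQ; rewrite /trig !(dotDl, dotDr, dotZl, dotZr) (dotC Q P) hP hQ hPQ.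
have cs := cos2sin2 s; ring: cs.
Qed.

Lemma trig_tangent n (P Q : 'rV[R]_n) s : dot P P = 1 -> dot Q Q = 1 -> dot P Q = 0 ->
  dot (trig Q (- P) s) (trig Q (- P) s) = 1 /\ dot (trig Q (- P) s) (trig P Q s) = 0.
Proof.
move=> hP hQ hPQ; rewrite /trig !(dotDl, dotDr, dotZl, dotZr, dotNl, dotNr) (dotC Q P) hP hQ hPQ.
have cs := cos2sin2 s; split; ring: cs.
Qed.

Lemma trig_germ_eq n (P Q P' Q' : 'rV[R]_n) (s : R) :
  (\forall r \near s, trig P Q r = trig P' Q' r) -> P = P' /\ Q = Q'.
Proof.
move=> e; have e0 := nbhs_singleton e.
have e1 : trig Q (- P) s = trig Q' (- P') s.
  have [_ <-] := is_derive_trig1 P Q s; have [_ <-] := is_derive_trig1 P' Q' s.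
  exact: near_eq_derive.
by split; [rewrite {1}(trigK P Q s).1 e0 e1 -(trigK P' Q' s).1|
  rewrite {1}(trigK P Q s).2 e0 e1 -(trigK P' Q' s).2].
Qed.

(** A curve that is locally a great circle is one great circle: two great
    circles with a common germ coincide.  The end points are added by
    continuity. *)
Lemma trig_global n (c : R -> 'rV[R]_n) (th : R) : 0 < th ->
  (forall s, 0 < s < th -> exists P Q, [/\ dot P P = 1, dot Q Q = 1, dot P Q = 0 &
     \forall r \near s, c r = trig P Q r]) ->
  (forall e : R, 0 < e -> exists2 d : R, 0 < d & forall s, 0 < s < d -> `|c s - c 0| < e) ->
  (forall e : R, 0 < e -> exists2 d : R, 0 < d & forall s, th - d < s < th -> `|c s - c th| < e) ->
  exists P Q, [/\ dot P P = 1, dot Q Q = 1, dot P Q = 0 & forall s, 0 <= s <= th -> c s = trig P Q s].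
Proof.
move=> th0 H c0 cth.
have h2 : 0 < th / 2 < th by rewrite divr_gt0 //=; lra.
have [P [Q [hP hQ hPQ HPQ]]] := H _ h2.
have in01 s : 0 < s < th -> \forall r \near s, c r = trig P Q r.
  move=> /andP[s0 s1].
  pose l u := th / 2 + u * (s - th / 2).
  have l1 : l 1 = s by rewrite /l; lra.
  rewrite -l1; apply: (@real_ind R (fun u => \forall r \near l u, c r = trig P Q r)); last by rewrite ler01 lexx.
  - by rewrite /l mul0r addr0.
  - move=> u _ /nbhs_interior/nbhs_ballP[e /= e0 He].
    exists (e / th); first by rewrite divr_gt0.
    move=> v /andP[uv vu] _; apply: He; rewrite /ball /= /l.
    rewrite (_ : _ - _ = (u - v) * (s - th / 2)); last by lra.
    have vu0 : 0 < v - u by rewrite subr_gt0.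
    rewrite normrM distrC (gtr0_norm vu0).
    apply: (@le_lt_trans _ _ ((v - u) * th)).
      by rewrite ler_wpM2l ?(ltW vu0) // ler_norml; apply/andP; split; lra.
    by rewrite -ltr_pdivlMr // ltrBlDl.
  - move=> u /andP[u0 u1] K.
    have lin : 0 < l u < th.
      by rewrite /l; apply/andP; split; nra.
    have [P' [Q' [hP' hQ' hPQ' /nbhs_interior HPQ']]] := H _ lin.
    have /nbhs_ballP[e /= e0 He] := HPQ'.
    pose v := Num.max 0 (u - e / (2 * th)).
    have eth : 0 < e / (2 * th) by rewrite divr_gt0 // mulr_gt0.
    have vu : 0 <= v < u by rewrite /v le_max lexx /= gt_max u0 /=; lra.
    have Kv := K v vu.
    have vl : u - e / (2 * th) <= v by rewrite /v le_max lexx orbT.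
    have : ball (l u) e (l v).
      rewrite /ball /= /l (_ : _ - _ = (u - v) * (s - th / 2)); last by lra.
      case/andP: vu => v0 vu.
      rewrite normrM gtr0_norm ?subr_gt0 //.
      apply: (@le_lt_trans _ _ (e / (2 * th) * th)).
        by apply: ler_pM => //; [rewrite subr_ge0 (ltW vu)|lra|rewrite ler_norml; apply/andP; split; lra].
      have -> : e / (2 * th) * th = e / 2 by field; rewrite gt_eqF.
      lra.
    move/He => Kv'.
    have [-> ->] : P = P' /\ Q = Q'.
      apply: (@trig_germ_eq _ _ _ _ _ (l v)).
      have K1 : \forall r \near l v, c r = trig P' Q' r := Kv'.
      by near=> r; rewrite -(near Kv r) // (near K1 r).
    exact: nbhs_singleton HPQ'.
exists P, Q; split => // s /andP[s0 s1].
have ct (r : R) (e : R) : 0 < e -> exists2 d : R, 0 < d & forall s, `|s - r| < d -> `|trig P Q s - trig P Q r| < e.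
  move=> e0; have /cvgrPdist_lt/(_ _ e0)/nbhs_ballP[d /= d0 Hd] := @trig_continuous _ P Q r.
  by exists d => // s' s'd; rewrite distrC; apply: Hd; rewrite /ball /= distrC.
have small (a b : 'rV[R]_n) : (forall e : R, 0 < e -> `|a - b| <= e) -> a = b.
  move=> h; apply/eqP; rewrite -subr_eq0 -normr_le0; apply/ler_addgt0Pr => e e0.
  by rewrite add0r; exact: h.
move: s0; rewrite le_eqVlt => /orP[/eqP <-|s0].
  apply: small => e e0; have e2 : 0 < e / 2 by rewrite divr_gt0.
  have [d1 d10 h1] := c0 _ e2; have [d2 d20 h2'] := ct 0 _ e2.
  pose r := Num.min (th / 2) (Num.min d1 d2 / 2).
  have r0 : 0 < r by rewrite /r !lt_min !divr_gt0 ?lt_min ?d10.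
  have [ra rb rc] : [/\ r < th, r < d1 & r < d2].
    have : r <= th / 2 /\ r <= Num.min d1 d2 / 2 by rewrite /r !ge_min !lexx orbT.
    have : Num.min d1 d2 <= d1 /\ Num.min d1 d2 <= d2 by rewrite !ge_min !lexx orbT.
    have : 0 < Num.min d1 d2 by rewrite lt_min d10.
    by move=> ? [? ?] [? ?]; split; lra.
  have E : c r = trig P Q r by apply: (nbhs_singleton (in01 r _)); rewrite r0.
  rewrite -(subrKA (c r)) (splitr e); apply: le_trans (ler_normD _ _) _; apply: lerD; apply: ltW.
    by rewrite distrC; apply: h1; rewrite r0.
  by rewrite E; apply: h2'; rewrite subr0 gtr0_norm.
move: s1; rewrite le_eqVlt => /orP[/eqP ->|s1]; last by apply: (nbhs_singleton (in01 s _)); rewrite s0.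
apply: small => e e0; have e2 : 0 < e / 2 by rewrite divr_gt0.
have [d1 d10 h1] := cth _ e2; have [d2 d20 h2'] := ct th _ e2.
pose r := Num.min (th / 2) (Num.min d1 d2 / 2).
have r0 : 0 < r by rewrite /r !lt_min !divr_gt0 ?lt_min ?d10.
have [ra rb rc] : [/\ r < th, r < d1 & r < d2].
  have : r <= th / 2 /\ r <= Num.min d1 d2 / 2 by rewrite /r !ge_min !lexx orbT.
  have : Num.min d1 d2 <= d1 /\ Num.min d1 d2 <= d2 by rewrite !ge_min !lexx orbT.
  have : 0 < Num.min d1 d2 by rewrite lt_min d10.
  by move=> ? [? ?] [? ?]; split; lra.
have E : c (th - r) = trig P Q (th - r) by apply: (nbhs_singleton (in01 _ _)); apply/andP; split; lra.
rewrite -(subrKA (c (th - r))) (splitr e); apply: le_trans (ler_normD _ _) _; apply: lerD; apply: ltW.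
  by rewrite distrC; apply: h1; apply/andP; split; lra.
by rewrite E; apply: h2'; rewrite addrAC subrr add0r normrN gtr0_norm.
Unshelve. all: by end_near. Qed.

(** Orthonormalize [p] and [q]. *)
Lemma chord n (p q : 'rV[R]_n) : dot p p = 1 -> dot q q = 1 -> q != p -> q != - p ->
  exists a (th : R), [/\ 0 < th < pi, dot a a = 1, dot p a = 0 & q = trig p a th].
Proof.
move=> p1 q1 n1 n2.
have h1 : dot p q < 1.
  have : 0 < dot (q - p) (q - p) by rewrite dot_gt0 subr_eq0.
  rewrite dot_sub_sqr p1 q1 (dotC q p); lra.
have h2 : -1 < dot p q.
  have : 0 < dot (q + p) (q + p) by rewrite dot_gt0 addr_eq0.
  rewrite !(dotDl, dotDr) p1 q1 (dotC q p); lra.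
have hd : -1 <= dot p q <= 1 by rewrite (ltW h1) (ltW h2).
pose th := acos (dot p q).
have ct : cos th = dot p q by rewrite /th acosK // in_itv.
have t0 : 0 < th by apply: acos_gt0; rewrite (ltW h2).
have tp : th < pi by apply: acos_ltpi; rewrite h2 (ltW h1).
have st : 0 < sin th by apply: sin_gt0_pi; rewrite t0.
exists ((sin th)^-1 *: (q - cos th *: p)), th; split.
- by rewrite t0.
- rewrite dotZl dotZr dot_sub_sqr dotZr q1 dotZl dotZr p1 (dotC q p) -ct.
  have cs := cos2sin2 th.
  rewrite (_ : 1 - _ + _ = sin th ^+ 2); first by field; rewrite gt_eqF.
  by ring: cs.
- by rewrite dotZr dotBr dotZr p1 mulr1 ct subrr mulr0.
- by rewrite /trig scalerA mulfV ?gt_eqF // scale1r addrC subrK.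
Qed.

Lemma chord_param n (p a : 'rV[R]_n) (th al be : R) : 0 < th < pi -> dot p p = 1 -> dot a a = 1 -> dot p a = 0 ->
  0 <= al -> 0 <= be -> dot (al *: p + be *: trig p a th) (al *: p + be *: trig p a th) = 1 ->
  exists2 s, 0 <= s <= th & al *: p + be *: trig p a th = trig p a s.
Proof.
move=> /andP[t0 tp] p1 a1 pa al0 be0.
have st : 0 < sin th by apply: sin_gt0_pi; rewrite t0.
have E : al *: p + be *: trig p a th = (al + be * cos th) *: p + (be * sin th) *: a.
  by apply/rowP => i; rewrite /trig !mxE; ring.
rewrite E !(dotDl, dotDr, dotZl, dotZr) (dotC a p) p1 a1 pa => N.
set x := al + be * cos th in N E *; set y := be * sin th in N E *.
have y0 : 0 <= y by rewrite mulr_ge0 // (ltW st).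
have xy : x ^+ 2 + y ^+ 2 = 1 by rewrite -N; ring.
have x1 : -1 <= x <= 1.
  rewrite -ler_norml -(@ler_sqr _ _ 1) ?nnegrE // expr1n real_normK ?num_real // -xy lerDl sqr_ge0 //.
pose s := acos x.
have cs : cos s = x by rewrite /s acosK // in_itv.
have ss : sin s = y by rewrite /s sin_acos // (_ : 1 - x ^+ 2 = y ^+ 2) ?sqrtr_sqr ?ger0_norm //; rewrite -xy; ring.
have s0 : 0 <= s by apply: acos_ge0.
have spi : s <= pi by apply: acos_lepi.
exists s; last by rewrite /trig cs ss.
rewrite s0 /= leNgt; apply/negP => ths.
have : 0 < sin (s - th) by apply: sin_gt0_pi; apply/andP; split; lra.
rewrite sinB cs ss /x /y => h.
have : 0 <= al * sin th by rewrite mulr_ge0 // (ltW st).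
by move: h; rewrite (_ : _ - _ = - (al * sin th)); [lra|ring].
Qed.

Lemma chord_comb n (p a : 'rV[R]_n) (th s : R) : 0 < th < pi -> 0 <= s <= th ->
  exists al be, [/\ 0 <= al, 0 <= be & trig p a s = al *: p + be *: trig p a th].
Proof.
move=> /andP[t0 tp] /andP[s0 s1].
have st : 0 < sin th by apply: sin_gt0_pi; rewrite t0.
exists (sin (th - s) / sin th), (sin s / sin th); split.
- by rewrite divr_ge0 ?(ltW st) // sin_ge0_pi //; apply/andP; split; lra.
- by rewrite divr_ge0 ?(ltW st) // sin_ge0_pi //; apply/andP; split; lra.
- apply/rowP => i; rewrite /trig sinB !mxE; field; by rewrite gt_eqF.
Qed.
End Arcs.

Section GeodesicMaps.
Variables (R : realType) (m : nat) (M : atlas_space R m).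
Hypothesis rM : riemannian M.
Let cM : charted M := riemannian_charted rM.

(** The local extensions in the definition of a geodesic isometric map are
    continuous. *)
Lemma geodesic_isometric_continuous k n (V : 'M[R]_(k, n)) S (f : 'rV[R]_n -> M) p A :
  geodesic_isometric_on V S f -> S p -> nbhs (f p) A ->
  \forall q \near p, S q -> A (f q).
Proof.
move=> [H _] Sp nA; have [cov _ _] := cM; have [j cj] := cov (f p).
have [U [F [oU Up sF HF _]]] := H p j Sp cj.
have [_ Fp] := HF p Sp Up.
have nF : nbhs (F p) (@chart R m M j @` (A `&` cdom j)) by rewrite Fp; exact: (chart_nbhs cM).
have nU : \forall q \near p, U q by exact: open_nbhs_nbhs.
have nF' := near_comp (smooth_continuous sF Up) nF.
near=> q => Sq; have Uq : U q by near: q.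
have [cq Fq] := HF q Sq Uq.
have : (@chart R m M j @` (A `&` cdom j)) (F q) by near: q.
by rewrite Fq => -[x [Ax cx] /(chart_inj cM cx cq) <-].
Unshelve. all: by end_near. Qed.

Lemma arc_span k n (V : 'M[R]_(k, n)) (S : set 'rV[R]_n) p a (t : R) :
  (forall x, S x -> (x <= V)%MS) -> (\forall s \near t, S (trig p a s)) ->
  (p <= V)%MS /\ (a <= V)%MS.
Proof.
move=> SV nS.
have /nbhs_ballP[e /= e0 He] := nS.
pose r := Num.min (e / 2) 1.
have r0 : 0 < r by rewrite /r lt_min ltr01 divr_gt0.
have re : r < e.
  have : r <= e / 2 by rewrite /r ge_min lexx.
  lra.
have rp : r < pi.
  have : r <= 1 by rewrite /r ge_min lexx orbT.
  have := @pi_ge2 R; lra.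
have sr : 0 < sin r by apply: sin_gt0_pi; rewrite r0.
have S1 := SV _ (nbhs_singleton nS).
have S2 : (trig p a (t + r) <= V)%MS.
  by apply: SV; apply: He; rewrite /ball /= opprD addNKr normrN gtr0_norm.
have cs := cos2sin2 t.
have Ep : p = (sin (t + r) / sin r) *: trig p a t - (sin t / sin r) *: trig p a (t + r).
  apply/rowP => i; rewrite /trig sinD cosD !mxE.
  transitivity ((cos t ^+ 2 + sin t ^+ 2) * p 0 i); first by rewrite cos2Dsin2 mul1r.
  by field; rewrite gt_eqF.
have Ea : a = (cos t / sin r) *: trig p a (t + r) - (cos (t + r) / sin r) *: trig p a t.
  apply/rowP => i; rewrite /trig sinD cosD !mxE.
  transitivity ((cos t ^+ 2 + sin t ^+ 2) * a 0 i); first by rewrite cos2Dsin2 mul1r.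
  by field; rewrite gt_eqF.
by split; [rewrite Ep|rewrite Ea]; rewrite -scaleNr addmx_sub // scalemx_sub.
Qed.

(** Great circle arcs go to unit speed geodesics, which spherical maps send to
    great circle arcs. *)
Lemma arc_trig k n (V : 'M[R]_(k, n)) S (f : 'rV[R]_n -> M) s p a (t : R) :
  geodesic_isometric_on V S f -> (forall x, S x -> (x <= V)%MS) ->
  dot p p = 1 -> dot a a = 1 -> dot p a = 0 ->
  (\forall r \near t, S (trig p a r)) -> spherical_at s (f (trig p a t)) ->
  exists P Q, [/\ dot P P = 1, dot Q Q = 1, dot P Q = 0 &
     \forall r \near t, s (f (trig p a r)) = trig P Q r].
Proof.
move=> [H1 H2] SV p1 a1 pa nS sp.
have St := nbhs_singleton nS.
have [cov _ _] := cM; have [j cj] := cov (f (trig p a t)).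
have [W [phi [oW Wp Wc sph Es]]] := sp j cj.
have [U [F [oU Up sF HF mF]]] := H1 _ j St cj.
have [pV aV] := arc_span SV nS.
pose x := @chart R m M j \o (fun r => f (trig p a r)).
have [_ Ft] := HF _ St Up.
have nU : \forall r \near t, U (trig p a r) by apply: (near_comp (@trig_continuous _ _ p a t)); exact: open_nbhs_nbhs.
have nW : \forall r \near t, W (F (trig p a r)).
  apply: (near_comp (f := F \o trig p a)); last by rewrite /= Ft; exact: open_nbhs_nbhs.
  apply: continuous_comp; [exact: trig_continuous|exact: smooth_continuous sF Up].
have [oc sm sy po] := metric_facts cM j.
have ug y (Wy : W y) : metric j y \in unitmx := metric_unit cM (Wc y Wy).
have nn : \forall r \near t, [/\ S (trig p a r), U (trig p a r) & W (F (trig p a r))].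
  by near=> r; split; near: r.
have [|P [Q [hP hQ hPQ HPQ]]] := @geodesic_trig R m (metric j) W phi oW (fun y Wy => sy y (Wc y Wy)) ug sph x t.
  have nn' := nbhs_interior nn.
  near=> r.
  have nr : \forall u \near r, [/\ S (trig p a u), U (trig p a u) & W (F (trig p a u))] by near: r.
  have [Sr Ur Wr] := nbhs_singleton nr.
  have [cr Fr] := HF _ Sr Ur.
  have [|_ /(_ j cr)[d1 d2 d3]] := H2 p a r p1 a1 pa; first by apply: filterS nr => u [].
  split.
  - by rewrite /x /= -Fr.
  - exact: nbhs_singleton d1.
  - exact: d2.
  - apply/rowP => i; rewrite !mxE; exact: d3.
  - have xF : \forall u \near r, x u = (F \o trig p a) u.
      by apply: filterS nr => u [Su Uu _]; have [_ e] := HF _ Su Uu; rewrite /x /= -e.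
    have dF := is_derive_chain_mx oU Ur (sF 1%N) (is_derive_trig1 p a r).
    have -> : derive1 x r = 'D_(trig a (- p) r) F (trig p a r).
      by rewrite derive1E; have [_ <-] := dF; exact: near_eq_derive.
    have [T1 T2] := trig_tangent r p1 a1 pa.
    have TV : (trig a (- p) r <= V)%MS by rewrite /trig addmx_sub // scalemx_sub // ?eqmx_opp.
    by rewrite /x /= -Fr mF.
exists P, Q; split => //.
have Es' : \forall r \near t, U (trig p a r) /\ S (trig p a r) -> s (f (trig p a r)) = phi (x r).
  have cF : {for t, continuous (F \o trig p a)}.
    apply: continuous_comp; [exact: trig_continuous|exact: smooth_continuous sF Up].
  have := near_comp (@trig_continuous _ _ p a t) (geodesic_isometric_continuous (conj H1 H2) St Es).
  by apply: filterS => r h [_ Sr]; rewrite h.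
near=> r; rewrite (near Es' r) //; first by near: r.
by split; near: r.
Unshelve. all: by end_near. Qed.

(** The arc from [p] to [q] goes to a great circle arc of the same length, and
    on an arc all points are combinations of the end points with the same
    coefficients as on the source. *)
Lemma cone_additive k n (V : 'M[R]_(k, n)) S (f : 'rV[R]_n -> M) s p q :
  geodesic_isometric_on V S f -> (forall x, S x -> (x <= V)%MS) ->
  dot p p = 1 -> dot q q = 1 -> q != p -> q != - p ->
  (forall al be, 0 <= al -> 0 <= be -> dot (al *: p + be *: q) (al *: p + be *: q) = 1 ->
     S (al *: p + be *: q) /\ spherical_at s (f (al *: p + be *: q))) ->
  dot (s (f p)) (s (f q)) = dot p q /\
  forall al be, 0 <= al -> 0 <= be -> dot (al *: p + be *: q) (al *: p + be *: q) = 1 ->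
     s (f (al *: p + be *: q)) = al *: s (f p) + be *: s (f q).
Proof.
move=> gf SV p1 q1 qp qNp Hc.
have [a [th [tpi a1 pa Eq]]] := chord p1 q1 qp qNp.
have /andP[t0 tp] := tpi.
have Sarc r : 0 <= r <= th -> S (trig p a r) /\ spherical_at s (f (trig p a r)).
  move=> rth; have [al [be [al0 be0 E]]] := chord_comb p a tpi rth.
  by rewrite E -Eq; apply: Hc => //; rewrite Eq -E trig_unit.
have cont r e : 0 <= r <= th -> 0 < e -> exists2 d : R, 0 < d & forall u, 0 <= u <= th -> `|u - r| < d ->
    `|s (f (trig p a u)) - s (f (trig p a r))| < e.
  move=> rth e0; have [Sr sr] := Sarc r rth.
  have [_ cs] := nbhs_singleton (spherical_at_unit cM sr).
  have ns : \forall x \near f (trig p a r), `|s (f (trig p a r)) - s x| < e.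
    by move/cvgrPdist_lt: cs => /(_ _ e0).
  have := near_comp (@trig_continuous _ _ p a r) (geodesic_isometric_continuous gf Sr ns).
  move=> /nbhs_ballP[d /= d0 Hd]; exists d => // u uth ud; rewrite distrC.
  by apply: Hd; [rewrite /ball /= distrC|have [] := Sarc u uth].
have [|||P [Q [hP hQ hPQ HPQ]]] := @trig_global R _ (fun r => s (f (trig p a r))) th t0.
- move=> r /andP[r0 r1]; apply: (arc_trig gf SV p1 a1 pa).
    have o : open [set` `]0, th[] by exact: itv_open.
    have : \forall u \near r, [set` `]0, th[] u by apply: open_nbhs_nbhs; split => //=; rewrite in_itv /= r0.
    apply: filterS => u /=; rewrite in_itv /= => /andP[u0 u1].
    by have [] := Sarc u; rewrite ?(ltW u0) ?(ltW u1).
  by have [] := Sarc r; rewrite ?(ltW r0) ?(ltW r1).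
- move=> e e0; have [|d d0 Hd] := cont 0 e _ e0; first by rewrite lexx (ltW t0).
  exists (Num.min d th); first by rewrite lt_min d0.
  move=> u /andP[u0]; rewrite lt_min => /andP[ud ut].
  by apply: Hd; [rewrite (ltW u0) (ltW ut)|rewrite subr0 gtr0_norm].
- move=> e e0; have [|d d0 Hd] := cont th e _ e0; first by rewrite lexx (ltW t0).
  exists (Num.min d th); first by rewrite lt_min d0.
  move=> u /andP[ud ut].
  have [m1 m2] : Num.min d th <= d /\ Num.min d th <= th by rewrite !ge_min !lexx orbT.
  apply: Hd; first by apply/andP; split; lra.
  by rewrite distrC gtr0_norm ?subr_gt0 //; lra.
have E0 : s (f p) = P.
  have := HPQ 0; rewrite lexx (ltW t0) => /(_ isT).
  by rewrite /trig cos0 sin0 !scale0r !scale1r !addr0.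
have E1 : s (f q) = trig P Q th by rewrite Eq HPQ // lexx (ltW t0).
split.
  by rewrite E0 E1 Eq /trig !(dotDr, dotZr) hP hPQ p1 pa.
move=> al be al0 be0 N.
have N' := N; rewrite Eq in N'.
have [r rth Er] := chord_param tpi p1 a1 pa al0 be0 N'.
rewrite {1}Eq Er HPQ // E0 E1.
have := f_equal (fun z => dot z p) Er; rewrite /trig !(dotDl, dotZl) (dotC a p) p1 pa !mulr0 !mulr1 !addr0 => e1.
have := f_equal (fun z => dot z a) Er; rewrite /trig !(dotDl, dotZl) a1 pa !mulr0 !mulr1 !add0r => e2.
rewrite -e1 -e2; apply/rowP => i; rewrite !mxE; ring.
Qed.

Section LocalIsometry.
Variables (n : nat) (J : 'M[R]_(n, 1 + m)) (h : sphere R m -> M).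
Hypothesis JJ : J *m J^T = 1%:M.

Lemma orth_neq0 (y : 'rV[R]_n) : dot y y = 1 -> y *m J != 0.
Proof. by move=> y1; rewrite -dot_gt0 dot_orth // y1. Qed.

Lemma near_neq0 (y : 'rV[R]_n) : dot y y = 1 -> \forall z \near y, z *m J != 0.
Proof.
move=> y1; have cD : {for y, continuous (fun z : 'rV[R]_n => dot z z)} by apply: dot_continuous; exact: cvg_id.
have : \forall z \near y, 0 < dot z z by apply: (cvgr_gt _ cD); rewrite y1.
by apply: filterS => z z0; rewrite -dot_gt0 dot_orth.
Qed.

(** A spherical map composed with a local isometry of the sphere is spherical,
    hence differs from the position vector by an orthogonal matrix. *)
Lemma local_isometry_linear (x : sphere R m) s : local_isometry_at h x -> spherical_at s (h x) ->
  exists C, C *m C^T = 1%:M /\ \forall y \near x, s (h y) = sv y *m C.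
Proof.
move=> [_ sh] /sh hs; have [C [CC E]] := spherical_at_unique (charted_sphere R m) (@spherical_sv R m x) hs.
by exists C.
Qed.

Lemma mulmx_continuous (y : 'rV[R]_n) : {for y, continuous (fun z : 'rV[R]_n => z *m J)}.
Proof. by apply: (continuous_mulmx (M := id) (N := fun=> J)); [exact: cvg_id|exact: cst_continuous]. Qed.

Lemma nrJ_continuous (y : 'rV[R]_n) : y *m J != 0 -> {for y, continuous (fun z : 'rV[R]_n => nr (z *m J))}.
Proof.
move=> y0; apply: (continuous_comp (f := fun z : 'rV[R]_n => z *m J)); [exact: mulmx_continuous|exact: nr_continuous].
Qed.

(** On tangent vectors at a unit vector radial projection has the identity as
    derivative. *)
Lemma nrE_derive (q u : 'rV[R]_n) (C : 'M[R]_(1 + m)) : dot q q = 1 -> dot u q = 0 ->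
  'D_u (fun y => nrE (y *m J) *m C) q = u *m J *m C.
Proof.
move=> q1 uq.
have q0 : q *m J != 0 := orth_neq0 q1.
have [N [oN Nq N0]] := nearP (near_neq0 q1).
have sJ : smooth N (fun y : 'rV[R]_n => y *m J) by apply: smooth_mulmxr => //; exact: smooth_id.
have sK : smooth N (fun y => nrE (y *m J) *m C).
  by apply: smooth_mulmxr => //; exact: (smooth_nrE oN sJ N0).
set K := fun y => _ in sK *.
have dK : is_derive q u K ('D_u K q) by apply/derivableP; exact: smooth_derivable sK Nq.
pose nu (y : 'rV[R]_n) := Num.sqrt (dot (y *m J) (y *m J)).
have sn : smooth N nu.
  by move=> k; apply: Ck_sqrt => //; [move=> y /N0; rewrite dot_gt0|exact: (smooth_dot oN sJ sJ)].
have dn : is_derive q u nu ('D_u nu q) by apply/derivableP; exact: smooth_derivable sn Nq.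
have nq : nu q = 1 by rewrite /nu dot_orth // q1 sqrtr1.
have Dn : 'D_u nu q = 0.
  have [_ E1] := is_deriveM dn dn.
  have dd : is_derive q u (fun y : 'rV[R]_n => dot y y) (dot u q + dot q u).
    by apply: is_derive_dot; exact: is_derive_id.
  have [_ E2] := dd; rewrite (dotC q u) uq addr0 in E2.
  have : 'D_u (nu * nu) q = 0.
    rewrite -E2; congr ('D_u _ q); apply/funext => y /=.
    by rewrite -[LHS]/(nu y * nu y) -expr2 sqr_sqrtr ?dot_ge0 // dot_orth.
  by rewrite E1 nq !scale1r => E0; lra.
have [_ E] := is_derive_scalemx dn dK; rewrite Dn scale0r add0r nq scale1r in E.
rewrite -E.
have dJ := is_derive_mulmx (is_derive_mulmx (is_derive_id q u) (is_derive_cst J q u)) (is_derive_cst C q u).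
rewrite !mulmx0 !addr0 in dJ; have [_ <-] := dJ.
apply: near_eq_derive; apply: (open_near oN Nq) => y /N0 y0.
by rewrite /K /nrE -scalemxAl scalerA mulfV ?scale1r // gt_eqF // sqrt_dot_gt0.
Qed.

(** Continuation produces local isometries of the sphere; two-convexity asks for
    geodesic isometric maps of subsets of the unit sphere of R^4.  The two are
    linked by orthonormal systems J, which embed spheres of lower dimension. *)
Lemma local_isometry_geodesic k (V : 'M[R]_(k, n)) (S : set 'rV[R]_n) :
  (forall q : M, exists s, spherical_at s q) -> (forall x, S x -> dot x x = 1) ->
  (forall x, S x -> local_isometry_at h (nr (x *m J))) ->
  geodesic_isometric_on V S (fun y => h (nr (y *m J))).
Proof.
move=> ex S1 HS.
have key p (j : cindex M) : S p -> cdom j (h (nr (p *m J))) -> exists U phi (C : 'M[R]_(1 + m)) (N : set 'rV[R]_n),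
   [/\ open U, U `<=` cimage j, spherical_on (metric j) phi U, C *m C^T = 1%:M & [/\ open N, N p &
    forall y, N y -> [/\ y *m J != 0, cdom j (h (nr (y *m J))), U (chart j (h (nr (y *m J)))),
      {for y, continuous (fun z : 'rV[R]_n => chart j (h (nr (z *m J))))} &
      phi (chart j (h (nr (y *m J)))) = nrE (y *m J) *m C]]].
  move=> Sp cj; have Lh := HS p Sp; have [s Hs] := ex (h (nr (p *m J))).
  have [U [phi [oU Up Uc sph Es]]] := Hs j cj.
  have [C [CC EC]] := local_isometry_linear Lh Hs.
  exists U, phi, C.
  have p0 := orth_neq0 (S1 p Sp).
  have nj : \forall x \near h (nr (p *m J)), [/\ cdom j x, U (chart j x) & s x = phi (chart j x)].
    near=> x; split; near: x => //; first exact: (near_cdom cM).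
    by apply: (near_comp (chart_continuous cM cj)); exact: open_nbhs_nbhs.
  have chh := local_isometry_continuous Lh; have [chn _] := Lh.
  have nS : \forall x \near nr (p *m J), [/\ {for x, continuous h}, s (h x) = sv x *m C &
     [/\ cdom j (h x), U (chart j (h x)) & s (h x) = phi (chart j (h x))]].
    have nj' := near_comp chh nj.
    by near=> x; split; near: x.
  have nY : \forall y \near p, y *m J != 0 /\ [/\ {for nr (y *m J), continuous h}, s (h (nr (y *m J))) = sv (nr (y *m J)) *m C &
     [/\ cdom j (h (nr (y *m J))), U (chart j (h (nr (y *m J)))) & s (h (nr (y *m J))) = phi (chart j (h (nr (y *m J))))]].
    have nS' := near_comp (nrJ_continuous p0) nS; have n0 := near_neq0 (S1 p Sp).
    by near=> y; split; near: y.
  have [N [oN Np HN]] := nearP nY; exists N; split => //; split => // y /HN[y0 [chy Ey [cy Uy Ey']]].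
  split => //; last by rewrite -Ey' Ey sv_nr.
  apply: (@continuous_comp _ _ _ (fun z : 'rV[R]_n => h (nr (z *m J))) (chart j)); last exact: (chart_continuous cM).
  by apply: (@continuous_comp _ _ _ (fun z : 'rV[R]_n => nr (z *m J)) h); [exact: nrJ_continuous|].
split=> [p j Sp cj|p a t p1 a1 pa nS].
  have [U [phi [C [N [oU Uc sph CC [oN Np HN]]]]]] := key p j Sp cj.
  have [oc sm sy po] := metric_facts cM j.
  have ug y (Uy : U y) : metric j y \in unitmx := metric_unit cM (Uc y Uy).
  have sJ : smooth N (fun y : 'rV[R]_n => y *m J) by apply: smooth_mulmxr => //; exact: smooth_id.
  have sK : smooth N (fun y => nrE (y *m J) *m C).
    by apply: smooth_mulmxr => //; apply: (smooth_nrE oN sJ) => y /HN[].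
  have [|||sF DF] := @lift_smooth R m (metric j) U phi oU (metric_smooth cM Uc) ug sph _ N
      (fun y => chart j (h (nr (y *m J)))) (fun y => nrE (y *m J) *m C) oN _ _ _ sK.
  - by move=> z /HN[].
  - by move=> z /HN[].
  - by move=> z /HN[].
  exists N, (fun y => chart j (h (nr (y *m J)))); split => //.
    by move=> q Sq /HN[].
  move=> q u v Sq Nq _ uq _ vq; have [_ s1 s2] := sph.
  have [_ cq Uq _ Eq] := HN q Nq.
  have Du := etrans (esym (nrE_derive C (S1 q Sq) uq)) (DF q u Nq).
  have Dv := etrans (esym (nrE_derive C (S1 q Sq) vq)) (DF q v Nq).
  apply: etrans (esym (s2 _ Uq _ _)) _.
  apply: etrans (congr2 (@dot R _) (esym Du) (esym Dv)) _.
  by rewrite !dot_orth.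
have St := nbhs_singleton nS.
have t0 := orth_neq0 (S1 _ St).
split.
  apply: (@continuous_comp _ _ _ (fun s => nr (trig p a s *m J)) h); last exact: local_isometry_continuous (HS _ St).
  apply: (@continuous_comp _ _ _ (trig p a) (fun y => nr (y *m J))); first exact: trig_continuous.
  exact: nrJ_continuous.
move=> j cj x.
have [U [phi [C [N [oU Uc sph CC [oN Np HN]]]]]] := key _ j St cj.
have [oc sm sy po] := metric_facts cM j.
have ug y (Uy : U y) : metric j y \in unitmx := metric_unit cM (Uc y Uy).
have nN : \forall r \near t, N (trig p a r) by apply: (near_comp (@trig_continuous _ _ p a t)); exact: open_nbhs_nbhs.
have o (v w : 'rV[R]_n) : dot (v *m J *m C) (w *m J *m C) = dot v w by rewrite !dot_orth.
have o1 (v w : 'rV[R]_n) c : dot v w = c -> dot (v *m J *m C) (w *m J *m C) = c by rewrite o.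
have [|d1 d2 d3] := @trig_geodesic R m (metric j) U phi oU (metric_smooth cM Uc) (fun y Uy => sy y (Uc y Uy)) ug sph x
  (p *m J *m C) (a *m J *m C) t (o1 _ _ _ p1) (o1 _ _ _ a1) (o1 _ _ _ pa).
  near=> r; have Nr : N (trig p a r) by near: r.
  have [r0 cr Ur cor Er] := HN _ Nr; split; [exact: Ur| |].
    apply: (@continuous_comp _ _ _ (trig p a) (fun y => chart j (h (nr (y *m J))))); last exact: cor.
    exact: trig_continuous.
  by rewrite /x /= Er -!trig_mulmx nrE_id // dot_orth // trig_unit.
split=> // k'; have := congr1 (fun M : 'rV[R]_m => M 0 k') d3; by rewrite !mxE.
Unshelve. all: by end_near. Qed.
End LocalIsometry.
End GeodesicMaps.

(** * Continuation along great circles through a point *)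

Lemma agree_near_refl (T : topologicalType) (A : Type) (f : T -> A) x : agree_near f f x.
Proof. by apply: nearW. Qed.

Section Continuation.
Variables (R : realType) (m : nat) (Psi : atlas_space R m).
Hypothesis kPsi : kflat 1 Psi.
Let rPsi : riemannian Psi := kPsi.1.
Let cPsi : charted Psi := riemannian_charted rPsi.
Let exPsi (q : Psi) : exists s, spherical_at s q := spherical_at_ex q kPsi.
Let hPsi : hausdorff_space Psi. Proof. by case: rPsi => -[]. Qed.
Local Notation S := (sphere R m).
Let cS : charted S := charted_sphere R m.
Local Notation E := 'rV[R]_(1 + m).

Lemma local_isometry_near (h : S -> Psi) x : local_isometry_at h x -> \forall y \near x, local_isometry_at h y.
Proof.
move=> [ch sh]; have [s Hs] := exPsi (h x).
have ns := near_comp (nbhs_singleton ch) (spherical_at_near rPsi Hs).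
have nsh := spherical_at_near (riemannian_sphere R m) (sh s Hs).
have ch' := nbhs_interior ch.
near=> y; apply: (local_isometry_ex (s := s) cPsi); near: y => //.
Unshelve. all: by end_near. Qed.

Lemma sphere_dist_dot (x y : S) : `|sv x - sv y| ^+ 2 <= 2 * (1 - dot (sv x) (sv y)).
Proof.
have -> : 2 * (1 - dot (sv x) (sv y)) = dot (sv x - sv y) (sv x - sv y).
  by rewrite dot_sub_sqr !sv1; ring.
rewrite -[leRHS]sqr_sqrtr ?dot_ge0 // lerXn2r ?nnegrE ?sqrtr_ge0 //.
apply: mx_norm_le; first by rewrite sqrtr_ge0.
move=> i j; rewrite ord1 -sqrtr_sqr ler_sqrt ?dot_ge0 //.
by rewrite /dot (bigD1 j) //= -expr2 lerDl sumr_ge0 // => k _; rewrite -expr2 sqr_ge0.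
Qed.

Lemma nbhs_sphere (x : S) (A : set S) : nbhs x A -> exists2 d : R, 0 < d & forall y, `|sv y - sv x| < d -> A y.
Proof.
rewrite /nbhs /= => -[_ [[W oW <-] Wx] WA].
have [d d0 Hd] := open_cball oW Wx.
by exists d => // y yd; apply: WA; apply: Hd; rewrite /cball /= ltW.
Qed.

Lemma sphere_ball_nbhs (x : S) (d : R) : 0 < d -> \forall y \near x, `|sv y - sv x| < d.
Proof.
move=> d0; have /cvgrPdist_lt/(_ _ d0) := @sv_continuous R m x.
by apply: filterS => y; rewrite distrC.
Qed.

Lemma sphere_ball_open (y : S) z (d : R) : `|sv y - z| < d -> \forall y' \near y, `|sv y' - z| < d.
Proof.
move=> yd; have n2 : \forall y' \near y, `|sv y' - sv y| < d - `|sv y - z| by apply: sphere_ball_nbhs; rewrite subr_gt0.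
apply: filterS n2 => y' zy; rewrite -(subrKA (sv y)); apply: le_lt_trans (ler_normD _ _) _.
by rewrite -ltrBrDr.
Qed.

Section Local.
(** Local inverse of a spherical map, as a local isometry from a piece of the
    sphere. *)
Lemma local_section s (q : Psi) (A : set Psi) : spherical_at s q -> nbhs q A -> exists (g : S -> Psi) (r : R) (O : set Psi),
  [/\ 0 < r, open O, O q /\ O `<=` A, forall p p', O p -> O p' -> s p = s p' -> p = p' &
   forall y, `|sv y - s q| < r -> [/\ O (g y), s (g y) = sv y & local_isometry_at g y]].
Proof.
move=> Hs nA; have [B1 [nO1 iO]] := spherical_at_inj cPsi Hs.
have nO2 : nbhs q (B1 `&` A `&` [set p | spherical_at s p]).
  by apply: filterI; [exact: filterI|exact: spherical_at_near rPsi Hs].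
have [B [oO Oq HO]] := nearP nO2.
have nO : nbhs q B by exact: open_nbhs_nbhs.
have iO' p p' : B p -> B p' -> s p = s p' -> p = p'.
  by move=> /HO[[a _] _] /HO[[b _] _]; exact: iO.
have [r r0 Hr] := spherical_at_surj cPsi Hs nO.
pose g (y : S) := xget q [set p | B p /\ s p = sv y].
have gP y : `|sv y - s q| < r -> B (g y) /\ s (g y) = sv y.
  move=> yr; have [p Op sp] := Hr _ (sv1 y) yr.
  by rewrite /g; case: xgetP => [z _ []//|/(_ p)]; case.
have cg y : `|sv y - s q| < r -> {for y, continuous g}.
  move=> yr A' nA'; have [Og sg] := gP y yr; have [_ spg] := HO _ Og.
  have nAO : nbhs (g y) (A' `&` B) by apply: filterI => //; exact: open_nbhs_nbhs.
  have [r' r0' Hr'] := spherical_at_surj cPsi spg nAO.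
  have n1 : \forall z \near y, `|sv z - sv y| < r' by exact: sphere_ball_nbhs.
  have n2 : \forall z \near y, `|sv z - sv y| < r - `|sv y - s q| by apply: sphere_ball_nbhs; rewrite subr_gt0.
  have : \forall z \near y, A' (g z); last by [].
  near=> z.
  have zr : `|sv z - s q| < r.
    rewrite -(subrKA (sv y)); apply: le_lt_trans (ler_normD _ _) _.
    by rewrite -ltrBrDr; near: z.
  have [Ogz sgz] := gP z zr.
  have [|p [A'p Op] sp] := Hr' _ (sv1 z).
    by rewrite sg; near: z.
  by rewrite (_ : g z = p) //; apply: iO' => //; rewrite sgz sp.
exists g, r, B; split => //; first by split=> // p /HO[[]].
move=> y yr; have [Og sg] := gP y yr; split => //.
apply: (local_isometry_ex (s := s) cPsi).
- by apply: filterS (sphere_ball_open yr) => z /cg.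
- by have [] := HO _ Og.
- apply: (@spherical_at_ext R m S (@sv R m) (s \o g) y); last exact: spherical_sv.
  by apply: filterS (sphere_ball_open yr) => z zr /=; have [_ ->] := gP z zr.
Unshelve. all: by end_near. Qed.

(** Composing with a suitable orthogonal matrix turns any spherical map at [h x]
    into an inverse of [h]. *)
Lemma adjusted_spherical (h : S -> Psi) x : local_isometry_at h x ->
  exists s, spherical_at s (h x) /\ \forall y \near x, s (h y) = sv y.
Proof.
move=> Lh; have [s Hs] := exPsi (h x).
have [C [CC EC]] := local_isometry_linear Lh Hs.
have CC' : C^T *m C^T^T = 1%:M by rewrite trmxK; apply/mulmx1C.
exists (fun p => s p *m C^T); split; first exact: spherical_at_orth.
by apply: filterS EC => y ->; rewrite -mulmxA CC mulmx1.
Qed.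
End Local.

Variable (v : S).
Local Notation vE := (sv v).

(** For b from 0 to infinity this runs through the great circle arc from [x] to
    [v], which is not reached.  Star-shapedness about [v] is closure under
    [ray], a condition that needs no bounds on the parameter. *)
Definition ray (x : S) (b : R) : S := nr (sv x + b *: vE).

Lemma ray_neq0 x (b : R) : sv x != - vE -> 0 <= b -> sv x + b *: vE != 0.
Proof.
move=> xv b0; apply/negP => /eqP e.
have e1 : sv x = - (b *: vE) by apply/eqP; rewrite -addr_eq0 e.
have : dot (sv x) (sv x) = b * b by rewrite e1 dotNl dotNr opprK dotZl dotZr sv1; ring.
rewrite sv1 => /esym/eqP; rewrite -expr2 sqrf_eq1 => /orP[/eqP b1|/eqP b1].
  by rewrite e1 b1 scale1r eqxx in xv.
by move: b0; rewrite b1 lerNr oppr0 ler10.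
Qed.

Lemma ray0 x : ray x 0 = x.
Proof. by rewrite /ray scale0r addr0 nr_sv. Qed.

Lemma ray_neqN x (b : R) : sv x != - vE -> 0 <= b -> sv (ray x b) != - vE.
Proof.
move=> xv b0; have h := ray_neq0 xv b0; have [c c0 e] := sv_nrP h.
rewrite /ray e; apply/negP => /eqP e1.
have := ray_neq0 xv (addr_ge0 b0 (ltW (_ : 0 < c^-1))); rewrite invr_gt0 => /(_ c0).
by rewrite scalerDl addrA -[sv x + _](scalerK (lt0r_neq0 c0)) e1 scalerN addNr eqxx.
Qed.

Lemma ray_ray x (b : R) : sv x != - vE -> 0 <= b -> exists2 c : R, 0 < c & forall b', ray (ray x b) b' = ray x (b + c * b').
Proof.
move=> xv b0; have h := ray_neq0 xv b0; have [c c0 e] := sv_nrP h.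
exists c^-1; first by rewrite invr_gt0.
move=> b''; rewrite {1}/ray -/(ray x b) e /ray -(nrZ (c *: (sv x + b *: vE) + b'' *: vE) (_ : 0 < c^-1)) ?invr_gt0 //; congr nr.
apply/rowP => i; rewrite !mxE; field; by rewrite gt_eqF.
Qed.

Lemma ray_continuous x (b : R) : sv x != - vE -> 0 <= b -> {for b, continuous (ray x)}.
Proof.
move=> xv b0; apply: (@continuous_comp _ _ _ (fun b : R => sv x + b *: vE) (@nr R m)).
  apply: (continuous_add_for (V := E) (a := fun=> sv x)); first exact: cst_continuous.
  by apply: (continuous_scale (a := id)); [exact: cvg_id|exact: cst_continuous].
exact/nr_continuous/ray_neq0.
Qed.

Lemma ray_continuous_l x (b : R) : sv x != - vE -> 0 <= b -> {for x, continuous (fun y => ray y b)}.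
Proof.
move=> xv b0; apply: (@continuous_comp _ _ _ (fun y : S => sv y + b *: vE) (@nr R m)).
  apply: (continuous_add_for (V := E) (b := fun=> b *: vE)); [exact: sv_continuous|exact: cst_continuous].
exact/nr_continuous/ray_neq0.
Qed.

(** The same arc from [v] to [x], parametrized by [0, 1]. *)
Definition seg (x : S) (t : R) : S := nr (t *: sv x + (1 - t) *: vE).

Lemma seg0 x : seg x 0 = v.
Proof. by rewrite /seg scale0r add0r subr0 scale1r nr_sv. Qed.

Lemma seg1 x : seg x 1 = x.
Proof. by rewrite /seg subrr scale0r addr0 scale1r nr_sv. Qed.

Lemma seg_ray x (t : R) : 0 < t <= 1 -> seg x t = ray x ((1 - t) / t).
Proof.
move=> /andP[t0 t1]; rewrite /ray -(nrZ _ t0) /seg scalerDr scalerA mulrCA mulfV ?gt_eqF //.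
by rewrite mulr1.
Qed.

Lemma seg_neq0 x (t : R) : sv x != - vE -> 0 <= t <= 1 -> t *: sv x + (1 - t) *: vE != 0.
Proof.
move=> xv /andP[]; rewrite le_eqVlt => /orP[/eqP <- _|t0 t1].
  by rewrite scale0r add0r subr0 scale1r sv_neq0.
have := @ray_neq0 x ((1 - t) / t) xv; rewrite divr_ge0 ?subr_ge0 ?(ltW t0) // => /(_ isT).
apply: contra => /eqP/(congr1 ( *:%R t^-1)); rewrite scaler0 scalerDr !scalerA mulVf ?gt_eqF // scale1r mulrC => ->.
by [].
Qed.

Lemma seg_continuous x (t : R) : sv x != - vE -> 0 <= t <= 1 -> {for t, continuous (seg x)}.
Proof.
move=> xv t01; apply: (@continuous_comp _ _ _ (fun t : R => t *: sv x + (1 - t) *: vE) (@nr R m)).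
  apply: (continuous_add_for (V := E) (a := fun t : R => t *: sv x)).
    by apply: (continuous_scale (a := id)); [exact: cvg_id|exact: cst_continuous].
  apply: (continuous_scale (a := fun t : R => 1 - t)); last exact: cst_continuous.
  by apply: (continuous_sub_for (V := R) (a := fun=> 1)); [exact: cst_continuous|exact: cvg_id].
exact/nr_continuous/seg_neq0.
Qed.

Lemma continuous_path (T : topologicalType) (c : R -> T) t A : {for t, continuous c} -> nbhs (c t) A ->
  exists2 e : R, 0 < e & forall s, 0 <= s <= 1 -> `|s - t| < e -> A (c s).
Proof.
move=> cc /cc /nbhs_ballP[e /= e0 He]; exists e => // s _ se; apply: He; by rewrite /ball /= distrC.
Qed.

(** Star-shaped about [v]; the antipode of [v] is excluded as it has no
    well-defined arc to [v]. *)
Definition star (N : set S) := [/\ N v, forall x, N x -> sv x != - vE & forall x b, N x -> 0 <= b -> N (ray x b)].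

Lemma star_seg N x t : star N -> N x -> 0 <= t <= 1 -> N (seg x t).
Proof.
move=> [Nv _ Nr] Nx /andP[]; rewrite le_eqVlt => /orP[/eqP <- _|t0 t1]; first by rewrite seg0.
by rewrite seg_ray ?t0 //; apply: Nr => //; rewrite divr_ge0 ?subr_ge0 ?(ltW t0).
Qed.

Variable h0 : S -> Psi.

(** The sets over which the germ of [h0] at [v] has been continued along arcs.
    Star-shapedness makes two continuations agree on the intersection of their
    domains. *)
Definition good (N : set S) (h : S -> Psi) :=
  [/\ open N, star N, forall x, N x -> local_isometry_at h x & agree_near h h0 v].

(** Rigidity along the arc from [v] to [x]. *)
Lemma star_agree N (h h' : S -> Psi) x : star N -> N x -> (forall x, N x -> local_isometry_at h x) ->
  (forall t, 0 <= t <= 1 -> local_isometry_at h' (seg x t)) -> agree_near h h' v -> agree_near h h' x.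
Proof.
move=> sN Nx Lh Lh' a0; rewrite -(seg1 x).
have [_ Nn _] := sN; have xv := Nn x Nx.
apply: (path_rigidity (c := seg x) cS cPsi hPsi exPsi).
- by move=> t A t01 nA; apply: continuous_path => //; exact: seg_continuous.
- by move=> t t01; split; [apply: Lh; exact: star_seg|exact: Lh'].
- by rewrite seg0.
Qed.

Lemma good_agree N h N' h' x : good N h -> good N' h' -> N x -> N' x -> h x = h' x.
Proof.
move=> [oN sN LN aN] [oN' sN' LN' aN'] Nx Nx'.
apply: (@nbhs_singleton _ x [set y | h y = h' y]); apply: (star_agree sN Nx LN).
  by move=> t t01; apply: LN'; exact: star_seg.
by near=> y; rewrite (near aN y) // (near aN' y).
Unshelve. all: by end_near. Qed.

(** The largest set over which the germ continues along arcs. *)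
Definition dom : set S := [set x | exists N h, good N h /\ N x].

(** All continuations glued together. *)
Definition dev (x : S) : Psi := xget (h0 x) [set p | exists N h, [/\ good N h, N x & p = h x]].

Lemma devE N h x : good N h -> N x -> dev x = h x.
Proof.
move=> gN Nx; rewrite /dev; case: xgetP => [p _ [N' [h' [gN' Nx' ->]]]|/(_ (h x))].
  exact: good_agree gN' gN Nx' Nx.
by case; exists N, h.
Qed.

Hypothesis Lh0 : local_isometry_at h0 v.

Lemma dot_ray x (b : R) : 0 <= dot (sv x) vE -> 0 <= b -> dot (sv x) vE <= dot (sv (ray x b)) vE.
Proof.
move=> d0 b0.
have xv : sv x != - vE by apply/negP => /eqP e; move: d0; rewrite e dotNl sv1 lerNr oppr0 ler10.
have h := ray_neq0 xv b0; rewrite /ray sv_nr // /nrE dotZl.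
have s0 := sqrt_dot_gt0 h; rewrite mulrC ler_pdivlMr //.
set d := dot (sv x) vE in d0 *.
have -> : dot (sv x + b *: vE) (sv x + b *: vE) = 1 + 2 * b * d + b ^+ 2.
  by rewrite !(dotDl, dotDr, dotZl, dotZr) !sv1 (dotC vE) -/d; ring.
have -> : dot (sv x + b *: vE) vE = d + b by rewrite dotDl dotZl sv1 mulr1.
have d1 : d ^+ 2 <= 1.
  have := dot_ge0 (sv x - d *: vE); rewrite dot_sub_sqr !(dotZl, dotZr) !sv1 -/d; lra.
rewrite -(@ler_sqr _ (_ * _)) ?nnegrE ?mulr_ge0 ?addr_ge0 ?sqrtr_ge0 //.
have p : 0 <= 1 + 2 * b * d + b ^+ 2 by rewrite !addr_ge0 ?mulr_ge0 ?sqr_ge0.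
rewrite exprMn sqr_sqrtr // -subr_ge0.
rewrite (_ : _ - _ = (1 - d ^+ 2) * (2 * b * d + b ^+ 2)); last by ring.
by rewrite mulr_ge0 ?subr_ge0 // addr_ge0 ?mulr_ge0 ?sqr_ge0.
Qed.

(** Spherical caps around [v] are star-shaped. *)
Lemma good_init : exists N, good N h0.
Proof.
have [r r0 Hr] := nbhs_sphere (local_isometry_near Lh0).
pose c := Num.max 0 (1 - r ^+ 2 / 2).
have c0 : 0 <= c by rewrite /c le_max lexx.
have c1 : c < 1 by rewrite /c gt_max ltr01 /= ltrBlDr ltrDl divr_gt0 // exprn_gt0.
exists [set x | c < dot (sv x) vE]; split.
- rewrite (_ : [set x | _] = [set x | setT x /\ [set a : R | c < a] (dot (sv x) vE)]); last first.
    by apply/seteqP; split=> [x|x []].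
  apply: (@open_preim_for _ _ (fun x => dot (sv x) vE) setT [set a | c < a]); [exact: openT|exact: open_gt|].
  by move=> x _; apply: dot_continuous; [exact: sv_continuous|exact: cst_continuous].
- split=> [|x /= xc|x b /= xc b0]; first by rewrite /= sv1.
    apply/negP => /eqP e; move: xc; rewrite e dotNl sv1 => /(le_lt_trans c0).
    by rewrite ltrNr oppr0 ltr10.
  by have d0 := ltW (le_lt_trans c0 xc); exact: lt_le_trans xc (dot_ray d0 b0).
- move=> x /= xc; apply: Hr; rewrite -(@ltr_sqr _ `|_| r) ?nnegrE ?(ltW r0) //.
  apply: le_lt_trans (sphere_dist_dot _ _) _.
  have : 1 - r ^+ 2 / 2 <= c by rewrite /c le_max lexx orbT.
  lra.
- exact: agree_near_refl.
Qed.

Lemma good_dom : good dom dev.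
Proof.
have [N0 g0] := good_init; have [oN0 [N0v _ _] _ _] := g0.
split.
- rewrite (_ : dom = \bigcup_(Nh in [set Nh : set S * (S -> Psi) | good Nh.1 Nh.2]) Nh.1); last first.
    apply/seteqP; split=> [x [N [h [g Nx]]]|x [[N h] /= g Nx]]; last by exists N, h.
    by exists (N, h).
  by apply: bigcup_open => -[N h] /= [].
- split=> [|x [N [h [[_ [_ Nn _] _ _] Nx]]]|x b [N [h [g Nx]]] b0]; first by exists N0, h0.
    exact: Nn.
  by exists N, h; split => //; have [_ [_ _ Nr] _ _] := g; exact: Nr.
- move=> x [N [h [g Nx]]]; have [oN _ LN _] := g.
  apply: local_isometry_ext (LN x Nx).
  have nN : \forall y \near x, N y by exact: open_nbhs_nbhs.
  by apply: filterS nN => y Ny; rewrite (devE g Ny).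
- have nN : \forall y \near v, N0 y by exact: open_nbhs_nbhs.
  by apply: filterS nN => y Ny; rewrite (devE g0 Ny).
Qed.

Lemma good_sub N h : good N h -> N `<=` dom.
Proof. by move=> g x Nx; exists N, h. Qed.

Lemma dom_ray x b : dom x -> 0 <= b -> dom (ray x b).
Proof. by have [_ [_ _ H] _ _] := good_dom; exact: H. Qed.

Lemma dom_v : dom v. Proof. by have [_ [H _ _] _ _] := good_dom. Qed.

Lemma open_dom : open dom. Proof. by have [H _ _ _] := good_dom. Qed.

Lemma near_dom x : dom x -> \forall y \near x, dom y.
Proof. by move=> Dx; apply: open_nbhs_nbhs; split => //; exact: open_dom. Qed.

Lemma dom_neqN x : dom x -> sv x != - vE.
Proof. by have [_ [_ H _] _ _] := good_dom; exact: H. Qed.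

Lemma dev_local x : dom x -> local_isometry_at dev x.
Proof. by have [_ _ H _] := good_dom; exact: H. Qed.

Lemma norm_sv_le (x : S) : `|sv x| <= 1.
Proof.
apply: mx_norm_le => // i j; rewrite ord1 -(@ler_sqr _ _ 1) ?nnegrE // expr1n -(sv1 x) /dot (bigD1 j) //= -expr2 real_normK ?num_real //.
by rewrite lerDl sumr_ge0 // => k _; rewrite -expr2 sqr_ge0.
Qed.

(** Convergence along a single ray suffices.  Choose a spherical map s at the
    limit q that inverts [dev] along the ray.  Its local inverse g continues
    [dev] to a neighbourhood of x; the union of the domain with all arcs to v
    that start near x is again star-shaped and open, and carries the
    continuation given by [dev] and g. *)
Lemma extension x (q : Psi) : sv x != - vE -> (forall b, 0 < b -> dom (ray x b)) ->
  (forall A : set Psi, nbhs q A -> exists2 d : R, 0 < d & forall b, 0 < b < d -> A (dev (ray x b))) ->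
  dom x.
Proof.
move=> xv Dx Hq.
have [s0 Hs0] := exPsi q.
have [d d0 Hd] := Hq _ (spherical_at_near rPsi Hs0).
pose b1 := d / 2.
have b10 : 0 < b1 by rewrite divr_gt0.
have b1d : b1 < d by rewrite /b1; lra.
have [C [CC EC]] := local_isometry_linear (dev_local (Dx _ b10)) (Hd b1 (introT andP (conj b10 b1d))).
have CC' : C^T *m C^T^T = 1%:M by rewrite trmxK; apply/mulmx1C.
(* Normalized in this way, s inverts dev near one point of the ray, hence
   along the ray by rigidity. *)
pose s p := s0 p *m C^T.
have Hs : spherical_at s q by exact: spherical_at_orth.
have Hsb b : 0 < b < d -> spherical_at s (dev (ray x b)) by move=> /Hd; exact: spherical_at_orth.
have key b : 0 < b < d -> \forall y \near ray x b, s (dev y) = sv y.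
  move=> /andP[bp bd].
  pose f := @mkS R m \o s \o dev.
  pose c (t : R) := ray x (b1 + t * (b - b1)).
  have cb t : 0 <= t <= 1 -> 0 < b1 + t * (b - b1) < d.
    by move=> /andP[t0 t1]; apply/andP; have [bb|bb] := leP b b1; split; nra.
  have fE b' : 0 < b' < d -> \forall y \near ray x b', sv (f y) = s (dev y).
    move=> b'd; have [cd _] := dev_local (Dx b' (andP b'd).1).
    have := near_comp (nbhs_singleton cd) (spherical_at_unit cPsi (Hsb b' b'd)).
    by apply: filterS => y [u _]; rewrite /f /= sv_mkS.
  have Lf b' : 0 < b' < d -> local_isometry_at f (ray x b').
    move=> b'd; have Ld := dev_local (Dx b' (andP b'd).1); have [cd sd] := Ld.
    have sp := sd _ (Hsb b' b'd).
    apply: (@local_isometry_ex R m S S f (ray x b') (@sv R m) cS).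
    - have e := nbhs_interior (fE b' b'd).
      have cs := near_comp (nbhs_singleton cd) (spherical_at_unit cPsi (Hsb b' b'd)).
      near=> y; apply: continuous_sphere.
      have ey : \forall z \near y, (s \o dev) z = (@sv R m \o f) z.
        have : \forall z \near y, sv (f z) = s (dev z) by near: y.
        by apply: filterS => z e'; rewrite /= e'.
      apply: (continuous_near_ext ey); apply: continuous_comp; first by near: y.
      have [] : dot (s (dev y)) (s (dev y)) = 1 /\ {for dev y, continuous s} by near: y.
      by [].
    - exact: spherical_sv.
    - apply: spherical_at_ext sp; apply: filterS (fE b' b'd) => y; exact: esym.
  have E1 : ray x b = c 1 by rewrite /c mul1r subrKC.
  have : agree_near f id (c 1).
    apply: (path_rigidity (c := c) cS cS (@hausdorff_sphere R m)).
    - by move=> y; exists (@sv R m); exact: spherical_sv.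
    - move=> t A t01 nA; apply: continuous_path => //.
      apply: (@continuous_comp _ _ _ (fun t : R => b1 + t * (b - b1)) (ray x)).
        apply: (continuous_add_for (V := R) (a := fun=> b1)); first exact: cst_continuous.
        by apply: (continuous_mul_for (a := id)); [exact: cvg_id|exact: cst_continuous].
      by apply: ray_continuous => //; have /andP[/ltW] := cb t t01.
    - move=> t t01; split; [exact: Lf (cb t t01)|exact: local_isometry_id].
    - rewrite /c mul0r addr0.
      have h1 := fE b1; rewrite b10 b1d in h1; have {}h1 := h1 isT.
      near=> y; apply: sv_inj; rewrite (near h1 y) // /s (near EC y) //.
      by rewrite -mulmxA CC mulmx1.
  rewrite -E1 => a1; have h1 := fE b (introT andP (conj bp bd)).
  near=> y; rewrite -(near h1 y) //; congr sv; by near: y.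
have sq : s q = sv x.
  have [_ csq] := nbhs_singleton (spherical_at_unit cPsi Hs).
  apply/eqP; rewrite -subr_eq0 -normr_le0; apply/ler_addgt0Pr => e e0; rewrite add0r.
  have e2 : 0 < e / 2 by rewrite divr_gt0.
  have n1 : \forall p \near q, `|s q - s p| < e / 2 by move/cvgrPdist_lt: csq => /(_ _ e2).
  have [d1 d10 H1] := Hq _ n1.
  have n2 : \forall b \near (0 : R), `|sv (ray x b) - sv x| < e / 2.
    apply: (near_comp (ray_continuous xv (lexx _)) (P := fun y => `|sv y - sv x| < e / 2)).
    by rewrite ray0; exact: sphere_ball_nbhs.
  have /nbhs_ballP[d2 /= d20 H2] := n2.
  pose b := Num.min d (Num.min d1 d2) / 2.
  have [bb0 bb1 bb2 bb3] : [/\ 0 < b, b < d, b < d1 & b < d2].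
    have : Num.min d (Num.min d1 d2) <= d /\ Num.min d (Num.min d1 d2) <= d1 /\ Num.min d (Num.min d1 d2) <= d2.
      by rewrite !ge_min !lexx /= !orbT.
    have : 0 < Num.min d (Num.min d1 d2) by rewrite !lt_min d0 d10.
    by rewrite /b; move=> ? [? [? ?]]; split; lra.
  rewrite -(subrKA (s (dev (ray x b)))) (splitr e); apply: le_trans (ler_normD _ _) _; apply: lerD; apply: ltW.
    by apply: H1; rewrite bb0.
  have kb : s (dev (ray x b)) = sv (ray x b) by apply: (nbhs_singleton (key b _)); rewrite bb0.
  by rewrite kb; apply: H2; rewrite /ball /= sub0r normrN gtr0_norm.
have [g [r [B [r0 oB [Bq _] iB gP]]]] := local_section Hs (@filterT _ _ _).
have nO : nbhs q B by exact: open_nbhs_nbhs.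
rewrite sq in gP.
have [d2 d20 Hd2] := Hq _ nO.
have [eta eta0 Heta] : exists2 eta : R, 0 < eta & forall z, `|z - sv x| < eta -> `|sv (nr z) - sv x| < r.
  have cn := nr_continuous (sv_neq0 x).
  have : \forall z \near sv x, `|sv (nr z) - sv x| < r.
    apply: (near_comp cn (P := fun y => `|sv y - sv x| < r)).
    by rewrite nr_sv; exact: sphere_ball_nbhs.
  move=> /nearP[B' [oB' Bx HB]]; have [eta eta0 He] := open_cball oB' Bx.
  by exists eta => // z ze; apply: HB; apply: He; rewrite /cball /= ltW.
pose be := Num.min (Num.min d d2) eta / 2.
have [be0 bed bed2 bee] : [/\ 0 < be, be < d, be < d2 & be <= eta / 2].
  have : Num.min (Num.min d d2) eta <= d /\ Num.min (Num.min d d2) eta <= d2 /\ Num.min (Num.min d d2) eta <= eta.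
    by rewrite !ge_min !lexx /= !orbT.
  have : 0 < Num.min (Num.min d d2) eta by rewrite !lt_min d0 d20.
  by rewrite /be; move=> ? [? [? ?]]; split; lra.
have rayr y b : `|sv y - sv x| < eta / 2 -> 0 <= b <= be -> `|sv (ray y b) - sv x| < r.
  move=> ye /andP[bg bl]; apply: Heta; rewrite addrAC.
  apply: le_lt_trans (ler_normD _ _) _; rewrite normrZ (ger0_norm bg).
  have := norm_sv_le v; have := normr_ge0 vE; set a := `|vE|; move: ye; set a' := `|_ - _| => *; nra.
have agx : agree_near dev g (ray x be).
  have h1 := key be; rewrite be0 bed in h1; have {}h1 := h1 isT.
  have [cd _] := dev_local (Dx be be0).
  have h2 : \forall y \near ray x be, B (dev y).
    apply: (near_comp (nbhs_singleton cd)); apply: open_nbhs_nbhs; split => //.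
    by apply: Hd2; rewrite be0.
  have h3 : \forall y \near ray x be, `|sv y - sv x| < r.
    by apply: sphere_ball_open; apply: rayr; rewrite ?subrr ?normr0 ?divr_gt0 // lexx (ltW be0).
  near=> y.
  have yr : `|sv y - sv x| < r by near: y.
  have [Og sg _] := gP y yr.
  by apply: iB => //; [near: y|rewrite sg; near: y].
have nB' : \forall y \near x, [/\ sv y != - vE, `|sv y - sv x| < eta / 2, dom (ray y be) & agree_near dev g (ray y be)].
  have n1 := near_comp (ray_continuous_l xv (ltW be0)) (near_dom (Dx be be0)).
  have n2 := near_comp (ray_continuous_l xv (ltW be0)) (nbhs_interior agx).
  have n3 : \forall y \near x, `|sv y - sv x| < eta / 2 by apply: sphere_ball_nbhs; rewrite divr_gt0.
  have n4 : \forall y \near x, `|sv y - sv x| < `|sv x + vE|.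
    by apply: sphere_ball_nbhs; rewrite normr_gt0 addr_eq0.
  near=> y; split; [|by near: y|by near: y|by near: y].
  apply/negP => /eqP e; have : `|sv y - sv x| < `|sv x + vE| by near: y.
  by rewrite e -opprD normrN addrC ltxx.
have [B' [oB' B'x HB']] := nearP nB'.
(* all arcs to v that start in B', up to but not including v *)
pose N1 := [set w : S | exists b : R, [/\ 0 <= b, sv w - b *: vE != 0 & B' (nr (sv w - b *: vE))]].
have N1P w : N1 w <-> exists y b', [/\ B' y, 0 <= b' & w = ray y b'].
  split=> [[b [bg z0 By]]|[y [b' [By b'0 ->]]]].
    have [c c0 e] := sv_nrP z0; exists (nr (sv w - b *: vE)), (c * b); split => //.
      by rewrite mulr_ge0 // ltW.
    by rewrite /ray e -scalerA -scalerDr subrK nrZ // nr_sv.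
  have [yv _ _ _] := HB' y By.
  have [c c0 e] := sv_nrP (ray_neq0 yv b'0); exists (c * b').
  have E1 : sv (ray y b') - (c * b') *: vE = c *: sv y.
    by rewrite /ray e scalerDr scalerA addrK.
  by rewrite E1 nrZ // nr_sv scaler_eq0 (negbTE (sv_neq0 y)) orbF gt_eqF // mulr_ge0 // ltW.
have oz : open [set z : E | z != 0].
  rewrite (_ : [set z | _] = [set z : E | setT z /\ [set a : R | 0 < a] (dot z z)]); last first.
    by apply/seteqP; split=> [z|z []] /=; rewrite dot_gt0.
  apply: (@open_preim_for _ _ (fun z : E => dot z z) setT [set a | 0 < a]); [exact: openT|exact: open_gt|].
  by move=> z _; apply: dot_continuous; exact: cvg_id.
have oN1 : open N1.
  rewrite (_ : N1 = \bigcup_(b in [set b : R | 0 <= b]) [set w | setT w /\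
      [set z : E | [set z : E | z != 0] z /\ B' (nr z)] (sv w - b *: vE)]); last first.
    by apply/seteqP; split=> [w [b [? ? ?]]|w [b ? [_ [? ?]]]]; exists b.
  apply: bigcup_open => b _; apply: (@open_preim_for _ _ (fun w : S => sv w - b *: vE)); first exact: openT.
    by apply: (@open_preim_for _ _ (@nr R m)) => // z; exact: nr_continuous.
  move=> w _; apply: (continuous_sub_for (V := E)); [exact: sv_continuous|exact: cst_continuous].
pose h' w := if `[< dom w >] then dev w else g w.
have domray y b b' : B' y -> 0 <= b -> b <= b' -> dom (ray y b) -> dom (ray y b').
  move=> By bg bb' Db; have [yv _ _ _] := HB' y By.
  have [c c0 e] := ray_ray yv bg.
  have -> : ray y b' = ray (ray y b) ((b' - b) / c).
    by rewrite e mulrCA mulfV ?gt_eqF // mulr1 subrKC.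
  by apply: dom_ray => //; rewrite divr_ge0 ?subr_ge0 // ltW.
have agree1 y b : B' y -> 0 <= b -> b <= be -> dom (ray y b) -> dev (ray y b) = g (ray y b).
  move=> By bg bl Db; have [yv ye Dbe a] := HB' y By.
  pose c (t : R) := ray y (be + t * (b - be)).
  have cb t : 0 <= t <= 1 -> b <= be + t * (b - be) <= be.
    by move=> /andP[t0 t1]; apply/andP; split; nra.
  have E1 : ray y b = c 1 by rewrite /c mul1r subrKC.
  have : agree_near dev g (c 1); last by rewrite -E1 => /nbhs_singleton.
  apply: (path_rigidity (c := c) cS cPsi hPsi exPsi).
  - move=> t A t01 nA; apply: continuous_path => //.
    apply: (@continuous_comp _ _ _ (fun t : R => be + t * (b - be)) (ray y)).
      apply: (continuous_add_for (V := R) (a := fun=> be)); first exact: cst_continuous.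
      by apply: (continuous_mul_for (a := id)); [exact: cvg_id|exact: cst_continuous].
    by apply: ray_continuous => //; have /andP[/(le_trans bg)] := cb t t01.
  - move=> t t01; have /andP[c1 c2] := cb t t01; split.
      by apply: dev_local; exact: domray c1 Db.
    by have [] := gP (c t) _; rewrite // /c; apply: rayr => //; rewrite c2 (le_trans bg).
  - by rewrite /c mul0r addr0.
have gN : good (dom `|` N1) h'.
  split.
  - by apply: openU => //; exact: open_dom.
  - split=> [|w [/dom_neqN //|/N1P[y [b' [By b'0 ->]]]]|w b [Dw|/N1P[y [b' [By b'0 ->]]]] bg].
    + by left; exact: dom_v.
    + by have [yv _ _ _] := HB' y By; exact: ray_neqN.
    + by left; exact: dom_ray.
    + right; apply/N1P; have [yv _ _ _] := HB' y By; have [c c0 ->] := ray_ray yv b'0.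
      by exists y, (b' + c * b); split => //; rewrite addr_ge0 // mulr_ge0 // ltW.
  - move=> w Nw; have [Dw|nDw] := pselect (dom w).
      apply: local_isometry_ext (dev_local Dw).
      by apply: filterS (near_dom Dw) => y Dy; rewrite /h' asboolT.
    case: Nw => // -[b [bg z0 By]].
    pose cc (w' : S) := (Num.sqrt (dot (sv w' - b *: vE) (sv w' - b *: vE)))^-1.
    have wE w' : sv w' - b *: vE != 0 -> w' = ray (nr (sv w' - b *: vE)) (cc w' * b).
      move=> w0; rewrite /ray sv_nr // /nrE -/(cc w') -scalerA -scalerDr subrK nrZ ?nr_sv //.
      by rewrite invr_gt0 sqrt_dot_gt0.
    have cc0 w' : sv w' - b *: vE != 0 -> 0 <= cc w' * b.
      by move=> w0; rewrite mulr_ge0 // invr_ge0 sqrtr_ge0.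
    have ccw : cc w * b < be.
      rewrite ltNge; apply/negP => h; apply: nDw; rewrite (wE w z0).
      have [_ _ Dbe _] := HB' _ By; exact: domray (ltW be0) h Dbe.
    have csub : {for w, continuous (fun w' : S => sv w' - b *: vE)}.
      by apply: (continuous_sub_for (V := E)); [exact: sv_continuous|exact: cst_continuous].
    have n1 : \forall w' \near w, sv w' - b *: vE != 0.
      have nz : nbhs (sv w - b *: vE) [set z : E | z != 0] by apply: open_nbhs_nbhs; split.
      exact: (csub _ nz).
    have n2 : \forall w' \near w, B' (nr (sv w' - b *: vE)).
      have nz : nbhs (sv w - b *: vE) [set z : E | B' (nr z)].
        by apply: (near_comp (nr_continuous z0)); exact: open_nbhs_nbhs.
      exact: (csub _ nz).
    have ccc : {for w, continuous (fun w' => cc w' * b)}.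
      apply: (continuous_mul_for (b := fun=> b)); last exact: cst_continuous.
      apply: (continuous_inv_for (a := fun w' : S => Num.sqrt (dot (sv w' - b *: vE) (sv w' - b *: vE)))).
        by rewrite gt_eqF // sqrt_dot_gt0.
      apply: (@continuous_comp _ _ _ (fun w' : S => dot (sv w' - b *: vE) (sv w' - b *: vE)) Num.sqrt); last exact: sqrt_continuous.
      exact: dot_continuous.
    have n3 : \forall w' \near w, cc w' * b < be by apply: (cvgr_lt _ ccc).
    have wr : `|sv w - sv x| < r.
      have [_ ye _ _] := HB' _ By; rewrite (wE w z0); apply: rayr => //.
      by rewrite (ltW ccw) andbT cc0.
    have [_ _ Lg] := gP w wr; apply: local_isometry_ext Lg.
    near=> w'; rewrite /h'; case: asboolP => // Dw'.
    have z'0 : sv w' - b *: vE != 0 by near: w'.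
    have By' : B' (nr (sv w' - b *: vE)) by near: w'.
    have lt' : cc w' * b < be by near: w'.
    by move: Dw'; rewrite (wE w' z'0) => Dw'; apply/esym; apply: agree1 => //; [exact: cc0|exact: ltW].
  - have [_ _ _ a] := good_dom; have nv := near_dom dom_v.
    near=> y; rewrite /h' asboolT; last by near: y.
    by near: y.
apply: (good_sub gN); right; apply/N1P; exists x, 0; split => //; by rewrite ray0.
Unshelve. all: by end_near. Qed.

(** If x were not in the domain, let b be the largest parameter for which the
    ray is not; along the rest of the ray [dev] is given by [gam] and thus
    converges.  The agreement of [dev] and [gam] is asked beyond such a b only,
    where the ray lies in the domain and rigidity provides it. *)
Lemma ray_lemma x (gam : R -> Psi) : sv x != - vE ->
  (forall b (A : set Psi), 0 <= b -> nbhs (gam b) A -> exists2 d : R, 0 < d & forall b', b < b' < b + d -> A (gam b')) ->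
  (forall b, 0 <= b -> (forall b', b < b' -> dom (ray x b')) -> forall b', b < b' -> dev (ray x b') = gam b') ->
  dom x.
Proof.
move=> xv cg ag.
have [//|nDx] := pselect (dom x).
pose T := [set b : R | 0 <= b /\ ~ dom (ray x b)].
have T0 : T 0 by split => //; rewrite ray0.
(* far along the ray one is close to v *)
have bT : has_ubound T.
  have nv : \forall z \near vE, dom (nr z).
    by apply: (near_comp (nr_continuous (sv_neq0 v))); rewrite nr_sv; exact: near_dom dom_v.
  have [A [oA Av HA]] := nearP nv; have [e e0 He] := open_cball oA Av.
  exists (`|sv x| / e + 1) => b [b0 nD]; rewrite leNgt; apply/negP => bg; apply: nD.
  have bp : 0 < b by apply: lt_trans bg; rewrite ltr_wpDl // divr_ge0 // ltW.
  rewrite /ray -(nrZ _ (_ : 0 < b^-1)) ?invr_gt0 //; apply: HA; apply: He.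
  rewrite /cball /= scalerDr scalerA mulVf ?gt_eqF // scale1r addrK normrZ gtr0_norm ?invr_gt0 //.
  rewrite mulrC ler_pdivrMr // -ler_pdivrMl //; apply: ltW; apply: lt_trans bg.
  by rewrite mulrC ltrDl.
have sT : has_sup T by split; [exists 0|].
set b := sup T.
have b0 : 0 <= b by apply: ub_le_sup.
have gtb b' : b < b' -> dom (ray x b').
  move=> bb'; have [//|nD] := pselect (dom (ray x b')).
  have : b' <= b by apply: ub_le_sup => //; split => //; rewrite (le_trans b0) // ltW.
  by rewrite leNgt bb'.
have nDb : ~ dom (ray x b).
  move=> Db; have := near_comp (ray_continuous xv b0) (near_dom Db).
  move=> /nbhs_ballP[e /= e0 He].
  have be : b - e < b by rewrite ltrBlDr ltrDl.
  have [c [c0 nDc] bc] := sup_gt (ex_intro _ 0 T0) be.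
  have cb : c <= b by apply: ub_le_sup.
  apply: nDc; apply: He; rewrite /ball /=.
  by rewrite ger0_norm ?subr_ge0 //; lra.
exfalso; apply: nDb.
have [l l0 El] := ray_ray xv b0.
apply: (@extension _ (gam b)).
- exact: ray_neqN.
- by move=> b' b'0; rewrite El; apply: gtb; rewrite ltrDl mulr_gt0.
- move=> A nA; have [d d0 Hd] := cg b A b0 nA.
  exists (d / l); first by rewrite divr_gt0.
  move=> b' /andP[b'0 b'd]; rewrite El (ag b b0 gtb).
    by apply: Hd; rewrite ltrDl mulr_gt0 //= ltrD2l mulrC -ltr_pdivlMr.
  by rewrite ltrDl mulr_gt0.
Qed.
End Continuation.

(** * Continuation over a tetrahedron *)

Section Simplex.
Variables (R : realType).

(** Faces are described by coefficient vectors with a vanishing entry. *)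
Lemma mulmx_row' k n (V : 'M[R]_(k, n)) (c : 'rV[R]_k) i : c 0 i = 0 ->
  c *m V = (\row_j c 0 (lift i j)) *m row' i V.
Proof.
move=> ci; rewrite !mulmx_sum_row (bigD1_ord i) //= ci scale0r add0r.
by apply: eq_bigr => j _; rewrite mxE; congr (_ *: _); apply/rowP => l; rewrite !mxE.
Qed.

Lemma simplex_face k n (V : 'M[R]_(k, n)) (c : 'rV[R]_k) i : (forall j, 0 <= c 0 j) -> c 0 i = 0 ->
  dot (c *m V) (c *m V) = 1 -> spherical_simplex (row' i V) (c *m V).
Proof.
move=> c0 ci N; split => //; exists (\row_j c 0 (lift i j)); last exact: mulmx_row'.
by move=> j; rewrite mxE.
Qed.

Lemma simplex_cone k n (V : 'M[R]_(k, n)) p q (al be : R) : spherical_simplex V p -> spherical_simplex V q ->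
  0 <= al -> 0 <= be -> dot (al *: p + be *: q) (al *: p + be *: q) = 1 ->
  spherical_simplex V (al *: p + be *: q).
Proof.
move=> [_ [c1 c10 ->]] [_ [c2 c20 ->]] al0 be0 N; split => //.
exists (al *: c1 + be *: c2); last by rewrite mulmxDl -!scalemxAl.
by move=> i; rewrite !mxE addr_ge0 // mulr_ge0.
Qed.

Lemma simplex_span k n (V : 'M[R]_(k, n)) x : spherical_simplex V x -> (x <= V)%MS.
Proof. by move=> [_ [c _ ->]]; exact: submxMl. Qed.

Lemma nrE_scale n (y : 'rV[R]_n) : y = Num.sqrt (dot y y) *: nrE y.
Proof.
have [->|y0] := eqVneq y 0; first by rewrite /nrE !scaler0.
by rewrite /nrE scalerA mulfV ?scale1r // gt_eqF // sqrt_dot_gt0.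
Qed.

Lemma convex_comb n (p q p0 : 'rV[R]_n) (a b : R) : 0 < a + b ->
  (a + b)^-1 *: (a *: p + b *: q) - p0 = (a / (a + b)) *: (p - p0) + (b / (a + b)) *: (q - p0).
Proof. by move=> ab; apply/rowP => i; rewrite !mxE; field; rewrite gt_eqF. Qed.

Lemma convex_norm n (p q p0 : 'rV[R]_n) (a b r : R) : 0 <= a -> 0 <= b -> 0 < a + b ->
  `|p - p0| <= r -> `|q - p0| <= r -> `|(a + b)^-1 *: (a *: p + b *: q) - p0| <= r.
Proof.
move=> a0 b0 ab hp hq; rewrite convex_comb //.
have ca : 0 <= a / (a + b) by rewrite divr_ge0 ?(ltW ab).
have cb : 0 <= b / (a + b) by rewrite divr_ge0 ?(ltW ab).
apply: le_trans (ler_normD _ _) _; rewrite (normrZ (a / (a + b))) (normrZ (b / (a + b))) (ger0_norm ca) (ger0_norm cb).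
have -> : r = (a / (a + b)) * r + (b / (a + b)) * r by field; rewrite gt_eqF.
by apply: lerD; exact: ler_wpM2l.
Qed.

Lemma comb_gt0 n (p q : 'rV[R]_n) (a b : R) : 0 <= a -> 0 <= b ->
  dot (a *: p + b *: q) (a *: p + b *: q) = 1 -> 0 < a + b.
Proof.
move=> a0 b0 N; rewrite lt_neqAle addr_ge0 // andbT eq_sym paddr_eq0 //; apply/negP => /andP[/eqP ea /eqP eb].
by move: N; rewrite ea eb !scale0r addr0 dot0l => /esym/eqP; rewrite oner_eq0.
Qed.

Lemma unit_scale n (p : 'rV[R]_n) (c : R) : dot p p = 1 -> 0 <= c -> dot (c *: p) (c *: p) = 1 -> c *: p = p.
Proof.
move=> p1 c0; rewrite dotZl dotZr p1 mulr1 => /eqP; rewrite -expr2 sqrf_eq1 => /orP[/eqP ->|/eqP e].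
  by rewrite scale1r.
by move: c0; rewrite e lerNr oppr0 ler10.
Qed.

Lemma simplex_nrE k n (V : 'M[R]_(k, n)) (c : 'rV[R]_k) : (forall j, 0 <= c 0 j) -> c *m V != 0 ->
  spherical_simplex V (nrE (c *m V)).
Proof.
move=> c0 N0; split; first exact: nrE1.
exists ((Num.sqrt (dot (c *m V) (c *m V)))^-1 *: c); last by rewrite -scalemxAl.
by move=> i; rewrite mxE mulr_ge0 // invr_ge0 sqrtr_ge0.
Qed.

Lemma face_nrE k n (V : 'M[R]_(k, n)) (c : 'rV[R]_k) i : (forall j, 0 <= c 0 j) -> c 0 i = 0 -> c *m V != 0 ->
  spherical_simplex (row' i V) (nrE (c *m V)).
Proof.
move=> c0 ci N0; rewrite (mulmx_row' V ci); apply: simplex_nrE; first by move=> j; rewrite mxE.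
by rewrite -mulmx_row'.
Qed.
End Simplex.

Section Tetra.
Variables (R : realType) (m : nat) (Psi : atlas_space R m).
Hypotheses (kPsi : kflat 1 Psi) (tc : two_convex Psi).
Let rPsi : riemannian Psi := kPsi.1.
Let cPsi : charted Psi := riemannian_charted rPsi.
Let exPsi (q : Psi) : exists s, spherical_at s q := spherical_at_ex q kPsi.
Let hPsi : hausdorff_space Psi. Proof. by case: rPsi => -[]. Qed.
Local Notation S := (sphere R m).
Local Notation E := 'rV[R]_(1 + m).
Variables (v : S) (h0 : S -> Psi).
Hypothesis Lh0 : local_isometry_at h0 v.
Local Notation D := (dom v h0).
Local Notation H := (dev v h0).

Section OneTetra.
Variables (J : 'M[R]_(4, 1 + m)) (V : 'M[R]_4) (i0 : 'I_4).
Hypotheses (JJ : J *m J^T = 1%:M) (hV : forall i, dot (row i V) (row i V) = 1) (uV : V \in unitmx)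
  (hv : row i0 V *m J = sv v)
  (faces : forall i, i != i0 -> forall y, spherical_simplex (row' i V) y -> D (nr (y *m J))).

Let p0 := row i0 V.
Let f (y : 'rV[R]_4) := H (nr (y *m J)).
Let i1 := lift i0 0.
Let i2 := lift i0 1.

Let i10 : i1 != i0. Proof. by rewrite eq_sym neq_lift. Qed.
Let i20 : i2 != i0. Proof. by rewrite eq_sym neq_lift. Qed.
Let i12 : i1 != i2. Proof. by rewrite (inj_eq lift_inj). Qed.

Let nrp0 : nr (p0 *m J) = v. Proof. by rewrite hv nr_sv. Qed.

Let unitJ (y : 'rV[R]_4) : dot y y = 1 -> sv (nr (y *m J)) = y *m J.
Proof. by move=> y1; rewrite nr_unit // dot_orth. Qed.

Let injJ (y : 'rV[R]_4) : y *m J = 0 -> y = 0.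
Proof. by move=> e; apply/eqP; rewrite -dot_eq0 -(dot_orth _ _ JJ) e dot0l. Qed.

Let p0E : p0 = delta_mx 0 i0 *m V. Proof. by rewrite -rowE. Qed.

Let delta_ge0 j : 0 <= (delta_mx 0 i0 : 'rV[R]_4) 0 j.
Proof. by rewrite mxE ler0n. Qed.

Let p0_face : spherical_simplex (row' i1 V) p0.
Proof.
rewrite p0E; apply: simplex_face; [exact: delta_ge0| |by rewrite -p0E; exact: (hV i0)].
by rewrite mxE (negbTE i10) andbF.
Qed.

Let p0_simplex : spherical_simplex V p0.
Proof. by split; [exact: (hV i0)|exists (delta_mx 0 i0); [exact: delta_ge0|exact: p0E]]. Qed.

Section Extended.
Variable F : 'rV[R]_4 -> Psi.
Hypotheses (gF : geodesic_isometric_on V (spherical_simplex V) F)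
  (Ff : forall i, i != i0 -> forall x, spherical_simplex (row' i V) x -> F x = f x).

Let SV x : spherical_simplex V x -> (x <= V)%MS := @simplex_span R 4 4 V x.

(** Near the vertex the simplex is covered by arcs that join two of the faces at
    the vertex.  Both maps are additive on such arcs and agree on the faces. *)
Lemma tetra_near_vertex : exists2 rho : R, 0 < rho & forall y, spherical_simplex V y -> `|y - p0| <= rho -> F y = f y.
Proof.
have [s [Hs Es]] := adjusted_spherical kPsi (dev_local kPsi Lh0 (dom_v kPsi Lh0)).
have [B [nB iB]] := spherical_at_inj cPsi Hs.
have Fp0 : F p0 = H v by rewrite (Ff i10 p0_face) /f nrp0.
have nW : nbhs (H v) (B `&` [set q | spherical_at s q]).
  by apply: filterI => //; exact: spherical_at_near rPsi Hs.
have n1 : \forall y \near p0, spherical_simplex V y -> (B `&` [set q | spherical_at s q]) (F y).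
  by apply: (geodesic_isometric_continuous rPsi gF p0_simplex); rewrite Fp0.
have n2 : \forall y \near p0, B (f y) /\ s (f y) = sv (nr (y *m J)).
  have cJ : {for p0, continuous (fun y : 'rV[R]_4 => nr (y *m J))}.
    by apply: nrJ_continuous; rewrite hv sv_neq0.
  have cH := local_isometry_continuous (dev_local kPsi Lh0 (dom_v kPsi Lh0)).
  have n3 : \forall x \near nr (p0 *m J), B (H x) /\ s (H x) = sv x.
    rewrite nrp0; have nB' := near_comp cH nB.
    by near=> x; split; near: x.
  exact: (near_comp cJ n3).
have n12 : nbhs p0 [set y | (spherical_simplex V y -> (B `&` [set q | spherical_at s q]) (F y)) /\
   (B (f y) /\ s (f y) = sv (nr (y *m J)))] by near=> y; split; near: y.
have [A [oA Ap HA]] := nearP n12.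
have [r r0 Hr] := open_cball oA Ap.
have p01 : dot p0 p0 = 1 := hV i0.
have p0n : p0 != 0 by rewrite -dot_gt0 p01.
have n4 : \forall z \near p0, `|nrE z - p0| <= r.
  have /cvgrPdist_le/(_ _ r0) := nrE_continuous p0n.
  by rewrite (nrE_id p01); apply: filterS => z; rewrite distrC.
have [A' [oA' Ap' HA']] := nearP n4.
have [r1' r10' Hr1'] := open_cball oA' Ap'.
pose r1 := Num.min r1' (`|p0| / 2).
have np0 : 0 < `|p0| by rewrite normr_gt0.
have r10 : 0 < r1 by rewrite /r1 lt_min r10' divr_gt0.
have r1p : r1 < `|p0|.
  have : r1 <= `|p0| / 2 by rewrite /r1 ge_min lexx orbT.
  by move: np0; set a := `|p0|; lra.
have Hr1 z : `|z - p0| <= r1 -> `|nrE z - p0| <= r.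
  by move=> h; apply: HA'; apply: Hr1'; apply: le_trans h _; rewrite /r1 ge_min lexx.
(* A point near p0 is split as y L1 + y (1 - L1): the coefficient at p0 is
   halved, the one at the vertex i1 goes to the first summand and the other
   two to the second.  So each summand lies in a face at p0, and both are
   close to multiples of p0. *)
pose d : 'rV[R]_4 := \row_j (if j == i0 then 2^-1 else if j == i1 then 1 else 0).
pose L1 : 'M[R]_4 := invmx V *m diag_mx d *m V.
have cL (M : 'M[R]_4) : continuous (fun y : 'rV[R]_4 => y *m M).
  by move=> y; apply: (continuous_mulmx (M := id) (N := fun=> M)); [exact: cvg_id|exact: cst_continuous].
have p0L : p0 *m L1 = 2^-1 *: p0.
  rewrite p0E /L1 !mulmxA mulmxK // -rowE row_diag_mx mxE eqxx -scalemxAl //.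
have p0L' : p0 *m (1%:M - L1) = 2^-1 *: p0.
  by rewrite mulmxBr mulmx1 p0L -{1}[p0]scale1r -scalerBl; congr (_ *: _); lra.
have half (M : 'M[R]_4) : p0 *m M = 2^-1 *: p0 -> \forall y \near p0, y *m M != 0 /\ `|nrE (y *m M) - p0| <= r1.
  move=> e; have h0' : p0 *m M != 0 by rewrite e scaler_eq0 (negbTE p0n) orbF invr_eq0 pnatr_eq0.
  have e1 : nrE (p0 *m M) = p0 by rewrite e nrEZ ?invr_gt0 // nrE_id.
  have cc : {for p0, continuous (fun y : 'rV[R]_4 => nrE (y *m M))}.
    by apply: (@continuous_comp _ _ _ (fun y : 'rV[R]_4 => y *m M) (@nrE R 4)); [exact: cL|exact: nrE_continuous].
  have m1 : \forall y \near p0, y *m M != 0.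
    have nz : nbhs (p0 *m M) [set z : 'rV[R]_4 | z != 0] := near_nonzero h0'.
    exact: (cL M _ _ nz).
  have m2 : \forall y \near p0, `|nrE (y *m M) - p0| <= r1.
    by move/cvgrPdist_le: cc => /(_ _ r10); rewrite e1; apply: filterS => y; rewrite distrC.
  by near=> y; split; near: y.
have n5 := half _ p0L; have n6 := half _ p0L'.
have n7 : nbhs p0 [set y : 'rV[R]_4 | [/\ y *m L1 != 0, `|nrE (y *m L1) - p0| <= r1,
    y *m (1%:M - L1) != 0, `|nrE (y *m (1%:M - L1)) - p0| <= r1 & `|y - p0| <= r]].
  have n8 : \forall y \near p0, `|y - p0| <= r.
    have /cvgrPdist_le/(_ _ r0) : {for p0, continuous (@id 'rV[R]_4)} by exact: cvg_id.
    by apply: filterS => z; rewrite distrC.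
  near=> y; have [] : y *m L1 != 0 /\ `|nrE (y *m L1) - p0| <= r1 by near: y.
  have [] : y *m (1%:M - L1) != 0 /\ `|nrE (y *m (1%:M - L1)) - p0| <= r1 by near: y.
  by split => //; near: y.
have [A2 [oA2 A2p HA2]] := nearP n7.
have [rho rho0 Hrho] := open_cball oA2 A2p.
exists rho => // y Sy yr.
have [y1n yp y2n yq yrr] := HA2 y (Hrho y yr).
have [y1 [c c0 Ey]] := Sy.
have Ed1 : y *m L1 = (c *m diag_mx d) *m V by rewrite Ey /L1 !mulmxA mulmxK.
have Ed2 : y *m (1%:M - L1) = (c - c *m diag_mx d) *m V by rewrite mulmxBr mulmx1 Ed1 Ey mulmxBl.
have cd j : (c *m diag_mx d) 0 j = c 0 j * d 0 j by rewrite mul_mx_diag mxE.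
have d01 j : 0 <= d 0 j <= 1.
  rewrite mxE; case: (j == i0); last by case: (j == i1); rewrite ?lexx ?ler01.
  by rewrite invr_ge0 ler0n invf_le1 ?ltr0n // ler1n.
have fp : spherical_simplex (row' i2 V) (nrE (y *m L1)).
  rewrite Ed1; apply: face_nrE; [move=> j|  |by rewrite -Ed1].
    by rewrite cd mulr_ge0 //; have /andP[] := d01 j.
  by rewrite cd mxE (negbTE i20) eq_sym (negbTE i12) mulr0.
have fq : spherical_simplex (row' i1 V) (nrE (y *m (1%:M - L1))).
  rewrite Ed2; apply: face_nrE; [move=> j|  |by rewrite -Ed2].
    rewrite mxE [(- _ : 'rV_4) 0 _]mxE cd -{1}[c 0 j]mulr1 -mulrBr mulr_ge0 // subr_ge0.
    by have /andP[] := d01 j.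
  rewrite mxE [(- _ : 'rV_4) 0 _]mxE cd mxE (negbTE i10) eqxx mulr1 subrr //.
set p := nrE (y *m L1) in yp fp.
set q := nrE (y *m (1%:M - L1)) in yq fq.
have Fp : F p = f p := Ff i20 fp.
have Fq : F q = f q := Ff i10 fq.
pose al := Num.sqrt (dot (y *m L1) (y *m L1)).
pose be := Num.sqrt (dot (y *m (1%:M - L1)) (y *m (1%:M - L1))).
have al0 : 0 <= al by rewrite sqrtr_ge0.
have be0 : 0 <= be by rewrite sqrtr_ge0.
have Eab : y = al *: p + be *: q.
  by rewrite /al /be /p /q -!nrE_scale -mulmxDr addrC subrK mulmx1.
have [p1 _] := fp; have [q1 _] := fq.
have Sp : spherical_simplex V p.
  rewrite /p Ed1; apply: simplex_nrE; last by rewrite -Ed1.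
  by move=> j; rewrite cd mulr_ge0 //; have /andP[] := d01 j.
have Sq : spherical_simplex V q.
  rewrite /q Ed2; apply: simplex_nrE; last by rewrite -Ed2.
  move=> j; rewrite mxE [(- _ : 'rV_4) 0 _]mxE cd -{1}[c 0 j]mulr1 -mulrBr mulr_ge0 // subr_ge0.
  by have /andP[] := d01 j.
have [pq|qp] := eqVneq q p.
  have yE : y = (al + be) *: p by rewrite Eab pq scalerDl.
  have -> : y = p by rewrite yE; apply: unit_scale; rewrite ?addr_ge0 // -yE.
  by [].
have qNp : q != - p.
  apply/negP => /eqP e; have : `|p0 + p0| <= r1 + r1.
    have -> : p0 + p0 = - ((p - p0) + (q - p0)).
      by rewrite e; apply/rowP => i; rewrite !mxE; ring.
    by rewrite normrN; apply: le_trans (ler_normD _ _) _; apply: lerD.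
  have -> : p0 + p0 = 2 *: p0 by rewrite scaler_nat mulr2n.
  by rewrite normrZ ger0_norm //; move: r1p; set a := `|p0|; lra.
have seg_in (a b : R) : 0 <= a -> 0 <= b -> dot (a *: p + b *: q) (a *: p + b *: q) = 1 -> `|a *: p + b *: q - p0| <= r.
  move=> a0 b0 N; have ab := comb_gt0 a0 b0 N.
  have -> : a *: p + b *: q = nrE ((a + b)^-1 *: (a *: p + b *: q)).
    by rewrite nrEZ ?invr_gt0 // nrE_id.
  by apply: Hr1; exact: convex_norm.
have [|_ add] := @cone_additive R m Psi rPsi 4 4 V (spherical_simplex V) F s p q gF SV p1 q1 qp qNp.
  move=> a b a0 b0 N; have Sx := simplex_cone Sp Sq a0 b0 N; split => //.
  by have [/(_ Sx) [_ ?] _] := HA _ (Hr _ (seg_in a b a0 b0 N)).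
have sJ z : spherical_simplex V z -> `|z - p0| <= r -> B (f z) /\ s (f z) = z *m J.
  move=> [z1 _] zr; have [_ [h1 h2]] := HA _ (Hr _ zr); split => //.
  by rewrite h2 unitJ.
have pr : `|p - p0| <= r by have := seg_in 1 0 ler01 (lexx 0); rewrite scale1r scale0r addr0; exact.
have qr : `|q - p0| <= r by have := seg_in 0 1 (lexx 0) ler01; rewrite scale1r scale0r add0r; exact.
have [_ sp] := sJ p Sp pr; have [_ sq] := sJ q Sq qr.
have [Bf sf] := sJ y Sy yrr.
have [/(_ Sy)[BF _] _] := HA _ (Hr _ yrr).
have EJ : y *m J = al *: (p *m J) + be *: (q *m J).
  by rewrite {1}Eab mulmxDl; congr (_ + _); exact/esym/scalemxAl.
by apply: iB => //; rewrite sf EJ {1}Eab add -?Eab // Fp Fq sp sq.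
Unshelve. all: by end_near. Qed.

Lemma nr_nrE_J (w : 'rV[R]_4) : w != 0 -> nr (nrE w *m J) = nr (w *m J).
Proof.
by move=> w0; rewrite {1}/nrE -scalemxAl nrZ // invr_gt0 sqrt_dot_gt0.
Qed.

Lemma simplex_antipode y : spherical_simplex V y -> sv (nr (y *m J)) != - sv v.
Proof.
move=> [y1 [c c0 Ey]]; rewrite unitJ // -hv; apply/negP => /eqP e.
have : y + p0 = 0 by apply: injJ; rewrite mulmxDl e addNr.
rewrite Ey p0E -mulmxDl => /(congr1 (fun z => z *m invmx V)); rewrite mulmxK // mul0mx.
move/(congr1 (fun z : 'rV[R]_4 => z 0 i0)); rewrite !mxE !eqxx /= => e1.
have := c0 i0; lra.
Qed.

Lemma weighted_mean_itv (a b s t : R) : 0 <= a -> 0 <= b -> 0 < a + b -> 0 <= s <= 1 -> 0 <= t <= 1 ->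
  0 <= (a * s + b * t) / (a + b) <= 1.
Proof.
move=> a0 b0 ab /andP[s0 s1] /andP[t0 t1].
rewrite divr_ge0 ?(ltW ab) ?addr_ge0 ?mulr_ge0 //= ler_pdivrMr // mul1r.
by apply: lerD; rewrite ler_piMr.
Qed.

Section Segment.
Variable y1 : 'rV[R]_4.
Hypotheses (Sy1 : spherical_simplex V y1) (Dy1 : D (nr (y1 *m J))).
Let z (t : R) := t *: y1 + (1 - t) *: p0.
Let Z (t : R) := nrE (z t).

Let zJ t : z t *m J = t *: sv (nr (y1 *m J)) + (1 - t) *: sv v.
Proof. by rewrite /z mulmxDl -!scalemxAl hv unitJ //; case: Sy1. Qed.

Let z_neq0 t : 0 <= t <= 1 -> z t != 0.
Proof.
move=> t01; apply/negP => /eqP e; have := seg_neq0 (simplex_antipode Sy1) t01.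
by rewrite -zJ e mul0mx eqxx.
Qed.

Let Z_simplex t : 0 <= t <= 1 -> spherical_simplex V (Z t).
Proof.
move=> t01; have [_ [c c0 Ey]] := Sy1; have := z_neq0 t01; rewrite /Z /z Ey p0E !scalemxAl -mulmxDl.
apply: simplex_nrE => j; case/andP: t01 => t0 t1.
by rewrite mxE addr_ge0 // mxE mulr_ge0 ?subr_ge0 // delta_ge0.
Qed.

Let Z_seg t : 0 <= t <= 1 -> nr (Z t *m J) = seg v (nr (y1 *m J)) t.
Proof. by move=> t01; rewrite /Z nr_nrE_J ?z_neq0 // zJ. Qed.

Let Z_dom t : 0 <= t <= 1 -> D (nr (Z t *m J)).
Proof. by move=> t01; rewrite Z_seg //; have [_ sD _ _] := good_dom kPsi Lh0; exact: star_seg. Qed.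

Let Z_continuous t : 0 <= t <= 1 -> {for t, continuous Z}.
Proof.
move=> t01; apply: (@continuous_comp _ _ _ z (@nrE R 4)); last exact/nrE_continuous/z_neq0.
apply: (continuous_add_for (V := 'rV[R]_4) (a := fun t : R => t *: y1)).
  by apply: (continuous_scale (a := id)); [exact: cvg_id|exact: cst_continuous].
apply: (continuous_scale (a := fun t : R => 1 - t)); last exact: cst_continuous.
by apply: (continuous_sub_for (V := R) (a := fun=> 1)); [exact: cst_continuous|exact: cvg_id].
Qed.

Let f_continuous t : 0 <= t <= 1 -> {for t, continuous (f \o Z)}.
Proof.
move=> t01; have [u1 _] := Z_simplex t01.
apply: (@continuous_comp _ _ _ Z f); first exact: Z_continuous.
apply: (@continuous_comp _ _ _ (fun y : 'rV[R]_4 => nr (y *m J)) H).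
  by apply: nrJ_continuous; apply/negP => /eqP/injJ e; move: u1; rewrite e dot0l => /esym/eqP; rewrite oner_eq0.
exact/(local_isometry_continuous (dev_local kPsi Lh0 _))/Z_dom.
Qed.

Let F_continuous t A : 0 <= t <= 1 -> nbhs (F (Z t)) A -> \forall u \near t, 0 <= u <= 1 -> A (F (Z u)).
Proof.
move=> t01 nA; have := near_comp (Z_continuous t01) (geodesic_isometric_continuous rPsi gF (Z_simplex t01) nA).
by apply: filterS => u h u01; exact/h/Z_simplex.
Qed.

Let Z_comb (u1 u2 a b : R) : 0 <= u1 <= u2 -> u2 <= 1 -> 0 <= a -> 0 <= b ->
  dot (a *: Z u1 + b *: Z u2) (a *: Z u1 + b *: Z u2) = 1 ->
  exists2 t, u1 <= t <= u2 & a *: Z u1 + b *: Z u2 = Z t.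
Proof.
move=> /andP[u10 u12] u21 a0 b0 N.
have h1 : 0 <= u1 <= 1 by rewrite u10 (le_trans u12).
have h2 : 0 <= u2 <= 1 by rewrite u21 (le_trans u10).
set a' := a * (Num.sqrt (dot (z u1) (z u1)))^-1; set b' := b * (Num.sqrt (dot (z u2) (z u2)))^-1.
have a'0 : 0 <= a' by rewrite mulr_ge0 // invr_ge0 sqrtr_ge0.
have b'0 : 0 <= b' by rewrite mulr_ge0 // invr_ge0 sqrtr_ge0.
have E1 : a *: Z u1 + b *: Z u2 = a' *: z u1 + b' *: z u2 by rewrite /Z /nrE !scalerA.
have ab : 0 < a' + b' by apply: (@comb_gt0 R 4 (z u1) (z u2)) => //; rewrite -E1.
exists ((a' * u1 + b' * u2) / (a' + b')).
  by rewrite ler_pdivlMr // ler_pdivrMr //; apply/andP; split; nra.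
have E2 : a' *: z u1 + b' *: z u2 = (a' + b') *: z ((a' * u1 + b' * u2) / (a' + b')).
  apply/rowP => i; rewrite /z !mxE; field; by rewrite gt_eqF.
by rewrite -[LHS](nrE_id N) E1 E2 nrEZ.
Qed.

(** Induction along the arc from the vertex to [y1].  Near a parameter t up to
    which the maps agree both are additive on a short arc around Z t, so that
    their values at one point behind t and at t determine the value at a point
    beyond t. *)
Lemma tetra_agree : F y1 = f y1.
Proof.
have Z0 : Z 0 = p0 by rewrite /Z /z scale0r add0r subr0 scale1r nrE_id //; exact: (hV i0).
have Z1 : Z 1 = y1 by rewrite /Z /z subrr scale0r addr0 scale1r nrE_id //; case: Sy1.
suff : forall t, 0 <= t <= 1 -> forall u, 0 <= u <= t -> F (Z u) = f (Z u).
  by move=> /(_ 1); rewrite ler01 lexx => /(_ isT 1); rewrite ler01 lexx Z1; apply.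
apply: (@real_ind R (fun t => forall u, 0 <= u <= t -> F (Z u) = f (Z u))).
- move=> u u0; have -> : u = 0 by apply/le_anti; rewrite andbC.
  by rewrite Z0 (Ff i10 p0_face).
- move=> t /andP[t0 t1] Pt.
  have t01 : 0 <= t <= 1 by rewrite t0 ltW.
  suff [e e0 He] : exists2 e : R, 0 < e & forall u, t < u < t + e -> u <= 1 -> F (Z u) = f (Z u).
    exists e => // s /andP[ts se] s1 u /andP[u0 us]; have [ut|tu] := leP u t; first by apply: Pt; rewrite u0.
    by apply: He; [rewrite tu (le_lt_trans us)|exact: le_trans us s1].
  move: t0; rewrite le_eqVlt => /orP[/eqP E0|t0].
    have [rho rho0 Hrho] := tetra_near_vertex.
    have /cvgrPdist_le/(_ _ rho0)/nbhs_ballP[e /= e0 He] := Z_continuous t01.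
    exists e => // u /andP[u0 ue] u1; apply: Hrho.
      by apply: Z_simplex; rewrite u1 E0 (ltW u0).
    have <- : Z t = p0 by rewrite -E0.
    rewrite distrC; apply: He; rewrite /ball /= distrC gtr0_norm ?subr_gt0 //; lra.
  have Dt := Z_dom t01.
  have [s [Hs Es]] := adjusted_spherical kPsi (dev_local kPsi Lh0 Dt).
  have [B [nB iB]] := spherical_at_inj cPsi Hs.
  have FZt : F (Z t) = f (Z t) by apply: Pt; rewrite (ltW t0) lexx.
  have n1 : \forall u \near t, 0 <= u <= 1 -> (B `&` [set q | spherical_at s q]) (F (Z u)).
    by apply: F_continuous => //; rewrite FZt; apply: filterI => //; exact: spherical_at_near rPsi Hs.
  have n2 : \forall u \near t, B (f (Z u)) := near_comp (f_continuous t01) nB.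
  have n3 : \forall u \near t, 0 <= u <= 1 -> s (f (Z u)) = Z u *m J.
    have cJ : {for t, continuous (fun u => nr (Z u *m J))}.
      apply: (@continuous_comp _ _ _ Z (fun y : 'rV[R]_4 => nr (y *m J))); first exact: Z_continuous.
      apply: nrJ_continuous; apply/negP => /eqP/injJ e; have [u1 _] := Z_simplex t01.
      by move: u1; rewrite e dot0l => /esym/eqP; rewrite oner_eq0.
    have := near_comp cJ Es; apply: filterS => u e u01; rewrite /f e unitJ //.
    by have [] := Z_simplex u01.
  have n123 : \forall u \near t, [/\ 0 <= u <= 1 -> (B `&` [set q | spherical_at s q]) (F (Z u)),
    B (f (Z u)) & 0 <= u <= 1 -> s (f (Z u)) = Z u *m J] by near=> u; split; near: u.
  have /nbhs_ballP[e /= e0 He] := n123.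
  have Hn u : `|t - u| < e -> 0 <= u <= 1 -> [/\ B (F (Z u)), spherical_at s (F (Z u)), B (f (Z u)) & s (f (Z u)) = Z u *m J].
    by move=> ue u01; have [/(_ u01) [? ?] ? /(_ u01) ?] := He u ue.
  exists e; first exact: e0.
  move=> u2 /andP[tu2 u2e] u21.
  (* a point behind t, at which the maps are known to agree *)
  pose u1 := Num.max (t - e / 2) (t / 2).
  have [u10 u1t u1e] : [/\ 0 < u1, u1 < t & t - e < u1].
    split; first by rewrite /u1 lt_max orbC divr_gt0.
      by rewrite /u1 gt_max; apply/andP; split; lra.
    by rewrite /u1 lt_max; apply/orP; left; lra.
  have in01 u : u1 <= u <= u2 -> 0 <= u <= 1 by move=> /andP[a b]; apply/andP; split; lra.
  have ine u : u1 <= u <= u2 -> `|t - u| < e by move=> /andP[a b]; rewrite ltr_norml; apply/andP; split; lra.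
  have u12 : u1 <= u2 by lra.
  have i1' : u1 <= u1 <= u2 by rewrite lexx.
  have i2' : u1 <= u2 <= u2 by rewrite lexx u12.
  have it : u1 <= t <= u2 by rewrite !ltW.
  have [BF2 _ Bf2 sf2] := Hn u2 (ine u2 i2') (in01 u2 i2').
  have [_ _ _ sf1] := Hn u1 (ine u1 i1') (in01 u1 i1').
  have [_ _ _ sft] := Hn t (ine t it) t01.
  have F1 : F (Z u1) = f (Z u1) by apply: Pt; rewrite !ltW.
  have [c1 c1'] := Z_simplex (in01 u1 i1'); have [c2 c2'] := Z_simplex (in01 u2 i2').
  have Nz u : u1 <= u <= u2 -> 0 < Num.sqrt (dot (z u) (z u)).
    by move=> /in01/z_neq0; exact: sqrt_dot_gt0.
  have [a [b [a0 b0 Et]]] : exists a b, [/\ 0 <= a, 0 < b & Z t = a *: Z u1 + b *: Z u2].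
    pose w u := Num.sqrt (dot (z u) (z u)).
    have w1 := Nz u1 i1'; have w2 := Nz u2 i2'; have wt := Nz t it.
    exists (((u2 - t) / (u2 - u1)) * w u1 / w t), (((t - u1) / (u2 - u1)) * w u2 / w t).
    have u21' : 0 < u2 - u1 by lra.
    split.
    - apply: mulr_ge0; last by rewrite invr_ge0 (ltW wt).
      by apply: mulr_ge0; [rewrite divr_ge0 ?subr_ge0 // ltW|exact: ltW w1].
    - apply: mulr_gt0; last by rewrite invr_gt0.
      by apply: mulr_gt0; [rewrite divr_gt0 // subr_gt0|exact: w2].
    - rewrite /Z /nrE -/(w u1) -/(w u2) -/(w t) /z; apply/rowP => i; rewrite !mxE; field.
      by rewrite !gt_eqF.
  have Nt : dot (a *: Z u1 + b *: Z u2) (a *: Z u1 + b *: Z u2) = 1 by rewrite -Et; have [] := Z_simplex t01.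
  have [Zeq|Zne] := eqVneq (Z u2) (Z u1); first by rewrite Zeq.
  have ZneN : Z u2 != - Z u1.
    apply/negP => /eqP e1.
    pose w u := Num.sqrt (dot (z u) (z u)).
    have w1 : 0 < w u1 := Nz u1 i1'; have w2 : 0 < w u2 := Nz u2 i2'.
    have : (w u2)^-1 *: z u2 + (w u1)^-1 *: z u1 = 0 by move/eqP: e1; rewrite -addr_eq0 => /eqP.
    have w12 : 0 < (w u2)^-1 + (w u1)^-1 by rewrite addr_gt0 ?invr_gt0.
    have -> : (w u2)^-1 *: z u2 + (w u1)^-1 *: z u1 =
        ((w u2)^-1 + (w u1)^-1) *: z (((w u2)^-1 * u2 + (w u1)^-1 * u1) / ((w u2)^-1 + (w u1)^-1)).
      apply/rowP => i; rewrite /z !mxE; move: w12; set p := (w u2)^-1; set q := (w u1)^-1 => pq; field; by rewrite gt_eqF.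
    move/eqP; rewrite scaler_eq0 gt_eqF //=; apply/negP; apply: z_neq0.
    by apply: weighted_mean_itv; rewrite ?invr_ge0 ?(ltW w1) ?(ltW w2) ?in01.
  have [|_ add] := @cone_additive R m Psi rPsi 4 4 V (spherical_simplex V) F s (Z u1) (Z u2) gF SV c1 c2 Zne ZneN.
    move=> a' b' a'0 b'0 N; have [|t' t'u ->] := Z_comb _ u21 a'0 b'0 N; first by rewrite (ltW u10).
    by split; [exact/Z_simplex/in01|have [] := Hn t' (ine t' t'u) (in01 t' t'u)].
  have EJ : Z t *m J = a *: (Z u1 *m J) + b *: (Z u2 *m J).
    by rewrite {1}Et mulmxDl; congr (_ + _); exact/esym/scalemxAl.
  have := add a b a0 (ltW b0) Nt; rewrite -Et FZt sft F1 sf1 EJ => /addrI/(scalerI (lt0r_neq0 b0)) e2.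
  by apply: iB => //; rewrite sf2 e2.
- move=> t /andP[t0 t1] K u /andP[u0]; rewrite le_eqVlt => /orP[/eqP ->|ut]; last by apply: (K u); rewrite ?u0 ?lexx.
  have t01 : 0 <= t <= 1 by rewrite (ltW t0).
  apply: hPsi => A B nA nB.
  have n1 := F_continuous t01 nA; have n2 := near_comp (f_continuous t01) nB.
  have n12 : \forall u \near t, (0 <= u <= 1 -> A (F (Z u))) /\ B (f (Z u)) by near=> u'; split; near: u'.
  have /nbhs_ballP[e /= e0 He] := n12.
  pose w := Num.max (t - e / 2) 0.
  have [w0 wt we] : [/\ 0 <= w, w < t & t - e < w].
    split; first by rewrite /w le_max lexx orbT.
      by rewrite /w gt_max t0 andbT; lra.
    by rewrite /w lt_max; apply/orP; left; lra.
  have [|h1 h2] := He w; first by rewrite /ball /= gtr0_norm ?subr_gt0 //; lra.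
  exists (F (Z w)); split; first by apply: h1; rewrite w0 (le_trans (ltW wt)).
  by rewrite (K w) ?w0 ?lexx.
Unshelve. all: by end_near. Qed.
End Segment.

(** [F] provides the limits along rays. *)
Lemma tetra_dom y : spherical_simplex V y -> D (nr (y *m J)).
Proof.
move=> Sy; have [y1 [c c0 Ey]] := Sy.
have xv := simplex_antipode Sy.
have zJ b : (y + b *: p0) *m J = sv (nr (y *m J)) + b *: sv v by rewrite mulmxDl -scalemxAl hv unitJ.
have z0 b : 0 <= b -> y + b *: p0 != 0.
  by move=> b0; apply/negP => /eqP e; have := ray_neq0 xv b0; rewrite -zJ e mul0mx eqxx.
have Sz b : 0 <= b -> spherical_simplex V (nrE (y + b *: p0)).
  move=> b0; have := z0 b b0; rewrite Ey p0E scalemxAl -mulmxDl; apply: simplex_nrE => j.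
  by rewrite mxE addr_ge0 // mxE mulr_ge0 // delta_ge0.
have rayE b : 0 <= b -> ray v (nr (y *m J)) b = nr (nrE (y + b *: p0) *m J).
  by move=> b0; rewrite nr_nrE_J ?z0 // zJ.
apply: (@ray_lemma R m Psi kPsi v h0 Lh0 _ (fun b => F (nrE (y + b *: p0)))) => //.
- move=> b A b0 nA.
  have cz : {for b, continuous (fun b : R => nrE (y + b *: p0))}.
    apply: (@continuous_comp _ _ _ (fun b : R => y + b *: p0) (@nrE R 4)); last exact/nrE_continuous/z0.
    apply: (continuous_add_for (V := 'rV[R]_4) (a := fun=> y)); first exact: cst_continuous.
    by apply: (continuous_scale (a := id)); [exact: cvg_id|exact: cst_continuous].
  have := near_comp cz (geodesic_isometric_continuous rPsi gF (Sz b b0) nA).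
  move=> /nbhs_ballP[d /= d0 Hd]; exists d => // b' /andP[bb' b'd]; apply: Hd.
    by rewrite /ball /= distrC gtr0_norm ?subr_gt0 //; lra.
  by apply: Sz; rewrite (le_trans b0) // ltW.
- move=> b b0 Db b' bb'; have b'0 : 0 <= b' by rewrite (le_trans b0) // ltW.
  rewrite (tetra_agree (Sz b' b'0)); first by rewrite /f -rayE.
  by rewrite -rayE //; exact: Db.
Qed.
End Extended.

(** Two-convexity extends the continuation from the three faces at [v] to the
    tetrahedron. *)
Lemma tetra y : spherical_simplex V y -> D (nr (y *m J)).
Proof.
have [F [gF Ff]] : exists F : 'rV[R]_4 -> Psi, geodesic_isometric_on V (spherical_simplex V) F /\
      forall i, i != i0 -> forall x, spherical_simplex (row' i V) x -> F x = f x.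
  apply: tc => // i ii0.
  apply: (local_isometry_geodesic rPsi JJ) => //; first by move=> x [].
  by move=> x Sx; apply: (dev_local kPsi Lh0); exact: faces Sx.
exact: tetra_dom gF Ff y.
Qed.
End OneTetra.
End Tetra.

(** * Continuation from a hemisphere *)

Section FourVectors.
Variables (R : realType).

Definition vec4 (a b c d : R) : 'rV[R]_4 := \row_j [:: a; b; c; d]`_j.

Definition mat4 n (p0 p1 p2 p3 : 'rV[R]_n) : 'M[R]_(4, n) := \matrix_i [:: p0; p1; p2; p3]`_i.

Lemma vec4_mul n a b c d (p0 p1 p2 p3 : 'rV[R]_n) :
  vec4 a b c d *m mat4 p0 p1 p2 p3 = a *: p0 + b *: p1 + c *: p2 + d *: p3.
Proof. by rewrite mulmx_sum_row !big_ord_recr big_ord0 /= add0r !mxE /= !rowK. Qed.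

Definition k0 : 'I_4 := @Ordinal 4 0 isT.
Definition k1 : 'I_4 := @Ordinal 4 1 isT.
Definition k2 : 'I_4 := @Ordinal 4 2 isT.
Definition k3 : 'I_4 := @Ordinal 4 3 isT.

Lemma ord4P (i : 'I_4) : [\/ i = k0, i = k1, i = k2 | i = k3].
Proof.
case: i => -[|[|[|[|//]]]] h; [exact: (Or41 _ _ _ (val_inj _))|exact: (Or42 _ _ _ (val_inj _))|
  exact: (Or43 _ _ _ (val_inj _))|exact: (Or44 _ _ _ (val_inj _))].
Qed.

Lemma vec4_eta (c : 'rV[R]_4) : c = vec4 (c 0 k0) (c 0 k1) (c 0 k2) (c 0 k3).
Proof. by apply/rowP => j; rewrite mxE; have [] := ord4P j => ->. Qed.

Lemma unitmx_ker n (P : 'M[R]_n) : (forall c : 'rV[R]_n, c *m P = 0 -> c = 0) -> P \in unitmx.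
Proof.
move=> H; rewrite -row_free_unit -kermx_eq0; apply/eqP/row_matrixP => i; rewrite row0.
by apply: H; rewrite -row_mul mulmx_ker row0.
Qed.

(** Orthonormality of four vectors, unfolded for use by rewriting. *)
Definition on4 n (p0 p1 p2 p3 : 'rV[R]_n) : Prop :=
  [/\ dot p0 p0 = 1, dot p1 p1 = 1, dot p2 p2 = 1, dot p3 p3 = 1 &
   [/\ dot p0 p1 = 0, dot p0 p2 = 0, dot p0 p3 = 0, dot p1 p2 = 0 & dot p1 p3 = 0 /\ dot p2 p3 = 0]].

Lemma mat4_orth n (p0 p1 p2 p3 : 'rV[R]_n) : on4 p0 p1 p2 p3 ->
  mat4 p0 p1 p2 p3 *m (mat4 p0 p1 p2 p3)^T = 1%:M.
Proof.
move=> [h0 h1 h2 h3 [h01 h02 h03 h12 [h13 h23]]].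
have E i j : (mat4 p0 p1 p2 p3 *m (mat4 p0 p1 p2 p3)^T) i j =
    dot (row i (mat4 p0 p1 p2 p3)) (row j (mat4 p0 p1 p2 p3)).
  by rewrite dotE [RHS]mxE [LHS]mxE; apply: eq_bigr => k _; rewrite !mxE.
apply/matrixP => i j; rewrite E !rowK [RHS]mxE.
by have [] := ord4P i => ->; have [] := ord4P j => -> /=; rewrite ?h0 ?h1 ?h2 ?h3 ?h01 ?h02 ?h03 ?h12 ?h13 ?h23 //
  dotC ?h01 ?h02 ?h03 ?h12 ?h13 ?h23.
Qed.
End FourVectors.

Section Hemisphere.
Variables (R : realType) (m : nat) (Psi : atlas_space R m).
Hypotheses (kPsi : kflat 1 Psi) (tc : two_convex Psi).
Local Notation S := (sphere R m).
Local Notation E := 'rV[R]_(1 + m).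
Variables (v : S) (h0 : S -> Psi).
Hypothesis Lh0 : local_isometry_at h0 v.
Local Notation D := (dom v h0).
Local Notation vE := (sv v).

(** The cone over the domain of continuation; working in the cone avoids
    normalizations. *)
Definition cdom_set : set E := [set z | z != 0 /\ D (nr z)].
Local Notation Dc := cdom_set.

Lemma open_nz : open [set z : E | z != 0].
Proof.
rewrite (_ : [set z | _] = [set z : E | setT z /\ [set a : R | 0 < a] (dot z z)]); last first.
  by apply/seteqP; split=> [z|z []] /=; rewrite dot_gt0.
apply: (@open_preim_for _ _ (fun z : E => dot z z) setT [set a | 0 < a]); [exact: openT|exact: open_gt|].
by move=> z _; apply: dot_continuous; exact: cvg_id.
Qed.

Lemma open_cdom_set : open Dc.
Proof.
apply: (open_preim_for (f := @nr R m) open_nz (open_dom kPsi Lh0)) => z; exact: nr_continuous.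
Qed.

Lemma Dc_scale z (a : R) : 0 < a -> Dc z -> Dc (a *: z).
Proof. by move=> a0 [z0 Dz]; split; [rewrite scaler_eq0 gt_eqF|rewrite nrZ]. Qed.

Lemma Dc_v : Dc vE.
Proof. by split; [exact: sv_neq0|rewrite nr_sv; exact: (dom_v kPsi Lh0)]. Qed.

(** Star-shapedness in the cone. *)
Lemma Dc_add z (a : R) : 0 <= a -> Dc z -> Dc (z + a *: vE).
Proof.
move=> a0 [z0 Dz]; have [c c0 e] := sv_nrP z0.
have xv := dom_neqN kPsi Lh0 Dz.
have ca : 0 <= c * a by rewrite mulr_ge0 // ltW.
have E1 : sv (nr z) + (c * a) *: vE = c *: (z + a *: vE) by rewrite e -scalerA -scalerDr.
split; first by have := ray_neq0 xv ca; rewrite E1 scaler_eq0 gt_eqF.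
by have := dom_ray kPsi Lh0 Dz ca; rewrite /ray E1 nrZ.
Qed.

(** [tetra] for a simplicial cone whose generators need not be normalized. *)
Lemma cone_tetra (J : 'M[R]_(4, 1 + m)) (P : 'M[R]_4) : J *m J^T = 1%:M -> P \in unitmx ->
  dot (row k0 P) (row k0 P) = 1 -> row k0 P *m J = vE ->
  (forall i (c : 'rV[R]_4), i != k0 -> (forall j, 0 <= c 0 j) -> c 0 i = 0 -> c *m P != 0 -> Dc (c *m P *m J)) ->
  forall c : 'rV[R]_4, (forall j, 0 <= c 0 j) -> c *m P != 0 -> Dc (c *m P *m J).
Proof.
move=> JJ uP P0 PJ Hf.
have rn i : row i P != 0.
  apply/negP => /eqP e; have : (delta_mx 0 i : 'rV[R]_4) *m P *m invmx P = 0 by rewrite -rowE e mul0mx.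
  by rewrite mulmxK // => /rowP/(_ i)/eqP; rewrite !mxE !eqxx oner_eq0.
have d0 i : 0 < (Num.sqrt (dot (row i P) (row i P)))^-1 by rewrite invr_gt0 sqrt_dot_gt0.
pose d : 'rV[R]_4 := \row_i (Num.sqrt (dot (row i P) (row i P)))^-1.
pose V : 'M[R]_4 := \matrix_i nrE (row i P).
have EV : V = diag_mx d *m P.
  by apply/row_matrixP => i; rewrite rowK row_mul row_diag_mx -scalemxAl -rowE mxE.
have uV : V \in unitmx.
  rewrite EV unitmx_mul uP andbT unitmxE det_diag unitfE; apply/prodf_neq0 => i _.
  by rewrite mxE gt_eqF.
have cd (c : 'rV[R]_4) : c *m V = (\row_j (c 0 j * d 0 j)) *m P.
  rewrite EV mulmxA; congr (_ *m _); apply/rowP => j; rewrite mul_mx_diag !mxE //.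
have inj (y : 'rV[R]_4) : y != 0 -> y *m J != 0.
  by rewrite -!dot_gt0 dot_orth.
have r1 : row k0 V = row k0 P by rewrite rowK nrE_id.
move=> c c0 N0; split; first exact: inj.
have Sy : spherical_simplex V (nrE (c *m P)).
  have Ec : c *m P = (\row_j (c 0 j / d 0 j)) *m V.
    rewrite cd; congr (_ *m _); apply/rowP => j; rewrite !mxE mulfVK // gt_eqF //.
  rewrite Ec; apply: simplex_nrE; last by rewrite -Ec.
  by move=> j; rewrite !mxE mulr_ge0 // invr_ge0 ltW.
have := @tetra R m Psi kPsi tc v h0 Lh0 J V k0 JJ _ uV _ _ _ Sy.
rewrite /nrE -scalemxAl nrZ ?invr_gt0 ?sqrt_dot_gt0 //; apply.
- by move=> i; rewrite rowK nrE1.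
- by rewrite r1.
- move=> i ii0 y [y1 [c' c'0 Ey]].
  pose e : 'rV[R]_4 := \row_j (if unlift i j is Some l then c' 0 l else 0).
  have ei : e 0 i = 0 by rewrite mxE unlift_none.
  have El : (\row_j e 0 (lift i j)) = c' by apply/rowP => j; rewrite !mxE liftK.
  have Ey' : y = e *m V by rewrite Ey (mulmx_row' V ei) El.
  rewrite Ey' cd.
  have [] := Hf i (\row_j (e 0 j * d 0 j)) ii0 => //.
  + move=> j; rewrite mxE mulr_ge0 //; last by rewrite mxE ltW.
    by rewrite mxE; case: (unlift i j).
  + by rewrite mxE ei mul0r.
  + by rewrite -cd -Ey' -dot_gt0 y1.
Qed.

(** Coordinates with respect to the pole, two vectors of its equator and a
    vector orthogonal to the hemisphere. *)
Definition comb (z1 z2 w : E) (a b c d : R) : E := a *: vE + b *: z1 + c *: z2 + d *: w.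

(** The equator is compact and the domain is open, so an edge in the equatorial
    plane can be pushed slightly beyond the hemisphere and to the side. *)
Lemma edge_near (z1 z2 w : E) (x0 y0 x1 y1 : R) :
  (forall b c : R, comb z1 z2 w 0 b c 0 != 0 -> D (nr (comb z1 z2 w 0 b c 0))) ->
  (forall mu : R, 0 <= mu <= 1 -> comb z1 z2 w 0 ((1 - mu) * x0 + mu * x1) ((1 - mu) * y0 + mu * y1) 0 != 0) ->
  \forall e \near (0 : R), forall mu : R, 0 <= mu <= 1 ->
    Dc (comb z1 z2 w (- e) ((1 - mu) * x0 + mu * x1) ((1 - mu) * y0 + mu * y1) (e ^+ 2)).
Proof.
move=> HD Hn.
pose g (p : R * R) : E := comb z1 z2 w (- p.2) ((1 - p.1) * x0 + p.1 * x1) ((1 - p.1) * y0 + p.1 * y1) (p.2 ^+ 2).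
have cg : continuous g.
  move=> p.
  have c1 : {for p, continuous (fun p : R * R => p.1)} by exact: cvg_fst.
  have c2 : {for p, continuous (fun p : R * R => p.2)} by exact: cvg_snd.
  have cst (a : R) : {for p, continuous (fun _ : R * R => a)} by exact: cst_continuous.
  have cm (a b : R) : {for p, continuous (fun p : R * R => (1 - p.1) * a + p.1 * b)}.
    apply: (continuous_add_for (V := R)); apply: continuous_mul_for => //.
    by apply: (continuous_sub_for (V := R)).
  have cN : {for p, continuous (fun p : R * R => - p.2)}.
    have -> : (fun p : R * R => - p.2) = (fun p => 0 - p.2) by apply/funext => q; rewrite sub0r.
    exact: (continuous_sub_for (V := R) (cst 0) c2).
  have c22 : {for p, continuous (fun p : R * R => p.2 ^+ 2)}.
    exact: (continuous_mul_for c2 c2).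
  have cv (z : E) : {for p, continuous (fun _ : R * R => z)} by exact: cst_continuous.
  exact: (continuous_add_for (continuous_add_for (continuous_add_for
    (continuous_scale cN (cv vE)) (continuous_scale (cm x0 x1) (cv z1)))
    (continuous_scale (cm y0 y1) (cv z2))) (continuous_scale c22 (cv w))).
have cpt : compact (`[(0 : R), 1] : set R) := @segment_compact R 0 1.
have := (compact_near_coveringP _).1 cpt R (nbhs (0 : R)) (fun e mu => Dc (g (mu, e))) _.
move=> H; have {}H := H _; have : \forall e \near (0 : R), `[0, 1] `<=` (fun mu : R => Dc (g (mu, e))).
  apply: H => mu; rewrite /= in_itv /= => mu01.
  have Dg : Dc (g (mu, 0)).
    have E0 : g (mu, 0) = comb z1 z2 w 0 ((1 - mu) * x0 + mu * x1) ((1 - mu) * y0 + mu * y1) 0.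
      by rewrite /g /= oppr0 expr0n.
    by rewrite E0; split; [exact: Hn|exact/HD/Hn].
  have nD : nbhs (g (mu, 0)) Dc by apply: open_nbhs_nbhs; split => //; exact: open_cdom_set.
  exact: (cg (mu, 0) _ nD).
by apply: filterS => e He mu mu01; apply: (He mu); rewrite /= in_itv.
Qed.

Lemma weights_ge0 (a b c q T M : R) : 0 < M -> - M <= a -> - M <= b -> b <= M -> - M <= c -> c <= M ->
  4 * M <= q -> 4 * M <= T ->
  [/\ 0 <= a + q, 0 <= T - 5 / 8 * (T - b), 0 <= (5 / 8 * (T - b) + 5 / 4 * c) / 2
    & 0 <= (5 / 8 * (T - b) - 5 / 4 * c) / 2].
Proof. by move=> *; split; lra. Qed.

Lemma triangle_independent (u1 u2 u3 : R) : u1 - 3 / 5 * (u2 + u3) = 0 -> 4 / 5 * (u2 - u3) = 0 ->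
  u1 + u2 + u3 = 0 -> [/\ u1 = 0, u2 = 0 & u3 = 0].
Proof. by move=> *; split; lra. Qed.

(** Take a triangle around the origin of the equatorial plane and push its
    vertices u_i to p_i = - e v + u_i + e^2 w.  By [edge_near] its edges lie in
    the domain, so the three faces with vertex v do, by star-shapedness, and
    then the whole cone spanned by v and the p_i does.  For small e this cone
    contains any given point with a positive w-coordinate: the sum of the p_i
    has w-coordinate of order e^2 but reaches below the equator by the larger e. *)
Lemma hemisphere_pos (z1 z2 w : E) : on4 vE z1 z2 w ->
  (forall a b c : R, 0 <= a -> comb z1 z2 w a b c 0 != 0 -> D (nr (comb z1 z2 w a b c 0))) ->
  forall a b c d : R, 0 < d -> D (nr (comb z1 z2 w a b c d)).
Proof.
move=> on Hh a b c d dp.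
have JJ := mat4_orth on; set J := mat4 _ _ _ _ in JJ.
have cJ a' b' c' d' : vec4 a' b' c' d' *m J = comb z1 z2 w a' b' c' d' by rewrite vec4_mul.
have nz a' b' c' d' : vec4 a' b' c' d' != 0 -> comb z1 z2 w a' b' c' d' != 0.
  by rewrite -cJ -!dot_gt0 dot_orth.
have nzxy b' c' : (b' != 0) || (c' != 0) -> comb z1 z2 w 0 b' c' 0 != 0.
  move=> h; apply: nz; apply/negP => /eqP e.
  have := congr1 (fun z : 'rV[R]_4 => z 0 k1) e; have := congr1 (fun z : 'rV[R]_4 => z 0 k2) e.
  by rewrite !mxE /= => e2 e1; move: h; rewrite e1 e2 eqxx.
have HD b' c' := Hh 0 b' c' (lexx 0).
have n12 := @edge_near z1 z2 w 1 0 (- (3 / 5)) (4 / 5) HD.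
have n13 := @edge_near z1 z2 w 1 0 (- (3 / 5)) (- (4 / 5)) HD.
have n23 := @edge_near z1 z2 w (- (3 / 5)) (4 / 5) (- (3 / 5)) (- (4 / 5)) HD.
have {}n12 := n12 _; have {}n13 := n13 _; have {}n23 := n23 _.
have nn : \forall e \near (0 : R), forall mu : R, 0 <= mu <= 1 ->
   [/\ Dc (comb z1 z2 w (- e) ((1 - mu) * 1 + mu * (- (3 / 5))) ((1 - mu) * 0 + mu * (4 / 5)) (e ^+ 2)),
     Dc (comb z1 z2 w (- e) ((1 - mu) * 1 + mu * (- (3 / 5))) ((1 - mu) * 0 + mu * (- (4 / 5))) (e ^+ 2)) &
     Dc (comb z1 z2 w (- e) ((1 - mu) * (- (3 / 5)) + mu * (- (3 / 5))) ((1 - mu) * (4 / 5) + mu * (- (4 / 5))) (e ^+ 2))].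
  have {}n12 : \forall e \near (0 : R), forall mu : R, 0 <= mu <= 1 -> 
     Dc (comb z1 z2 w (- e) ((1 - mu) * 1 + mu * (- (3 / 5))) ((1 - mu) * 0 + mu * (4 / 5)) (e ^+ 2)).
    apply: n12 => mu mu01; apply: nzxy.
    have [-> |h] := eqVneq mu 0; first by rewrite subr0 !mul1r mul0r addr0 oner_eq0.
    by apply/orP; right; rewrite mulr0 add0r mulf_neq0.
  have {}n13 : \forall e \near (0 : R), forall mu : R, 0 <= mu <= 1 -> 
     Dc (comb z1 z2 w (- e) ((1 - mu) * 1 + mu * (- (3 / 5))) ((1 - mu) * 0 + mu * (- (4 / 5))) (e ^+ 2)).
    apply: n13 => mu mu01; apply: nzxy.
    have [-> |h] := eqVneq mu 0; first by rewrite subr0 !mul1r mul0r addr0 oner_eq0.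
    by apply/orP; right; rewrite mulr0 add0r mulf_neq0 // oppr_eq0.
  have {}n23 : \forall e \near (0 : R), forall mu : R, 0 <= mu <= 1 -> 
     Dc (comb z1 z2 w (- e) ((1 - mu) * (- (3 / 5)) + mu * (- (3 / 5))) ((1 - mu) * (4 / 5) + mu * (- (4 / 5))) (e ^+ 2)).
    apply: n23 => mu mu01; apply: nzxy; apply/orP; left.
    by rewrite -mulrDl subrK mul1r oppr_eq0.
  by near=> e => mu mu01; split; move: mu mu01; near: e.
have /nbhs_ballP[r /= r0 Hr] := nn.
pose M := 1 + `|a| + `|b| + `|c|.
have M0 : 0 < M by rewrite /M !ltr_wpDr.
have [a1 b1 c1] : [/\ `|a| <= M, `|b| <= M & `|c| <= M].
  by rewrite /M; move: (normr_ge0 a) (normr_ge0 b) (normr_ge0 c); clear; move=> ? ? ?; split; lra.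
(* The bound e <= d / (4 M) makes the target point lie in the cone: the
   coefficients below are nonnegative as soon as d / e >= 4 M. *)
pose e := Num.min (r / 2) (Num.min 1 (d / (4 * M))).
have [e0 er e1 eM] : [/\ 0 < e, e < r, e <= 1 & e <= d / (4 * M)].
  split.
  - by rewrite /e !lt_min !divr_gt0 // ?mulr_gt0 // ltr01.
  - by rewrite /e gt_min; apply/orP; left; lra.
  - by rewrite /e !ge_min lexx /= orbT.
  - by rewrite /e !ge_min lexx /= !orbT.
have He := Hr e; rewrite /ball /= sub0r normrN gtr0_norm // in He; have {}He := He er.
pose p1 := vec4 (- e) 1 0 (e ^+ 2).
pose p2 := vec4 (- e) (- (3 / 5)) (4 / 5) (e ^+ 2).
pose p3 := vec4 (- e) (- (3 / 5)) (- (4 / 5)) (e ^+ 2).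
pose P : 'M[R]_4 := mat4 (vec4 1 0 0 0) p1 p2 p3.
(* The rational points u_i = (1, 0), (-3/5, 4/5), (-3/5, -4/5) of the unit
   circle surround the origin. *)
have cP l u1 u2 u3 : vec4 l u1 u2 u3 *m P = vec4 (l - e * (u1 + u2 + u3)) (u1 - (3 / 5) * (u2 + u3))
     ((4 / 5) * (u2 - u3)) (e ^+ 2 * (u1 + u2 + u3)).
  rewrite vec4_mul; apply/rowP => j; rewrite !mxE.
  by have [] := ord4P j => -> /=; ring.
have cPJ l u1 u2 u3 : vec4 l u1 u2 u3 *m P *m J = u1 *: (p1 *m J) + u2 *: (p2 *m J) + u3 *: (p3 *m J) + l *: vE.
  rewrite vec4_mul !mulmxDl -!scalemxAl.
  have -> : vec4 1 0 0 0 *m J = vE by rewrite cJ /comb !scale0r !addr0 scale1r.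
  by rewrite -!addrA addrC !addrA.
have uP : P \in unitmx.
  apply: unitmx_ker => c'; rewrite [c']vec4_eta cP.
  set l := c' 0 k0; set u1 := c' 0 k1; set u2 := c' 0 k2; set u3 := c' 0 k3 => h.
  have h0' := congr1 (fun z : 'rV[R]_4 => z 0 k0) h; have h1' := congr1 (fun z : 'rV[R]_4 => z 0 k1) h.
  have h2' := congr1 (fun z : 'rV[R]_4 => z 0 k2) h; have h3' := congr1 (fun z : 'rV[R]_4 => z 0 k3) h.
  rewrite !mxE /= in h0' h1' h2' h3'.
  have T0 : u1 + u2 + u3 = 0.
    by move/eqP: h3'; rewrite mulf_eq0 expf_eq0 /= gt_eqF //= => /eqP.
  rewrite T0 mulr0 subr0 in h0'.
  have [-> -> ->] := triangle_independent h1' h2' T0.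
  by rewrite h0'; apply/rowP => j; rewrite !mxE; have [] := ord4P j => ->.
have r0P : row k0 P = vec4 1 0 0 0 by rewrite rowK.
have v1 : vec4 1 0 0 0 *m J = vE by rewrite cJ /comb !scale0r !addr0 scale1r.
(* a combination of two of the p_i is a positive multiple of an edge point *)
have edge (q q' : 'rV[R]_4) (u u' : R) : 0 <= u -> 0 <= u' ->
   (forall mu : R, 0 <= mu <= 1 -> Dc (((1 - mu) *: q + mu *: q') *m J)) -> 
   forall l, 0 <= l -> (u *: (q *m J) + u' *: (q' *m J)) + l *: vE != 0 -> Dc ((u *: (q *m J) + u' *: (q' *m J)) + l *: vE).
  move=> u0 u'0 Hq l l0 N0.
  have [uu|uu] := eqVneq (u + u') 0.
    have [eu eu'] : u = 0 /\ u' = 0 by move/eqP: uu; rewrite paddr_eq0 // => /andP[/eqP-> /eqP->].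
    rewrite eu eu' !scale0r !add0r in N0 *.
    apply: Dc_scale; last exact: Dc_v.
    by rewrite lt_neqAle l0 andbT eq_sym; apply: contra N0 => /eqP ->; rewrite scale0r.
  have up : 0 < u + u' by rewrite lt_neqAle eq_sym uu addr_ge0.
  apply: Dc_add => //.
  have -> : u *: (q *m J) + u' *: (q' *m J) = (u + u') *: (((1 - u' / (u + u')) *: q + (u' / (u + u')) *: q') *m J).
    rewrite mulmxDl -!scalemxAl scalerDr !scalerA; congr (_ *: _ + _ *: _); field; by rewrite gt_eqF.
  apply: Dc_scale => //; apply: Hq.
  by rewrite divr_ge0 // ?(ltW up) //= ler_pdivrMr // mul1r lerDr.
have edgeE (x0 y0 x1 y1 mu : R) : ((1 - mu) *: vec4 (- e) x0 y0 (e ^+ 2) + mu *: vec4 (- e) x1 y1 (e ^+ 2)) *m J =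
    comb z1 z2 w (- e) ((1 - mu) * x0 + mu * x1) ((1 - mu) * y0 + mu * y1) (e ^+ 2).
  rewrite -cJ; congr (_ *m _); apply/rowP => j; rewrite !mxE.
  by have [] := ord4P j => -> /=; ring.
have faces i (c' : 'rV[R]_4) : i != k0 -> (forall j, 0 <= c' 0 j) -> c' 0 i = 0 -> c' *m P != 0 -> Dc (c' *m P *m J).
  move=> ik c'0 ci N0.
  have N1 : c' *m P *m J != 0 by move: N0; rewrite -!dot_gt0 (dot_orth _ _ JJ).
  move: N1; rewrite [c']vec4_eta cPJ.
  have [E0|E1|E2|E3] := ord4P i.
  - by rewrite E0 eqxx in ik.
  - rewrite E1 in ci; rewrite ci scale0r add0r; apply: edge => // mu mu01; rewrite edgeE.
    by have [] := He mu mu01.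
  - rewrite E2 in ci; rewrite ci scale0r addr0; apply: edge => // mu mu01; rewrite edgeE.
    by have [] := He mu mu01.
  - rewrite E3 in ci; rewrite ci scale0r addr0; apply: edge => // mu mu01; rewrite edgeE.
    by have [] := He mu mu01.
have row1 : dot (row k0 P) (row k0 P) = 1 by rewrite r0P -(dot_orth _ _ JJ) v1 sv1.
have rowJ : row k0 P *m J = vE by rewrite r0P.
have key := cone_tetra JJ uP row1 rowJ faces.
pose T := d / e ^+ 2.
have e20 : 0 < e ^+ 2 by rewrite exprn_gt0.
have de : 4 * M <= d / e.
  have h : e * (4 * M) <= d by move: eM; rewrite ler_pdivlMr // mulr_gt0.
  by rewrite ler_pdivlMr // mulrC.
have TM : 4 * M <= T.
  apply: (le_trans de).
  have h : e ^+ 2 <= e by rewrite expr2 ler_piMl // ltW.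
  by rewrite /T ler_pM2l // lef_pV2 ?posrE.
(* solving for the coefficients of the target point *)
pose l := a + d / e; pose mm := 5 / 8 * (T - b).
have [ab bb cb] : [/\ - M <= a, - M <= b <= M & - M <= c <= M].
  by move: a1 b1 c1; rewrite !ler_norml => /andP[-> _] -> ->.
have /andP[bb1 bb2] := bb; have /andP[cb1 cb2] := cb.
have := key (vec4 l (T - mm) ((mm + 5 / 4 * c) / 2) ((mm - 5 / 4 * c) / 2)).
have -> : vec4 l (T - mm) ((mm + 5 / 4 * c) / 2) ((mm - 5 / 4 * c) / 2) *m P = vec4 a b c d.
  rewrite cP; apply/rowP => j; rewrite !mxE.
  have [] := ord4P j => -> /=; rewrite /l /mm /T; field; by rewrite gt_eqF.
rewrite cJ; case => //.
- have [q0 q1 q2 q3] : [/\ 0 <= l, 0 <= T - mm, 0 <= (mm + 5 / 4 * c) / 2 & 0 <= (mm - 5 / 4 * c) / 2].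
    exact: weights_ge0 M0 ab bb1 bb2 cb1 cb2 de TM.
  by move=> j; rewrite mxE; have [] := ord4P j => -> /=.
- apply/negP => /eqP/(congr1 (fun z : 'rV[R]_4 => z 0 k3)); rewrite !mxE /= => d00.
  by rewrite d00 ltxx in dp.
Unshelve. all: by end_near. Qed.

(** By symmetry in w the points off the 3-space of the hemisphere are in the
    domain. *)
Lemma hemisphere_side (z1 z2 w : E) : on4 vE z1 z2 w ->
  (forall a b c : R, 0 <= a -> comb z1 z2 w a b c 0 != 0 -> D (nr (comb z1 z2 w a b c 0))) ->
  forall a b c d : R, d != 0 -> D (nr (comb z1 z2 w a b c d)).
Proof.
move=> on Hh a b c d; rewrite neq_lt => /orP[d0|d0]; last exact: hemisphere_pos.
have on' : on4 vE z1 z2 (- w).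
  have [h0' h1 h2 h3 [h01 h02 h03 h12 [h13 h23]]] := on.
  by split; rewrite ?dotNl ?dotNr ?opprK //; split; rewrite ?dotNr ?h03 ?h13 ?h23 ?oppr0.
have E1 a' b' c' d' : comb z1 z2 w a' b' c' d' = comb z1 z2 (- w) a' b' c' (- d').
  by rewrite /comb scalerN scaleNr opprK.
rewrite E1; apply: (hemisphere_pos on') => [a' b' c' a'0|]; last by rewrite oppr_gt0.
by have := Hh a' b' c' a'0; rewrite E1 oppr0.
Qed.

(** Off the 3-space of the hemisphere, use the orthogonal direction through the
    point.  A point of the opposite hemisphere other than - v has a nonzero z1-
    or z2-coordinate; exchange that vector with [w0] and use that the points
    with a nonzero [w0]-coordinate are already covered. *)
Lemma hemisphere_dom (z1 z2 w0 : E) : on4 vE z1 z2 w0 ->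
  (forall a b c : R, 0 <= a -> comb z1 z2 0 a b c 0 != 0 -> D (nr (comb z1 z2 0 a b c 0))) ->
  forall x : S, sv x != - vE -> D x.
Proof.
move=> on0 Hh x xv.
have [h0' h1 h2 h3 [h01 h02 h03 h12 [h13 h23]]] := on0.
have cw w a b c : comb z1 z2 w a b c 0 = comb z1 z2 0 a b c 0 by rewrite /comb !scale0r.
have side w : on4 vE z1 z2 w -> forall a b c d : R, d != 0 -> D (nr (comb z1 z2 w a b c d)).
  by move=> on; apply: hemisphere_side => // a b c a0; rewrite cw; exact: Hh.
pose a := dot (sv x) vE; pose b := dot (sv x) z1; pose c := dot (sv x) z2.
pose r := sv x - (a *: vE + b *: z1 + c *: z2).
have dotr y : dot r y = dot (sv x) y - (a * dot vE y + b * dot z1 y + c * dot z2 y).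
  by rewrite dotBl !dotDl !dotZl.
have rv : dot r vE = 0 by rewrite dotr h0' (dotC z1) h01 (dotC z2) h02 -/a; ring.
have rz1 : dot r z1 = 0 by rewrite dotr h1 h01 (dotC z2) h12 -/b; ring.
have rz2 : dot r z2 = 0 by rewrite dotr h2 h02 h12 -/c; ring.
have xE : sv x = a *: vE + b *: z1 + c *: z2 + r by rewrite /r addrC subrK.
have [r0|rn] := eqVneq r 0; last first.
  have sr := sqrt_dot_gt0 rn.
  have on : on4 vE z1 z2 (nrE r).
    by split=> //; [exact: nrE1|split => //; rewrite /nrE ?dotZr ?(dotC _ r) ?rv ?rz1 ?rz2 ?mulr0 //; split; rewrite dotZr (dotC _ r) ?rz1 ?rz2 mulr0].
  have := side _ on a b c (Num.sqrt (dot r r)) (lt0r_neq0 sr).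
  by rewrite /comb -nrE_scale -xE nr_sv.
rewrite r0 addr0 in xE.
have xE0 : sv x = comb z1 z2 0 a b c 0 by rewrite /comb scaler0 addr0.
have [a0|a0] := leP 0 a.
  have := Hh a b c a0; rewrite -xE0 nr_sv; apply; exact: sv_neq0.
have [c0|cn] := eqVneq c 0.
  have [b0|bn] := eqVneq b 0.
    move: xv; rewrite xE b0 c0 !scale0r !addr0.
    have : a * a = 1 by rewrite -(sv1 x) xE b0 c0 !scale0r !addr0 dotZl dotZr h0' mulr1.
    move/eqP; rewrite -expr2 sqrf_eq1 => /orP[/eqP a1|/eqP ->]; first by rewrite a1 ltr10 in a0.
    by rewrite scaleN1r eqxx.
  have on : on4 vE z2 w0 z1.
    by split => //; split; rewrite // ?(dotC z2 z1) // (dotC w0).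
  have E1 : sv x = comb z2 w0 z1 a c 0 b.
    by rewrite /comb scale0r addr0 xE -!addrA; congr (_ + _); rewrite addrC.
  rewrite -(nr_sv x) E1; apply: (hemisphere_side on) bn => a' b' c' a'0.
  have -> : comb z2 w0 z1 a' b' c' 0 = comb z1 z2 w0 a' 0 b' c' by rewrite /comb !scale0r !addr0.
  have [-> N0|cn' _] := eqVneq c' 0; last exact: side.
  by move: N0; rewrite cw; exact: Hh.
have on : on4 vE z1 w0 z2.
  by split => //; split; rewrite // (dotC w0).
have E1 : sv x = comb z1 w0 z2 a b 0 c by rewrite /comb scale0r addr0 xE.
rewrite -(nr_sv x) E1; apply: (hemisphere_side on) cn => a' b' c' a'0.
have -> : comb z1 w0 z2 a' b' c' 0 = comb z1 z2 w0 a' b' 0 c' by rewrite /comb !scale0r !addr0.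
have [-> N0|cn' _] := eqVneq c' 0; last exact: side.
by move: N0; rewrite cw; exact: Hh.
Qed.
End Hemisphere.

(** * Extension to the sphere *)

Section StarDomain.
Variables (R : realType) (m : nat) (Psi : atlas_space R m).
Hypothesis kPsi : kflat 1 Psi.
Local Notation S := (sphere R m).
Local Notation E := 'rV[R]_(1 + m).
Variables (v : S) (h0 : S -> Psi) (N : set S).
Hypotheses (sN : star v N) (LN : forall x, N x -> local_isometry_at h0 x).

Lemma star_base_local : local_isometry_at h0 v.
Proof. by apply: LN; have [] := sN. Qed.

(** Where the local isometry [h0] itself is defined on a star-shaped set, it
    provides the limits along rays. *)
Lemma star_dom x : N x -> dom v h0 x.
Proof.
move=> Nx; have [Nv NN Nr] := sN; have xv := NN _ Nx.
apply: (@ray_lemma R m Psi kPsi v h0 star_base_local x (fun b => h0 (ray v x b))) => //.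
  move=> b A b0 nA.
  have c1 := local_isometry_continuous (LN (Nr _ _ Nx b0)).
  have c2 := ray_continuous xv b0.
  have : \forall b' \near b, A (h0 (ray v x b')).
    exact: (near_comp c2 (near_comp c1 nA)).
  move=> /nbhs_ballP[d /= d0 Hd]; exists d => // b' /andP[b1 b2]; apply: Hd.
  by rewrite /ball /= distrC ger0_norm ?subr_ge0 ?(ltW b1) // ltrBlDl.
move=> b b0 Hd b' bb'.
have [_ sD LD aD] := good_dom kPsi star_base_local.
have b'0 : 0 <= b' by apply: le_trans b0 (ltW bb').
have Nb := Nr _ _ Nx b'0.
have : agree_near (dev v h0) h0 (ray v x b').
  apply: (star_agree kPsi sD (Hd _ bb') LD) => // t t01; apply: LN; exact: (star_seg sN).
exact: nbhs_singleton.
Qed.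

Lemma star_dev x : N x -> agree_near (dev v h0) h0 x.
Proof.
move=> Nx; have [_ sD LD aD] := good_dom kPsi star_base_local.
by apply: (star_agree kPsi sD (star_dom Nx) LD) => // t t01; apply: LN; exact: (star_seg sN).
Qed.
End StarDomain.

Section Extension.
Variables (R : realType) (m : nat) (Psi : atlas_space R m).
Hypotheses (kPsi : kflat 1 Psi) (tc : two_convex Psi).
Local Notation S := (sphere R m).
Local Notation E := 'rV[R]_(1 + m).

(** The vectors z1 and z2 span the equator of the hemisphere with pole v. *)
Definition halfsphere (v z1 z2 : E) : set S :=
  [set x | exists a b c : R, 0 <= a /\ sv x = a *: v + b *: z1 + c *: z2].

Lemma sv_ray (v x : S) (b : R) : sv x != - sv v -> 0 <= b -> exists2 c : R, 0 < c & sv (ray v x b) = c *: (sv x + b *: sv v).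
Proof. by move=> xv b0; exact: sv_nrP (ray_neq0 xv b0). Qed.

Lemma star_halfsphere (v : S) (z1 z2 : E) : dot (sv v) z1 = 0 -> dot (sv v) z2 = 0 ->
  star v (halfsphere (sv v) z1 z2).
Proof.
move=> v1 v2.
have nv x : halfsphere (sv v) z1 z2 x -> sv x != - sv v.
  move=> [a [b [c [a0 e]]]]; apply/eqP => e'.
  have := congr1 (dot (sv v)) e; rewrite e' dotNr !dotDr !dotZr v1 v2 sv1 !mulr0 !addr0 mulr1 => h.
  by move: a0; rewrite -h ler0N1.
split=> //; first by exists 1, 0, 0; rewrite ler01 scale1r !scale0r !addr0.
move=> x b Hx b0; have [c c0 e] := sv_ray (nv x Hx) b0; have [a [b' [c' [a0 e']]]] := Hx.
exists (c * (a + b)), (c * b'), (c * c'); split; first by rewrite mulr_ge0 ?addr_ge0 // ltW.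
rewrite e e' -!scalerA -!scalerDr; congr (_ *: _).
by rewrite scalerDl -!addrA; congr (_ + _); rewrite !addrA addrC !addrA.
Qed.

Lemma halfsphere_full (v : S) (z1 z2 w0 : E) h0 : on4 (sv v) z1 z2 w0 ->
  (forall x, halfsphere (sv v) z1 z2 x -> local_isometry_at h0 x) ->
  forall x : S, sv x != - sv v -> @dom R m Psi v h0 x.
Proof.
move=> on LO; have [e0 e1 e2 e3 [e01 e02 e03 e12 [e13 e23]]] := on.
have sN := star_halfsphere e01 e02.
apply: (hemisphere_dom kPsi tc (star_base_local sN LO) on) => a b c a0 N0.
apply: (star_dom kPsi sN LO); have [k k0 ek] := sv_nrP N0.
exists (k * a), (k * b), (k * c); split; first by rewrite mulr_ge0 // ltW.
by rewrite ek /comb scaler0 addr0 !scalerDr !scalerA.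
Qed.

(** The arc that joins the antipodes of [v] and [w]. *)
Definition opp_cone (v w : E) : set S :=
  [set x | exists a b : R, [/\ 0 <= a, 0 <= b & sv x = - (a *: w + b *: v)]].

Lemma star_opp_cone (v w : S) : dot (sv v) (sv w) = 0 -> star w (~` opp_cone (sv v) (sv w)).
Proof.
move=> vw.
have nw x : ~ opp_cone (sv v) (sv w) x -> sv x != - sv w.
  by move=> H; apply/eqP => e; apply: H; exists 1, 0; rewrite ler01 lexx scale1r scale0r addr0.
split=> //.
  move=> [a [b [a0 b0 e]]]; have := congr1 (dot (sv w)) e.
  rewrite dotNr dotDr !dotZr sv1 (dotC (sv w)) vw mulr0 addr0 mulr1 => h.
  by move: a0; rewrite -[a]opprK -h ler0N1.
move=> x b Hx b0 [a [b' [a0 b'0 e']]]; have [c c0 e] := sv_ray (nw x Hx) b0; apply: Hx.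
exists (c^-1 * a + b), (c^-1 * b'); split; first by rewrite addr_ge0 // mulr_ge0 // invr_ge0 ltW.
  by rewrite mulr_ge0 // invr_ge0 ltW.
have -> : sv x = c^-1 *: sv (ray w x b) - b *: sv w.
  by rewrite e scalerA mulVf ?gt_eqF // scale1r addrK.
by rewrite e' scalerN scalerDr !scalerA scalerDl -!opprD; congr (- _); rewrite addrAC.
Qed.

(** The continuation from [v] misses the antipode of [v], the one from an
    orthogonal point w misses the antipode of w.  The second is a continuation
    of the first off the arc from - v to - w; they agree on that arc as well,
    since its complement is dense. *)
Lemma sphere_extension (v : S) (z1 z2 w0 : E) (h0 : S -> Psi) : on4 (sv v) z1 z2 w0 ->
  (forall x, halfsphere (sv v) z1 z2 x -> local_isometry_at h0 x) ->
  exists theta : S -> Psi, (forall x, local_isometry_at theta x) /\ agree_near theta h0 v.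
Proof.
move=> on LO; have [e0 e1 e2 e3 [e01 e02 e03 e12 [e13 e23]]] := on.
have sN := star_halfsphere e01 e02.
have Lv := star_base_local sN LO.
have full := halfsphere_full on LO.
pose w : S := nr w0; have ew : sv w = w0 by exact: nr_unit.
pose h1 := dev v h0.
have vw : dot (sv v) (sv w) = 0 by rewrite ew.
have sN1 := star_opp_cone vw.
have L1 x : (~` opp_cone (sv v) (sv w)) x -> local_isometry_at h1 x.
  move=> Hx; apply: (dev_local kPsi Lv); apply: full; apply/eqP => e; apply: Hx.
  by exists 0, 1; rewrite ler01 lexx scale1r scale0r add0r.
have Lw := star_base_local sN1 L1.
have on' : on4 (sv w) z1 z2 (sv v).
  by rewrite ew; do 2!(split; rewrite ?sv1 ?(dotC w0) ?(dotC z1 (sv v)) ?(dotC z2 (sv v)) //).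
have LO1 x : halfsphere (sv w) z1 z2 x -> local_isometry_at h1 x.
  move=> [a [b [c [a0 ex]]]]; apply: L1 => -[al [be [al0 be0 e]]].
  have dv := congr1 (dot (sv v)) (etrans (esym ex) e); have dw := congr1 (dot (sv w)) (etrans (esym ex) e).
  have d1 := congr1 (dot z1) (etrans (esym ex) e); have d2 := congr1 (dot z2) (etrans (esym ex) e).
  have [f0 f1 f2] : [/\ dot w0 z1 = 0, dot w0 z2 = 0 & dot z2 z1 = 0] by split; rewrite dotC.
  have [g0 g1 g2] : [/\ dot w0 (sv v) = 0, dot z1 (sv v) = 0 & dot z2 (sv v) = 0] by split; rewrite dotC.
  rewrite ew !(dotNr, dotDr, dotZr, e0, e1, e2, e3, e01, e02, e03, e12, e13, e23, f0, f1, f2, g0, g1, g2) in dv dw d1 d2.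
  have bb : b = 0 by lra.
  have cc : c = 0 by lra.
  have aa : a = 0 by lra.
  by have := sv_neq0 x; rewrite ex aa bb cc !scale0r !addr0 eqxx.
have full1 := halfsphere_full on' LO1.
pose h2 := dev w h1.
have [[hS _] _ _ _ _] := riemannian_sphere R m.
have [[hPsi _] _ _ _ _] := kPsi.1.
have cPsi := riemannian_charted kPsi.1.
have agree (x : S) : sv x != - sv v -> sv x != - sv w -> agree_near h1 h2 x.
  move=> xv xw.
  have La : local_isometry_at h1 x by apply: (dev_local kPsi Lv); exact: full.
  have Lb : local_isometry_at h2 x by apply: (dev_local kPsi Lw); exact: full1.
  apply: (local_rigidity (@charted_sphere R m) cPsi hPsi) => //; first by move=> q; exact: spherical_at_ex.
  (* Points with a nonzero z1-coordinate are off the arc. *)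
  have off (y : S) : dot (sv y) z1 != 0 -> agree_near h1 h2 y.
    move=> yz; have : agree_near h2 h1 y.
      apply: (star_dev kPsi sN1 L1) => -[a [b [_ _ e]]]; move: yz.
      by rewrite e ew dotNl dotDl !dotZl (dotC w0) e13 e01 !mulr0 addr0 oppr0 eqxx.
    by apply: filterS => z ->.
  move=> A nA; have [x1|x1] := eqVneq (dot (sv x) z1) 0; last first.
    by exists x; split; [exact: off|exact: nbhs_singleton].
  have c1 : {for (0 : R), continuous (fun e : R => sv x + e *: z1)}.
    apply: continuous_add_for; first exact: cst_continuous.
    by apply: continuous_scale; [exact: cvg_id|exact: cst_continuous].
  have x0 : sv x + 0 *: z1 != 0 by rewrite scale0r addr0 sv_neq0.
  have nA' : nbhs (nr (sv x + 0 *: z1) : S) A by rewrite scale0r addr0 nr_sv.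
  have [d /= d0 Hd] := (nbhs_ballP _ _).1 (near_comp c1 (near_comp (nr_continuous x0) nA')).
  have Ad : A (nr (sv x + (d / 2) *: z1)).
    by apply: Hd; rewrite /ball /= sub0r normrN gtr0_norm ?divr_gt0 //; lra.
  exists (nr (sv x + (d / 2) *: z1)); split => //; apply: off.
  have z0 : sv x + (d / 2) *: z1 != 0.
    apply/negP => /eqP/(congr1 (fun z => dot z z1)); rewrite dotDl dotZl x1 e1 dot0l => h; lra.
  have [k k0 ->] := sv_nrP z0.
  by rewrite dotZl dotDl dotZl x1 e1 mulf_neq0 ?gt_eqF // add0r mulr1 divr_gt0.
exists (fun x => if sv x == - sv v then h2 x else h1 x); split=> [x|].
  have [xv|xv] := eqVneq (sv x) (- sv v); last first.
    apply: (local_isometry_ext _ (dev_local kPsi Lv (full _ xv))).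
    apply: filterS (near_dom kPsi Lv (full _ xv)) => y Dy.
    by rewrite (negPf (dom_neqN kPsi Lv Dy)).
  have xw : sv x != - sv w.
    rewrite xv eqr_opp; apply/eqP => e; have := vw; rewrite -e sv1 => /eqP; by rewrite oner_eq0.
  apply: (local_isometry_ext _ (dev_local kPsi Lw (full1 _ xw))).
  apply: filterS (near_dom kPsi Lw (full1 _ xw)) => y Dy.
  case: eqVneq => // yv; apply/esym.
  exact: (nbhs_singleton (agree _ yv (dom_neqN kPsi Lw Dy))).
have [_ _ _ aD] := good_dom kPsi Lv.
have Dv := near_dom kPsi Lv (dom_v kPsi Lv).
have : \forall y \near v, dom v h0 y /\ h1 y = h0 y by apply: filterI.
by apply: filterS => y [Dy <-]; rewrite (negPf (dom_neqN kPsi Lv Dy)).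
Qed.
End Extension.

(** * Geodesic isometric maps into the sphere *)

Section SphereMaps.
Variables (R : realType) (m : nat).
Local Notation S := (sphere R m).
Local Notation E := 'rV[R]_(1 + m).

Lemma dot_suml (I : Type) (r : seq I) n (F : I -> 'rV[R]_n) y :
  dot (\sum_(i <- r) F i) y = \sum_(i <- r) dot (F i) y.
Proof.
elim: r => [|i r IH]; first by rewrite !big_nil dot0l.
by rewrite !big_cons dotDl IH.
Qed.

Lemma unit_eq n (x y : 'rV[R]_n) : dot x x = 1 -> dot y y = 1 -> dot x y = 1 -> x = y.
Proof.
move=> xx yy xy; apply/eqP; rewrite -subr_eq0; apply/negPn; rewrite -dot_gt0.
by rewrite dotBl !dotBr xx yy (dotC y) xy !subrr ltxx.
Qed.

Lemma geodesic_dot k n (V : 'M[R]_(k, n)) (Q : set 'rV[R]_n) (f : 'rV[R]_n -> S) p q :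
  geodesic_isometric_on V Q f -> (forall x, Q x -> (x <= V)%MS) -> (forall x, Q x -> dot x x = 1) ->
  (forall p q al be, Q p -> Q q -> 0 <= al -> 0 <= be ->
    dot (al *: p + be *: q) (al *: p + be *: q) = 1 -> Q (al *: p + be *: q)) ->
  Q p -> Q q -> q != - p -> dot (sv (f p)) (sv (f q)) = dot p q.
Proof.
move=> gf sV unit cone Qp Qq qNp.
have [->|qp] := eqVneq q p; first by rewrite sv1 unit.
have H := @cone_additive R m S (@riemannian_sphere R m) k n V Q f (@sv R m) p q gf sV (unit _ Qp) (unit _ Qq) qp qNp.
have [] // := H _ => al be al0 be0 u; split; last exact: spherical_sv.
exact: cone.
Qed.

Lemma geodesic_isometric_sub (M : atlas_space R m) (O : set M) k n (V : 'M[R]_(k, n)) (Q : set 'rV[R]_n)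
    (f : 'rV[R]_n -> submanifold O) :
  geodesic_isometric_on V Q f -> @geodesic_isometric_on R k n m V Q M (fun x => set_val (f x)).
Proof.
move=> [H1 H2]; split=> [p j Qp cp|p a t pp aa pa nS]; first exact: H1.
have [c H] := H2 p a t pp aa pa nS; split; last exact: H.
apply: (@continuous_comp _ _ _ (fun s : R => f (cos s *: p + sin s *: a)) (@set_val M O)) => //.
exact: set_val_continuous.
Qed.

Local Notation o0 := (@Ordinal 3 0 isT).
Local Notation o1 := (@Ordinal 3 1 isT).
Local Notation o2 := (@Ordinal 3 2 isT).

Lemma ord3P (i : 'I_3) : [\/ i = o0, i = o1 | i = o2].
Proof.
by case: i => -[|[|[|//]]] h; [exact: (Or31 _ _ (val_inj _))|exact: (Or32 _ _ (val_inj _))|exact: (Or33 _ _ (val_inj _))].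
Qed.

(** Inner products of non-antipodal points are preserved, so the images of the
    basis vectors are orthonormal, and the image of x has the coordinates of x
    with respect to them; being of norm 1 it has no other component.  Two
    equatorial points are antipodal to basis vectors and need a detour through a
    point of the open hemisphere. *)
Lemma hemisphere_linear (f : 'rV[R]_3 -> S) :
  geodesic_isometric_on (1%:M : 'M[R]_3) (@hemisphere R) f ->
  exists J : 'M[R]_(3, 1 + m), J *m J^T = 1%:M /\ forall x, hemisphere x -> sv (f x) = x *m J.
Proof.
move=> gf.
have D p q : hemisphere p -> hemisphere q -> q != - p -> dot (sv (f p)) (sv (f q)) = dot p q.
  apply: (geodesic_dot gf) => [x _|x [] //|x y al be [x1 x2] [y1 y2] a0 b0 u]; first exact: submx1.
  by split => //; rewrite !mxE addr_ge0 // mulr_ge0.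
pose e i : 'rV[R]_3 := delta_mx 0 i.
have eE i j : dot (e i) (e j) = (i == j)%:R by rewrite dot_delta mxE eqxx eq_sym.
have He i : hemisphere (e i) by split; rewrite ?eE ?eqxx // mxE ler0n.
pose J := \matrix_i sv (f (e i)).
have JJ : J *m J^T = 1%:M.
  apply/matrixP => i j; have -> : (J *m J^T) i j = dot (row i J) (row j J).
    by rewrite dotE [RHS]mxE [LHS]mxE; apply: eq_bigr => k _; rewrite !mxE.
  rewrite !rowK D // ?eE ?mxE //.
  apply/eqP => /(congr1 (dot (e j))); rewrite dotNr !eE eqxx => h.
  have := ler0n R (j == i); by rewrite -[_%:R]opprK -h ler0N1.
have xJ (x : 'rV[R]_3) y : dot y (x *m J) = \sum_i x 0 i * dot y (sv (f (e i))).
  rewrite mulmx_sum_row dotC dot_suml; apply: eq_bigr => i _; by rewrite dotZl rowK dotC.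
have xE (x : 'rV[R]_3) : dot x x = \sum_i x 0 i * dot x (e i).
  by apply: eq_bigr => i _; rewrite dot_delta.
have lin x : hemisphere x -> (forall i, dot (sv (f x)) (sv (f (e i))) = dot x (e i)) -> sv (f x) = x *m J.
  move=> [x1 _] H; apply: unit_eq; rewrite ?sv1 ?dot_orth //.
  by rewrite xJ -[RHS]x1 xE; apply: eq_bigr => i _; rewrite H.
have lin1 x : hemisphere x -> x != - e o0 -> x != - e o1 -> sv (f x) = x *m J.
  move=> Hx x0 x1; apply: lin => // i; apply: D => //.
  rewrite eq_sym eqr_oppLR; have [->|->|->] := ord3P i => //.
  apply/eqP => h; have [_] := Hx; rewrite h !mxE /= => h'.
  by move: h'; rewrite ler0N1.
have opp k : k != o2 -> dot (sv (f (- e k))) (sv (f (e k))) = -1.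
  (* a unit vector between - e k and the pole e o2 *)
  move=> k2; pose y : 'rV[R]_3 := - (3 / 5) *: e k + (4 / 5) *: e o2.
  have ek2 : dot (e k) (e o2) = 0 by rewrite eE (negPf k2).
  have y1 : dot y y = 1.
    rewrite /y dotDl !dotDr !dotZl !dotZr (dotC (e o2) (e k)) ek2 !eE !eqxx /=; lra.
  have Hy : hemisphere y.
    split=> //; rewrite (_ : ord_max = o2); last exact: val_inj.
    by rewrite -dot_delta -/(e o2) /y dotDl !dotZl ek2 eE eqxx /= mulr0 add0r mulr1 divr_ge0.
  have HN : hemisphere (- e k).
    split; first by rewrite dotNl dotNr opprK eE eqxx.
    rewrite (_ : ord_max = o2); last exact: val_inj.
    by rewrite -dot_delta -/(e o2) dotNl ek2 oppr0.
  have yN i : y != - e i.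
    apply/eqP => /(congr1 (dot (e o2))); rewrite /y dotNr dotDr !dotZr (dotC (e o2) (e k)) ek2 !eE eqxx.
    by case: (o2 == i) => /= h; clear -h; lra.
  have := D _ _ HN Hy; rewrite opprK => /(_ _)H.
  have {}H : dot (sv (f (- e k))) (sv (f y)) = dot (- e k) y.
    apply: H; apply/eqP => /(congr1 (dot (e o2))); rewrite /y dotDr !dotZr (dotC (e o2) (e k)) ek2 eE eqxx /= => h; clear -h; lra.
  move: H; rewrite (lin1 y) // /y mulmxDl -!scalemxAl -!rowE !rowK !dotDr !dotZr !dotNl ek2 eE eqxx.
  have -> : dot (sv (f (- e k))) (sv (f (e o2))) = 0.
    rewrite D // ?dotNl ?ek2 ?oppr0 // opprK; apply/eqP => /(congr1 (dot (e o2))).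
    by rewrite (dotC (e o2) (e k)) ek2 eE eqxx => /eqP; rewrite oner_eq0.
  have -> : (1 *- true : R) = -1 by [].
  by clear; move=> h; lra.
exists J; split=> // x Hx.
have [xk|H0] := eqVneq x (- e o0).
  apply: lin => // i; have [->|i0] := eqVneq i o0; first by rewrite xk opp // dotNl eE eqxx.
  apply: D => //; rewrite xk opprK; apply/eqP => /(congr1 (dot (e i))); rewrite !eE eqxx (negPf i0) => /eqP.
  by rewrite oner_eq0.
have [xk|H1] := eqVneq x (- e o1); last exact: lin1.
apply: lin => // i; have [->|i0] := eqVneq i o1; first by rewrite xk opp // dotNl eE eqxx.
apply: D => //; rewrite xk opprK; apply/eqP => /(congr1 (dot (e i))); rewrite !eE eqxx (negPf i0) => /eqP.
by rewrite oner_eq0.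
Qed.

(** Any two vertices lie on a common face among the three, so inner products of
    vertices are preserved; the linear map determined by the vertices is an
    isometry and agrees with [f] on each face, as points of a face are
    determined by their inner products with its vertices. *)
Lemma two_convex_sphere : two_convex S.
Proof.
move=> V i0 f V1 uV gf.
pose L : 'M[R]_(4, 1 + m) := \matrix_i sv (f (row i V)).
have ext (i : 'I_4) (c : 'rV[R]_3) : exists2 e : 'rV[R]_4, (e 0 i = 0 /\ forall l, e 0 (lift i l) = c 0 l) & c *m row' i V = e *m V.
  pose e : 'rV[R]_4 := \row_j (if unlift i j is Some l then c 0 l else 0).
  have ei : e 0 i = 0 by rewrite mxE unlift_none.
  have El l : e 0 (lift i l) = c 0 l by rewrite mxE liftK.
  exists e; first by split.
  by rewrite (mulmx_row' V ei); congr (_ *m _); apply/rowP => l; rewrite mxE El.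
have face_row i j : j != i -> spherical_simplex (row' i V) (row j V).
  move=> ji; rewrite rowE; apply: simplex_face; last by rewrite -rowE V1.
    by move=> l; rewrite mxE ler0n.
  by rewrite mxE eq_sym (negPf ji) andbF.
have D i p q : i != i0 -> spherical_simplex (row' i V) p -> spherical_simplex (row' i V) q -> q != - p ->
    dot (sv (f p)) (sv (f q)) = dot p q.
  move=> ii0; apply: (geodesic_dot (gf _ ii0)) => [x|x [] //|x y al be]; first exact: simplex_span.
  exact: simplex_cone.
have anti i j x : j != i -> spherical_simplex (row' i V) x -> x != - row j V.
  move=> ji [_ [c c0 ->]]; have [e [ei El] ->] := ext i c.
  apply/eqP => /eqP; rewrite -subr_eq0 opprK rowE -mulmxDl => /eqP h.
  have := congr1 (fun z : 'rV[R]_4 => (z *m invmx V) 0 j) h; rewrite mulmxK // mul0mx !mxE !eqxx /=.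
  have ij : i != j by rewrite eq_sym.
  have [l -> _] := unlift_some ij; rewrite El => h'.
  by have := c0 l; rewrite -[c 0 l]opprK (_ : - c 0 l = 1) ?ler0N1 //; lra.
have other (j k : 'I_4) : exists i : 'I_4, [&& i != i0, i != j & i != k].
  have [i Hi|H] := pickP (fun i : 'I_4 => [&& i != i0, i != j & i != k]); first by exists i.
  have := uniq_leq_size (enum_uniq 'I_4) (s2 := [:: i0; j; k]); rewrite size_enum_ord => /(_ _)/= HH.
  suff /HH : {subset enum 'I_4 <= [:: i0; j; k]} by [].
  move=> i _; have := H i; rewrite !inE; by case: (i == i0); case: (i == j); case: (i == k).
have LL : L *m L^T = V *m V^T.
  have row_dot k (A : 'M[R]_(4, k)) i j : (A *m A^T) i j = dot (row i A) (row j A).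
    by rewrite dotE [RHS]mxE [LHS]mxE; apply: eq_bigr => l _; rewrite !mxE.
  apply/matrixP => j k; rewrite !row_dot !rowK.
  have [i /and3P[ii0 ij ik]] := other j k.
  rewrite eq_sym in ij; rewrite eq_sym in ik.
  by apply: (D i) => //; [exact: face_row|exact: face_row|apply: (anti _ _ _ ij); exact: face_row].
pose J := invmx V *m L.
have VJ : V *m J = L by rewrite mulKVmx.
have JJ : J *m J^T = 1%:M.
  by rewrite trmx_mul -mulmxA (mulmxA L) LL -mulmxA -trmx_mul mulVmx // trmx1 mulmx1 mulVmx.
exists (fun y => nr (y *m J)); split.
  apply: (@local_isometry_geodesic R m S (@riemannian_sphere R m) 4 J id JJ 4 V (spherical_simplex V)).
  - by move=> q; exists (@sv R m); exact: spherical_sv.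
  - by move=> x [].
  - by move=> x _; exact: local_isometry_id.
move=> i ii0 x Sx; rewrite -[RHS]nr_sv; congr nr; apply/esym/unit_eq; rewrite ?sv1 ?dot_orth //; try by case: Sx.
have [x1 [c c0 xc]] := Sx; have [e [ei El] ce] := ext i c.
rewrite -[RHS]x1 {2 4}xc ce -mulmxA VJ dotC [RHS]dotC !mulmx_sum_row !dot_suml; apply: eq_bigr => j _.
rewrite !dotZl rowK; have [->|ji] := eqVneq j i; first by rewrite ei !mul0r.
congr (_ * _); rewrite (D i) //; first exact: face_row.
exact: (anti _ _ _ ji Sx).
Qed.

Lemma orthogonal_unit (J : 'M[R]_(3, 1 + m)) : (3 <= m)%N ->
  exists w : E, dot w w = 1 /\ forall i, dot w (row i J) = 0.
Proof.
move=> m3; have kn : kermx J^T != 0.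
  rewrite kermx_eq0 -row_leq_rank -ltnNge; apply: leq_ltn_trans (rank_leq_col _) _.
  by rewrite add1n ltnS.
pose w := nz_row (kermx J^T); have wn : w != 0 by rewrite nz_row_eq0.
have wJ : w *m J^T = 0 by apply: sub_kermxP; exact: nz_row_sub.
exists (nrE w); split; first exact: nrE1.
move=> i; rewrite /nrE dotZl; have -> : dot w (row i J) = (w *m J^T) 0 i.
  by rewrite dotE !mxE; apply: eq_bigr => k _; rewrite !mxE.
by rewrite wJ mxE mulr0.
Qed.
End SphereMaps.

(** * Simple connectedness of the sphere *)

Section SimplyConnected.
Variables (R : realType).

(** Retraction of the line onto the unit interval: it makes paths on [0, 1]
    continuous on the line, and also serves to build piecewise linear functions. *)
Definition clamp01 (t : R) : R := if t <= 0 then 0 else if t <= 1 then t else 1.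

Lemma clamp01P t : [\/ t <= 0 /\ clamp01 t = 0, 0 <= t <= 1 /\ clamp01 t = t | 1 <= t /\ clamp01 t = 1].
Proof.
rewrite /clamp01; case: (leP t 0) => t0; first exact: Or31.
by case: (leP t 1) => t1; [apply: Or32; rewrite (ltW t0)|apply: Or33; split => //; exact: ltW].
Qed.

Lemma clamp01_itv t : 0 <= clamp01 t <= 1.
Proof. by have [[_ ->]|[h ->]|[_ ->]] := clamp01P t; rewrite ?lexx ?ler01. Qed.

Lemma clamp01_id t : 0 <= t <= 1 -> clamp01 t = t.
Proof. by have [[h ->]|[h ->]|[h ->]] := clamp01P t => // /andP[a b]; apply/eqP; rewrite eq_le ?a ?b ?h. Qed.

Lemma clamp01_ge1 t : 1 <= t -> clamp01 t = 1.
Proof. by have [[h ->]|[/andP[h h'] ->]|[h ->]] := clamp01P t => // t1; lra. Qed.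

Lemma clamp01_dist s t : `|clamp01 s - clamp01 t| <= `|s - t|.
Proof.
have [[h ->]|[/andP[h h'] ->]|[h ->]] := clamp01P s; have [[k ->]|[/andP[k k'] ->]|[k ->]] := clamp01P t;
  rewrite ?subrr ?normr0 //; rewrite ler_norml; apply/andP; have := ler_norm (s - t);
  have := ler_norm (- (s - t)); rewrite normrN => *; split; lra.
Qed.

Lemma clamp01_continuous : continuous clamp01.
Proof.
move=> t A /nbhs_ballP[e /= e0 H]; apply/nbhs_ballP; exists e => // s ts; apply: H.
by apply: le_lt_trans ts; exact: clamp01_dist.
Qed.

Lemma clamp01_path (T : topologicalType) (c : R -> T) : {within `[0, 1], continuous c} ->
  continuous (c \o clamp01).
Proof.
move=> cc t A nA; have [e e0 H] := within_itv_near cc (clamp01_itv t) nA.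
apply/nbhs_ballP; exists e => // s ts; apply: H; first exact: clamp01_itv.
by rewrite distrC; apply: le_lt_trans ts; exact: clamp01_dist.
Qed.

(** A product of nonzero polynomials has a nonroot x; take the vector of powers
    of x. *)
Lemma avoid_hyperplanes n (ls : seq 'rV[R]_n) : (forall l, l \in ls -> l != 0) ->
  exists z, forall l, l \in ls -> dot z l != 0.
Proof.
move=> ls0; pose P := \prod_(l <- ls) rVpoly l.
have P0 : P != 0.
  rewrite prodf_seq_neq0; apply/allP => l lls /=; apply: contra (ls0 l lls) => /eqP e.
  by rewrite -[l]rVpolyK e linear0.
pose rs : seq R := [seq k%:R | k <- iota 0 (size P)].
have urs : uniq rs by rewrite map_inj_uniq ?iota_uniq // => a b /eqP; rewrite eqr_nat => /eqP.
have /allPn[x _ Px] : ~~ all (root P) rs.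
  by apply/negP => H; have := max_poly_roots P0 H urs; rewrite size_map size_iota ltnn.
exists (\row_i x ^+ i) => l lls; move: Px; rewrite /root horner_prod prodf_seq_neq0 => /allP/(_ l lls)/=.
rewrite (horner_coef_wide _ (size_poly _ _)); congr (_ != 0); apply: eq_bigr => i _.
by rewrite coef_rVpoly_ord mxE mulrC.
Qed.

Lemma normal_to_two n (p q : 'rV[R]_n) : (2 < n)%N -> exists l, [/\ l != 0, dot p l = 0 & dot q l = 0].
Proof.
move=> n2; pose A : 'M[R]_(2, n) := col_mx p q.
have kn : kermx A^T != 0.
  by rewrite kermx_eq0 -row_leq_rank -ltnNge; apply: leq_ltn_trans (rank_leq_col _) _.
exists (nz_row (kermx A^T)); rewrite nz_row_eq0; split => //.
all: have : nz_row (kermx A^T) *m A^T = 0 by apply: sub_kermxP; exact: nz_row_sub.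
all: rewrite [A^T](@tr_col_mx _ 1 1) (@mul_mx_row _ _ _ 1 1) -(@row_mx0 _ _ 1 1) => /(@eq_row_mx _ _ 1 1)[h1 h2].
  by rewrite dotC dotE h1 mxE.
by rewrite dotC dotE h2 mxE.
Qed.

Section Loops.
Variable (m : nat).
Local Notation S := (sphere R m).
Local Notation E := 'rV[R]_(1 + m).

Lemma uniform_positive (c : R -> S) : continuous c ->
  exists2 n, (0 < n)%N & forall s t, 0 <= s <= 1 -> 0 <= t <= 1 -> `|s - t| < n%:R^-1 -> 0 < dot (sv (c s)) (sv (c t)).
Proof.
move=> cc.
have cd (p : R * R) : {for p, continuous (fun p : R * R => dot (sv (c p.1)) (sv (c (p.1 + p.2))))}.
  have c1 : {for p, continuous (fun p : R * R => p.1)} by exact: cvg_fst.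
  have c2 : {for p, continuous (fun p : R * R => p.1 + p.2)}.
    by apply: (continuous_add_for (V := R)); [exact: cvg_fst|exact: cvg_snd].
  have c3 (f : R * R -> R) : {for p, continuous f} -> {for p, continuous (fun p => sv (c (f p)))}.
    move=> cf; apply: (@continuous_comp _ _ _ f (fun x => sv (c x))); first exact: cf.
    by apply: (@continuous_comp _ _ _ c (@sv R m)); [exact: cc|exact: sv_continuous].
  by apply: dot_continuous; exact: c3.
have cpt : compact (`[(0 : R), 1] : set R) := @segment_compact R 0 1.
have H := (compact_near_coveringP _).1 cpt R (nbhs (0 : R)) (fun e t => 0 < dot (sv (c t)) (sv (c (t + e)))).
have : \forall e \near (0 : R), `[0, 1] `<=` (fun t : R => 0 < dot (sv (c t)) (sv (c (t + e)))).
  apply: H => t _; have := cd (t, 0) [set x | 0 < x].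
  apply; apply: open_nbhs_nbhs; split; first exact: open_gt.
  by rewrite /= addr0 sv1 ltr01.
move=> /nbhs_ballP[e /= e0 He].
have [n n0 ne] : exists2 n, (0 < n)%N & n%:R^-1 < e.
  have ei : 0 < e^-1 by rewrite invr_gt0.
  exists (Num.truncn e^-1).+1 => //; rewrite -[X in _ < X]invrK ltf_pV2 ?posrE //.
  by have /andP[] := truncn_itv (ltW ei).
exists n => // s t s01 t01 st.
have := He (t - s); rewrite /ball /= sub0r normrN distrC => /(_ (lt_trans st ne) s).
by rewrite /= in_itv /= subrKC => ->.
Qed.

(** Piecewise linear interpolation of [c] at the multiples of 1/n, as a sum of
    hat functions. *)
Definition polygon (n : nat) (c : R -> S) (t : R) : E :=
  \sum_(k < n.+1) clamp01 (1 - `|n%:R * t - k%:R|) *: sv (c (k%:R / n%:R)).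

Lemma hat_far (x : R) : 1 <= `|x| -> clamp01 (1 - `|x|) = 0.
Proof. by move=> h; rewrite /clamp01 ifT //; lra. Qed.

Lemma hat_near (x : R) : `|x| < 1 -> 0 < clamp01 (1 - `|x|).
Proof.
move=> h; have := normr_ge0 x => h'; rewrite clamp01_id; first by rewrite subr_gt0.
by apply/andP; split; lra.
Qed.

Lemma nat_far (i j : nat) : i != j -> 1 <= `|i%:R - j%:R : R|.
Proof.
rewrite neq_ltn => /orP[]; rewrite -(ler_nat R) -natr1 => h.
  by rewrite ler0_norm; lra.
by rewrite ger0_norm; lra.
Qed.

Lemma polygon_vertex n (c : R -> S) (j : 'I_n.+1) t : n%:R * t = j%:R -> polygon n c t = sv (c (j%:R / n%:R)).
Proof.
move=> e; rewrite /polygon (bigD1 j) //= big1 => [|k kj].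
  by rewrite addr0 e subrr normr0 subr0 clamp01_id ?ler01 ?lexx // scale1r.
by rewrite e hat_far ?scale0r //; apply: nat_far; rewrite eq_sym.
Qed.

Lemma continuous_sum_for (T : topologicalType) (V : normedModType R) n (F : 'I_n -> T -> V) t :
  (forall i, {for t, continuous (F i)}) -> {for t, continuous (fun x => \sum_i F i x)}.
Proof.
elim: n F => [|n IH] F cF.
  have -> : (fun x => \sum_i F i x) = cst 0 by apply/funext => x; rewrite big_ord0.
  exact: cst_continuous.
have -> : (fun x => \sum_i F i x) = (fun x => \sum_(i < n) F (widen_ord (leqnSn n) i) x + F ord_max x).
  by apply/funext => x; rewrite big_ord_recr.
by apply: continuous_add_for => //; exact: IH.
Qed.

Lemma polygon_continuous n c : continuous (polygon n c).
Proof.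
move=> t; apply: continuous_sum_for => k; apply: continuous_scale; last exact: cst_continuous.
apply: (@continuous_comp _ _ _ (fun t : R => 1 - `|n%:R * t - k%:R|) clamp01); last exact: clamp01_continuous.
apply: (continuous_sub_for (V := R)); first exact: cst_continuous.
apply: (@continuous_comp _ _ _ (fun t : R => n%:R * t - k%:R) (fun x : R => `|x|)); last exact: norm_continuous.
apply: (continuous_sub_for (V := R)); last exact: cst_continuous.
by apply: continuous_mul_for; [exact: cst_continuous|exact: cvg_id].
Qed.

Section Approximation.
Variables (c : R -> S) (n : nat).
Hypotheses (n0 : (0 < n)%N)
  (close : forall s t, 0 <= s <= 1 -> 0 <= t <= 1 -> `|s - t| < n%:R^-1 -> 0 < dot (sv (c s)) (sv (c t))).

Lemma node_itv (k : nat) : (k <= n)%N -> 0 <= (k%:R / n%:R : R) <= 1.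
Proof. by move=> kn; rewrite divr_ge0 ?ler0n //= ler_pdivrMr ?ltr0n // mul1r ler_nat. Qed.

Lemma node_dist (k : nat) (t : R) : `|k%:R / n%:R - t| = `|n%:R * t - k%:R| / n%:R.
Proof.
have n1 : (n%:R : R) != 0 by rewrite pnatr_eq0 -lt0n.
have -> : k%:R / n%:R - t = - ((n%:R * t - k%:R) / n%:R) by rewrite mulrBl mulrAC mulfV // mul1r opprB.
by rewrite normrN normrM normfV normr_nat.
Qed.

(** This makes the segment from c t to the polygon avoid the origin. *)
Lemma polygon_dot (t : R) : 0 <= t <= 1 -> 0 < dot (polygon n c t) (sv (c t)).
Proof.
move=> t01; have /andP[t0 t1] := t01; have nt0 : 0 <= n%:R * t by rewrite mulr_ge0.
have term (k : 'I_n.+1) : `|n%:R * t - k%:R| < 1 -> 0 < dot (sv (c (k%:R / n%:R))) (sv (c t)).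
  move=> h; apply: close => //; first by apply: node_itv; rewrite -ltnS.
  by rewrite node_dist -[X in _ < X]mul1r ltr_pM2r // invr_gt0 ltr0n.
have nn (k : 'I_n.+1) : 0 <= clamp01 (1 - `|n%:R * t - k%:R|) * dot (sv (c (k%:R / n%:R))) (sv (c t)).
  have [h|h] := ltP `|n%:R * t - k%:R| 1; last by rewrite hat_far ?mul0r.
  by rewrite mulr_ge0 ?ltW ?hat_near ?term.
have /andP[k1 k2] := truncn_itv nt0; set k := Num.truncn _ in k1 k2.
have kn : (k < n.+1)%N.
  by rewrite ltnS -(ler_nat R); apply: le_trans k1 _; rewrite -[X in _ <= X]mulr1 ler_wpM2l.
rewrite /polygon dot_suml; under eq_bigr do rewrite dotZl.
rewrite (bigD1 (Ordinal kn)) //=; apply: ltr_wpDr; first by apply: sumr_ge0 => i _; exact: nn.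
have h : `|n%:R * t - k%:R| < 1.
  by rewrite ger0_norm ?subr_ge0 // ltrBlDl natr1.
by rewrite mulr_gt0 ?hat_near //; exact: (term (Ordinal kn)).
Qed.

(** Each side of the polygon lies in a plane through the origin, hence in a
    hyperplane. *)
Lemma polygon_misses : (1 < m)%N -> exists z : E, dot z z = 1 /\
  forall t, 0 <= t <= 1 -> sv (nr (polygon n c t)) != z.
Proof.
move=> m2.
have L (k : nat) : exists l : E, [/\ l != 0, dot (sv (c (k%:R / n%:R))) l = 0 & dot (sv (c (k.+1%:R / n%:R))) l = 0].
  by apply: normal_to_two; rewrite add1n ltnS.
have {L}[L HL] := choice L.
have [z Hz] : exists z, forall l, l \in [seq L k | k <- iota 0 n.+1] -> dot z l != 0.
  by apply: avoid_hyperplanes => l /mapP[k _ ->]; have [] := HL k.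
have z0 : z != 0.
  have := Hz (L 0%N); rewrite map_f ?mem_iota // => /(_ isT).
  by apply: contra => /eqP ->; rewrite dot0l.
exists (nrE z); split; first exact: nrE1.
move=> t t01; have /andP[t0 t1] := t01; have nt0 : 0 <= n%:R * t by rewrite mulr_ge0.
have p0 : polygon n c t != 0.
  by apply/negP => /eqP e; have := polygon_dot t01; rewrite e dot0l ltxx.
have /andP[k1 k2] := truncn_itv nt0; set k := Num.truncn _ in k1 k2.
have kn : (k < n.+1)%N.
  by rewrite ltnS -(ler_nat R); apply: le_trans k1 _; rewrite -[X in _ <= X]mulr1 ler_wpM2l.
have [_ h1 h2] := HL k.
have pl : dot (polygon n c t) (L k) = 0.
  rewrite /polygon dot_suml big1 // => i _; rewrite dotZl.
  have [->|ik] := eqVneq (i : nat) k; first by rewrite h1 mulr0.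
  have [->|ik'] := eqVneq (i : nat) k.+1; first by rewrite h2 mulr0.
  rewrite hat_far ?mul0r //.
  have [ik1|ik1] := ltnP i k.
    have : (i%:R + 1 <= k%:R :> R) by rewrite natr1 ler_nat.
    by move=> ?; rewrite ger0_norm; lra.
  have : (k.+1%:R + 1 <= i%:R :> R).
    by rewrite natr1 ler_nat ltn_neqAle eq_sym ik' ltn_neqAle eq_sym ik.
  by move=> ?; rewrite ler0_norm; lra.
apply/eqP => e; have [a a0 e'] := sv_nrP p0.
have := Hz (L k); rewrite map_f ?mem_iota //= => /(_ isT)/eqP; apply.
by rewrite (nrE_scale z) -e e' !dotZl pl !mulr0.
Qed.
End Approximation.

Section Contraction.
Variables (z x0 y0 : E).
Hypotheses (z1 : dot z z = 1) (x01 : dot x0 x0 = 1) (x0z : x0 != z) (y0z : dot y0 z = 0)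
  (x0E : x0 = dot x0 z *: z + (1 - dot x0 z) *: y0).

(** Straight-line contraction towards [x0] in the stereographic chart from [z],
    written in homogeneous form: there y0 is the chart of [x0] and the vector
    below is a multiple of the inverse stereographic projection of (1 - b) y + b
    y0.  Clearing the denominator once makes the expression polynomial, and for
    b = 0 it makes sense at [z] as well. *)
Definition contract (b : R) (x : E) : E :=
  ((1 - b) ^+ 2 * (1 + dot x z) + 2 * b * (1 - b) * dot (x - dot x z *: z) y0
    + b ^+ 2 * (1 - dot x z) * dot y0 y0 - (1 - dot x z)) *: z
  + 2 *: ((1 - b) *: (x - dot x z *: z) + (b * (1 - dot x z)) *: y0).

Lemma dot_lt1 (x : E) : dot x x = 1 -> x != z -> 0 < 1 - dot x z.
Proof.
move=> x1 xz; have : 0 < dot (x - z) (x - z) by rewrite dot_gt0 subr_eq0.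
by rewrite dotBl !dotBr x1 z1 (dotC z) => h; lra.
Qed.

(** Up to the factor 1 - x.z the vector is the inverse stereographic projection
    of Y, in homogeneous form. *)
Lemma contractE b x : dot x x = 1 -> x != z ->
  let Y := (1 - b) *: (x - dot x z *: z) + (b * (1 - dot x z)) *: y0 in
  dot Y z = 0 /\
  (1 - dot x z) *: contract b x = (dot Y Y - (1 - dot x z) ^+ 2) *: z + (2 * (1 - dot x z)) *: Y.
Proof.
move=> xx xz Y; have d0 := dot_lt1 xx xz.
have uz (w : E) : dot (w - dot w z *: z) z = 0 by rewrite dotBl dotZl z1 mulr1 subrr.
split; first by rewrite /Y dotDl !dotZl uz y0z !mulr0 addr0.
have uu : dot (x - dot x z *: z) (x - dot x z *: z) = 1 - dot x z ^+ 2.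
  by rewrite dotBr dotZr uz mulr0 subr0 dotBl xx dotZl (dotC z) expr2.
rewrite /contract scalerDr !scalerA; congr (_ *: _ + _); last by rewrite mulrC.
have -> : dot Y Y = (1 - b) ^+ 2 * (1 - dot x z ^+ 2) + 2 * (1 - b) * (b * (1 - dot x z)) * dot (x - dot x z *: z) y0
    + (b * (1 - dot x z)) ^+ 2 * dot y0 y0.
  move: uu; rewrite /Y; set u := x - _ => uu; rewrite dotDl !dotDr !dotZl !dotZr uu (dotC y0); ring.
by ring.
Qed.

Lemma contract0 x : contract 0 x = 2 *: x.
Proof. by apply/rowP => i; rewrite /contract !mxE; ring. Qed.

Lemma contract_neq0 b x : dot x x = 1 -> b = 0 \/ x != z -> contract b x != 0.
Proof.
move=> xx [->|xz].
  rewrite contract0 scaler_eq0 pnatr_eq0 /=; by rewrite -dot_gt0 xx ltr01.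
have [Yz E1] := contractE b xx xz; have d0 := dot_lt1 xx xz.
set Y := _ + _ in Yz E1; apply/negP => /eqP e; move: E1; rewrite e scaler0 => /esym E1.
have := congr1 (fun w => dot w z) E1; rewrite dotDl !dotZl z1 Yz mulr0 addr0 mulr1 dot0l => h.
have := congr1 (fun w => dot w Y) E1; rewrite dotDl !dotZl (dotC z) Yz mulr0 add0r dot0l => /eqP.
rewrite !mulf_eq0 pnatr_eq0 (gt_eqF d0) /= => /eqP h'.
by move: h; rewrite h' sub0r => /eqP; rewrite oppr_eq0 expf_eq0 /= gt_eqF.
Qed.

Lemma norm_y0 : (1 - dot x0 z) * dot y0 y0 = 1 + dot x0 z.
Proof.
have d0 := dot_lt1 x01 x0z; have := x01.
have zy0 : dot z y0 = 0 by rewrite dotC.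
rewrite {1 2}x0E; set s := dot x0 z in d0 *; rewrite dotDl !dotDr !dotZl !dotZr z1 y0z zy0 => h.
apply: (@mulfI _ (1 - s)); first by rewrite gt_eqF.
by lra.
Qed.

Lemma contract1 x : dot x x = 1 -> x != z -> nr (contract 1 x) = nr x0 :> S.
Proof.
move=> xx xz; have d0 := dot_lt1 x01 x0z; have d1 := dot_lt1 xx xz; have yy := norm_y0.
have k0 : 0 < 2 * (1 - dot x z) / (1 - dot x0 z) by rewrite divr_gt0 // mulr_gt0.
rewrite -(nrZ x0 k0); congr nr; rewrite /contract; move: d0 yy; set s := dot x0 z; set Y := dot y0 y0 => d0 yy.
have -> : x0 = s *: z + (1 - s) *: y0 by exact: x0E.
have -> : Y = (1 + s) / (1 - s) by rewrite -yy mulrAC mulfV ?mul1r // gt_eqF.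
by apply/rowP => i; rewrite !mxE; field; rewrite gt_eqF.
Qed.

Lemma contract_base b : nr (contract b x0) = nr x0 :> S.
Proof.
have d0 := dot_lt1 x01 x0z; have yy := norm_y0.
rewrite -(nrZ x0 (ltr0n R 2)); congr nr; rewrite /contract.
have u : x0 - dot x0 z *: z = (1 - dot x0 z) *: y0 by rewrite {1}x0E addrC addKr.
rewrite u dotZl; move: d0 yy u; set s := dot x0 z; set Y := dot y0 y0 => d0 yy u.
have -> : x0 = s *: z + (1 - s) *: y0 by exact: x0E.
apply/rowP => i; rewrite !mxE.
have -> : (1 - b) ^+ 2 * (1 + s) + 2 * b * (1 - b) * ((1 - s) * Y) + b ^+ 2 * (1 - s) * Y - (1 - s) = 2 * s.
  by rewrite -[_ * (1 - s) * Y]mulrA yy; ring.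
by ring.
Qed.
End Contraction.

Lemma contract_continuous (z y0 : E) (p : R * E) : {for p, continuous (fun q : R * E => contract z y0 q.1 q.2)}.
Proof.
have c1 : {for p, continuous (fun q : R * E => q.1)} by exact: cvg_fst.
have c2 : {for p, continuous (fun q : R * E => q.2)} by exact: cvg_snd.
have cst a : {for p, continuous (fun _ : R * E => a : R)} by exact: cst_continuous.
have csv a : {for p, continuous (fun _ : R * E => a : E)} by exact: cst_continuous.
have cb : {for p, continuous (fun q : R * E => 1 - q.1)} by exact: (continuous_sub_for (cst 1) c1).
have cz : {for p, continuous (fun q : R * E => dot q.2 z)} by exact: (dot_continuous c2 (csv z)).
have cd : {for p, continuous (fun q : R * E => 1 - dot q.2 z)} by exact: (continuous_sub_for (cst 1) cz).
have cu : {for p, continuous (fun q : R * E => q.2 - dot q.2 z *: z)}.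
  exact: (continuous_sub_for c2 (continuous_scale cz (csv z))).
have cbb : {for p, continuous (fun q : R * E => (1 - q.1) ^+ 2)} by exact: (continuous_mul_for cb cb).
have ccc : {for p, continuous (fun q : R * E => q.1 ^+ 2)} by exact: (continuous_mul_for c1 c1).
have e1 := continuous_mul_for cbb (continuous_add_for (cst 1) cz).
have e2 := continuous_mul_for (continuous_mul_for (continuous_mul_for (cst 2) c1) cb) (dot_continuous cu (csv y0)).
have e3 := continuous_mul_for (continuous_mul_for ccc cd) (cst (dot y0 y0)).
have f1 := continuous_scale (continuous_sub_for (continuous_add_for (continuous_add_for e1 e2) e3) cd) (csv z).
have f2 := continuous_scale (cst 2) (continuous_add_for (continuous_scale cb cu) (continuous_scale (continuous_mul_for c1 cd) (csv y0))).
exact: (continuous_add_for f1 f2).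
Qed.

(** In the first half of the time the loop is moved to the polygon, in the
    second half the polygon is contracted within the complement of a point that
    it misses; since the contraction at time 0 is the identity everywhere, one
    formula covers both halves. *)
Lemma sphere_null_homotopic (c : R -> S) : (1 < m)%N -> {within `[0, 1], continuous c} -> c 0 = c 1 ->
  exists H : R * R -> S,
    [/\ {within `[0, 1] `*` `[0, 1], continuous H}, forall t, t \in `[0, 1] -> H (0, t) = c t,
        forall t, t \in `[0, 1] -> H (1, t) = c 0 & forall s, s \in `[0, 1] -> H (s, 0) = c 0 /\ H (s, 1) = c 0].
Proof.
move=> m2 cc c01; pose C := c \o clamp01; have cC : continuous C := clamp01_path cc.
have [n n0 close] := uniform_positive cC.
have [z [z1 Hz]] := polygon_misses n0 close m2.
have C0 : C 0 = c 0 by rewrite /C /= clamp01_id ?lexx ?ler01.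
have C1 : C 1 = c 0 by rewrite /C /= clamp01_id ?lexx ?ler01 // c01.
have n1 : (n%:R : R) != 0 by rewrite pnatr_eq0 -lt0n.
have P0 : polygon n C 0 = sv (c 0).
  by rewrite (@polygon_vertex n C ord0) ?mulr0 // mul0r C0.
have P1 : polygon n C 1 = sv (c 0).
  by rewrite (@polygon_vertex n C ord_max) ?mulr1 //= mulfV // C1.
pose x0 := sv (c 0); have x01 : dot x0 x0 = 1 := sv1 (c 0).
have x0z : x0 != z by have := Hz 0; rewrite P0 nr_sv lexx ler01 => /(_ isT).
have d0 := dot_lt1 z1 x01 x0z.
pose y0 := (1 - dot x0 z)^-1 *: (x0 - dot x0 z *: z).
have y0z : dot y0 z = 0 by rewrite /y0 dotZl dotBl dotZl z1 mulr1 subrr mulr0.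
have x0E : x0 = dot x0 z *: z + (1 - dot x0 z) *: y0.
  by rewrite /y0 scalerA mulfV ?gt_eqF // scale1r addrC subrK.
pose L (a t : R) : E := (1 - a) *: sv (C t) + a *: polygon n C t.
have L0 a t : 0 <= a <= 1 -> 0 <= t <= 1 -> L a t != 0.
  move=> /andP[a0 a1] t01; have pd := polygon_dot n0 close t01.
  apply/negP => /eqP/(congr1 (fun w => dot w (sv (C t)))); rewrite dot0l dotDl !dotZl sv1 mulr1 => h.
  have [a0'|a0'] := eqVneq a 0; first by move: h; rewrite a0' mul0r; lra.
  have : 0 < a * dot (polygon n C t) (sv (C t)) by rewrite mulr_gt0 // lt_neqAle eq_sym a0'.
  by lra.
pose H (p : R * R) : S := nr (contract z y0 (clamp01 (2 * clamp01 p.1 - 1))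
    (sv (nr (L (clamp01 (2 * clamp01 p.1)) (clamp01 p.2))))).
(* At each time at most one of the two deformations is under way. *)
have key (s : R) : clamp01 (2 * s - 1) = 0 \/ clamp01 (2 * s) = 1.
  have [h|h] := leP (2 * s) 1.
    by left; rewrite /clamp01 ifT //; lra.
  by right; have [[]|[/andP[h1 h2] ->]|[_ ->]] // := clamp01P (2 * s); lra.
have LN1 t : 0 <= t <= 1 -> sv (nr (L 1 t)) != z.
  by move=> t01; rewrite /L subrr scale0r add0r scale1r; exact: Hz.
have N0 p : contract z y0 (clamp01 (2 * clamp01 p.1 - 1)) (sv (nr (L (clamp01 (2 * clamp01 p.1)) (clamp01 p.2)))) != 0.
  apply: (contract_neq0 z1 y0z); first exact: sv1.
  have [->|->] := key (clamp01 p.1); [by left|right]; apply: LN1; exact: clamp01_itv.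
exists H; split.
- apply: continuous_subspaceT => p.
  have cl (f : R * R -> R) : {for p, continuous f} -> {for p, continuous (fun q => clamp01 (f q))}.
    by move=> cf; apply: (@continuous_comp _ _ _ f clamp01) => //; exact: clamp01_continuous.
  have cst (a : R) : {for p, continuous (fun _ : R * R => a)} by exact: cst_continuous.
  have s1 : {for p, continuous (fun p : R * R => clamp01 p.1)} by apply: cl; exact: cvg_fst.
  have s2 : {for p, continuous (fun p : R * R => clamp01 p.2)} by apply: cl; exact: cvg_snd.
  have s3 := cl _ (continuous_mul_for (cst 2) s1).
  have s4 := cl _ (continuous_sub_for (continuous_mul_for (cst 2) s1) (cst 1)).
  have cCt : {for p, continuous (fun p : R * R => sv (C (clamp01 p.2)))}.
    apply: (@continuous_comp _ _ _ (fun p : R * R => C (clamp01 p.2)) (@sv R m)); last exact: sv_continuous.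
    by apply: (@continuous_comp _ _ _ (fun p : R * R => clamp01 p.2) C) => //; exact: cC.
  have cPt : {for p, continuous (fun p : R * R => polygon n C (clamp01 p.2))}.
    by apply: (@continuous_comp _ _ _ (fun p : R * R => clamp01 p.2) (polygon n C)) => //; exact: polygon_continuous.
  have cL := continuous_add_for (continuous_scale (continuous_sub_for (cst 1) s3) cCt) (continuous_scale s3 cPt).
  have cnL : {for p, continuous (fun p : R * R => sv (nr (L (clamp01 (2 * clamp01 p.1)) (clamp01 p.2)) : S))}.
    apply: (@continuous_comp _ _ _ (fun p : R * R => nr (L (clamp01 (2 * clamp01 p.1)) (clamp01 p.2)) : S) (@sv R m)); last exact: sv_continuous.
    apply: (@continuous_comp _ _ _ (fun p : R * R => L (clamp01 (2 * clamp01 p.1)) (clamp01 p.2)) (@nr R m)); first exact: cL.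
    by apply: nr_continuous; apply: L0; exact: clamp01_itv.
  apply: (@continuous_comp _ _ _ (fun p : R * R => contract z y0 (clamp01 (2 * clamp01 p.1 - 1)) (sv (nr (L (clamp01 (2 * clamp01 p.1)) (clamp01 p.2)))))
     (@nr R m)); last exact: nr_continuous (N0 p).
  apply: (@continuous_comp _ _ _ (fun p : R * R => (clamp01 (2 * clamp01 p.1 - 1), sv (nr (L (clamp01 (2 * clamp01 p.1)) (clamp01 p.2)) : S)))
     (fun q : R * E => contract z y0 q.1 q.2)); last exact: contract_continuous.
  exact: (cvg_pair s4 cnL).
- move=> t; rewrite in_itv /= => t01; rewrite /H /= (clamp01_id t01).
  have -> : clamp01 0 = 0 by rewrite clamp01_id ?lexx ?ler01.
  have -> : clamp01 (2 * 0 - 1) = 0 by rewrite /clamp01 ifT //; lra.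
  have -> : clamp01 (2 * 0) = 0 by rewrite mulr0 clamp01_id ?lexx ?ler01.
  rewrite contract0 nrZ // nr_sv /L subr0 scale1r scale0r addr0 nr_sv /C /= clamp01_id //.
- move=> t; rewrite in_itv /= => t01; rewrite /H /= (clamp01_id t01).
  have -> : clamp01 1 = 1 by rewrite clamp01_id ?lexx ?ler01.
  have -> : clamp01 (2 * 1 - 1) = 1 by rewrite clamp01_id; lra.
  have -> : clamp01 (2 * 1) = 1 by apply: clamp01_ge1; rewrite mulr1 ler1n.
  rewrite (contract1 z1 x01 x0z y0z x0E) ?sv1 ?nr_sv //; exact: LN1.
- move=> s; rewrite in_itv /= => s01; rewrite /H /= (clamp01_id s01).
  have -> : clamp01 0 = 0 by rewrite clamp01_id ?lexx ?ler01.
  have -> : clamp01 1 = 1 by rewrite clamp01_id ?lexx ?ler01.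
  have e0 a : L a 0 = x0 by rewrite /L C0 P0 -scalerDl subrK scale1r.
  have e1 a : L a 1 = x0 by rewrite /L C1 P1 -scalerDl subrK scale1r.
  by rewrite e0 e1 /x0 nr_sv (contract_base z1 x01 x0z y0z x0E) nr_sv.
Qed.

(** Great circle arcs; for antipodal points through any orthogonal vector. *)
Lemma sphere_path (x y : S) : (0 < m)%N ->
  exists c : R -> S, [/\ {within `[0, 1], continuous c}, c 0 = x & c 1 = y].
Proof.
move=> m0.
have arc a th : dot a a = 1 -> dot (sv x) a = 0 -> sv y = trig (sv x) a th ->
    exists c : R -> S, [/\ {within `[0, 1], continuous c}, c 0 = x & c 1 = y].
  move=> aa xa yE; exists (fun t => nr (trig (sv x) a (t * th))); split.
  - apply: continuous_subspaceT => t.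
    apply: (@continuous_comp _ _ _ (fun t : R => trig (sv x) a (t * th)) (@nr R m)).
      apply: (@continuous_comp _ _ _ (fun t : R => t * th) (trig (sv x) a)); last exact: trig_continuous.
      by apply: continuous_mul_for; [exact: cvg_id|exact: cst_continuous].
    by apply: nr_continuous; rewrite -dot_gt0 trig_unit ?sv1 ?ltr01.
  - by rewrite mul0r /trig cos0 sin0 scale1r scale0r addr0 nr_sv.
  - by rewrite mul1r -yE nr_sv.
have [->|xy] := eqVneq y x.
  by exists (fun=> x); split => //; apply: continuous_subspaceT => t; exact: cst_continuous.
have [yx|yx] := eqVneq (sv y) (- sv x); last first.
  have sxy : sv y != sv x by apply: contra xy => /eqP/sv_inj ->.
  by have [a [th [_ aa xa yE]]] := chord (sv1 x) (sv1 y) sxy yx; exact: (arc a th).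
have kn : kermx (sv x)^T != 0.
  by rewrite kermx_eq0 -row_leq_rank -ltnNge; apply: leq_ltn_trans (rank_leq_col _) _; rewrite add1n ltnS.
pose w := nz_row (kermx (sv x)^T); have wn : w != 0 by rewrite nz_row_eq0.
have wx : w *m (sv x)^T = 0 by apply: sub_kermxP; exact: nz_row_sub.
apply: (arc (nrE w) pi); first exact: nrE1.
  have dwx : dot w (sv x) = 0 by rewrite dotE wx mxE.
  by rewrite dotC /nrE dotZl dwx mulr0.
by rewrite /trig cospi sinpi scale0r addr0 scaleN1r.
Qed.

Lemma simply_connected_sphere : (1 < m)%N -> simply_connected R S.
Proof.
move=> m2; split; first by exists (nr 0).
  by move=> x y; apply: sphere_path; exact: ltnW.
by move=> c; exact: sphere_null_homotopic.
Qed.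
End Loops.
End SimplyConnected.

(** * The two-hull *)

Section TwoHull.
Variables (R : realType) (m : nat) (Omega : set (sphere R m)).
Hypotheses (hm : (3 <= m)%N) (openO : open Omega) (scO : simply_connected R (submanifold Omega)).
Local Notation S := (sphere R m).
Local Notation SO := (submanifold Omega).

Lemma immersion_rigidity (M N : atlas_space R m) (f g : M -> N) (p : M) : simply_connected R M ->
  charted M -> kflat 1 N -> (forall q, local_isometry_at f q) -> (forall q, local_isometry_at g q) ->
  agree_near f g p -> f = g.
Proof.
move=> [_ paths _] cM kN Lf Lg fg; apply/funext => q.
have [c [cc c0 c1]] := paths p q; have [[hN _] _ _ _ _] := kN.1.
have : agree_near f g (c 1).
  apply: (path_rigidity cM (riemannian_charted kN.1) hN) => //.
  - by move=> q'; exact: spherical_at_ex.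
  - by move=> t A t01 nA; exact: (within_itv_near cc).
  - by rewrite c0.
by rewrite c1; exact: nbhs_singleton.
Qed.

Lemma charted_domain : charted SO.
Proof. exact: (charted_submanifold (@charted_sphere R m) openO). Qed.

Lemma inclusion_local (p : SO) : local_isometry_at (set_val : SO -> S) p.
Proof.
exact: ((local_isometry_sub (@charted_sphere R m) openO (@id S) p).2 (local_isometry_id _)).
Qed.

Lemma inclusion_immersion : isometric_immersion (set_val : SO -> S).
Proof.
apply: local_isometry_immersion; [exact: charted_domain|exact: charted_sphere| |exact: inclusion_local].
by move=> q; exists (@sv R m); exact: spherical_sv.
Qed.

(** The universal property of the sphere.  The map [psi] is transported to a map
    [psiS] of the sphere with arbitrary values off [Omega], to which
    [sphere_extension] applies with the hemisphere in [Omega]. *)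
Lemma immersion_extends (Psi : atlas_space R m) (psi : SO -> Psi) (e : 'rV[R]_3 -> SO) :
  geodesic_isometric_on (1%:M : 'M[R]_3) (@hemisphere R) e -> kflat 1 Psi -> two_convex Psi ->
  isometric_immersion psi ->
  exists2 theta : S -> Psi, isometric_immersion theta & psi = theta \o set_val.
Proof.
move=> ge kPsi tc ipsi; have cPsi := riemannian_charted kPsi.1.
pose f x : S := set_val (e x).
have gf : geodesic_isometric_on (1%:M : 'M[R]_3) (@hemisphere R) f := geodesic_isometric_sub ge.
have [J [JJ fJ]] := hemisphere_linear gf.
have rJ i j : dot (row i J) (row j J) = (i == j)%:R.
  by rewrite !rowE dot_orth // dot_delta mxE eqxx eq_sym.
pose o0 := @Ordinal 3 0 isT; pose o1 := @Ordinal 3 1 isT; pose o2 := @Ordinal 3 2 isT.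
have He : hemisphere (delta_mx 0 o2 : 'rV[R]_3).
  by split; [rewrite dot_delta mxE !eqxx|rewrite mxE ler0n].
pose p0 := e (delta_mx 0 o2); pose v : S := set_val p0.
have vE : sv v = row o2 J by rewrite [LHS]fJ // rowE.
have [w [w1 wJ]] := orthogonal_unit J hm.
have on : on4 (sv v) (row o0 J) (row o1 J) w.
  have Jw i : dot (row i J) w = 0 by rewrite dotC.
  by rewrite vE; do 2!(split; rewrite ?rJ ?Jw ?w1).
pose psiS (x : S) : Psi := if pselect (Omega x) is left h then psi (exist _ x (mem_set h)) else psi p0.
have psiE p : psiS (set_val p) = psi p.
  rewrite /psiS; case: pselect => [h|[]]; last exact: (set_mem (valP p)).
  by congr psi; apply: val_inj.
have Lpsi p : local_isometry_at psi p := isometric_immersion_local p charted_domain cPsi ipsi.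
have LS x : Omega x -> local_isometry_at psiS x.
  move=> Ox; apply: ((local_isometry_sub (@charted_sphere R m) openO psiS (exist _ x (mem_set Ox))).1).
  apply: (local_isometry_ext _ (Lpsi _)).
  have -> : psiS \o set_val = psi by apply/funext => p; exact: psiE.
  exact: (@agree_near_refl SO Psi psi).
have half x : halfsphere (sv v) (row o0 J) (row o1 J) x -> Omega x.
  move=> [a [b [c [a0 xE]]]].
  pose y : 'rV[R]_3 := b *: delta_mx 0 o0 + c *: delta_mx 0 o1 + a *: delta_mx 0 o2.
  have yJ : y *m J = sv x by rewrite xE vE /y !mulmxDl -!scalemxAl -!rowE addrAC [RHS]addrAC -addrA addrC.
  have Hy : hemisphere y.
    split; first by rewrite -(dot_orth _ _ JJ) yJ sv1.
    rewrite (_ : ord_max = o2); last exact: val_inj.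
    by rewrite !mxE /= !mulr0 !add0r mulr1.
  have <- : f y = x by apply: sv_inj; rewrite fJ.
  exact: (set_mem (valP (e y))).
have [theta [Lth agr]] := sphere_extension kPsi tc on (fun x h => LS x (half x h)).
exists theta.
  have ex (q : Psi) := spherical_at_ex q kPsi.
  exact: (local_isometry_immersion (@charted_sphere R m) cPsi ex Lth).
apply: (immersion_rigidity (p := p0) scO charted_domain kPsi) => //.
  by move=> q; apply: (local_isometry_comp (inclusion_local q)); exact: Lth.
have cv : {for p0, continuous (set_val : SO -> S)} := @set_val_continuous S Omega p0.
have near : nbhs p0 (fun p : SO => theta (set_val p) = psiS (set_val p)) := near_comp cv agr.
by apply: filterS near => p /=; rewrite psiE => ->.
Qed.

Lemma sphere_two_hull (e : 'rV[R]_3 -> SO) :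
  geodesic_isometric_on (1%:M : 'M[R]_3) (@hemisphere R) e -> is_two_hull SO S.
Proof.
move=> ge; split.
- by apply: simply_connected_sphere; exact: ltn_trans hm.
- exact: kflat_sphere.
- exact: two_convex_sphere.
- exists set_val; first exact: inclusion_immersion.
  by move=> Psi psi _ kPsi tc ipsi; exact: (immersion_extends ge).
Qed.

(** Both composites are local isometries that are the identity near a point of
    Omega.  For theta' o theta this uses that theta is locally injective and
    theta o theta' = id. *)
Lemma two_hull_isometric (Phi : atlas_space R m) (e : 'rV[R]_3 -> SO) :
  geodesic_isometric_on (1%:M : 'M[R]_3) (@hemisphere R) e -> is_two_hull SO Phi -> isometric Phi S.
Proof.
move=> ge [scP kP tcP [phi iphi univ]].
have [scS kS tcS _] := sphere_two_hull ge.
have cP := riemannian_charted kP.1; have cS := @charted_sphere R m.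
have [theta ith E1] := univ S set_val scS kS tcS inclusion_immersion.
have [theta' ith' E2] := immersion_extends ge kP tcP iphi.
have Lt q : local_isometry_at theta q := isometric_immersion_local q cP cS ith.
have Lt' x : local_isometry_at theta' x := isometric_immersion_local x cS cP ith'.
pose p0 : SO := e 0.
have t1 p : theta (phi p) = set_val p by rewrite E1.
have t2 p : theta' (set_val p) = phi p by rewrite E2.
have c1 : theta \o theta' = id.
  apply: (immersion_rigidity (p := set_val p0) scS cS kS).
  - by move=> x; exact: local_isometry_comp.
  - by move=> x; exact: local_isometry_id.
  have : nbhs (set_val p0 : S) Omega by apply: open_nbhs_nbhs; split => //; exact: (set_mem (valP p0)).
  by apply: filterS => x Ox; rewrite /= -[x]/(set_val (exist _ x (mem_set Ox) : SO)) t2 t1.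
have c2 : theta' \o theta = id.
  apply: (immersion_rigidity (p := phi p0) scP cP kP).
  - by move=> x; exact: local_isometry_comp.
  - by move=> x; exact: local_isometry_id.
  have [A [nA injA]] := spherical_at_inj cP ((Lt (phi p0)).2 _ (@spherical_sv R m (theta (phi p0)))).
  have c := local_isometry_continuous (local_isometry_comp (Lt (phi p0)) (Lt' _)).
  have nA' : nbhs ((theta' \o theta) (phi p0)) A by rewrite /= t1 t2.
  have : \forall q \near phi p0, A q /\ A ((theta' \o theta) q) by apply: filterI => //; exact: (near_comp c nA').
  apply: filterS => q [Aq Aq']; apply: injA => //=.
  by rewrite -[theta (theta' _)]/((theta \o theta') _) c1.
exists theta, theta'; split => // x.
  by rewrite -[LHS]/((theta' \o theta) x) c2.
by rewrite -[LHS]/((theta \o theta') x) c1.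
Qed.
End TwoHull.

Theorem proposition4p3 (R : realType) (m : nat) (hm : (3 <= m)%N)
    (Omega : set (sphere R m)) (openO : open Omega)
    (scO : simply_connected R (submanifold Omega))
    (he : exists e : 'rV[R]_3 -> submanifold Omega,
       geodesic_embedding_of_hemisphere e) :
  (exists Phi : atlas_space R m, is_two_hull (submanifold Omega) Phi) /\
  (forall Phi : atlas_space R m,
     is_two_hull (submanifold Omega) Phi -> isometric Phi (sphere R m)).
Proof.
have [e [ge _]] := he; split; first by exists (sphere R m); exact: (sphere_two_hull hm openO scO ge).
by move=> Phi; exact: (two_hull_isometric hm openO scO ge).
Qed.
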